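(* Let $2<p<6$, $\alpha>0$, $\gamma=\frac p2-1$ and $\mathbf N>\frac1{2\sqrt\alpha}$. Then there exists $\beta_0=\beta_0(p,\alpha,\mathbf N)>0$ such that for every $0\le\beta<\beta_0$ the probability measure on $C(\mathbb R)$ $$\rho_L=\frac1{Z_L}\exp\Big(\frac{\beta}{pL^\gamma}\int_{-L/2}^{L/2}|\varphi|^p\,dx\Big)\mathbf 1_{\{M(\varphi)\le\mathbf NL\}}\,\mu_L$$ converges weakly to the Ornstein–Uhlenbeck measure with mass parameter $\alpha$ as $L\to\infty$. The same result holds for $\gamma>\frac p2-1$, $\mathbf N>\frac1{2\sqrt\alpha}$, and every $0\le\beta<+\infty$.
   Context: $\mu_L$ is the law of $\sum_{k\in\mathbb Z}\frac{g_k}{\sqrt{\alpha+4\pi^2(k/L)^2}}\frac{e^{2\pi ikx/L}}{\sqrt L}$ with $g_k$ i.i.d. standard complex Gaussians ($\mathbb E|g_k|^2=1$, $\mathbb E g_k^2=0$), viewed as a measure on $C(\mathbb R)$ through $L$-periodic functions. $M(\varphi)=\int_{-L/2}^{L/2}|\varphi|^2dx$, and $Z_L$ is the normalising constant. The Ornstein–Uhlenbeck measure with mass parameter $\alpha$ is the centred complex-valued Gaussian measure on $C(\mathbb R)$ such that for all $f,g\in C_c^\infty(\mathbb R)$, with $\langle\varphi,f\rangle=\int_{\mathbb R}\varphi f\,dx$, one has $\mathbb E[\langle\varphi,f\rangle\overline{\langle\varphi,g\rangle}]=\int_{\mathbb R}f\,(\alpha-\partial_x^2)^{-1}\overline g\,dx$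 and $\mathbb E[\langle\varphi,f\rangle\langle\varphi,g\rangle]=0$. $C(\mathbb R)$ carries the compact-open topology (locally uniform convergence). *)

(* Defs.v *)
From HB Require Import structures.
From mathcomp Require Import all_boot all_order all_algebra finmap.
From mathcomp Require Import all_classical all_reals all_analysis.
From mathcomp Require Import complex.

Set Implicit Arguments.
Unset Strict Implicit.
Unset Printing Implicit Defensive.

Import Order.TTheory GRing.Theory Num.Theory.
Import numFieldNormedType.Exports.

Local Open Scope classical_set_scope.
Local Open Scope ring_scope.

(* [Rcomplex R] is the field of complex numbers over [R], seen as a real normed
   space: its norm takes values in [R]. The library gives it a norm but no
   topology. *)
Lemma Rcomplex_normrZ (R : realType) (a : R) (z : Rcomplex R) :
  `|a *: z| = `|a| * `|z|.
Proof.
case: z => x y; rewrite /Num.norm /= !exprMn -mulrDr sqrtrM ?sqr_ge0//.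
by rewrite sqrtr_sqr.
Qed.

HB.instance Definition _ (R : realType) := isPointed.Build (Rcomplex R) 0.
HB.instance Definition _ (R : realType) :=
  PseudoMetric.copy (Rcomplex R) (pseudoMetric_normed (Rcomplex R)).
HB.instance Definition _ (R : realType) :=
  NormedZmod_PseudoMetric_eq.Build R (Rcomplex R) erefl.
HB.instance Definition _ (R : realType) :=
  PseudoMetricNormedZmod_Lmodule_isNormedModule.Build R (Rcomplex R)
    (@Rcomplex_normrZ R).

Definition cexpi (R : realType) (t : R) : Rcomplex R := Complex (cos t) (sin t).

Definition path_space (R : realType) := continuousType R (Rcomplex R).

HB.instance Definition _ (R : realType) := Choice.on (path_space R).
HB.instance Definition _ (R : realType) :=
  isPointed.Build (path_space R) (cst 0 : path_space R).
HB.instance Definition _ (R : realType) :=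
  Topological.copy (path_space R)
    (initial_topology
      ((fun phi : path_space R => phi : R -> Rcomplex R) :
        path_space R -> {compact-open, R -> Rcomplex R})).

Definition borel (T : ptopologicalType) := g_sigma_algebraType (@open T).

Definition mutual_independence d (Om : measurableType d) (R : realType)
    (P : probability Om R) (I : choiceType) d' (T : measurableType d')
    (X : I -> Om -> T) : Prop :=
  forall (J : {fset I}) (A : I -> set T), (forall i, measurable (A i)) ->
    P (\bigcap_(i in [set` J]) X i @^-1` A i) =
    (\prod_(i <- J) P (X i @^-1` A i))%E.

(* The case [sigma = 0] is separate: [normal_prob 0 0] is not a Dirac mass. *)
Definition centred_gaussian d (Om : measurableType d) (R : realType)
    (P : probability Om R) (X : Om -> R) : Prop :=
  measurable_fun setT X /\
  exists sigma : R, forall A : set R, measurable A ->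
    P (X @^-1` A) =
      (if sigma == 0 then \d_(0 : R) A else normal_prob 0 sigma A).

Definition cintegral d (T : measurableType d) (R : realType)
    (m : {measure set T -> \bar R}) (h : T -> Rcomplex R) : Rcomplex R :=
  Complex (\int[m]_t complex.Re (h t)) (\int[m]_t complex.Im (h t)).

Definition standard_complex_gaussian d (Om : measurableType d) (R : realType)
    (P : probability Om R) (g : Om -> Rcomplex R) : Prop :=
  [/\ forall a b : R, centred_gaussian P
        (fun w => a * complex.Re (g w) + b * complex.Im (g w)),
      ('E_P[fun w => (`|g w| ^+ 2)%R] = 1)%E
    & cintegral P (fun w => g w ^+ 2) = 0].

Definition fourier_term (R : realType) (alpha L : R) (c : Rcomplex R) (k : int)
    (x : R) : Rcomplex R :=
  (Num.sqrt (alpha + 4 * pi ^+ 2 * (k%:~R / L) ^+ 2))^-1 *: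
    ((Num.sqrt L)^-1 *: (c * cexpi (2 * pi * k%:~R * x / L))).

(* [m] is the measure mu_L: the law of the random series, which is summed over
   |k| <= n with n tending to infinity. *)
Definition is_free_field (R : realType) (alpha L : R)
    (m : probability (borel (path_space R)) R) : Prop :=
  exists (d : measure_display) (Om : measurableType d) (P : probability Om R)
    (g : int -> {mfun Om >-> borel (Rcomplex R)})
    (phi : {mfun Om >-> borel (path_space R)}),
  [/\ mutual_independence P g,
      forall k, standard_complex_gaussian P (g k),
      {ae P, forall w, {compact-open,
        (fun n x => \sum_(j < n.*2.+1)
           fourier_term alpha L (g (j%:Z - n%:Z) w) (j%:Z - n%:Z) x) @ \oo
          --> (phi w : path_space R)}}
    & forall A, measurable A -> m A = distribution P phi A].

Definition mass (R : realType) (L : R) (phi : path_space R) : R :=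
  \int[lebesgue_measure]_(x in `[- L / 2, L / 2]) (`|phi x| ^+ 2).

Definition potential (R : realType) (p L : R) (phi : path_space R) : R :=
  \int[lebesgue_measure]_(x in `[- L / 2, L / 2]) (`|phi x| `^ p).

Definition gibbs_weight (R : realType) (p gamma beta N L : R)
    (phi : path_space R) : R :=
  expR (beta / (p * L `^ gamma) * potential p L phi) *
  \1_[set psi | mass L psi <= N * L] phi.

Definition partition_function (R : realType) (p gamma beta N L : R)
    (m : probability (borel (path_space R)) R) : \bar R :=
  (\int[m]_phi (gibbs_weight p gamma beta N L phi)%:E)%E.

Definition is_gibbs_measure (R : realType) (p gamma beta N L : R)
    (m rho : probability (borel (path_space R)) R) : Prop :=
  (0 < partition_function p gamma beta N L m < +oo)%E /\
  forall A, measurable A -> rho A =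
    ((fine (partition_function p gamma beta N L m))^-1%:E *
     \int[m]_(phi in A) (gibbs_weight p gamma beta N L phi)%:E)%E.

Definition test_function (R : realType) (f : R -> Rcomplex R) : Prop :=
  (forall n x, derivable (derive1n n f) x 1) /\
  compact (closure [set x | f x != 0]).

Definition pairing (R : realType) (phi f : R -> Rcomplex R) : Rcomplex R :=
  cintegral lebesgue_measure (fun x => phi x * f x).

(* (alpha - d^2/dx^2)^-1 h for a test function h: the only square-integrable
   solution u of alpha u - u'' = h (u is then in H^2, since u'' is alpha u - h). *)
Definition resolvent (R : realType) (alpha : R) (h : R -> Rcomplex R) :
    R -> Rcomplex R :=
  xget (cst 0) [set u : R -> Rcomplex R |
    [/\ forall x, derivable u x 1,
        forall x, derivable (derive1n 1 u) x 1,
        forall x, alpha *: u x - derive1n 2 u x = h x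
      & (\int[lebesgue_measure]_x (`|u x| ^+ 2)%:E < +oo)%E]].

(* Gaussian measure on a locally convex space: every continuous real-linear
   functional is a centred Gaussian variable. *)
Definition centred_gaussian_measure (R : realType)
    (nu : probability (borel (path_space R)) R) : Prop :=
  forall l : path_space R -> R, continuous l ->
    (forall (a : R) (phi psi chi : path_space R),
       (forall x, chi x = a *: phi x + psi x) -> l chi = a * l phi + l psi) ->
    centred_gaussian nu l.

Definition is_ornstein_uhlenbeck (R : realType) (alpha : R)
    (nu : probability (borel (path_space R)) R) : Prop :=
  centred_gaussian_measure nu /\
  forall f g : R -> Rcomplex R, test_function f -> test_function g ->
    cintegral nu (fun phi : path_space R =>
        pairing phi f * conjc (pairing phi g)) =
      pairing f (resolvent alpha (fun x => conjc (g x))) /\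
    cintegral nu (fun phi : path_space R => pairing phi f * pairing phi g) = 0.

Definition converges_weakly (R : realType) (T : ptopologicalType)
    (rho : R -> probability (borel T) R) (nu : probability (borel T) R) : Prop :=
  forall F : T -> R, continuous F -> (exists M, forall t, `|F t| <= M) ->
    (\int[rho L]_t F t) @[L --> +oo] --> \int[nu]_t F t.

(* Main.v *)
(* For the free field mu write D for its Cameron-Martin norm, the l^2 norm of the Gaussian
   coefficients. If u(x) v(y) <= exp(D(x - y)^2 / 2) with u, v >= 0, then (E u)(E v) <= 1: for one
   coefficient this is the Prekopa-Leindler inequality, it tensorises over finitely many coefficients,
   and it passes to the limit. It is used twice. With V the exponent of the Gibbs density,
   u = exp(2 V) 1_A with A = {M < (N + 1) L} and v = 1_B with B = {int (1 + |psi|^6) < K L}: by a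
   Sobolev inequality, going from psi in B to phi in A changes the exponent by at most
   C L^(1 - gamma) + D(phi - psi)^2 / 2 when beta L^(p/2 - 1 - gamma) is small, so that
   E exp(2 V) 1_A <= exp(C L^(1 - gamma) + C'). With S the sum of the translates of a local Lipschitz
   functional F over n = O(L) tiles, u = exp(l S) and v = exp(-l S - a), where a = O(n l^2), give
   E exp(l (S - n E F)) <= exp(a). The Gibbs measure rho is translation invariant because mu is
   and both are periodic, so Jensen's inequality and 2 x y <= x^2 + y^2 yield
     exp(l n (E_rho F - E_mu F)) <= (E exp(2 V) 1_A + E exp(2 l (S - n E_mu F))) / (2 Z).
   As Z is bounded below (Markov's inequality, since E M / L -> 1 / (2 sqrt alpha) < N), this gives
   E_rho F - E_mu F <= C (1 + L^(1 - gamma)) / (l L) + C l, and l is arbitrary. Finally mu_L converges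
   to the Ornstein-Uhlenbeck measure by convergence of covariances. *)

Require Import Defs.
From HB Require Import structures.
From mathcomp Require Import all_boot all_order all_algebra finmap.
From mathcomp Require Import all_classical all_reals all_analysis.
From mathcomp Require Import measurable_realfun.
From mathcomp Require Import complex ring lra zify.

Set Implicit Arguments.
Unset Strict Implicit.
Unset Printing Implicit Defensive.

Import Order.TTheory GRing.Theory Num.Theory.
Import numFieldNormedType.Exports.

Local Open Scope classical_set_scope.
Local Open Scope ring_scope.

(** * Expectations of bounded measurable functions *)

(** Prekopa-Leindler is applied to functions of finitely many independent coefficients, while the
    coefficients of the free field enter through their characteristic function only. Hence a detour
    through a product model: a continuity theorem for Lipschitz functions identifies the two laws on
    finitely many coordinates. Functionals that are Lipschitz for the sup distance on a segment
    survive the passage to the full series; u = exp(2 V) 1_A is not of this kind. It is lower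
    semicontinuous once A is open, so its inf-convolutions are Lipschitz, stay below u and thus
    inherit the product inequality, and converge to u. The condition p < 6 enters through |f|^p =
    |f|^2 (|f|^4)^((p - 2) / 4): the outer exponent is below 1, so the Sobolev bound on |f|^4,
    linear in D^2, can be used with a coefficient as small as desired, and D^2 / 2 absorbs it. The
    measures rho_L must exist for every L > 0, also when N L is far below the mean mass. Positivity
    of Z then rests on a small ball estimate, and its finiteness on the product inequality with a
    set B of merely positive measure. *)

Section bounded_expectation.
Context d (T : measurableType d) (R : realType) (m : probability T R).
Implicit Types f g h : T -> R.

(** Against a probability such functions are integrable, so their real-valued expectations can be
    added, compared and interchanged without further conditions. *)
Definition bounded_mfun f := measurable_fun setT f /\ exists M : R, forall x, `|f x| <= M.

Lemma bmf_integrable f : bounded_mfun f -> m.-integrable setT (EFin \o f).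
Proof.
move=> [mf [M fM]]; apply: measurable_bounded_integrable => //.
  by rewrite [X in (X < _)%E]probability_setT ltry.
exists M; split; first exact: num_real.
by move=> x Mx y _ /=; rewrite (le_trans (fM y))// ltW.
Qed.

Lemma bmf_cst (c : R) : bounded_mfun (cst c).
Proof. by split => //; exists `|c|. Qed.

Lemma bmfD f g : bounded_mfun f -> bounded_mfun g -> bounded_mfun (fun x => f x + g x).
Proof.
move=> [mf [M fM]] [mg [N gN]]; split; first exact: measurable_funD.
by exists (M + N) => x; rewrite (le_trans (ler_normD _ _))// lerD.
Qed.

Lemma bmfM f g : bounded_mfun f -> bounded_mfun g -> bounded_mfun (fun x => f x * g x).
Proof.
move=> [mf [M fM]] [mg [N gN]]; split; first exact: measurable_funM.
by exists (M * N) => x; rewrite normrM ler_pM.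
Qed.

Lemma bmfZ (c : R) f : bounded_mfun f -> bounded_mfun (fun x => c * f x).
Proof. by move=> bf; apply: (bmfM (bmf_cst c) bf). Qed.

Lemma bmfN f : bounded_mfun f -> bounded_mfun (fun x => - f x).
Proof.
move=> [mf [M fM]]; split; first exact: measurableT_comp.
by exists M => x; rewrite normrN.
Qed.

Lemma bmfB f g : bounded_mfun f -> bounded_mfun g -> bounded_mfun (fun x => f x - g x).
Proof. by move=> bf bg; apply: (bmfD bf (bmfN bg)). Qed.

Lemma bmf_sum (I : Type) (s : seq I) (F : I -> T -> R) :
  (forall i, bounded_mfun (F i)) -> bounded_mfun (fun x => \sum_(i <- s) F i x).
Proof.
move=> bF; elim: s => [|i s IHs].
  rewrite (_ : (fun x => _) = cst 0); first exact: bmf_cst.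
  by apply/funext => x; rewrite big_nil.
rewrite (_ : (fun x => _) = (fun x => F i x + \sum_(j <- s) F j x)).
  exact: bmfD.
by apply/funext => x; rewrite big_cons.
Qed.

Lemma bmf_indic (A : set T) : measurable A -> bounded_mfun (\1_A : T -> R).
Proof.
move=> mA; split; first exact: measurable_indic.
by exists 1 => x; rewrite indicE; case: (x \in A); rewrite ?normr1 ?normr0 ?ler01.
Qed.

Lemma EFin_Rint f : bounded_mfun f -> (\int[m]_x f x)%:E = (\int[m]_x (f x)%:E)%E.
Proof.
move=> bf; rewrite /Rintegral fineK//.
exact: (integrable_fin_num measurableT (bmf_integrable bf)).
Qed.

Lemma Rint_cst (c : R) : \int[m]_x c = c.
Proof. by rewrite Rintegral_cst// [X in fine X]probability_setT mulr1. Qed.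

Lemma Rint_sum (I : Type) (s : seq I) (F : I -> T -> R) :
  (forall i, bounded_mfun (F i)) ->
  \int[m]_x (\sum_(i <- s) F i x) = \sum_(i <- s) \int[m]_x F i x.
Proof.
move=> bF; elim: s => [|i s IHs].
  under eq_Rintegral do rewrite big_nil.
  by rewrite big_nil Rint_cst.
rewrite big_cons -IHs -RintegralD//; last 2 first.
- exact: bmf_integrable.
- by apply: bmf_integrable; exact: bmf_sum.
by apply: eq_Rintegral => x _; rewrite big_cons.
Qed.

Lemma Rint_le f g : bounded_mfun f -> bounded_mfun g -> (forall x, f x <= g x) ->
  \int[m]_x f x <= \int[m]_x g x.
Proof.
by move=> bf bg fg; apply: le_Rintegral => //; apply: bmf_integrable.
Qed.

Lemma Rint_abs_le f (M : R) : bounded_mfun f -> (forall x, `|f x| <= M) -> `|\int[m]_x f x| <= M.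
Proof.
move=> bf fM; rewrite ler_norml; apply/andP; split.
  rewrite -[leLHS]Rint_cst; apply: Rint_le (bmf_cst _) bf _ => x.
  by have := fM x; rewrite ler_norml => /andP[].
rewrite -[leRHS]Rint_cst; apply: Rint_le bf (bmf_cst _) _ => x.
by have := fM x; rewrite ler_norml => /andP[].
Qed.

Lemma Rint_dist f g (M : R) : bounded_mfun f -> bounded_mfun g ->
  (forall x, `|f x - g x| <= M) -> `|\int[m]_x f x - \int[m]_x g x| <= M.
Proof.
move=> bf bg fgM; rewrite -RintegralB//; [|exact: bmf_integrable..].
by apply: Rint_abs_le => //; exact: bmfB.
Qed.

Lemma Rint_dist_le f g h : bounded_mfun f -> bounded_mfun g -> bounded_mfun h ->
  (forall x, `|f x - g x| <= h x) -> `|\int[m]_x f x - \int[m]_x g x| <= \int[m]_x h x.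
Proof.
move=> bf bg bh fgM; rewrite -RintegralB//; [|exact: bmf_integrable..].
have bfg : bounded_mfun (fun x => f x - g x) by exact: bmfB.
apply: (le_trans (le_normr_Rintegral _ _)) => //; first exact: bmf_integrable.
apply: Rint_le => //; split; first by apply: measurableT_comp => //; case: bfg.
by case: bfg => _ [M H]; exists M => x; rewrite normr_id.
Qed.

Lemma bounded_cvg_ae (f_ : nat -> T -> R) f (M : R) :
  (forall n, measurable_fun setT (f_ n)) -> measurable_fun setT f ->
  (forall n x, `|f_ n x| <= M) -> {ae m, forall x, f_ n x @[n --> \oo] --> f x} ->
  \int[m]_x f_ n x @[n --> \oo] --> \int[m]_x f x.
Proof.
move=> mf_ mf fM fcvg.
have [|||||_ _ H] := @dominated_convergence _ _ _ m setT measurableT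
  (fun n x => (f_ n x)%:E) (fun x => (f x)%:E) (cst M%:E).
- by move=> n; apply/measurable_EFinP.
- exact/measurable_EFinP.
- apply: filterS fcvg => x fx _; by apply: cvg_EFin => //; exact: nearW.
- by apply/integrableP; split => //; rewrite integral_cst// [X in (_ * X)%E]probability_setT mule1 ltry.
- by apply: aeW => x n _ /=; rewrite lee_fin.
have bi : m.-integrable setT (EFin \o f).
  have [|||||//] := @dominated_convergence _ _ _ m setT measurableT
    (fun n x => (f_ n x)%:E) (fun x => (f x)%:E) (cst M%:E).
  + by move=> n; apply/measurable_EFinP.
  + exact/measurable_EFinP.
  + apply: filterS fcvg => x fx _; by apply: cvg_EFin => //; exact: nearW.
  + by apply/integrableP; split => //; rewrite integral_cst// [X in (_ * X)%E]probability_setT mule1 ltry.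
  + by apply: aeW => x n _ /=; rewrite lee_fin.
apply: fine_cvg; rewrite fineK; last exact: (integrable_fin_num measurableT bi).
exact: H.
Qed.

Lemma bounded_cvg (f_ : nat -> T -> R) f (M : R) :
  (forall n, measurable_fun setT (f_ n)) ->
  (forall n x, `|f_ n x| <= M) -> (forall x, f_ n x @[n --> \oo] --> f x) ->
  \int[m]_x f_ n x @[n --> \oo] --> \int[m]_x f x.
Proof.
move=> mf_ fM fcvg; apply: bounded_cvg_ae => //; last exact: aeW.
exact: (@measurable_fun_cvg _ _ _ setT f_ f).
Qed.

Lemma RintD f g : bounded_mfun f -> bounded_mfun g ->
  \int[m]_x (f x + g x) = \int[m]_x f x + \int[m]_x g x.
Proof. by move=> bf bg; rewrite RintegralD//; exact: bmf_integrable. Qed.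

Lemma RintB f g : bounded_mfun f -> bounded_mfun g ->
  \int[m]_x (f x - g x) = \int[m]_x f x - \int[m]_x g x.
Proof. by move=> bf bg; rewrite RintegralB//; exact: bmf_integrable. Qed.

Lemma RintZ c f : bounded_mfun f -> \int[m]_x (c * f x) = c * \int[m]_x f x.
Proof. by move=> bf; rewrite RintegralZl//; exact: bmf_integrable. Qed.

End bounded_expectation.

Lemma Rint_fubini d1 d2 (T1 : measurableType d1) (T2 : measurableType d2) (R : realType)
   (m1 : probability T1 R) (m2 : probability T2 R) (f : T1 * T2 -> R) :
  bounded_mfun f ->
  \int[m1]_x \int[m2]_y f (x, y) = \int[m2]_y \int[m1]_x f (x, y).
Proof.
move=> [mf [M fM]].
have b2 x : bounded_mfun (fun y => f (x, y)).
  by split; [exact: measurableT_comp|exists M].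
have b1 y : bounded_mfun (fun x => f (x, y)).
  by split; [exact: measurableT_comp|exists M].
rewrite /Rintegral; congr fine.
under eq_integral do rewrite -/(Rintegral _ _ _) EFin_Rint//.
under [RHS]eq_integral do rewrite -/(Rintegral _ _ _) EFin_Rint//.
apply: (@Fubini _ _ _ _ _ m1 m2 (EFin \o f)).
apply/integrable12ltyP; first exact/measurable_EFinP.
have E1 : m1 setT = 1%E := probability_setT m1.
have E2 : m2 setT = 1%E := probability_setT m2.
apply: (@le_lt_trans _ _ (\int[m1]_x (cst M%:E x))%E); last first.
  by rewrite integral_cst// [X in (_ * X)%E]E1 mule1 ltry.
have mf' : measurable_fun setT (fun z => `|(EFin \o f) z|)%E.
  by apply: measurableT_comp => //; exact/measurable_EFinP.
apply: ge0_le_integral => //.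
- by move=> x _; apply: integral_ge0.
- exact: (@measurable_fun_fubini_tonelli_F _ _ T1 T2 R m2 _ mf' (fun z => abse_ge0 _)).
- move=> x _; rewrite -[leRHS]mule1 -E2 -integral_cst//.
  apply: ge0_le_integral => //=.
  + by apply/measurable_EFinP/measurableT_comp => //; case: (b2 x).
  + by move=> y _; rewrite lee_fin.
Qed.

Lemma bmf_Rint2 d1 d2 (T1 : measurableType d1) (T2 : measurableType d2) (R : realType)
   (m2 : probability T2 R) (f : T1 -> T2 -> R) :
  bounded_mfun (fun z : T1 * T2 => f z.1 z.2) ->
  bounded_mfun (fun x => \int[m2]_y f x y).
Proof.
move=> [mf [M fM]].
have b2 x : bounded_mfun (f x).
  split; last by exists M => y; exact: (fM (x, y)).
  exact: (measurableT_comp mf (pair1_measurable x)).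
split; last by exists M => x; apply: Rint_abs_le => // y; exact: (fM (x, y)).
(* Measurability of the inner integral comes from Tonelli, hence the shift by [M] to a nonnegative
   integrand, undone at the end. *)
pose F (z : T1 * T2) := (f z.1 z.2 + M)%:E.
have mF : measurable_fun setT F.
  by apply/measurable_EFinP; apply: measurable_funD.
have F0 z : (0 <= F z)%E.
  by rewrite lee_fin; have := fM z; rewrite ler_norml; lra.
have H := @measurable_fun_fubini_tonelli_F _ _ T1 T2 R m2 F mF F0.
have -> : (fun x => \int[m2]_y f x y) = (fun x => fine (fubini_F m2 F x) - M).
  apply/funext => x; rewrite /fubini_F /F /=.
  under eq_integral do rewrite EFinD.
  rewrite integralD//; last 2 first.
  - exact: bmf_integrable.
  - exact: (bmf_integrable m2 (bmf_cst _ M)).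
  rewrite fineD; last 2 first.
  - exact: (integrable_fin_num measurableT (bmf_integrable m2 (b2 x))).
  - exact: (integrable_fin_num measurableT (bmf_integrable m2 (bmf_cst _ M))).
  by rewrite -/(Rintegral m2 setT (fun=> M)) Rint_cst addrK.
by apply: measurable_funB => //; exact: measurableT_comp.
Qed.

(** The usual exchange of limits with an error [e / 3]. It is applied with [u'] the integrals of a
    simpler function that is close to the original one in mean. *)
Lemma approx_cvg (R : realType) (u : nat -> R) (v : R) :
  (forall e, 0 < e -> exists u' v', [/\ u' n @[n --> \oo] --> v', `|v - v'| <= e &
     \forall n \near \oo, `|u n - u' n| <= e]) -> u n @[n --> \oo] --> v.
Proof.
move=> H; apply/cvgrPdist_le => e e0.
have e3 : 0 < e / 3 by rewrite divr_gt0.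
have [u' [v' [uv' vv' uu']]] := H _ e3.
move/cvgrPdist_le : uv' => /(_ _ e3) uv'.
near=> n.
have h1 : `|u n - u' n| <= e / 3 by near: n.
have h2 : `|v' - u' n| <= e / 3 by near: n.
move: h1 h2 vv'; rewrite !ler_norml; lra.
Unshelve. all: by end_near. Qed.

Ltac bmf := repeat (first [assumption | exact: bmf_cst | apply: bmfD | apply: bmfB
  | apply: bmfZ | apply: bmfM | apply: bmfN]).

(** * Gaussian characteristic functions and moments *)

Section density.
Context d (T : measurableType d) (R : realType).
Variables (mu nu : {measure set T -> \bar R}) (p : T -> R).
Hypotheses (mp : measurable_fun setT p) (p0 : forall x, 0 <= p x).
Hypothesis nuE : forall A, measurable A -> (nu A = \int[mu]_(x in A) (p x)%:E)%E.
Import HBNNSimple.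

Lemma ge0_integral_density (h : T -> R) :
  measurable_fun setT h -> (forall x, 0 <= h x) ->
  (\int[nu]_x (h x)%:E = \int[mu]_x (h x * p x)%:E)%E.
Proof.
move=> mh h0.
have meh : measurable_fun setT (EFin \o h) by exact/measurable_EFinP.
pose f_ := nnsfun_approx measurableT meh.
have f_nd x k l : (k <= l)%N -> (f_ k x <= f_ l x)%R.
  by move=> kl; exact/lefP/nd_nnsfun_approx.
have f_h x : (f_ n x)%:E @[n --> \oo] --> (h x)%:E by apply: cvg_nnsfun_approx => //= y _; rewrite lee_fin.
transitivity (limn (fun n => \int[nu]_x (f_ n x)%:E))%E.
  rewrite -monotone_convergence//=.
  - by apply: eq_integral => x _; apply/esym/cvg_lim.
  - by move=> n; exact/measurable_EFinP/measurable_funTS.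
  - by move=> n ? _; rewrite lee_fin.
  - by move=> x _ k l kl; rewrite lee_fin f_nd.
transitivity (limn (fun n => \int[mu]_x (f_ n x * p x)%:E))%E; last first.
  rewrite -monotone_convergence//=.
  - apply: eq_integral => x _; apply/cvg_lim => //.
    under eq_fun do rewrite EFinM.
    by rewrite EFinM; apply: cvgeZr.
  - by move=> n; apply/measurable_EFinP; apply: measurable_funM.
  - by move=> n x _; rewrite lee_fin mulr_ge0.
  - by move=> x _ k l kl; rewrite lee_fin ler_wpM2r// f_nd.
apply: congr_lim; apply/funext => n /=.
under eq_integral do rewrite fimfunE -fsumEFin//.
rewrite ge0_integral_fsum//; last 2 first.
  - by move=> r; exact/measurable_EFinP/measurableT_comp.
  - by move=> r x _; rewrite EFinM nnfun_muleindic_ge0.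
under [RHS]eq_integral.
  move=> x _; rewrite fimfunE mulrC EFinM -fsumEFin// ge0_mule_fsumr; last first.
    by move=> r; rewrite EFinM nnfun_muleindic_ge0.
  over.
rewrite [RHS]ge0_integral_fsum//; last 2 first.
  - move=> r; apply: emeasurable_funM; first exact/measurable_EFinP.
    by exact/measurable_EFinP/measurableT_comp.
  - move=> r x _; rewrite mule_ge0 ?lee_fin//.
    by rewrite -lee_fin EFinM nnfun_muleindic_ge0.
apply: eq_fsbigr => r _.
rewrite integralZl_indic_nnsfun//= integral_indic// setIT nuE//.
(* A negative [r] has an empty level set, and both sides vanish. *)
have [r0|r0] := ltP r 0.
  rewrite preimage_nnfun0// integral_set0 mule0.
  by apply/esym; apply: integral0_eq => x _; rewrite indicE in_set0 mulr0 mule0.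
rewrite integral_mkcond -ge0_integralZl//; last 2 first.
  - by apply/(measurable_restrictT _ _).1 => //; apply/measurable_funTS/measurable_EFinP.
  - by move=> x _; rewrite erestrict_ge0//= => y _; rewrite lee_fin.
apply: eq_integral => x _; rewrite patchE indicE; case: ifP => _.
  by rewrite mulr1 muleC.
by rewrite mulr0 !mule0.
Qed.

End density.

Lemma ge0_integral_law d1 d2 (T1 : measurableType d1) (T2 : measurableType d2) (R : realType)
    (m : {measure set T1 -> \bar R}) (nu : {measure set T2 -> \bar R}) (X : T1 -> T2)
    (h : T2 -> R) : measurable_fun setT X ->
  (forall A, measurable A -> m (X @^-1` A) = nu A) ->
  measurable_fun setT h -> (forall x, 0 <= h x) ->
  (\int[nu]_x (h x)%:E = \int[m]_w (h (X w))%:E)%E.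
Proof.
move=> mX lawX mh h0.
pose X' : {mfun T1 >-> T2} := mfun_Sub (mem_set mX).
transitivity (\int[pushforward m X']_x (h x)%:E)%E.
  by apply: eq_measure_integral => A mA _; rewrite /pushforward -lawX.
rewrite ge0_integral_pushforward//; first exact/measurable_EFinP.
by move=> y _; rewrite lee_fin.
Qed.

Lemma cvg_exprn (R : realType) (f : nat -> R) (l : R) k :
  f n @[n --> \oo] --> l -> f n ^+ k @[n --> \oo] --> l ^+ k.
Proof.
move=> fl; elim: k => [|k IHk]; first by under eq_fun do rewrite expr0; exact: cvg_cst.
by under eq_fun do rewrite exprS; rewrite exprS; apply: cvgM.
Qed.

Section real_line_calculus.
Context (R : realType).
Notation mu := (@lebesgue_measure R).

Lemma continuous_mfun (f : R -> R) : continuous f -> measurable_fun setT f.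
Proof. by move=> cf; exact: continuous_measurable_fun. Qed.

Lemma is_derive_continuous (F f : R -> R) : (forall x : R, is_derive x (1 : R) F (f x)) -> continuous F.
Proof.
move=> dF x; apply: differentiable_continuous.
by apply/derivable1_diffP; case: (dF x).
Qed.

Lemma is_derive_derive1 (F f : R -> R) : (forall x : R, is_derive x (1 : R) F (f x)) -> (F^`() = f)%classic.
Proof. by move=> dF; apply/funext => x; rewrite derive1E; apply: derive_val. Qed.

Lemma FTC_Rint (F f : R -> R) a b : a <= b -> (forall x : R, is_derive x (1 : R) F (f x)) ->
  continuous f -> \int[mu]_(x in `[a, b]) f x = F b - F a.
Proof.
move=> ab dF cf; have cF := is_derive_continuous dF.
move: ab; rewrite le_eqVlt => /predU1P[->|ab].
  by rewrite set_itv1 Rintegral_set1 subrr.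
rewrite /Rintegral (@continuous_FTC2 _ f F a b)//.
- exact: continuous_subspaceT.
- split => [x _||]; first by case: (dF x).
  + by apply: cvg_at_right_filter; exact: cF.
  + by apply: cvg_at_left_filter; exact: cF.
- by move=> x _; rewrite (is_derive_derive1 dF).
Qed.

Lemma continuous_itv_integrable (f : R -> R) a b : continuous f ->
  mu.-integrable `[a, b] (EFin \o f).
Proof.
move=> cf; apply: continuous_compact_integrable; first exact: segment_compact.
exact: continuous_subspaceT.
Qed.

Lemma integral_derivative_eq0 (G g : R -> R) : (forall x : R, is_derive x (1 : R) G (g x)) ->
  continuous g -> mu.-integrable setT (EFin \o g) ->
  G n%:R @[n --> \oo] --> 0 -> G (- n%:R) @[n --> \oo] --> 0 ->
  \int[mu]_x g x = 0.
Proof.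
move=> dG cg ig G1 G2.
have cvg0 : \int[mu]_(x in `[- n%:R, n%:R]) g x @[n --> \oo] --> 0.
  rewrite (_ : (fun n => _) = (fun n => G n%:R - G (- n%:R))); last first.
    by apply/funext => n; rewrite (FTC_Rint _ dG cg)// ge0_cp.
  by rewrite -[X in _ --> X](subr0 0); apply: cvgB.
suff : \int[mu]_(x in `[- n%:R, n%:R]) g x @[n --> \oo] --> \int[mu]_x g x.
  by move=> /cvg_lim <-//; apply: cvg_lim.
under eq_fun do rewrite Rintegral_mkcond.
apply: fine_cvg; rewrite fineK; last exact: integrable_fin_num ig.
have [|||||_ _ //] := @dominated_convergence _ _ _ mu setT measurableT
  (fun n x => ((g \_ `[- n%:R, n%:R]) x)%:E) (EFin \o g) (fun x => `|(g x)%:E|)%E.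
- move=> n; apply/measurable_EFinP/(measurable_restrictT _ _).1 => //.
  by apply: measurable_funTS; exact: continuous_mfun.
- by apply/measurable_EFinP; exact: continuous_mfun.
- apply: aeW => x _; apply: cvg_near_cst; near=> n.
  rewrite patchE ifT// inE/= in_itv/= -ler_norml; near: n.
  exact: nbhs_infty_ger.
- exact: integrable_abse.
- apply: aeW => x n _; rewrite patchE; case: ifP => //= _.
  by rewrite normr0 lee_fin.
Unshelve. all: by end_near. Qed.

End real_line_calculus.

Section gaussian_characteristic.
Context (R : realType) (s : R) (s0 : s != 0).
Notation mu := (@lebesgue_measure R).
Notation p := (normal_pdf (0 : R) s).

Lemma normal_pdf_deriv (x : R) : is_derive x (1 : R) p (- (x / s ^+ 2) * p x).
Proof.
rewrite normal_pdfE//.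
have H : is_derive x (1 : R) (fun y => - (y - 0) ^+ 2 / (s ^+ 2 *+ 2) : R) (- (x / s ^+ 2)).
  apply: is_derive_eq; rewrite /GRing.scale/=.
  by rewrite !subr0; field.
have := @is_derive1_comp _ expR _ _ _ _ (is_derive_expR _) H.
move=> /(@is_deriveZ _ _ _ _ (normal_peak s)).
by move=> H2; apply: is_derive_eq; rewrite /GRing.scale/= /normal_fun; ring.
Qed.

(** Half of the Gaussian exponent absorbs the factor |x|; what is left is, up to a constant, the
    normal density of deviation sqrt 2 s. *)
Lemma integrable_normr_normal_pdf : mu.-integrable setT (fun x => (`|x| * p x)%:E).
Proof.
have s20 : Num.sqrt 2 * s != 0 :> R by rewrite mulf_neq0// gt_eqF// sqrtr_gt0.
have pk := normal_peak_gt0 s0; have pk2 := normal_peak_gt0 s20.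
have := integrable_normal_pdf 0 (Num.sqrt 2 * s).
move=> /(integrableZl measurableT (2 * `|s| * normal_peak s / normal_peak (Num.sqrt 2 * s))).
apply: le_integrable => //.
  apply/measurable_EFinP; apply: measurable_funM; first exact: (@measurableT_comp _ _ _ _ _ _ _ _ _ (@normr_measurable _ setT)).
  exact: measurable_normal_pdf.
move=> x _; rewrite -EFinM !gee0_abs ?lee_fin; last 2 first.
- by rewrite mulr_ge0 ?normal_pdf_ge0// divr_ge0 ?(ltW pk2)// !mulr_ge0// ltW.
- by rewrite mulr_ge0 ?normal_pdf_ge0.
rewrite !normal_pdfE// /normal_fun.
have -> : - (x - 0) ^+ 2 / (s ^+ 2 *+ 2) = - (x ^+ 2 / (4 * s ^+ 2)) + - (x ^+ 2 / (4 * s ^+ 2)).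
  by rewrite subr0; field.
have -> : - (x - 0) ^+ 2 / ((Num.sqrt 2 * s) ^+ 2 *+ 2) = - (x ^+ 2 / (4 * s ^+ 2)).
  by rewrite subr0 exprMn sqr_sqrtr//; field.
rewrite expRD; set E := expR _.
have E0 : 0 < E by exact: expR_gt0.
(* With y = |x| / (2 |s|) this is y <= exp(y^2), which follows from y <= 1 + y^2. *)
have xE : `|x| * E <= 2 * `|s|.
  rewrite /E expRN ler_pdivrMr ?expR_gt0//.
  have s1 : 0 < `|s| by rewrite normr_gt0.
  have -> : x ^+ 2 / (4 * s ^+ 2) = (`|x| / (2 * `|s|)) ^+ 2.
    by rewrite expr_div_n exprMn !real_normK ?num_real//; congr (_ / _); ring.
  set y := `|x| / (2 * `|s|).
  have -> : `|x| = 2 * `|s| * y by rewrite /y; field; rewrite gt_eqF.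
  rewrite ler_pM2l ?mulr_gt0//; apply: le_trans (expR_ge1Dx _).
  have : 0 <= (y - 1) ^+ 2 by exact: sqr_ge0.
  by have : 0 <= y ^+ 2 by [exact: sqr_ge0]; nra.
have -> : 2 * `|s| * normal_peak s / normal_peak (Num.sqrt 2 * s) * (normal_peak (Num.sqrt 2 * s) * E)
   = normal_peak s * E * (2 * `|s|) by field; rewrite gt_eqF.
have -> : `|x| * (normal_peak s * (E * E)) = normal_peak s * E * (`|x| * E) by ring.
by rewrite ler_pM2l// mulr_gt0.
Qed.

Lemma integrable_trig_normal_pdf (f : R -> R) : continuous f -> (forall x, `|f x| <= 1) ->
  mu.-integrable setT (fun x => (f x * p x)%:E).
Proof.
move=> cf f1; apply: le_integrable (integrable_normal_pdf 0 s) => //.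
  by apply/measurable_EFinP/measurable_funM; [exact: continuous_mfun|exact: measurable_normal_pdf].
move=> x _ /=; rewrite lee_fin normrM -[leRHS]mul1r.
by rewrite ler_wpM2r.
Qed.

Lemma integrable_xtrig_normal_pdf (f : R -> R) : continuous f -> (forall x, `|f x| <= 1) ->
  mu.-integrable setT (fun x => (x * f x * p x)%:E).
Proof.
move=> cf f1; apply: le_integrable integrable_normr_normal_pdf => //.
  apply/measurable_EFinP/measurable_funM; last exact: measurable_normal_pdf.
  by apply: measurable_funM => //; exact: continuous_mfun.
move=> x _ /=; rewrite lee_fin !normrM normr_id -[leRHS]mulr1 -!mulrA ler_wpM2l//.
by rewrite mulrC ler_wpM2l.
Qed.

Let cvg_normal_pdf : p n%:R @[n --> \oo] --> (0 : R).
Proof.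
have pk := normal_peak_gt0 s0.
rewrite normal_pdfE//.
have s20 : 0 < s ^+ 2 by rewrite exprn_even_gt0.
apply/cvgrPdist_le => e e0; near=> n.
rewrite sub0r normrN ger0_norm; last by rewrite mulr_ge0 ?ltW ?expR_gt0.
rewrite /normal_fun subr0 mulNr expRN ler_pdivrMr ?expR_gt0//.
apply: (@le_trans _ _ (e * (n%:R ^+ 2 / (s ^+ 2 *+ 2)))); last first.
  by rewrite ler_pM2l//; apply: le_trans (expR_ge1Dx _); rewrite lerDr.
rewrite -ler_pdivrMl// ler_pdivlMr ?mulrn_wgt0//.
apply: (@le_trans _ _ n%:R).
  by near: n; apply: nbhs_infty_ger.
rewrite expr2 -[leLHS]mulr1 ler_wpM2l// ler1n; near: n; exact: nbhs_infty_gt.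
Unshelve. all: by end_near. Qed.

Let normal_pdfN x : p (- x) = p x.
Proof. by rewrite !normal_pdfE// /normal_fun !subr0 sqrrN. Qed.

Let cvg_trig_normal_pdf (f : nat -> R) : (forall n, `|f n| <= 1) ->
  f n * p n%:R @[n --> \oo] --> (0 : R).
Proof.
move=> f1; apply/cvgrPdist_le => e e0; move/cvgrPdist_le : cvg_normal_pdf => /(_ _ e0).
apply: filterS => n; rewrite !sub0r !normrN normrM; apply: le_trans.
by rewrite -[leRHS]mul1r ler_wpM2r.
Qed.

Let ncos1 (x : R) : `|cos x| <= 1. Proof. exact: cos_max. Qed.
Let nsin1 (x : R) : `|sin x| <= 1. Proof. exact: sin_max. Qed.

Variable c : R.

Let ccos (t : R) : continuous (fun x => cos (t * x + c)).
Proof. by move=> x; apply: continuous_comp; [apply: cvgD; [exact: mulrl_continuous|exact: cvg_cst]|exact: continuous_cos]. Qed.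
Let csin (t : R) : continuous (fun x => sin (t * x + c)).
Proof. by move=> x; apply: continuous_comp; [apply: cvgD; [exact: mulrl_continuous|exact: cvg_cst]|exact: continuous_sin]. Qed.
Let cp : continuous p. Proof. exact: continuous_normal_pdf. Qed.

Let gauss_ibp t : \int[mu]_x (x * sin (t * x + c) * p x) = s ^+ 2 * t * \int[mu]_x (cos (t * x + c) * p x).
Proof.
have ic := integrable_trig_normal_pdf (@ccos t) (fun x => ncos1 _).
have is_ := integrable_xtrig_normal_pdf (@csin t) (fun x => nsin1 _).
have icZ := integrableZl measurableT t ic.
have isZ := integrableZl measurableT (s ^- 2) is_.
have H : \int[mu]_x (t * (cos (t * x + c) * p x) - s ^- 2 * (x * sin (t * x + c) * p x)) = 0.
  apply: (@integral_derivative_eq0 _ (fun x => sin (t * x + c) * p x)).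
  - move=> x; have h1 : is_derive x (1 : R) (fun y => t * y + c) t.
      by apply: is_derive_eq; rewrite /GRing.scale/= mulr1 addr0.
    have h2 := @is_derive1_comp _ sin _ _ _ _ (is_derive_sin _) h1.
    have h3 := @is_deriveM _ _ _ _ _ _ _ _ h2 (normal_pdf_deriv x).
    by apply: is_derive_eq; rewrite /GRing.scale/=; field.
  - move=> x; apply: cvgB; apply: cvgM; try exact: cvg_cst; apply: cvgM; try exact: cp.
      exact: ccos.
    by apply: cvgM; [exact: cvg_id|exact: csin].
  - exact: (integrableB measurableT icZ isZ).
  - exact: cvg_trig_normal_pdf.
  - under eq_fun do rewrite normal_pdfN; exact: cvg_trig_normal_pdf.
move: H; rewrite RintegralB// !RintegralZl// => /eqP; rewrite subr_eq0 => /eqP H.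
by rewrite -mulrA H mulrA mulfV ?mul1r// sqrf_eq0.
Qed.

Let Phi t := \int[mu]_x (cos (t * x + c) * p x).

Let Phi_deriv t : is_derive t (1 : R) Phi (- (s ^+ 2 * t * Phi t)).
Proof.
pose f (t x : R) := cos (t * x + c) * p x.
have df t' x : is_derive t' (1 : R) (f ^~ x) (- (x * sin (t' * x + c) * p x)).
  have h1 : is_derive t' (1 : R) (fun y => y * x + c) x.
    by apply: is_derive_eq; rewrite /GRing.scale/= mulr1 mulr0 add0r addr0.
  have h2 := @is_derive1_comp _ cos _ _ _ _ (is_derive_cos _) h1.
  have h3 := @is_deriveM _ _ _ _ _ _ _ _ h2 (is_derive_cst (p x) t' 1).
  by apply: is_derive_eq; rewrite /GRing.scale/=; ring.
have d1 t' x : partial1of2 f t' x = - (x * sin (t' * x + c) * p x).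
  by rewrite partial1of2E; apply: derive_val.
have It : `]t - 1, t + 1[%classic t by rewrite /= in_itv/= ltrBlDr ltrDl ltr01.
have intf x : `]t - 1, t + 1[%classic x -> mu.-integrable setT (EFin \o f x).
  by move=> _; exact: (integrable_trig_normal_pdf (@ccos x) (fun x => ncos1 _)).
have derf x y : `]t - 1, t + 1[%classic x -> setT y -> derivable (f ^~ y) x 1.
  by move=> _ _; case: (df x y).
have G0 (x : R) : 0 <= `|x| * p x by rewrite mulr_ge0 ?normal_pdf_ge0.
have Gub x y : `]t - 1, t + 1[%classic x -> setT y -> `|partial1of2 f x y| <= `|y| * p y.
  move=> _ _; rewrite d1 normrN !normrM (ger0_norm (normal_pdf_ge0 _ _ _)).
  by rewrite ler_wpM2r ?normal_pdf_ge0// -[leRHS]mulr1 ler_wpM2l.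
have D := derivable_under_integral measurableT It intf derf G0 integrable_normr_normal_pdf Gub.
have E := differentiation_under_integral measurableT It intf derf G0 integrable_normr_normal_pdf Gub.
apply: DeriveDef => //; rewrite -derive1E E.
under eq_Rintegral do rewrite d1 -mulN1r.
rewrite RintegralZl//; last exact: (integrable_xtrig_normal_pdf (@csin t) (fun x => nsin1 _)).
by rewrite gauss_ibp mulN1r.
Qed.

(** The phase [c] lets one real identity carry both the cosine and the sine transform.
    Differentiation under the integral and integration by parts give Phi' = - s^2 t Phi, so Phi(t)
    exp(s^2 t^2 / 2) is constant, equal to its value cos c at 0. *)
Lemma normal_characteristic t :
  \int[mu]_x (cos (t * x + c) * p x) = expR (- (s ^+ 2 * t ^+ 2 / 2)) * cos c.
Proof.
pose F t := Phi t * expR (s ^+ 2 * t ^+ 2 / 2).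
have dF t' : is_derive t' (1 : R) F 0.
  have h1 : is_derive t' (1 : R) (fun t => s ^+ 2 * t ^+ 2 / 2) (s ^+ 2 * t').
    by apply: is_derive_eq; rewrite /GRing.scale/=; field.
  have h2 := @is_derive1_comp _ expR _ _ _ _ (is_derive_expR _) h1.
  have h3 := @is_deriveM _ _ _ _ _ _ _ _ (Phi_deriv t') h2.
  by apply: is_derive_eq; rewrite /GRing.scale/=; ring.
have : F t = F 0 by apply: is_derive_0_is_cst.
rewrite /F expr0n/= mulr0 mul0r expR0 mulr1 => FE.
have P0 : Phi 0 = cos c.
  rewrite /Phi; under eq_Rintegral do rewrite mul0r add0r.
  rewrite RintegralZl//; last exact: integrable_normal_pdf.
  by rewrite /Rintegral integral_normal_pdf mulr1.
move: FE; rewrite P0 => FE.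
by rewrite expRN mulrC -FE mulfK// gt_eqF ?expR_gt0.
Qed.

End gaussian_characteristic.

Lemma fatou_bound d (T : measurableType d) (R : realType) (m : {measure set T -> \bar R})
    (f_ : nat -> T -> R) (f : T -> R) (C : \bar R) :
  (forall n, measurable_fun setT (f_ n)) -> measurable_fun setT f ->
  (forall n x, 0 <= f_ n x) -> (forall x, 0 <= f x) ->
  {ae m, forall x, f_ n x @[n --> \oo] --> f x} ->
  (forall n, \int[m]_x (f_ n x)%:E <= C)%E ->
  (\int[m]_x (f x)%:E <= C)%E.
Proof.
move=> mf_ mf f_0 f0 fcvg fC.
have mEf n : measurable_fun setT (fun x => (f_ n x)%:E) by exact/measurable_EFinP.
have -> : (\int[m]_x (f x)%:E = \int[m]_x limn_einf (fun n => (f_ n x)%:E))%E.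
  apply: ae_eq_integral => //.
  - exact/measurable_EFinP.
  - apply: measurableT_comp => //; apply: measurable_fun_limn_esup => n.
    exact: measurableT_comp.
  - apply: filterS fcvg => x fx _; apply/esym.
    apply: (cvg_limn_einf_sup (l := (f x)%:E) _).1.
    by apply: cvg_EFin => //; exact: nearW.
apply: (le_trans (fatou m measurableT mEf _)).
  by move=> n x _; rewrite lee_fin.
rewrite limn_einf_lim; apply: lime_le.
  exact: is_cvg_einfs.
apply: nearW => n; apply: le_trans (fC n).
by apply: ereal_inf_lbound; exists n => /=.
Qed.

Section exp_trig_bounds.
Context (R : realType).
Implicit Types (y : R).

Lemma ge0_derive_homo (F f : R -> R) (a b : R) : (forall x : R, is_derive x (1 : R) F (f x)) ->
  (forall x, a <= x <= b -> 0 <= f x) -> a <= b -> F a <= F b.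
Proof.
move=> dF f0 ab.
have [|x xab FE] := @MVT_segment _ F f a b ab (fun x _ => dF x).
  exact/continuous_subspaceT/(is_derive_continuous dF).
by rewrite -subr_ge0 FE mulr_ge0 ?subr_ge0// f0// -in_itv.
Qed.

Lemma expRN_le2 y : 0 <= y -> expR (- y) <= 1 - y + y ^+ 2 / 2.
Proof.
move=> y0; rewrite -subr_ge0.
pose F y : R := 1 - y + y ^+ 2 / 2 - expR (- y).
have -> : 0 = F 0 by rewrite /F oppr0 expR0; field.
apply: (@ge0_derive_homo F (fun y => -1 + y + expR (- y))) => //.
  move=> x; have h := @is_derive1_comp _ expR _ _ _ _ (is_derive_expR _) (is_deriveNid x 1).
  by apply: is_derive_eq; rewrite /GRing.scale/=; field.
by move=> x _; have := expR_ge1Dx (- x); lra.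
Qed.

Lemma expRN_ge3 y : 0 <= y -> 1 - y + y ^+ 2 / 2 - y ^+ 3 / 6 <= expR (- y).
Proof.
move=> y0; rewrite -subr_ge0.
pose F y : R := expR (- y) - (1 - y + y ^+ 2 / 2 - y ^+ 3 / 6).
have -> : 0 = F 0 by rewrite /F oppr0 expR0; field.
apply: (@ge0_derive_homo F (fun y => - expR (- y) + 1 - y + y ^+ 2 / 2)) => //.
  move=> x; have h := @is_derive1_comp _ expR _ _ _ _ (is_derive_expR _) (is_deriveNid x 1).
  by apply: is_derive_eq; rewrite /GRing.scale/=; field.
by move=> x /andP[x0 _]; have := expRN_le2 x0; lra.
Qed.

Lemma normr_sin_le y : `|sin y| <= `|y|.
Proof.
wlog y0 : y / 0 <= y.
  move=> H; have [/H//|/ltW y0] := leP 0 y.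
  by rewrite -normrN -sinN -[in leRHS]normrN H// oppr_ge0.
rewrite (ger0_norm y0) ler_norml.
have dF x : is_derive x (1 : R) (fun y => sin y + y) (cos x + 1) by apply: is_derive_eq.
have dG x : is_derive x (1 : R) (fun y => y - sin y) (1 - cos x) by apply: is_derive_eq.
have F0 : forall x, 0 <= x <= y -> 0 <= cos x + 1.
  by move=> x _; have := cos_geN1 x; lra.
have G0 : forall x, 0 <= x <= y -> 0 <= 1 - cos x.
  by move=> x _; have := cos_le1 x; lra.
have := ge0_derive_homo dF F0 y0; have := ge0_derive_homo dG G0 y0.
by rewrite sin0; lra.
Qed.

Lemma onem_cosE y : 2 - 2 * cos y = (2 * sin (y / 2)) ^+ 2.
Proof.
have -> : y = (y / 2) *+ 2 by field.
rewrite cos_mulr2n; have -> : y / 2 *+ 2 / 2 = y / 2 by field.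
rewrite exprMn sin2cos2; ring.
Qed.

Lemma onem_cos_le y : 2 - 2 * cos y <= y ^+ 2.
Proof.
rewrite onem_cosE -[leLHS]real_normK ?num_real// -[leRHS]real_normK ?num_real//.
rewrite ler_sqr ?nnegrE// normrM ger0_norm//.
have := normr_sin_le (y / 2); rewrite normrM (@ger0_norm _ (2^-1)) ?invr_ge0//; lra.
Qed.

Lemma cvg_sin_quotient (x : R) : (2 * sin (n.+1%:R^-1 * x / 2)) / n.+1%:R^-1 @[n --> \oo] --> x.
Proof.
have d : is_derive (0 : R) (1 : R) (fun h => 2 * sin (h * x / 2)) x.
  have h1 : is_derive (0 : R) (1 : R) (fun y => y * x / 2) (x / 2).
    by apply: is_derive_eq; rewrite /GRing.scale/=; field.
  have h2 := @is_derive1_comp _ sin _ _ _ _ (is_derive_sin _) h1.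
  by apply: is_derive_eq; rewrite /GRing.scale/= !mul0r cos0; field.
case: d => d dE.
have : (h^-1 *: ((fun h => 2 * sin (h * x / 2)) (h *: (1 : R) + 0) - 2 * sin (0 * x / 2))) @[h --> 0^'] --> x.
  by rewrite -[X in _ --> X]dE; move: d => /cvg_ex[l dl]; rewrite /derive (cvg_lim _ dl).
move=> /cvgr_dnbhsP/(_ (fun n => n.+1%:R^-1)) H.
have {}H := H (conj (fun n => invr_neq0 (lt0r_neq0 (ltr0Sn _ n))) cvg_harmonic).
apply: cvg_trans H; apply: near_eq_cvg; apply: nearW => n /=.
by rewrite /GRing.scale/= !mul0r sin0 mulr0 subr0 mulr1 addr0 mulrC.
Qed.

End exp_trig_bounds.

Section gaussian_moments.
Context d (T : measurableType d) (R : realType) (P : probability T R).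
Implicit Types X : T -> R.

Lemma bmf_cos X t c : measurable_fun setT X -> bounded_mfun (fun w => cos (t * X w + c)).
Proof.
move=> mX; split; last by exists 1 => w; exact: cos_max.
apply: measurableT_comp; first by apply: continuous_mfun; exact: continuous_cos.
by apply: measurable_funD => //; exact: measurable_funM.
Qed.

Lemma centred_gaussian_char X : centred_gaussian P X ->
  exists2 s, 0 <= s & forall t c, \int[P]_w cos (t * X w + c) = expR (- (s * t ^+ 2 / 2)) * cos c.
Proof.
move=> [mX [sigma sigmaE]]; exists (sigma ^+ 2); first exact: sqr_ge0.
move=> t c.
have bX := bmf_cos t c mX.
(* The summand 1 keeps the integrand nonnegative, so that its integral can be moved to the law of
   [X]. *)
pose h (x : R) := 1 + cos (t * x + c).
have ch : continuous (fun x : R => cos (t * x + c)).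
  move=> x; apply: continuous_comp; last exact: continuous_cos.
  by apply: cvgD; [exact: mulrl_continuous|exact: cvg_cst].
have mh : measurable_fun setT h by apply: measurable_funD => //; exact: continuous_mfun.
have h0 x : 0 <= h x by rewrite /h; have := cos_geN1 (t * x + c); lra.
have E1 : (1 + \int[P]_w cos (t * X w + c))%:E = (\int[P]_w (h (X w))%:E)%E.
  rewrite -[1](Rint_cst P) -RintegralD//; last 2 first.
  - exact: (bmf_integrable P (bmf_cst _ _)).
  - exact: bmf_integrable.
  by rewrite EFin_Rint//; apply: bmfD => //; exact: bmf_cst.
suff : (\int[P]_w (h (X w))%:E = (1 + expR (- (sigma ^+ 2 * t ^+ 2 / 2)) * cos c)%:E)%E.
  by rewrite -E1 => -[] /addrI.
have mX' : @measurable_fun _ _ T (measurableTypeR R) setT X := mX.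
have mh' : @measurable_fun _ _ (measurableTypeR R) _ setT h := mh.
have [s0|s0] := eqVneq sigma 0.
  rewrite -(@ge0_integral_law _ _ _ _ _ P (\d_(0%R : measurableTypeR R)) _ _ mX' _ mh')//; last first.
    by move=> A mA; apply: etrans (sigmaE A mA) _; rewrite s0 eqxx.
  rewrite integral_dirac//; last exact/measurable_EFinP.
  by rewrite diracT mul1e s0 expr0n/= !mul0r oppr0 expR0 mul1r /h mulr0 add0r.
rewrite -(@ge0_integral_law _ _ _ _ _ P (normal_prob 0 sigma) _ _ mX' _ mh')//; last first.
  by move=> A mA; apply: etrans (sigmaE A mA) _; rewrite (negbTE s0).
rewrite (@ge0_integral_density _ _ _ lebesgue_measure _ (normal_pdf 0 sigma))//; last 2 first.
- exact: measurable_normal_pdf.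
- exact: normal_pdf_ge0.
have ic := integrable_trig_normal_pdf sigma ch (fun x => cos_max _).
under eq_integral do rewrite /h mulrDl mul1r EFinD.
rewrite integralD//; last exact: integrable_normal_pdf.
rewrite integral_normal_pdf EFinD -(normal_characteristic s0 c t) /Rintegral fineK//.
exact: (integrable_fin_num measurableT ic).
Qed.

Section moments.
Context (X : T -> R) (s : R) (mX : measurable_fun setT X) (s0 : 0 <= s).
Hypothesis Xchar : forall t, \int[P]_w cos (t * X w) = expR (- (s * t ^+ 2 / 2)).

Let q t w := 2 - 2 * cos (t * X w).

Let bc t : bounded_mfun (fun w => cos (t * X w)).
Proof. by have := bmf_cos t 0 mX; under eq_fun do rewrite addr0. Qed.

Let bq t : bounded_mfun (q t).
Proof. by apply: bmfB; [exact: bmf_cst|exact: bmfZ]. Qed.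

Let bqn t n : bounded_mfun (fun w => q t w ^+ n).
Proof.
elim: n => [|n IHn]; first exact: bmf_cst.
by under eq_fun do rewrite exprS; exact: bmfM.
Qed.

Let q0 t w : 0 <= q t w. Proof. by rewrite /q; have := cos_le1 (t * X w); lra. Qed.

Let Eq1 t : \int[P]_w q t w = 2 - 2 * expR (- (s * t ^+ 2 / 2)).
Proof.
rewrite /q RintegralB//; last 2 first.
- exact: (bmf_integrable P (bmf_cst _ _)).
- by apply: bmf_integrable; exact: bmfZ.
by rewrite Rint_cst RintegralZl// ?Xchar//; exact: bmf_integrable.
Qed.

(* [(2 - 2 cos (t x)) / t^2] tends to [x^2] as [t] tends to [0], and its means are given by the
   characteristic function. *)
Let moment_fatou k C : (forall t, \int[P]_w (q t w ^+ k) <= C * t ^+ (2 * k)) ->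
  (\int[P]_w (X w ^+ (2 * k))%:E <= C%:E)%E.
Proof.
move=> qC; pose u n : R := n.+1%:R^-1.
have u0 n : u n != 0 by rewrite invr_neq0.
have mf n : bounded_mfun (fun w => (q (u n) w / (u n) ^+ 2) ^+ k).
  under eq_fun do rewrite expr_div_n mulrC.
  by apply: bmfZ; exact: bqn.
apply: (@fatou_bound _ _ _ P (fun n w => (q (u n) w / (u n) ^+ 2) ^+ k)).
- by move=> n; case: (mf n).
- exact: measurable_funX.
- by move=> n w; rewrite exprn_ge0// divr_ge0// sqr_ge0.
- by move=> w; rewrite exprM exprn_ge0// sqr_ge0.
- apply: aeW => w; rewrite exprM.
  under eq_fun do rewrite /q onem_cosE -expr_div_n.
  by do 2 apply: cvg_exprn; exact: cvg_sin_quotient.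
- move=> n; rewrite -EFin_Rint// lee_fin.
  under eq_Rintegral do rewrite expr_div_n mulrC.
  rewrite RintegralZl//; last exact: bmf_integrable.
  by rewrite ler_pdivrMl ?exprn_gt0 ?invr_gt0// (mulrC _ C) -exprM.
Qed.

(** Fatou gives only the upper bound. The lower one comes from 2 - 2 cos y <= y^2, which bounds the
    second moment from below by the difference quotients of the characteristic function. *)
Lemma gaussian_moment2 : (\int[P]_w (X w ^+ 2)%:E = s%:E)%E.
Proof.
apply/eqP; rewrite eq_le; apply/andP; split.
  apply: (@moment_fatou 1) => t.
  under eq_Rintegral do rewrite expr1.
  by rewrite Eq1; have := expR_ge1Dx (- (s * t ^+ 2 / 2)); lra.
apply/lee_addgt0Pr => e e0.
pose I := (\int[P]_w (X w ^+ 2)%:E)%E.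
have lowb t : t != 0 -> (((2 - 2 * expR (- (s * t ^+ 2 / 2))) / t ^+ 2)%:E <= I)%E.
  move=> t0; rewrite -Eq1 mulrC -RintegralZl//; last exact: bmf_integrable.
  rewrite EFin_Rint; last exact: bmfZ.
  apply: ge0_le_integral => //.
  - by move=> w _; rewrite lee_fin mulr_ge0// invr_ge0 sqr_ge0.
  - by apply/measurable_EFinP; case: (bmfZ (t ^- 2) (bq t)).
  - by apply/measurable_EFinP; exact: measurable_funX.
  - move=> w _; rewrite lee_fin ler_pdivrMl ?exprn_even_gt0//.
    by rewrite -exprMn; exact: onem_cos_le.
have [s1|s1] := eqVneq s 0.
  rewrite s1; apply: adde_ge0; last by rewrite lee_fin ltW.
  by apply: integral_ge0 => w _; rewrite lee_fin sqr_ge0.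
have sp : 0 < s by rewrite lt_def s1.
(* By the second order bound on exp the quotient is at least s - s^2 t^2 / 4, which for this t is s
   - e / 4. *)
pose t := Num.sqrt (e / s ^+ 2).
have t0 : 0 < t by rewrite sqrtr_gt0 divr_gt0// exprn_gt0.
have t2 : t ^+ 2 = e / s ^+ 2 by rewrite sqr_sqrtr// divr_ge0// ?sqr_ge0// ltW.
rewrite -leeBlDr// -EFinB; apply: le_trans (lowb t (lt0r_neq0 t0)); rewrite lee_fin.
rewrite ler_pdivlMr ?exprn_gt0//.
have y0 : 0 <= s * t ^+ 2 / 2 by rewrite divr_ge0// mulr_ge0 ?sqr_ge0// ltW.
have := expRN_le2 y0; set E := expR _.
have e2 : s ^+ 2 * t ^+ 2 = e by rewrite t2; field.
have -> : (s * t ^+ 2 / 2) ^+ 2 = (s ^+ 2 * t ^+ 2) / 4 * t ^+ 2 by field.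
rewrite e2.
by have := mulr_ge0 (ltW e0) (sqr_ge0 t); nra.
Qed.

(** (2 - 2 cos)^2 is a combination of the cosines of t X and 2 t X, with means exp(- y) and exp(- 4
    y) for y = s t^2 / 2. Taylor bounds on these leave 16 y^2; the loss from the exact constant 3 to
    4 is harmless. *)
Lemma gaussian_moment4 : (\int[P]_w (X w ^+ 4)%:E <= (4 * s ^+ 2)%:E)%E.
Proof.
apply: (@moment_fatou 2) => t.
have -> : \int[P]_w (q t w ^+ 2) = \int[P]_w (6 + (- 8 * cos (t * X w) + 2 * cos (2 * t * X w))).
  apply: eq_Rintegral => w _; rewrite /q.
  have -> : 2 * t * X w = (t * X w) *+ 2 by rewrite -mulrA mulr_natl.
  by rewrite cos_mulr2n; ring.
have [b1 b2] := (bmfZ (- 8) (bc t), bmfZ 2 (bc (2 * t))).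
rewrite !RintD; try by bmf.
rewrite !RintZ; try by bmf.
rewrite Rint_cst !Xchar.
have y0 : 0 <= s * t ^+ 2 / 2 by rewrite divr_ge0// mulr_ge0 ?sqr_ge0.
have -> : s * (2 * t) ^+ 2 / 2 = 4 * (s * t ^+ 2 / 2) by ring.
have -> : 4 * s ^+ 2 * t ^+ (2 * 2) = 16 * (s * t ^+ 2 / 2) ^+ 2 by field.
move: y0; set y := s * _ / 2 => y0.
have y40 : 0 <= 4 * y by rewrite mulr_ge0.
have := expRN_le2 y40; have := expR_ge1Dx (- y); nra.
Qed.

(** In the expansion 20 - 30 cos + 12 cos 2 - 2 cos 3 of (2 - 2 cos)^3 the terms of order 0, 1 and 2
    in y cancel, so that Taylor bounds on the means leave a multiple of y^3. *)
Lemma gaussian_moment6 : (\int[P]_w (X w ^+ 6)%:E <= (31 * s ^+ 3)%:E)%E.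
Proof.
apply: (@moment_fatou 3) => t.
have -> : \int[P]_w (q t w ^+ 3) = \int[P]_w ((20 + - 30 * cos (t * X w)) +
    (12 * cos (2 * t * X w) + - 2 * cos (3 * t * X w))).
  apply: eq_Rintegral => w _; rewrite /q.
  have -> : 3 * t * X w = (t * X w) *+ 2 + t * X w by ring.
  have -> : 2 * t * X w = (t * X w) *+ 2 by rewrite -mulrA mulr_natl.
  rewrite (cosD (t * X w *+ 2) (t * X w)) cos_mulr2n sin_mulr2n.
  have -> : (cos (t * X w) * sin (t * X w)) *+ 2 * sin (t * X w) =
    2 * cos (t * X w) * (sin (t * X w)) ^+ 2 by ring.
  by rewrite sin2cos2; ring.
have [b1 b2] := (bmfZ (- 30) (bc t), bmfZ 12 (bc (2 * t))).
have b3 := bmfZ (- 2) (bc (3 * t)).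
rewrite !RintD; try by bmf.
rewrite !RintZ; try by bmf.
rewrite Rint_cst !Xchar.
have y0 : 0 <= s * t ^+ 2 / 2 by rewrite divr_ge0// mulr_ge0 ?sqr_ge0.
have -> : s * (2 * t) ^+ 2 / 2 = 4 * (s * t ^+ 2 / 2) by ring.
have -> : s * (3 * t) ^+ 2 / 2 = 9 * (s * t ^+ 2 / 2) by ring.
have -> : 31 * s ^+ 3 * t ^+ (2 * 3) = 248 * (s * t ^+ 2 / 2) ^+ 3 by field.
move: y0; set y := s * _ / 2 => y0.
have y40 : 0 <= 4 * y by rewrite mulr_ge0.
have y90 : 0 <= 9 * y by rewrite mulr_ge0.
have := expRN_le2 y40; have := expRN_ge3 y0; have := expRN_ge3 y90.
set a := expR _; set b := expR _; set c := expR _ => h1 h2 h3.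
have -> : 248 * y ^+ 3 = 20 - 30 * (1 - y + y ^+ 2 / 2 - y ^+ 3 / 6) + (12 * (1 - 4 * y + (4 * y) ^+ 2 / 2) - 2 * (1 - 9 * y + (9 * y) ^+ 2 / 2 - (9 * y) ^+ 3 / 6)) by field.
lra.
Qed.

End moments.
End gaussian_moments.

(** * The Prekopa-Leindler inequality on the line *)

Section prekopa_leindler.
Context (R : realType).
Notation mu := (@lebesgue_measure R).

Lemma measurable_gt_fun (f : R -> R) t : measurable_fun setT f -> measurable [set x | t < f x].
Proof.
move=> mf; rewrite (_ : [set x | _] = setT `&` f @^-1` `]t, +oo[%classic).
  by apply: mf => //; exact: measurable_itv.
by rewrite setTI; apply/seteqP; split => x /=; rewrite in_itv/= andbT.
Qed.

Lemma measurable_hypograph (f : R -> R) : measurable_fun setT f ->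
  measurable [set z : R * R | z.1 < f z.2].
Proof.
move=> mf; rewrite (_ : [set z | _] = setT `&` (fun z : R * R => f z.2 - z.1) @^-1` `]0, +oo[%classic).
  have : measurable_fun setT (fun z : R * R => f z.2 - z.1).
    by apply: measurable_funB; [exact: (measurableT_comp mf measurable_snd)|exact: measurable_fst].
  by apply => //; exact: measurable_itv.
by rewrite setTI; apply/seteqP; split => x /=; rewrite in_itv/= andbT subr_gt0.
Qed.

Lemma measurable_level (f : R -> R) : measurable_fun setT f ->
  measurable_fun setT (fun t : R => mu [set x | t < f x]).
Proof.
move=> /measurable_hypograph mS; have := measurable_fun_xsection mu mS.
congr (measurable_fun _ _); apply/funext => t /=; congr (mu _).
by apply/seteqP; split => x; rewrite /xsection /= inE.
Qed.

Lemma layer_cake (f : R -> R) : measurable_fun setT f -> (forall x, 0 <= f x <= 1) ->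
  (\int[mu]_x (f x)%:E = \int[mu]_(t in `]0%R, 1%R[) mu [set x | (t < f x)%R])%E.
Proof.
move=> mf f01.
pose S := [set z : R * R | z.1 < f z.2] `&` (`]0%R, 1%R[%classic `*` setT).
have mS : measurable S.
  by apply: measurableI; [exact: measurable_hypograph|exact: measurableX].
pose F (z : R * R) := (\1_S z : R)%:E.
have mF : measurable_fun setT F by apply/measurable_EFinP; exact: measurable_indic.
have F0 z : (0 <= F z)%E by rewrite lee_fin.
have E1 : (\int[mu]_x \int[mu]_y F (x, y) = \int[mu]_(t in `]0%R, 1%R[) mu [set x | (t < f x)%R])%E.
{ rewrite [RHS]integral_mkcond; apply: eq_integral => t _.
  rewrite patchE; case: ifPn => tI.
  - rewrite -[X in _ = mu X]setIT -integral_indic//; last exact: measurable_gt_fun.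
    apply: eq_integral => y _; rewrite /F !indicE; congr ((_ : bool)%:R%:E).
    apply/idP/idP; rewrite !inE /S /=; first by case.
    by move=> h; split => //; split => //; rewrite inE in tI.
  - apply: integral0_eq => y _; rewrite /F indicE memNset// => -[_ [/= h _]].
    by move/negP: tI; apply; rewrite inE. }
have E2 : (\int[mu]_y \int[mu]_x F (x, y) = \int[mu]_y (f y)%:E)%E.
{ apply: eq_integral => y _; have /andP[f0 f1] := f01 y.
  transitivity (\int[mu]_x (\1_(`]0%R, f y[%classic : set R) x : R)%:E)%E.
  - apply: eq_integral => x _; rewrite /F !indicE; congr ((_ : bool)%:R%:E).
    apply/idP/idP; rewrite !inE /S /= !in_itv/=; first by case=> -> [/andP[-> _]].
    by move=> /andP[h1 h2]; split => //; split => //; rewrite h1 (lt_le_trans h2).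
  - rewrite integral_indic//= setIT lebesgue_measure_itv/= lte_fin.
    by case: ltP => [_|h]; rewrite ?sube0//; congr EFin; apply/eqP; rewrite eq_le f0. }
by rewrite -E1 -E2; exact/esym/fubini_tonelli.
Qed.

(** Brunn-Minkowski on the line when the sumset lies in an interval: each set has measure at most
    its supremum minus its infimum, the suprema add up to at most 2 r and the infima to at least - 2
    r. *)
Lemma midpoint_interval_measure (S1 S2 : set R) (r : R) : 0 < r ->
  S1 !=set0 -> S2 !=set0 -> measurable S1 -> measurable S2 ->
  (forall x y, S1 x -> S2 y -> `|x + y| <= 2 * r) ->
  (mu S1 + mu S2 <= 2 * (2 * r)%:E)%E.
Proof.
move=> r0 [x0 Sx0] [y0 Sy0] mS1 mS2 H.
have hs1 : has_sup S1.
  by split; [exists x0|exists (2 * r - y0) => x Sx; have := H _ _ Sx Sy0; rewrite ler_norml; lra].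
have hs2 : has_sup S2.
  by split; [exists y0|exists (2 * r - x0) => y Sy; have := H _ _ Sx0 Sy; rewrite ler_norml; lra].
have hi1 : has_inf S1.
  by split; [exists x0|exists (- (2 * r) - y0) => x Sx; have := H _ _ Sx Sy0; rewrite ler_norml; lra].
have hi2 : has_inf S2.
  by split; [exists y0|exists (- (2 * r) - x0) => y Sy; have := H _ _ Sx0 Sy; rewrite ler_norml; lra].
have s12 : sup S1 + sup S2 <= 2 * r.
  rewrite -lerBrDr; apply: ge_sup; first by exists x0.
  move=> x Sx; rewrite lerBrDr -lerBrDl; apply: ge_sup; first by exists y0.
  by move=> y Sy; have := H _ _ Sx Sy; rewrite ler_norml; lra.
have i12 : - (2 * r) <= inf S1 + inf S2.
  rewrite -lerBlDr; apply: lb_le_inf; first by exists x0.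
  move=> x Sx; rewrite lerBlDr -lerBlDl; apply: lb_le_inf; first by exists y0.
  by move=> y Sy; have := H _ _ Sx Sy; rewrite ler_norml; lra.
have mI (S : set R) : has_sup S -> has_inf S -> measurable S ->
   (mu S <= (sup S - inf S)%:E)%E.
  move=> hs hi mS.
  have iS : inf S <= sup S.
    case: hs => -[z Sz] us; apply: (@le_trans _ _ z).
      by apply: ge_inf => //; case: hi.
    by apply: ub_le_sup.
  apply: (@le_trans _ _ (mu `[inf S, sup S]%classic)).
    apply: le_measure; rewrite ?inE//.
    move=> z Sz /=; rewrite in_itv/=; apply/andP; split.
      by apply: ge_inf => //; case: hi.
    by apply: ub_le_sup => //; case: hs.
  by rewrite lebesgue_measure_itv/= lte_fin; case: ifP => // _; rewrite lee_fin subr_ge0.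
apply: (le_trans (leeD (mI _ hs1 hi1 mS1) (mI _ hs2 hi2 mS2))).
by rewrite -EFinD -EFinM lee_fin; lra.
Qed.

(** Let g be the Gaussian exp(- x^2). Dividing a = u g and b = v g by their suprema A and B makes
    the level sets {a > t A} and {b > t B} nonempty for every t < 1. By the hypothesis on u and v
    the midpoints of their points lie in {g > t c} with c = sqrt (A B), an interval. Integration
    over t bounds I / A + J / B by 2 sqrt pi / c, and the inequality between arithmetic and
    geometric means makes A and B cancel. *)
Lemma gauss_inf_convolution (u v : R -> R) (M : R) :
  continuous u -> continuous v ->
  (forall x, 0 <= u x <= M) -> (forall x, 0 <= v x <= M) ->
  (forall x y, u x * v y <= expR ((x - y) ^+ 2 / 2)) ->
  \int[mu]_x (u x * gauss_fun x) * \int[mu]_x (v x * gauss_fun x) <= pi.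
Proof.
move=> cu cv u0 v0 uv.
have M0 : 0 <= M by have /andP[a b] := u0 0; exact: le_trans b.
pose a x := u x * gauss_fun x; pose b x := v x * gauss_fun x.
have ia (w : R -> R) : continuous w -> (forall x, 0 <= w x <= M) ->
    mu.-integrable setT (fun x => (w x * gauss_fun x)%:E).
  move=> cw w0; have := integrableZl measurableT M (@integrableT_gauss R).
  apply: le_integrable => //.
    by apply/measurable_EFinP/measurable_funM; [exact: continuous_mfun|exact: measurable_gauss_fun].
  move=> x _; have /andP[w1 w2] := w0 x; rewrite -EFinM !gee0_abs ?lee_fin ?mulr_ge0 ?gauss_fun_ge0//.
  by rewrite ler_wpM2r ?gauss_fun_ge0.
have sup_pos (w : R -> R) : continuous w -> (forall x, 0 <= w x <= M) ->
   \int[mu]_x (w x * gauss_fun x) = 0 \/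
   exists2 A, 0 < A & (forall x, w x * gauss_fun x <= A) /\ (forall t, t < A -> exists x, t < w x * gauss_fun x).
  move=> cw w0; pose S := range (fun x => w x * gauss_fun x).
  have S0 : S !=set0 by exists (w 0 * gauss_fun 0), 0.
  have hS : has_sup S.
    split => //; exists M => _ [x _ <-]; have /andP[w1 w2] := w0 x.
    by rewrite -[leRHS]mulr1 ler_pM ?gauss_fun_ge0 ?gauss_fun_le1.
  have ubS x : w x * gauss_fun x <= sup S by apply: ub_le_sup; [case: hS|exists x].
  have supge0 : 0 <= sup S.
    by apply: le_trans (ubS 0); rewrite mulr_ge0 ?gauss_fun_ge0//; case/andP: (w0 0).
  move: supge0; rewrite le_eqVlt => /predU1P[s0|s0]; [left|right; exists (sup S) => //; split => //].
    rewrite -(Rintegral_set0 mu (cst 0)) /Rintegral; congr fine.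
    rewrite integral_set0; apply: integral0_eq => x _; congr EFin; apply/eqP.
    rewrite eq_le mulr_ge0 ?gauss_fun_ge0 ?andbT//; last by case/andP: (w0 x).
    by rewrite s0.
  move=> t tS; have [_ [x _ <-] tx] := sup_gt S0 tS.
  by exists x.
have [->|[A A0 [aA Aa]]] := sup_pos _ cu u0; first by rewrite mul0r pi_ge0.
have [->|[B B0 [bB Bb]]] := sup_pos _ cv v0; first by rewrite mulr0 pi_ge0.
pose c := Num.sqrt (A * B).
have c0 : 0 < c by rewrite sqrtr_gt0 mulr_gt0.
have c2 : c ^+ 2 = A * B by rewrite sqr_sqrtr// mulr_ge0// ltW.
have mw (w : R -> R) : continuous w -> measurable_fun setT (fun x => w x * gauss_fun x).
  by move=> cw; apply: measurable_funM; [exact: continuous_mfun|exact: measurable_gauss_fun].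
(* Only levels t in (0, 1) occur, so the rescaled Gaussian is cut off at 1. *)
pose k x := Num.min (gauss_fun x / c) 1.
have mk : measurable_fun setT k.
  apply: measurable_minr => //; apply: measurable_funM => //; exact: measurable_gauss_fun.
have key : (\int[mu]_x (a x / A)%:E + \int[mu]_x (b x / B)%:E <= 2%:E * \int[mu]_x (k x)%:E)%E.
  have ma : measurable_fun setT (fun x => a x / A) by apply: measurable_funM => //; exact: mw.
  have mb : measurable_fun setT (fun x => b x / B) by apply: measurable_funM => //; exact: mw.
  rewrite layer_cake//; last first.
    move=> x; rewrite divr_ge0 ?(ltW A0) ?mulr_ge0 ?gauss_fun_ge0//=; last by case/andP: (u0 x).
    by rewrite ler_pdivrMr// mul1r; exact: aA.
  rewrite (@layer_cake (fun x => b x / B))//; last first.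
    move=> x; rewrite divr_ge0 ?(ltW B0) ?mulr_ge0 ?gauss_fun_ge0//=; last by case/andP: (v0 x).
    by rewrite ler_pdivrMr// mul1r; exact: bB.
  rewrite layer_cake//; last first.
    by move=> x; rewrite /k le_min divr_ge0 ?gauss_fun_ge0 ?(ltW c0)// ler01 ge_min lexx orbT.
  have mlev (f : R -> R) : measurable_fun setT f -> measurable_fun (`]0%R, 1%R[%classic : set R) (fun t => mu [set x | (t < f x)%R]).
    by move=> mf; apply: measurable_funTS; exact: measurable_level.
  rewrite -ge0_integralD//; [|exact: mlev..].
  rewrite -ge0_integralZl//; last exact: mlev.
  apply: ge0_le_integral => //.
  - by move=> t _; rewrite adde_ge0.
  - by apply: emeasurable_funD; exact: mlev.
  - by apply: emeasurable_funM => //; exact: mlev.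
  move=> t /=; rewrite in_itv/= => /andP[t0 t1].
  have tA : t * A < A by rewrite gtr_pMl.
  have tB : t * B < B by rewrite gtr_pMl.
  have [x0 x0A] := Aa _ tA; have [y0 y0B] := Bb _ tB.
  have sub x y : t < a x / A -> t < b y / B -> t * c < expR (- ((x + y) / 2) ^+ 2).
    rewrite !ltr_pdivlMr// => ha hb.
    rewrite -ltr_sqr ?nnegrE ?mulr_ge0 ?expR_ge0 ?(ltW t0) ?(ltW c0)//.
    rewrite exprMn c2.
    have -> : t ^+ 2 * (A * B) = (t * A) * (t * B) by ring.
    apply: (@lt_le_trans _ _ (a x * b y)).
      by apply: ltr_pM => //; rewrite mulr_ge0// ltW.
    rewrite /a /b /gauss_fun.
    have -> : u x * expR (- x ^+ 2) * (v y * expR (- y ^+ 2)) = (u x * v y) * expR (- x ^+ 2 - y ^+ 2).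
      by rewrite expRD; ring.
    apply: (@le_trans _ _ (expR ((x - y) ^+ 2 / 2) * expR (- x ^+ 2 - y ^+ 2))).
      by rewrite ler_wpM2r ?expR_ge0.
    rewrite -expRD [leRHS]expr2 -expRD ler_expR; lra.
  (* Nonempty level sets have a midpoint, where the Gaussian is at most 1; the logarithm of t c is
     therefore negative and the radius [r] is real. *)
  have tc1 : t * c < 1.
    have := sub x0 y0; rewrite !ltr_pdivlMr// => /(_ x0A y0B) h; apply: (lt_le_trans h).
    by rewrite -expR0 ler_expR oppr_le0 sqr_ge0.
  have tc0 : 0 < t * c by rewrite mulr_gt0.
  pose r := Num.sqrt (- ln (t * c)).
  have lnlt : ln (t * c) < 0 by rewrite ln_lt0// tc0.
  have r0 : 0 < r by rewrite sqrtr_gt0 oppr_gt0.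
  have r2 : r ^+ 2 = - ln (t * c) by rewrite sqr_sqrtr// oppr_ge0 ltW.
  have lev z : t * c < expR (- z ^+ 2) <-> `|z| < r.
    rewrite -[in X in X < _](lnK tc0) ltr_expR ltrNr -r2 -[z ^+ 2]real_normK ?num_real//.
    by rewrite ltr_sqr ?nnegrE ?(ltW r0).
  have -> : mu [set x | t < k x] = (2 * r)%:E.
    rewrite (_ : [set x | _] = `]- r, r[%classic).
      rewrite lebesgue_measure_itv/= lte_fin ifT; last by rewrite gtrN.
      by rewrite -EFinB; congr EFin; ring.
    apply/seteqP; split => x /=; rewrite /k lt_min t1 andbT ltr_pdivlMr// in_itv/= -ltr_norml.
      by move/lev.
    by move/lev.
  apply: midpoint_interval_measure => //.
  - by exists x0 => /=; rewrite ltr_pdivlMr.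
  - by exists y0 => /=; rewrite ltr_pdivlMr.
  - exact: measurable_gt_fun.
  - exact: measurable_gt_fun.
  - move=> x y /= xa yb; have := sub _ _ xa yb => /lev.
    by rewrite normrM (@ger0_norm _ 2^-1) ?invr_ge0//; lra.
have Ea : (\int[mu]_x (a x / A)%:E = (\int[mu]_x a x / A)%:E)%E.
  under eq_integral do rewrite mulrC EFinM.
  rewrite integralZl//; last exact: ia.
  by rewrite mulrC EFinM /Rintegral fineK//; exact: (integrable_fin_num measurableT (ia _ cu u0)).
have Eb : (\int[mu]_x (b x / B)%:E = (\int[mu]_x b x / B)%:E)%E.
  under eq_integral do rewrite mulrC EFinM.
  rewrite integralZl//; last exact: ia.
  by rewrite mulrC EFinM /Rintegral fineK//; exact: (integrable_fin_num measurableT (ia _ cv v0)).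
have Ek : (\int[mu]_x (k x)%:E <= (Num.sqrt pi / c)%:E)%E.
  apply: (@le_trans _ _ (\int[mu]_x ((c^-1)%:E * (gauss_fun x)%:E))%E).
    apply: ge0_le_integral => //.
    - by move=> x _; rewrite lee_fin /k le_min divr_ge0 ?gauss_fun_ge0 ?(ltW c0)// ler01.
    - exact/measurable_EFinP.
    - by apply: emeasurable_funM => //; apply/measurable_EFinP; exact: measurable_gauss_fun.
    - by move=> x _; rewrite -EFinM lee_fin /k mulrC ge_min lexx.
  rewrite ge0_integralZl//.
  - by rewrite integralT_gauss -EFinM mulrC.
  - by apply/measurable_EFinP; exact: measurable_gauss_fun.
  - by move=> x _; rewrite lee_fin gauss_fun_ge0.
  - by rewrite lee_fin invr_ge0 ltW.
have : \int[mu]_x a x / A + \int[mu]_x b x / B <= 2 * (Num.sqrt pi / c).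
  rewrite -lee_fin EFinD -Ea -Eb EFinM; apply: (le_trans key).
  by rewrite lee_pmul2l ?lte_fin.
rewrite -/a -/b; set I := \int[mu]_x a x; set J := \int[mu]_x b x => IJ.
have I0 : 0 <= I / A.
  rewrite divr_ge0 ?(ltW A0)//; apply: Rintegral_ge0 => x _.
  by rewrite mulr_ge0 ?gauss_fun_ge0//; case/andP: (u0 x).
have J0 : 0 <= J / B.
  rewrite divr_ge0 ?(ltW B0)//; apply: Rintegral_ge0 => x _.
  by rewrite mulr_ge0 ?gauss_fun_ge0//; case/andP: (v0 x).
have : (I / A + J / B) ^+ 2 <= (2 * (Num.sqrt pi / c)) ^+ 2.
  by rewrite ler_sqr ?nnegrE ?addr_ge0// (le_trans (addr_ge0 I0 J0)).
have -> : (2 * (Num.sqrt pi / c)) ^+ 2 = 4 * (pi / (A * B)) :> R.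
  by rewrite exprMn expr_div_n c2 sqr_sqrtr ?pi_ge0//; ring.
have := sqr_ge0 (I / A - J / B) => h1 h2.
have : (I / A) * (J / B) <= pi / (A * B) by nra.
have -> : I / A * (J / B) = I * J / (A * B) by field; rewrite !gt_eqF.
by rewrite ler_pM2r// invr_gt0 mulr_gt0.
Qed.

End prekopa_leindler.

(** * Continuity theorem for Lipschitz functions of finitely many variables *)

Section normal_expectation.
Context (R : realType).
Notation mu := (@lebesgue_measure R).

Lemma Rint_normal_prob (s : R) (h : R -> R) : measurable_fun setT h -> (forall x, 0 <= h x) ->
  \int[normal_prob 0 s]_x h x = \int[mu]_x (h x * normal_pdf 0 s x).
Proof.
move=> mh h0; congr fine.
rewrite (@ge0_integral_density _ _ _ mu _ (normal_pdf 0 s))//.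
- exact: measurable_normal_pdf.
- exact: normal_pdf_ge0.
Qed.

Lemma bmf_cos_normal (t c : R) : bounded_mfun (fun z : measurableTypeR R => cos (t * z + c)).
Proof.
split; last by exists 1 => w; exact: cos_max.
apply: continuous_mfun => x; apply: continuous_comp; last exact: continuous_cos.
by apply: cvgD; [exact: mulrl_continuous|exact: cvg_cst].
Qed.

Lemma normal_prob_char (s t c : R) : s != 0 ->
  \int[normal_prob (0 : R) s]_x cos (t * x + c) = expR (- (s ^+ 2 * t ^+ 2 / 2)) * cos c.
Proof.
move=> s0; have bc := bmf_cos_normal t c.
apply: (@addrI _ 1); rewrite -[X in X + _](Rint_cst (normal_prob 0 s) 1) -RintD//; last exact: bmf_cst.
rewrite Rint_normal_prob; last 2 first.
- by have [m _] : bounded_mfun (fun z : measurableTypeR R => 1 + cos (t * z + c)) by apply: bmfD => //; exact: bmf_cst.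
- by move=> x; have := cos_geN1 (t * x + c); lra.
have ic : mu.-integrable setT (fun x => (cos (t * x + c) * normal_pdf 0 s x)%:E).
  apply: integrable_trig_normal_pdf; last by move=> x; exact: cos_max.
  by move=> x; apply: continuous_comp; [apply: cvgD; [exact: mulrl_continuous|exact: cvg_cst]|exact: continuous_cos].
under eq_Rintegral do rewrite mulrDl mul1r.
rewrite RintegralD//; last exact: integrable_normal_pdf.
rewrite {1}/Rintegral integral_normal_pdf/=; congr (_ + _).
exact: normal_characteristic.
Qed.

End normal_expectation.

Section levy_one_coordinate.
Context (R : realType) d (T : measurableType d) (P : nat -> probability T R) (P0 : probability T R).
Variables (Y X : T -> R) (M : R).
Hypotheses (mY : measurable_fun setT Y) (mX : measurable_fun setT X) (YM : forall w, `|Y w| <= M).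
Hypothesis char_cvg : forall t c,
  \int[P n]_w (Y w * cos (t * X w + c)) @[n --> \oo] --> \int[P0]_w (Y w * cos (t * X w + c)).

Notation gam := (normal_prob (0 : R) 1).
Let bump (x : R) : R := expR (- (x ^+ 2 / 2)).

Let cbump : continuous bump.
Proof.
move=> x; apply: continuous_comp; last exact: continuous_expR.
apply: cvgN; apply: cvgM; last exact: cvg_cst.
exact: exprn_continuous.
Qed.

Let bump01 x : 0 <= bump x <= 1.
Proof. by rewrite expR_ge0/= -expR0 ler_expR oppr_le0 divr_ge0 ?sqr_ge0. Qed.

Let bump1 x : `|bump x| <= 1.
Proof. by have /andP[a b] := bump01 x; rewrite ger0_norm. Qed.

Let bumpE (x : R) : bump x = \int[gam]_z cos (x * z).
Proof.
rewrite /bump; have := normal_prob_char x 0 (oner_neq0 R).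
rewrite cos0 mulr1 expr1n mul1r => <-.
by apply: eq_Rintegral => z _; rewrite addr0.
Qed.

Let bcos0 (t : R) : bounded_mfun (fun z : measurableTypeR R => cos (t * z)).
Proof. by have := bmf_cos_normal t 0; under eq_fun do rewrite addr0. Qed.

Let bYbump (e : R) : bounded_mfun (fun z : T * measurableTypeR R => Y z.1 * bump ((X z.1 - z.2) / e)).
Proof.
apply: bmfM.
- split; last by exists M => z; exact: YM.
  exact: (measurableT_comp mY measurable_fst).
- split; last by exists 1 => z; exact: bump1.
  apply: measurableT_comp; first by apply: continuous_mfun; exact: cbump.
  apply: measurable_funM => //; apply: measurable_funB; last exact: measurable_snd.
  exact: (measurableT_comp mX measurable_fst).
Qed.

(* [bump x] is the mean of [cos (x z)] over a standard normal [z]. *)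
Lemma levy_bump (e y : R) : e != 0 ->
  \int[P n]_w (Y w * bump ((X w - y) / e)) @[n --> \oo] --> \int[P0]_w (Y w * bump ((X w - y) / e)).
Proof.
move=> e0.
have swap : bounded_mfun (fun z : T * measurableTypeR R => Y z.1 * cos (z.2 / e * X z.1 + (- (y * z.2 / e)))).
{ apply: bmfM.
  - split; last by exists M => z; exact: YM.
    exact: (measurableT_comp mY measurable_fst).
  - split; last by exists 1 => z; exact: cos_max.
    apply: measurableT_comp; first by apply: continuous_mfun; exact: continuous_cos.
    have m2 : measurable_fun setT (fun z : T * measurableTypeR R => (z.2 : R)) by exact: measurable_snd.
    have m1 : measurable_fun setT (fun z : T * measurableTypeR R => X z.1).
      exact: (measurableT_comp mX measurable_fst).
    apply: measurable_funD; first by apply: measurable_funM => //; exact: measurable_funM.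
    by apply: measurableT_comp => //; apply: measurable_funM => //; exact: measurable_funM. }
have E (P' : probability T R) : \int[P']_w (Y w * bump ((X w - y) / e)) =
  \int[gam]_z \int[P']_w (Y w * cos (z / e * X w + (- (y * z / e)))).
{ transitivity (\int[P']_w \int[gam]_z (Y w * cos (z / e * X w + (- (y * z / e))))).
  - apply: eq_Rintegral => w _; rewrite bumpE -RintZ; last exact: bcos0.
    by apply: eq_Rintegral => z _; congr (_ * cos _); field.
  - exact: (@Rint_fubini _ _ _ _ _ P' gam (fun z => Y z.1 * cos (z.2 / e * X z.1 + (- (y * z.2 / e))))). }
rewrite E; under eq_fun do rewrite E.
apply: (@bounded_cvg _ _ _ gam _ _ M).
- move=> n; have [|b _] := @bmf_Rint2 _ _ (measurableTypeR R) T R (P n)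
    (fun z w => Y w * cos (z / e * X w + - (y * z / e))); last exact: b.
  case: swap => m [M' h]; split; last by exists M' => z; exact: (h (z.2, z.1)).
  exact: (measurableT_comp m (@measurable_swap _ _ (measurableTypeR R) T)).
- move=> n z; apply: Rint_abs_le.
    apply: bmfM; first by split => //; exists M.
    exact: bmf_cos.
  move=> w; rewrite normrM -[leRHS]mulr1 ler_pM//.
  exact: cos_max.
- by move=> z; exact: char_cvg.
Qed.

Variables (h : R -> R) (H A K : R).
Hypotheses (A0 : 0 < A) (K0 : 0 <= K) (h0 : forall x, 0 <= h x <= H).
Hypotheses (hA : forall x, A < `|x| -> h x = 0) (hK : forall x y, `|h x - h y| <= K * `|x - y|).

Let ch : continuous h.
Proof.
move=> x; apply/cvgrPdist_le => e e0.
near=> y; apply: (le_trans (hK x y)).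
rewrite (@le_trans _ _ ((K + 1) * `|x - y|))// ?ler_wpM2r// ?lerDl//.
rewrite -ler_pdivlMl ?ltr_wpDl//; near: y.
by apply: cvgr_dist_le; [exact: cvg_id|rewrite mulr_gt0// invr_gt0 ltr_wpDl].
Unshelve. all: by end_near. Qed.

Let AA : - A < A. Proof. by rewrite gtrN. Qed.
Notation unif := (uniform_prob AA).

(** The convolution of [h] with the centred normal density of deviation [e]. Lebesgue measure on
    [-A, A] is written as 2 A times a uniform law, so that Fubini for probabilities applies. *)
Let smooth (e x : R) : R := 2 * A * normal_peak e * \int[unif]_y (h y * bump ((x - y) / e)).

Let bhb e x : bounded_mfun (fun y : measurableTypeR R => h y * bump ((x - y) / e)).
Proof.
split; last first.
  exists H => y; have /andP[a b] := h0 y; have /andP[a' b'] := bump01 ((x - y) / e).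
  by rewrite ger0_norm ?mulr_ge0// -[leRHS]mulr1 ler_pM.
apply: continuous_mfun => y; apply: cvgM; first exact: ch.
apply: continuous_comp; last exact: cbump.
by apply: cvgM; [apply: cvgB; [exact: cvg_cst|exact: cvg_id]|exact: cvg_cst].
Qed.

(** The truncation at 2 H keeps the integrand bounded independently of [e], for bounded convergence
    as [e] tends to 0. *)
Let modulus e : R := \int[gam]_z (Num.min (2 * H) (K * `|e * z|)).

Let bmod e : bounded_mfun (fun z : measurableTypeR R => Num.min (2 * H) (K * `|e * z|)).
Proof.
have H0 : 0 <= H by have /andP[a b] := h0 0; exact: le_trans b.
split; last first.
  exists (2 * H) => z; rewrite ger0_norm ?ge_min ?lexx//.
  by rewrite le_min !mulr_ge0.
by apply: measurable_minr => //; apply: measurable_funM => //; apply: measurableT_comp => //; exact: measurable_funM.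
Qed.

Lemma smooth_dist e x : 0 < e -> `|smooth e x - h x| <= modulus e.
Proof.
move=> e0.
have pe : 0 < normal_peak e by apply: normal_peak_gt0; rewrite gt_eqF.
(* Substitution y = x + e z; the restriction to [-A, A] disappears because [h] vanishes outside. *)
have E1 : smooth e x = \int[gam]_z h (x + e * z).
{ pose G y := h y * bump ((x - y) / e).
  have m1 : measurable_fun setT G by case: (bhb e x).
  have p1 y : 0 <= G y.
    by rewrite mulr_ge0//; [case/andP: (h0 y)|case/andP: (bump01 ((x - y) / e))].
  have cG : continuous G.
    move=> y; apply: cvgM; first exact: ch.
    apply: continuous_comp; last exact: cbump.
    by apply: cvgM; [apply: cvgB; [exact: cvg_cst|exact: cvg_id]|exact: cvg_cst].
  have IE : (\int[lebesgue_measure]_(y in `[(- A)%R, A]) (G y)%:E = \int[lebesgue_measure]_y (G y)%:E)%E.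
    rewrite integral_mkcond; apply: eq_integral => y _.
    rewrite patchE; case: ifPn => //; rewrite notin_setE/= in_itv/= => /negP.
    by rewrite -ler_norml -ltNge /G => /hA ->; rewrite mul0r.
  have Ifin : (\int[lebesgue_measure]_y (G y)%:E)%E \is a fin_num.
    rewrite -IE; apply: integrable_fin_num => //.
    exact: continuous_itv_integrable.
  have -> : smooth e x = normal_peak e * fine (\int[lebesgue_measure]_y (G y)%:E)%E.
  { rewrite /smooth /Rintegral integral_uniform//; last exact/measurable_EFinP.
    rewrite IE fineM//= opprK; set I := fine _.
    by have -> : A + A = 2 * A by [ring]; field; rewrite gt_eqF. }
  rewrite Rint_normal_prob; last 2 first.
  - apply: continuous_mfun => z; apply: continuous_comp; last exact: ch.
    by apply: cvgD; [exact: cvg_cst|exact: mulrl_continuous].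
  - by move=> z; case/andP: (h0 (x + e * z)).
  have dF z : is_derive z (1 : R) (fun z => x + e * z) e.
    by apply: is_derive_eq; rewrite /GRing.scale/=; ring.
  have F' : ((fun z => x + e * z)^`())%classic = cst e by rewrite (is_derive_derive1 dF).
  have FE : (fun z : R => x + e * z) = (fun z : R => (z + x / e) * e).
    by apply/funext => z; field; rewrite gt_eqF.
  have sub : (\int[lebesgue_measure]_y (G y)%:E = \int[lebesgue_measure]_z (G (x + e * z) * e)%:E)%E.
  { rewrite (@increasing_ge0_integration_by_substitutionT _ (fun z => x + e * z))//.
    - by rewrite F'.
    - by move=> z1 z2 z12; rewrite ltrD2l ltr_pM2l.
    - by rewrite F' => ?; exact: cvg_cst.
    - by rewrite F'; exact: is_cvg_cst.
    - by rewrite F'; exact: is_cvg_cst.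
    - by rewrite FE; exact: (gt0_cvgMlNy e0 (@cvg_addrr_Ny _ _)).
    - by rewrite FE; exact: (gt0_cvgMly e0 (@cvg_addrr _ _)). }
  rewrite -[normal_peak e]/(fine (normal_peak e)%:E) -fineM// sub -ge0_integralZl//; last 3 first.
  - apply/measurable_EFinP/measurable_funM => //; apply: (measurableT_comp m1).
    by apply: measurable_funD => //; exact: measurable_funM.
  - by move=> z _; rewrite lee_fin mulr_ge0// ltW.
  - by rewrite lee_fin ltW.
  congr fine; apply: eq_integral => z _; rewrite -EFinM normal_pdfE ?oner_neq0//; congr EFin.
  have -> : normal_peak 1 = normal_peak e * e :> R.
    rewrite /normal_peak expr1n mul1r -mulrnAr sqrtrM ?sqr_ge0// sqrtr_sqr gtr0_norm//.
    by rewrite invfM mulrAC mulVf ?mul1r ?gt_eqF.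
  rewrite /G /normal_fun /bump; have -> : (x - (x + e * z)) / e = - z by field; rewrite gt_eqF.
  rewrite subr0 sqrrN expr1n mulNr.
  by ring. }
have bh : bounded_mfun (fun z : measurableTypeR R => h (x + e * z)).
{ split; last by exists H => z; have /andP[a b] := h0 (x + e * z); rewrite ger0_norm.
  apply: continuous_mfun => z; apply: continuous_comp; last exact: ch.
  by apply: cvgD; [exact: cvg_cst|exact: mulrl_continuous]. }
rewrite E1 -[h x](Rint_cst gam); apply: Rint_dist_le => //; first exact: bmf_cst.
move=> z; rewrite le_min; apply/andP; split.
  have /andP[a b] := h0 (x + e * z); have /andP[a' b'] := h0 x.
  by rewrite ler_norml; lra.
by apply: (le_trans (hK _ _)); rewrite addrC addKr.
Qed.

Lemma modulus_cvg0 : modulus n.+1%:R^-1 @[n --> \oo] --> 0.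
Proof.
have H0 : 0 <= H by have /andP[a b] := h0 0; exact: le_trans b.
rewrite -[X in _ --> X](Rint_cst gam 0); apply: (@bounded_cvg _ _ _ gam _ _ (2 * H)).
- by move=> n; case: (bmod n.+1%:R^-1).
- move=> n z; rewrite ger0_norm ?ge_min ?lexx//.
  by rewrite le_min !mulr_ge0.
- move=> z; apply: (@squeeze_cvgr _ _ _ _ (cst 0) (fun n => K * `|z| * n.+1%:R^-1)).
  + apply: nearW => n; rewrite le_min !mulr_ge0//= ge_min.
    by rewrite normrM ger0_norm ?invr_ge0// -mulrA (mulrC `|z|) lexx orbT.
  + exact: cvg_cst.
  + by rewrite -[X in _ --> X](mulr0 (K * `|z|)); apply: cvgM; [exact: cvg_cst|exact: cvg_harmonic].
Qed.

Let bsmooth e : bounded_mfun (smooth e).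
Proof.
apply: bmfZ; apply: (@bmf_Rint2 _ _ (measurableTypeR R) (measurableTypeR R) R unif (fun x y => h y * bump ((x - y) / e))).
split; last first.
  exists H => z; have /andP[a b] := h0 z.2; have /andP[a' b'] := bump01 ((z.1 - z.2) / e).
  by rewrite ger0_norm ?mulr_ge0// -[leRHS]mulr1 ler_pM.
apply: measurable_funM.
  by apply: (@measurableT_comp _ _ _ _ _ _ h); [exact: continuous_mfun|exact: measurable_snd].
apply: (@measurableT_comp _ _ _ _ _ _ bump); first by apply: continuous_mfun; exact: cbump.
apply: measurable_funM => //; apply: measurable_funB; [exact: measurable_fst|exact: measurable_snd].
Qed.

(** [h] is replaced by its Gaussian regularisation, uniformly close to it. This is an average over y
    of Gaussian bumps centred at y, to which [levy_bump] applies. The weight [Y] will carry the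
    factors that depend on other coordinates. *)
Lemma levy_one_coordinate :
  \int[P n]_w (Y w * h (X w)) @[n --> \oo] --> \int[P0]_w (Y w * h (X w)).
Proof.
have M0 : 0 <= M by apply: le_trans (YM (point)).
have H0 : 0 <= H by have /andP[a b] := h0 0; exact: le_trans b.
apply: approx_cvg => e e0.
have [n0 n0e] : exists n0, M * modulus n0.+1%:R^-1 <= e.
{ have : M * modulus n.+1%:R^-1 @[n --> \oo] --> 0.
    by rewrite -[X in _ --> X](mulr0 M); apply: cvgM; [exact: cvg_cst|exact: modulus_cvg0].
  move=> /cvgrPdist_le/(_ _ e0)[n0 _ /(_ _ (leqnn n0))] /=; rewrite sub0r normrN => h1.
  by exists n0; apply: le_trans h1; exact: ler_norm. }
pose e1 : R := n0.+1%:R^-1.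
have e10 : 0 < e1 by rewrite invr_gt0.
have bY : bounded_mfun Y by split => //; exists M.
have bs : bounded_mfun (fun w => smooth e1 (X w)).
  by case: (bsmooth e1) => m [B hB]; split; [exact: measurableT_comp|exists B].
have bh : bounded_mfun (fun w => h (X w)).
  split; last by exists H => w; have /andP[a b] := h0 (X w); rewrite ger0_norm.
  by apply: measurableT_comp => //; exact: continuous_mfun.
have near (P' : probability T R) :
  `|\int[P']_w (Y w * h (X w)) - \int[P']_w (Y w * smooth e1 (X w))| <= e.
{ apply: Rint_dist; [exact: bmfM|exact: bmfM|].
  move=> w; rewrite -mulrBr normrM; apply: le_trans n0e; rewrite ler_pM// distrC.
  exact: smooth_dist. }
exists (fun n => \int[P n]_w (Y w * smooth e1 (X w))), (\int[P0]_w (Y w * smooth e1 (X w))).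
split; [|exact: near|by apply: nearW => n; exact: near].
have bhY : bounded_mfun (fun z : T * measurableTypeR R => h z.2 * (Y z.1 * bump ((X z.1 - z.2) / e1))).
{ apply: bmfM => //; split; last by exists H => z; have /andP[a b] := h0 z.2; rewrite ger0_norm.
  by apply: (@measurableT_comp _ _ _ _ _ _ h); [exact: continuous_mfun|exact: measurable_snd]. }
have E (P' : probability T R) : \int[P']_w (Y w * smooth e1 (X w)) = 2 * A * normal_peak e1 *
  \int[unif]_y (h y * \int[P']_w (Y w * bump ((X w - y) / e1))).
{ transitivity (\int[P']_w (2 * A * normal_peak e1 * \int[unif]_y (h y * (Y w * bump ((X w - y) / e1))))).
  - apply: eq_Rintegral => w _; rewrite /smooth mulrCA; congr (_ * _).
    rewrite -RintZ; last exact: bhb.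
    by apply: eq_Rintegral => y _; rewrite mulrCA.
  - rewrite RintZ; last first.
      exact: (@bmf_Rint2 _ _ T (measurableTypeR R) R unif (fun w y => h y * (Y w * bump ((X w - y) / e1)))).
    congr (_ * _).
    rewrite (@Rint_fubini _ _ _ _ _ P' unif (fun z => h z.2 * (Y z.1 * bump ((X z.1 - z.2) / e1))))//.
    apply: eq_Rintegral => y _; rewrite /= RintZ//.
    apply: bmfM => //; split; last by exists 1 => w; exact: bump1.
    apply: measurableT_comp; first by apply: continuous_mfun; exact: cbump.
    by apply: measurable_funM => //; exact: measurable_funB. }
rewrite E; under eq_fun do rewrite E.
apply: cvgM; first exact: cvg_cst.
have bB n : bounded_mfun (fun y : measurableTypeR R => \int[P n]_w (Y w * bump ((X w - y) / e1))).
{ apply: (@bmf_Rint2 _ _ (measurableTypeR R) T R (P n) (fun y w => Y w * bump ((X w - y) / e1))).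
  case: (bYbump e1) => m [M' hM'].
  split; last by exists M' => z; exact: (hM' (z.2, z.1)).
  exact: (measurableT_comp m (@measurable_swap _ _ (measurableTypeR R) T)). }
apply: (@bounded_cvg _ _ _ unif _ _ (H * M)).
- by move=> n; apply: measurable_funM; [exact: continuous_mfun|case: (bB n)].
- move=> n y; rewrite normrM ler_pM//; first by have /andP[a b] := h0 y; rewrite ger0_norm.
  apply: Rint_abs_le.
    apply: bmfM => //; split; last by exists 1 => w; exact: bump1.
    apply: measurableT_comp; first by apply: continuous_mfun; exact: cbump.
    by apply: measurable_funM => //; exact: measurable_funB.
  by move=> w; rewrite normrM -[leRHS]mulr1 ler_pM.
- by move=> y; apply: cvgM; [exact: cvg_cst|apply: levy_bump; rewrite gt_eqF].
Qed.

End levy_one_coordinate.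

(** * Tent functions and interpolation on a grid *)

Section hat.
Context (R : realType).

Definition ramp (u : R) : R := Num.min 1 (Num.max 0 (u + 1)).

(** The tent function supported in [-1, 1], written as a difference so that sums of its integer
    translates telescope. *)
Definition hat (u : R) : R := ramp u - ramp (u - 1).

Lemma ramp01 u : 0 <= ramp u <= 1.
Proof. by rewrite /ramp le_min ler01 le_max lexx ge_min lexx. Qed.

Lemma ramp0 u : u <= -1 -> ramp u = 0.
Proof. by move=> u1; rewrite /ramp max_l ?min_r//; lra. Qed.

Lemma ramp1 u : 0 <= u -> ramp u = 1.
Proof. by move=> u1; rewrite /ramp min_l// le_max; apply/orP; right; lra. Qed.

Lemma ramp_homo u v : u <= v -> ramp u <= ramp v.
Proof.
move=> uv; rewrite /ramp le_min ge_min lexx/= ge_min; apply/orP; right.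
by rewrite ge_max !le_max lexx/= lerD2r uv orbT.
Qed.

Lemma ramp_lip u v : `|ramp u - ramp v| <= `|u - v|.
Proof.
wlog uv : u v / v <= u.
  by move=> H; have [/H//|/ltW/H] := leP v u; rewrite (distrC u) (distrC (ramp u)).
rewrite !ger0_norm ?subr_ge0 ?ramp_homo// /ramp /Num.min /Num.max.
by case: ifPn; case: ifPn; case: ifPn; case: ifPn; rewrite -?leNgt => *; lra.
Qed.

Lemma hat01 u : 0 <= hat u <= 1.
Proof.
rewrite /hat subr_ge0 ramp_homo ?gerBl//=.
by have /andP[a b] := ramp01 u; have /andP[c d] := ramp01 (u - 1); lra.
Qed.

Lemma hat_eq0 u : 1 <= `|u| -> hat u = 0.
Proof.
move=> u1; rewrite /hat; have [u0|u0] := leP 0 u.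
  by rewrite ger0_norm// in u1; rewrite !ramp1 ?subrr//; lra.
by rewrite ltr0_norm// in u1; rewrite !ramp0 ?subrr//; lra.
Qed.

Lemma hat_lip u v : `|hat u - hat v| <= 2 * `|u - v|.
Proof.
have := ramp_lip u v; have := ramp_lip (u - 1) (v - 1).
have -> : u - 1 - (v - 1) = u - v by ring.
rewrite /hat; set a := ramp u; set b := ramp v; set c := ramp _; set e := ramp _.
move=> h1 h2; have -> : a - c - (b - e) = (a - b) - (c - e) by ring.
by apply: (le_trans (ler_normB _ _)); lra.
Qed.

Lemma sum_hat u n : \sum_(i < n) hat (u - i%:R) = ramp u - ramp (u - n%:R).
Proof.
elim: n => [|n IHn]; first by rewrite big_ord0 subr0 subrr.
rewrite big_ord_recr/= IHn /hat -natr1.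
have -> : u - n%:R - 1 = u - (n%:R + 1) by ring.
by ring.
Qed.

End hat.

Lemma cvg_sumr (R : realType) (I : Type) (s : seq I) (F : I -> nat -> R) (l : I -> R) :
  (forall i, F i n @[n --> \oo] --> l i) ->
  \sum_(i <- s) F i n @[n --> \oo] --> \sum_(i <- s) l i.
Proof.
move=> Fl; elim: s => [|i s IHs].
  by under eq_fun do rewrite big_nil; rewrite big_nil; exact: cvg_cst.
by under eq_fun do rewrite big_cons; rewrite big_cons; apply: cvgD.
Qed.

Section coordinates.
Context (R : realType).
Implicit Types (a b : nat -> R) (G : (nat -> R) -> R).

Definition update a (j : nat) (x : R) : nat -> R := fun i => if i == j then x else a i.

(** Functions of [j] variables are encoded on infinite sequences; the condition also forces [G] to
    depend on the first [j] entries only, which allows inductions on [j] without dependent types. *)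
Definition lip_in (j : nat) (K : R) G := forall a b, `|G a - G b| <= K * \sum_(i < j) `|a i - b i|.

Lemma lip_update j K G x : lip_in j.+1 K G -> lip_in j K (fun a => G (update a j x)).
Proof.
move=> GK a b; apply: (le_trans (GK _ _)); rewrite big_ord_recr/= /update eqxx subrr normr0 addr0.
rewrite le_eqVlt; apply/orP; left; apply/eqP; congr (_ * _).
by apply: eq_bigr => i _; rewrite ltn_eqF.
Qed.

Definition grid_point (k i : nat) : R := (i%:R - (k.+1 ^ 2)%:R) / k.+1%:R.
Definition grid_hat (k i : nat) (x : R) : R := hat (k.+1%:R * x + (k.+1 ^ 2)%:R - i%:R).
Definition grid_size (k : nat) := (2 * k.+1 ^ 2).+1.
Definition grid_sum k x := \sum_(i < grid_size k) grid_hat k i x.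
(* Piecewise linear interpolation of [G] in the variable [j], on the grid of mesh [1 / (k + 1)]
   in [-(k + 1), k + 1]. *)
Definition grid_approx k j G a :=
  \sum_(i < grid_size k) G (update a j (grid_point k i)) * grid_hat k i (a j).

Lemma grid_hat01 k i x : 0 <= grid_hat k i x <= 1. Proof. exact: hat01. Qed.

Lemma grid_hat_lip k i x y : `|grid_hat k i x - grid_hat k i y| <= (2 * k.+1%:R) * `|x - y|.
Proof.
apply: (le_trans (hat_lip _ _)); rewrite -mulrA ler_pM2l//.
have -> : k.+1%:R * x + (k.+1 ^ 2)%:R - i%:R - (k.+1%:R * y + (k.+1 ^ 2)%:R - i%:R) = k.+1%:R * (x - y) by ring.
by rewrite normrM ger0_norm.
Qed.

Lemma grid_hat_supp k (i : 'I_(grid_size k)) x : k.+1%:R + 1 < `|x| -> grid_hat k i x = 0.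
Proof.
move=> xk; apply: hat_eq0.
have i1 : (i%:R : R) <= 2 * k.+1%:R ^+ 2.
  by rewrite -natrX -natrM ler_nat -ltnS; exact: ltn_ord.
have i0 : 0 <= (i%:R : R) by [].
have k1 : 1 <= (k.+1%:R : R) by rewrite ler1n.
rewrite natrX; set K := k.+1%:R in xk i1 k1 *.
move: xk; rewrite ler_normr lter_normr => /orP[xk|xk]; apply/orP; [left|right]; nra.
Qed.

Lemma grid_sumE k x : grid_sum k x =
  ramp (k.+1%:R * x + (k.+1 ^ 2)%:R) - ramp (k.+1%:R * x + (k.+1 ^ 2)%:R - (grid_size k)%:R).
Proof. exact: sum_hat. Qed.

Lemma grid_sum01 k x : 0 <= grid_sum k x <= 1.
Proof.
rewrite grid_sumE subr_ge0 ramp_homo ?gerBl//=.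
have /andP[_ h] := ramp01 (k.+1%:R * x + (k.+1 ^ 2)%:R).
have /andP[h' _] := ramp01 (k.+1%:R * x + (k.+1 ^ 2)%:R - (grid_size k)%:R).
lra.
Qed.

Lemma grid_sum1 k x : `|x| <= k%:R -> grid_sum k x = 1.
Proof.
rewrite ler_norml => /andP[x1 x2]; rewrite grid_sumE.
have k0 : 0 <= (k%:R : R) by [].
rewrite ramp1 ?ramp0 ?subr0//.
  have -> : (grid_size k)%:R = 2 * k.+1%:R ^+ 2 + 1 :> R.
    by rewrite /grid_size -natr1 natrM natrX.
  by rewrite natrX -natr1; nra.
by rewrite natrX -natr1; nra.
Qed.

(** Inside the grid the hats form a partition of unity, and only nodes within 1 / (k + 1) of the
    point contribute. The defect of the partition outside is paid by the bound [M]. *)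
Lemma grid_error k j (K M : R) G a : 0 <= K -> lip_in j.+1 K G -> (forall a, `|G a| <= M) ->
  `|G a - grid_approx k j G a| <= K / k.+1%:R + M * (1 - grid_sum k (a j)).
Proof.
move=> K0 GK GM.
have -> : G a - grid_approx k j G a = G a * (1 - grid_sum k (a j)) +
   \sum_(i < grid_size k) (G a - G (update a j (grid_point k i))) * grid_hat k i (a j).
  rewrite /grid_approx /grid_sum mulrBr mulr1 mulr_sumr.
  under [X in _ = _ + X]eq_bigr do rewrite mulrBl.
  by rewrite sumrB; ring.
have /andP[s0 s1] := grid_sum01 k (a j).
rewrite addrC; apply: (le_trans (ler_normD _ _)); apply: lerD; last first.
  by rewrite normrM (@ger0_norm _ (1 - _)) ?subr_ge0// ler_wpM2r ?subr_ge0.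
apply: (le_trans (ler_norm_sum _ _ _)).
apply: (@le_trans _ _ (\sum_(i < grid_size k) (K / k.+1%:R) * grid_hat k i (a j))); last first.
  by rewrite -mulr_sumr -[leRHS]mulr1 ler_wpM2l// divr_ge0.
apply: ler_sum => i _; have /andP[h0 h1] := grid_hat01 k i (a j).
rewrite normrM (@ger0_norm _ (grid_hat _ _ _))//.
have [hz|hz] := ltP `|k.+1%:R * a j + (k.+1 ^ 2)%:R - i%:R| 1; last first.
  by rewrite /grid_hat hat_eq0// !mulr0.
rewrite ler_wpM2r//; apply: (le_trans (GK _ _)).
rewrite big_ord_recr/= big1 ?add0r; last first.
  by move=> i' _; rewrite /update ltn_eqF// subrr normr0.
rewrite ler_wpM2l// /update eqxx /grid_point.
have -> : a j - (i%:R - (k.+1 ^ 2)%:R) / k.+1%:R = (k.+1%:R * a j + (k.+1 ^ 2)%:R - i%:R) / k.+1%:R.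
  by field.
by rewrite normrM (@ger0_norm _ k.+1%:R^-1) ?invr_ge0// ler_piMl ?invr_ge0// ltW.
Qed.

Lemma grid_approx_cvg j (K M : R) G a : 0 <= K -> lip_in j.+1 K G -> (forall a, `|G a| <= M) ->
  grid_approx k j G a @[k --> \oo] --> G a.
Proof.
move=> K0 GK GM; apply/cvgrPdist_le => e e0; near=> k.
apply: (le_trans (grid_error k a K0 GK GM)).
rewrite grid_sum1 ?subrr ?mulr0 ?addr0; last by near: k; exact: nbhs_infty_ger.
rewrite ler_pdivrMr// mulrC -ler_pdivrMr//.
apply: (@le_trans _ _ k%:R); last by rewrite ler_nat.
by near: k; exact: nbhs_infty_ger.
Unshelve. all: by end_near. Qed.

End coordinates.

Section levy.
Context (R : realType) d (T : measurableType d) (P : nat -> probability T R) (P0 : probability T R).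
Variables (l : nat -> T -> R) (m : nat).
Hypothesis ml : forall i, measurable_fun setT (l i).

(** [G] is a limit of sums of products of a function of fewer coordinates with a function of the
    last one, so measurability follows by induction on [j]. *)
Lemma lip_measurable j (K M : R) (G : (nat -> R) -> R) : 0 <= K -> lip_in j K G -> (forall a, `|G a| <= M) ->
  measurable_fun setT (fun w => G (l ^~ w)).
Proof.
elim: j G => [|j IHj] G K0 GK GM.
  rewrite (_ : (fun w => _) = cst (G (fun=> 0))); first exact: measurable_cst.
  apply/funext => w; apply/eqP; rewrite -subr_eq0 -normr_le0.
  by apply: (le_trans (GK _ _)); rewrite big_ord0 mulr0.
apply: (@measurable_fun_cvg _ _ _ setT (fun k w => grid_approx k j G (l ^~ w))) => [k|w _].
  apply: measurable_sum => i; apply: measurable_funM.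
    by apply: (IHj (fun a => G (update a j (grid_point R k i)))) => //; exact: lip_update.
  apply: (@measurableT_comp _ _ _ _ _ _ (grid_hat k i)) => //.
  apply: continuous_mfun => x; apply/cvgrPdist_le => e e0; near=> y.
  apply: (le_trans (grid_hat_lip _ _ _ _)); rewrite -ler_pdivlMl//; near: y.
  by apply: cvgr_dist_le; [exact: cvg_id|rewrite mulr_gt0// invr_gt0 mulr_gt0].
exact: (@grid_approx_cvg _ j K M G (l ^~ w) K0 GK GM).
Unshelve. all: by end_near. Qed.

Let S (t : nat -> R) c w := \sum_(i < m) t i * l i w + c.

Hypothesis char_cvg : forall t c,
  \int[P n]_w cos (S t c w) @[n --> \oo] --> \int[P0]_w cos (S t c w).

Let mS t c : measurable_fun setT (S t c).
Proof.
apply: measurable_funD => //; apply: measurable_sum => i; exact: measurable_funM.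
Qed.

Let bcos t c : bounded_mfun (fun w => cos (S t c w)).
Proof.
split; last by exists 1 => w; exact: cos_max.
by apply: measurableT_comp => //; apply: continuous_mfun; exact: continuous_cos.
Qed.

Let cos_prod t c j t' c' w : (j < m)%N ->
  cos (S t c w) * cos (t' * l j w + c') =
  2^-1 * cos (S (fun i => t i + t' * (i == j)%:R) (c + c') w) +
  2^-1 * cos (S (fun i => t i - t' * (i == j)%:R) (c - c') w).
Proof.
move=> jm.
have E b : S (fun i => t i + b * (i == j)%:R) c w = S t c w + b * l j w.
  rewrite /S; under eq_bigr do rewrite mulrDl.
  rewrite big_split/= addrAC; congr (_ + _).
  rewrite (bigD1 (Ordinal jm))//= eqxx mulr1 big1 ?addr0// => i ij.
  by rewrite (negbTE (_ : (i : nat) != j)) ?mulr0 ?mul0r//; apply: contra ij => /eqP ij; apply/eqP/val_inj.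
have -> : S (fun i => t i + t' * (i == j)%:R) (c + c') w = S t c w + (t' * l j w + c').
  by rewrite -[RHS]addrA !addrA -E /S; ring.
have -> : S (fun i => t i - t' * (i == j)%:R) (c - c') w = S t c w - (t' * l j w + c').
  have := E (- t'); rewrite /S => E'.
  have -> : \sum_(i < m) (t i - t' * (i == j :> nat)%:R) * l i w = \sum_(i < m) (t i + - t' * (i == j :> nat)%:R) * l i w.
    by apply: eq_bigr => i _; rewrite mulNr.
  by rewrite addrA E'; ring.
by rewrite (cosD (S t c w) (t' * l j w + c')) (cosB (S t c w) (t' * l j w + c')); field.
Qed.

(** Induction on the number of coordinates of [G], which closes thanks to the factor cos (S t c):
    interpolation in the last coordinate leaves functions of fewer coordinates times hats,
    [levy_one_coordinate] trades each hat for cosines of that coordinate, and a product of two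
    cosines is a sum of cosines with changed frequencies and phases. *)
Lemma levy_lip_aux j (K M : R) (G : (nat -> R) -> R) t c : (j <= m)%N -> 0 <= K -> lip_in j K G ->
  (forall a, `|G a| <= M) ->
  \int[P n]_w (G (l ^~ w) * cos (S t c w)) @[n --> \oo] --> \int[P0]_w (G (l ^~ w) * cos (S t c w)).
Proof.
elim: j G t c => [|j IHj] G t c jm K0 GK GM.
  have Gc w : G (l ^~ w) = G (fun=> 0).
    apply/eqP; rewrite -subr_eq0 -normr_le0.
    by apply: (le_trans (GK _ _)); rewrite big_ord0 mulr0.
  have E (P' : probability T R) : \int[P']_w (G (l ^~ w) * cos (S t c w)) = G (fun=> 0) * \int[P']_w cos (S t c w).
    by rewrite -RintZ; [apply: eq_Rintegral => w _; rewrite Gc|exact: bcos].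
  rewrite E; under eq_fun do rewrite E.
  by apply: cvgM; [exact: cvg_cst|exact: char_cvg].
have M0 : 0 <= M by apply: le_trans (GM (fun=> 0)).
have mG x : measurable_fun setT (fun w => G (update (l ^~ w) j x)).
  by apply: (@lip_measurable j K M (fun a => G (update a j x))) => //; exact: lip_update.
have mG' : measurable_fun setT (fun w => G (l ^~ w)) by exact: (lip_measurable K0 GK GM).
have bgh k i : bounded_mfun (fun w => grid_hat k i (l j w)).
  split; last by exists 1 => w; have /andP[h0 h1] := grid_hat01 k i (l j w); rewrite ger0_norm.
  apply: (@measurableT_comp _ _ _ _ _ _ (grid_hat k i)) => //.
  apply: continuous_mfun => x; apply/cvgrPdist_le => e e0; near=> y.
  apply: (le_trans (grid_hat_lip _ _ _ _)); rewrite -ler_pdivlMl//; near: y.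
  by apply: cvgr_dist_le; [exact: cvg_id|rewrite mulr_gt0// invr_gt0 mulr_gt0].
have one k (i : 'I_(grid_size k)) (Y : T -> R) (B : R) : measurable_fun setT Y -> (forall w, `|Y w| <= B) ->
  (forall t' c', \int[P n]_w (Y w * cos (t' * l j w + c')) @[n --> \oo] --> \int[P0]_w (Y w * cos (t' * l j w + c'))) ->
  \int[P n]_w (Y w * grid_hat k i (l j w)) @[n --> \oo] --> \int[P0]_w (Y w * grid_hat k i (l j w)).
{ move=> mY YB Ycvg.
  apply: (@levy_one_coordinate _ _ _ P P0 Y (l j) B mY (ml j) YB Ycvg (grid_hat k i) 1 (k.+1%:R + 1) (2 * k.+1%:R)) => //.
  - exact: grid_hat01.
  - by move=> x; exact: grid_hat_supp.
  - exact: grid_hat_lip. }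
have bgs k : bounded_mfun (fun w => grid_sum k (l j w)) by apply: bmf_sum => i; exact: bgh.
(* Tightness: the mass that this coordinate puts outside the grid under [P n] is controlled in the
   limit by the mass under [P0], so that [k] can be chosen for [P0] alone. *)
have gs_cvg k : \int[P n]_w grid_sum k (l j w) @[n --> \oo] --> \int[P0]_w grid_sum k (l j w).
{ rewrite Rint_sum//; under eq_fun do rewrite Rint_sum//.
  apply: cvg_sumr => i.
  have E1 (P' : probability T R) : \int[P']_w grid_hat k i (l j w) = \int[P']_w (cst 1 w * grid_hat k i (l j w)).
    by apply: eq_Rintegral => w _; rewrite mul1r.
  rewrite E1; under eq_fun do rewrite E1.
  apply: (@one k i (cst 1) 1); first exact: measurable_cst.
    by move=> w; rewrite normr1.
  move=> t' c'.
  have E (P' : probability T R) : \int[P']_w (cst 1 w * cos (t' * l j w + c')) =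
     \int[P']_w cos (S (fun i => t' * (i == j)%:R) c' w).
    apply: eq_Rintegral => w _; rewrite mul1r /S; congr (cos (_ + _)).
    rewrite (bigD1 (Ordinal jm))//= eqxx mulr1 big1 ?addr0// => i' ij.
    by rewrite (negbTE (_ : (i' : nat) != j)) ?mulr0 ?mul0r//; apply: contra ij => /eqP ij; apply/eqP/val_inj.
  by rewrite E; under eq_fun do rewrite E; exact: char_cvg. }
have gs0 : \int[P0]_w grid_sum k (l j w) @[k --> \oo] --> (1 : R).
{ rewrite -[X in _ --> X](Rint_cst P0 1); apply: (@bounded_cvg _ _ _ P0 _ _ 1).
  - by move=> k; case: (bgs k).
  - by move=> k w; have /andP[h0 h1] := grid_sum01 k (l j w); rewrite ger0_norm.
  - move=> w; apply: cvg_near_cst; near=> k; rewrite grid_sum1//; near: k; exact: nbhs_infty_ger. }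
apply: approx_cvg => e e0.
have [k [kK kM]] : exists k, K / k.+1%:R <= e / 3 /\ M * (1 - \int[P0]_w grid_sum k (l j w)) <= e / 3.
{ have e3 : 0 < e / 3 by rewrite divr_gt0.
  have e4 : 0 < e / 3 / (M + 1) by rewrite divr_gt0// ltr_wpDl.
  have : \forall k \near \oo, K / k.+1%:R <= e / 3.
    near=> k; rewrite ler_pdivrMr// mulrC -ler_pdivrMr//.
    apply: (@le_trans _ _ k%:R); last by rewrite ler_nat.
    by near: k; exact: nbhs_infty_ger.
  move=> H1; move/cvgrPdist_le : gs0 => /(_ _ e4) H2.
  have [k0 _ Hk] := filterI H1 H2.
  have [h1 h2] := Hk k0 (leqnn k0); exists k0; split => //.
  move: h2; rewrite ler_pdivlMr ?ltr_wpDl// => h2; apply: le_trans h2.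
  rewrite mulrC; have := ler_norm (1 - \int[P0]_w grid_sum k0 (l j w)).
  by have := normr_ge0 (1 - \int[P0]_w grid_sum k0 (l j w)); nra. }
have bGi (i : 'I_(grid_size k)) : bounded_mfun (fun w => G (update (l ^~ w) j (grid_point R k i)) * cos (S t c w)).
  by apply: bmfM => //; split => //; exists M.
have E1 w : grid_approx k j G (l ^~ w) * cos (S t c w) =
  \sum_(i < grid_size k) (G (update (l ^~ w) j (grid_point R k i)) * cos (S t c w) * grid_hat k i (l j w)).
  by rewrite /grid_approx mulr_suml; apply: eq_bigr => i _; rewrite mulrAC.
have bE1 : bounded_mfun (fun w => grid_approx k j G (l ^~ w) * cos (S t c w)).
  by under eq_fun do rewrite E1; apply: bmf_sum => i; exact: bmfM.
have dist (P' : probability T R) :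
  `|\int[P']_w (G (l ^~ w) * cos (S t c w)) - \int[P']_w (grid_approx k j G (l ^~ w) * cos (S t c w))|
   <= K / k.+1%:R + M * (1 - \int[P']_w grid_sum k (l j w)).
{ have -> : K / k.+1%:R + M * (1 - \int[P']_w grid_sum k (l j w)) =
    \int[P']_w (K / k.+1%:R + M * (1 - grid_sum k (l j w))).
    by rewrite RintD ?Rint_cst ?RintZ ?RintB ?Rint_cst//; bmf.
  apply: Rint_dist_le => //; [|by bmf|].
    by apply: bmfM => //; split => //; exists M.
  move=> w; rewrite -mulrBl normrM -[leRHS]mulr1 ler_pM//.
    exact: grid_error.
  exact: cos_max. }
exists (fun n => \int[P n]_w (grid_approx k j G (l ^~ w) * cos (S t c w))),
  (\int[P0]_w (grid_approx k j G (l ^~ w) * cos (S t c w))); split.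
- have E3 (P' : probability T R) : \int[P']_w (grid_approx k j G (l ^~ w) * cos (S t c w)) =
    \sum_(i < grid_size k) \int[P']_w (G (update (l ^~ w) j (grid_point R k i)) * cos (S t c w) * grid_hat k i (l j w)).
    rewrite -Rint_sum; last by move=> i; exact: bmfM.
    by apply: eq_Rintegral => w _; rewrite E1.
  rewrite E3; under eq_fun do rewrite E3.
  apply: cvg_sumr => i; apply: (one k i _ M); first by case: (bGi i).
    move=> w; rewrite normrM -[leRHS]mulr1 ler_pM//; exact: cos_max.
  move=> t' c'.
  have E2 (P' : probability T R) : \int[P']_w (G (update (l ^~ w) j (grid_point R k i)) * cos (S t c w) * cos (t' * l j w + c')) =
    2^-1 * \int[P']_w (G (update (l ^~ w) j (grid_point R k i)) * cos (S (fun i => t i + t' * (i == j)%:R) (c + c') w)) +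
    2^-1 * \int[P']_w (G (update (l ^~ w) j (grid_point R k i)) * cos (S (fun i => t i - t' * (i == j)%:R) (c - c') w)).
  { have bG' t'' c'' : bounded_mfun (fun w => G (update (l ^~ w) j (grid_point R k i)) * cos (S t'' c'' w)).
      by apply: bmfM => //; split => //; exists M.
    rewrite -RintZ// -RintZ// -RintD; [|exact: bmfZ|exact: bmfZ].
    by apply: eq_Rintegral => w _; rewrite -mulrA cos_prod//; ring. }
  rewrite E2; under eq_fun do rewrite E2.
  by apply: cvgD; apply: cvgM; try exact: cvg_cst; apply: (IHj (fun a => G (update a j (grid_point R k i)))) => //;
    try exact: ltnW; exact: lip_update.
- apply: (le_trans (dist P0)); apply: (le_trans (lerD kK kM)); lra.
- have e3 : 0 < e / 3 / (M + 1) by rewrite !divr_gt0// ltr_wpDl.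
  move/cvgrPdist_le : (gs_cvg k) => /(_ _ e3); apply: filterS => n hn.
  apply: (le_trans (dist (P n))).
  move: hn; rewrite ler_pdivlMr ?ltr_wpDl// => hn.
  have h1 := ler_norm (\int[P0]_w grid_sum k (l j w) - \int[P n]_w grid_sum k (l j w)).
  have h2 := normr_ge0 (\int[P0]_w grid_sum k (l j w) - \int[P n]_w grid_sum k (l j w)).
  have h3 : M * (1 - \int[P n]_w grid_sum k (l j w)) <= M * (1 - \int[P0]_w grid_sum k (l j w)) +
     M * `|\int[P0]_w grid_sum k (l j w) - \int[P n]_w grid_sum k (l j w)|.
    by rewrite -mulrDr ler_wpM2l//; lra.
  have h4 : M * `|\int[P0]_w grid_sum k (l j w) - \int[P n]_w grid_sum k (l j w)| <= e / 3.
    by apply: le_trans hn; rewrite mulrC ler_wpM2l// lerDl.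
  apply: (le_trans (lerD kK (le_trans h3 (lerD kM h4)))); lra.
Unshelve. all: by end_near. Qed.

Lemma levy_lip (K M : R) (G : (nat -> R) -> R) : 0 <= K -> lip_in m K G -> (forall a, `|G a| <= M) ->
  \int[P n]_w G (l ^~ w) @[n --> \oo] --> \int[P0]_w G (l ^~ w).
Proof.
move=> K0 GK GM; have := @levy_lip_aux m K M G (fun=> 0) 0 (leqnn m) K0 GK GM.
have E w : cos (S (fun=> 0) 0 w) = 1.
  by rewrite /S big1 ?addr0 ?cos0// => i _; rewrite mul0r.
have E2 (P' : probability T R) : \int[P']_w (G (l ^~ w) * cos (S (fun=> 0) 0 w)) = \int[P']_w G (l ^~ w).
  by apply: eq_Rintegral => w _; rewrite E mulr1.
by rewrite E2; under eq_fun do rewrite E2.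
Qed.

End levy.

(** * Independent Gaussian coordinates *)

Lemma Rint_prod d1 d2 (T1 : measurableType d1) (T2 : measurableType d2) (R : realType)
   (m1 : probability T1 R) (m2 : probability T2 R) (m : probability (T1 * T2)%type R) (f : T1 * T2 -> R) :
  (forall A, measurable A -> m A = (m1 \x m2)%E A) ->
  bounded_mfun f -> \int[m]_z f z = \int[m1]_x \int[m2]_y f (x, y).
Proof.
move=> mE [mf [M fM]].
have bf : bounded_mfun f by split => //; exists M.
have b2 x : bounded_mfun (fun y => f (x, y)).
  by split; [exact: (measurableT_comp mf (pair1_measurable x))|exists M].
have b12 : bounded_mfun (fun x => \int[m2]_y f (x, y)).
  apply: (@bmf_Rint2 _ _ T1 T2 R m2 (fun x y => f (x, y))).
  by move: bf; congr bounded_mfun; apply/funext => -[].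
have M0 : 0 <= M by apply: le_trans (fM point).
have f0 z : 0 <= f z + M by have := fM z; rewrite ler_norml; lra.
have bfM : bounded_mfun (fun z => f z + M) by apply: bmfD => //; exact: bmf_cst.
apply: (@addIr _ M); rewrite -[X in _ + X](Rint_cst m M) -RintD//; last exact: bmf_cst.
rewrite -[X in _ = _ + X](Rint_cst m1 M) -RintD//; last exact: bmf_cst.
have -> : \int[m1]_x (\int[m2]_y f (x, y) + M) = \int[m1]_x \int[m2]_y (f (x, y) + M).
  by apply: eq_Rintegral => x _; rewrite RintD// ?Rint_cst//; exact: bmf_cst.
rewrite /Rintegral; congr fine.
transitivity (\int[(m1 \x m2)%E]_z (f z + M)%:E)%E.
  by apply: eq_measure_integral => A mA _; exact: mE.
rewrite fubini_tonelli1//; last by apply/measurable_EFinP; case: bfM.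
apply: eq_integral => x _; rewrite /fubini_F -/(Rintegral _ _ _) EFin_Rint//.
by apply: bmfD => //; exact: bmf_cst.
Qed.

Lemma product_probability_exists d1 d2 (T1 : measurableType d1) (T2 : measurableType d2) (R : realType)
   (m1 : probability T1 R) (m2 : probability T2 R) :
  exists m : probability (T1 * T2)%type R, forall A, measurable A -> m A = (m1 \x m2)%E A.
Proof.
have E : (m1 \x m2)%E setT = 1%E.
  rewrite -setXTT product_measure1E//.
  have := probability_setT m1; have := probability_setT m2.
  by rewrite -[LHS](mule1) => E2 E1; rewrite [X in (X * _)%E]E1 [X in (_ * X)%E](_ : _ = 1%E) ?mule1// -E2 mule1.
pose mix := @Measure_isProbability.Build _ _ _ (m1 \x m2)%E E.
pose m : probability (T1 * T2)%type R := HB.pack (m1 \x m2)%E mix.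
by exists m.
Qed.

Section normal_half.
Context (R : realType).
(** The deviation of the real and imaginary parts of a standard complex Gaussian. The density is
    then exp(- x^2) / sqrt pi, the weight of [gauss_inf_convolution]. *)
Definition half_sd : R := (Num.sqrt 2)^-1.

Lemma half_sd_neq0 : half_sd != 0.
Proof. by rewrite invr_neq0// gt_eqF// sqrtr_gt0. Qed.

Lemma half_sd_sqr : half_sd ^+ 2 = 2^-1.
Proof. by rewrite exprVn sqr_sqrtr. Qed.

Lemma normal_half_char (t c : R) :
  \int[normal_prob (0 : R) half_sd]_x cos (t * x + c) = expR (- (t ^+ 2 / 4)) * cos c.
Proof.
rewrite normal_prob_char ?half_sd_neq0// half_sd_sqr; congr (expR (- _) * _); by field.
Qed.

(* Prekopa-Leindler at midpoints, as [x^2 + y^2 = 2 ((x + y) / 2)^2 + (x - y)^2 / 2]. *)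
Lemma normal_half_tau (u v : R -> R) (M : R) : continuous u -> continuous v ->
  (forall x, 0 <= u x <= M) -> (forall x, 0 <= v x <= M) ->
  (forall x y, u x * v y <= expR ((x - y) ^+ 2 / 2)) ->
  (\int[normal_prob (0 : R) half_sd]_x u x) * (\int[normal_prob (0 : R) half_sd]_x v x) <= 1.
Proof.
move=> cu cv u0 v0 uv.
have E (w : R -> R) : continuous w -> (forall x, 0 <= w x <= M) ->
  \int[normal_prob (0 : R) half_sd]_x w x = (Num.sqrt pi)^-1 * \int[lebesgue_measure]_x (w x * gauss_fun x).
{ move=> cw w0; rewrite Rint_normal_prob; [|exact: continuous_mfun|by move=> x; case/andP: (w0 x)].
  rewrite -RintegralZl//; last first.
    have M0 : 0 <= M by have /andP[a b] := w0 0; exact: le_trans b.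
    have := integrableZl measurableT M (@integrableT_gauss R).
    apply: le_integrable => //.
      by apply/measurable_EFinP/measurable_funM; [exact: continuous_mfun|exact: measurable_gauss_fun].
    move=> x _; have /andP[w1 w2] := w0 x; rewrite -EFinM !gee0_abs ?lee_fin ?mulr_ge0 ?gauss_fun_ge0//.
    by rewrite ler_wpM2r ?gauss_fun_ge0.
  apply: eq_Rintegral => x _; rewrite normal_pdfE ?half_sd_neq0// /normal_peak /normal_fun half_sd_sqr.
  have -> : 2^-1 * pi *+ 2 = pi :> R by field.
  by rewrite subr0 -mulr_natr mulVf// divr1 mulrCA mulrA. }
rewrite !E// mulrACA -invfM -expr2 sqr_sqrtr ?pi_ge0// ler_pdivrMl ?pi_gt0// mulr1.
exact: gauss_inf_convolution.
Qed.

End normal_half.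

(** Tensorisation by induction on the number of coordinates. For fixed last coordinates x and y the
    inequality in the other ones bounds the product of the partial means of u and v by exp((x - y)^2
    / 2), which is the hypothesis of the inequality on the line. The Lipschitz condition provides
    measurability and the continuity of the partial means. *)
Lemma iid_normal_model (R : realType) (N : nat) :
  exists d (T : measurableType d) (Q : probability T R) (xi : nat -> T -> R),
  [/\ forall i, measurable_fun setT (xi i),
    forall (t : nat -> R) c, \int[Q]_w cos (\sum_(i < N) t i * xi i w + c) =
      expR (- (\sum_(i < N) t i ^+ 2 / 4)) * cos c &
    forall (u v : (nat -> R) -> R) (K M : R), 0 <= K -> lip_in N K u -> lip_in N K v ->
      (forall a, 0 <= u a <= M) -> (forall a, 0 <= v a <= M) ->
      (forall a b, u a * v b <= expR ((\sum_(i < N) (a i - b i) ^+ 2) / 2)) ->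
      (\int[Q]_w u (xi ^~ w)) * (\int[Q]_w v (xi ^~ w)) <= 1].
Proof.
elim: N => [|N [d [T [Q [xi [mxi charxi tau]]]]]].
  exists _, (measurableTypeR R), (normal_prob (0 : R) 1 : probability (measurableTypeR R) R), (fun _ => idfun).
  split.
  - by move=> i; exact: measurable_id.
  - move=> t c; rewrite [in RHS]big_ord0 oppr0 expR0 mul1r -[RHS](Rint_cst (normal_prob (0 : R) 1)).
    by apply: eq_Rintegral => w _; rewrite big_ord0 add0r.
  - move=> u v K M K0 uK vK u0 v0 uv.
    have cst0 (u' : (nat -> R) -> R) : lip_in 0 K u' -> forall a, u' a = u' (fun=> 0).
      move=> uK' a; apply/eqP; rewrite -subr_eq0 -normr_le0.
      by apply: (le_trans (uK' _ _)); rewrite big_ord0 mulr0.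
    have E (u' : (nat -> R) -> R) : lip_in 0 K u' -> \int[normal_prob (0 : R) 1]_w u' (fun=> w) = u' (fun=> 0).
      move=> uK'; rewrite -[RHS](Rint_cst (normal_prob (0 : R) 1)).
      by apply: eq_Rintegral => w _; rewrite cst0.
    rewrite !E//; apply: (le_trans (uv _ _)).
    by rewrite big_ord0 mul0r expR0.
pose gam : probability (measurableTypeR R) R := normal_prob (0 : R) (half_sd R).
have [m mE] := product_probability_exists Q gam.
(* Place N holds the new coordinate; larger indices merely repeat it. *)
pose xi' i (z : T * measurableTypeR R) : R := if (i < N)%N then xi i z.1 else z.2.
have mxi' i : measurable_fun setT (xi' i).
  by rewrite /xi'; case: (i < N)%N; [exact: (measurableT_comp (mxi i) measurable_fst)|exact: measurable_snd].
have xiE (G : (nat -> R) -> R) K x y : lip_in N.+1 K G -> G (xi' ^~ (x, y)) = G (update (xi ^~ x) N y).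
  move=> GK; apply/eqP; rewrite -subr_eq0 -normr_le0; apply: (le_trans (GK _ _)).
  rewrite big1 ?mulr0// => i _; rewrite /xi' /update /=.
  have := ltn_ord i; rewrite ltnS leq_eqVlt => /orP[/eqP ->|iN]; first by rewrite ltnn eqxx subrr normr0.
  by rewrite iN ltn_eqF// subrr normr0.
exists _, _, m, xi'; split => //.
- move=> t c.
  have bc : bounded_mfun (fun z : T * measurableTypeR R => cos (\sum_(i < N.+1) t i * xi' i z + c)).
  { split; last by exists 1 => z; exact: cos_max.
    apply: measurableT_comp; first by apply: continuous_mfun; exact: continuous_cos.
    by apply: measurable_funD => //; apply: measurable_sum => i; exact: measurable_funM. }
  rewrite (Rint_prod mE)//.
  have E x : \int[gam]_y cos (\sum_(i < N.+1) t i * xi' i (x, y) + c) =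
     expR (- (t N ^+ 2 / 4)) * cos (\sum_(i < N) t i * xi i x + c).
  { rewrite -normal_half_char; apply: eq_Rintegral => y _; congr cos.
    rewrite big_ord_recr/= /xi' ltnn/=; under eq_bigr do rewrite ltn_ord.
    by ring. }
  under eq_Rintegral do rewrite E.
  rewrite RintZ ?charxi ?mulrA ?expRD//.
    by rewrite -expRD big_ord_recr/=; congr (expR _ * _); ring.
  split; last by exists 1 => w; exact: cos_max.
  apply: measurableT_comp; first by apply: continuous_mfun; exact: continuous_cos.
  by apply: measurable_funD => //; apply: measurable_sum => i; exact: measurable_funM.
- move=> u v K M K0 uK vK u0 v0 uv.
  have M0 : 0 <= M by have /andP[a b] := u0 (fun=> 0); exact: le_trans b.
  have abs (w : (nat -> R) -> R) : (forall a, 0 <= w a <= M) -> forall a, `|w a| <= M.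
    by move=> w0 a; have /andP[a1 a2] := w0 a; rewrite ger0_norm.
  have mw (w : (nat -> R) -> R) : lip_in N.+1 K w -> (forall a, 0 <= w a <= M) ->
     bounded_mfun (fun z => w (xi' ^~ z)).
    by move=> wK w0; split; [exact: (lip_measurable mxi' K0 wK (abs _ w0))|exists M => z; exact: abs].
  pose W (w : (nat -> R) -> R) y := \int[Q]_x w (update (xi ^~ x) N y).
  have bw (w : (nat -> R) -> R) y : lip_in N.+1 K w -> (forall a, 0 <= w a <= M) ->
     bounded_mfun (fun x => w (update (xi ^~ x) N y)).
    move=> wK w0; split; last by exists M => x; exact: abs.
    exact: (lip_measurable mxi K0 (lip_update y wK) (fun a => abs _ w0 _)).
  have E (w : (nat -> R) -> R) : lip_in N.+1 K w -> (forall a, 0 <= w a <= M) ->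
     \int[m]_z w (xi' ^~ z) = \int[gam]_y W w y.
  { move=> wK w0; rewrite (Rint_prod mE); last exact: mw.
    rewrite (@Rint_fubini _ _ _ _ _ Q gam (fun z => w (xi' ^~ z))); last exact: mw.
    by apply: eq_Rintegral => y _; apply: eq_Rintegral => x _; rewrite (xiE _ K). }
  have cW (w : (nat -> R) -> R) : lip_in N.+1 K w -> (forall a, 0 <= w a <= M) -> continuous (W w).
  { move=> wK w0 y0; apply/cvgrPdist_le => e e0; near=> y.
    apply: Rint_dist; [exact: bw|exact: bw|move=> x].
    apply: (le_trans (wK _ _)); rewrite big_ord_recr/= big1 ?add0r; last first.
      by move=> i _; rewrite /update ltn_eqF// subrr normr0.
    rewrite /update eqxx (@le_trans _ _ ((K + 1) * `|y0 - y|))// ?ler_wpM2r// ?lerDl//.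
    rewrite -ler_pdivlMl ?ltr_wpDl//; near: y.
    by apply: cvgr_dist_le; [exact: cvg_id|rewrite mulr_gt0// invr_gt0 ltr_wpDl]. }
  have W0 (w : (nat -> R) -> R) : lip_in N.+1 K w -> (forall a, 0 <= w a <= M) -> forall y, 0 <= W w y <= M.
  { move=> wK w0 y; apply/andP; split.
      by apply: Rintegral_ge0 => x _; case/andP: (w0 (update (xi ^~ x) N y)).
    apply: (le_trans (ler_norm _)); apply: Rint_abs_le; [exact: bw|by move=> x; exact: abs]. }
  rewrite !E//; apply: (@normal_half_tau _ _ _ M); [exact: cW|exact: cW|exact: W0|exact: W0|].
  (* The factor [c] absorbs the share (x - y)^2 / 2 of the last coordinate, so that u with last
     entry x and c times v with last entry y satisfy the hypothesis in N coordinates. *)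
  move=> x y; pose c := expR (- ((x - y) ^+ 2 / 2)).
  have c0 : 0 < c by exact: expR_gt0.
  have c1 : c <= 1 by rewrite -expR0 ler_expR oppr_le0 divr_ge0 ?sqr_ge0.
  suff : W u x * (c * W v y) <= 1.
    rewrite mulrCA /c expRN ler_pdivrMl ?expR_gt0// mulr1; apply.
  rewrite /W -RintZ; last exact: bw.
  apply: (tau (fun a => u (update a N x)) (fun a => c * v (update a N y)) K M K0).
  + exact: lip_update.
  + move=> a b; rewrite -mulrBr normrM gtr0_norm//.
    apply: (@le_trans _ _ (1 * `|v (update a N y) - v (update b N y)|)); first by rewrite ler_wpM2r.
    by rewrite mul1r; exact: (lip_update y vK).
  + by move=> a.
  + move=> a; have /andP[h1 h2] := v0 (update a N y); rewrite mulr_ge0 ?(ltW c0)//=.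
    by rewrite -[leRHS]mul1r ler_pM ?(ltW c0).
  + move=> a b; rewrite mulrCA /c expRN ler_pdivrMl ?expR_gt0// -expRD.
    apply: (le_trans (uv _ _)); rewrite ler_expR big_ord_recr/= /update eqxx mulrDl addrC lerD2l.
    rewrite ler_pM2r ?invr_gt0// ler_sum// => i _.
    by rewrite ltn_eqF.
Unshelve. all: by end_near. Qed.

Lemma Rint_law d1 d2 (T1 : measurableType d1) (T2 : measurableType d2) (R : realType)
    (P1 : probability T1 R) (P2 : probability T2 R) (X : T1 -> T2) (h : T2 -> R) :
  measurable_fun setT X -> (forall A, measurable A -> P1 (X @^-1` A) = P2 A) ->
  bounded_mfun h -> \int[P2]_x h x = \int[P1]_w h (X w).
Proof.
move=> mX XE [mh [M hM]].
have bh : bounded_mfun h by split => //; exists M.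
have bhX : bounded_mfun (fun w => h (X w)) by split; [exact: measurableT_comp|exists M].
apply: (@addIr _ M); rewrite -[X in _ + X](Rint_cst P2 M) -RintD//; last exact: bmf_cst.
rewrite -[X in _ = _ + X](Rint_cst P1 M) -RintD//; last exact: bmf_cst.
rewrite /Rintegral; congr fine.
apply: (@ge0_integral_law _ _ _ _ _ P1 P2 X (fun x => h x + M)) => //.
  exact: measurable_funD.
by move=> x; have := hM x; rewrite ler_norml; lra.
Qed.

(* Both laws are pushed to the space of tuples, so that [levy_lip] applies. *)
Lemma law_transfer d1 d2 (T1 : measurableType d1) (T2 : measurableType d2) (R : realType)
    (P1 : probability T1 R) (P2 : probability T2 R) (X1 : nat -> T1 -> R) (X2 : nat -> T2 -> R)
    (N : nat) (K M : R) (G : (nat -> R) -> R) :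
  (forall i, measurable_fun setT (X1 i)) -> (forall i, measurable_fun setT (X2 i)) ->
  (forall (t : nat -> R) c, \int[P1]_w cos (\sum_(i < N) t i * X1 i w + c) =
     \int[P2]_w cos (\sum_(i < N) t i * X2 i w + c)) ->
  0 <= K -> lip_in N K G -> (forall a, `|G a| <= M) ->
  \int[P1]_w G (X1 ^~ w) = \int[P2]_w G (X2 ^~ w).
Proof.
move=> m1 m2 charE K0 GK GM.
pose l i (z : N.-tuple (measurableTypeR R)) : R := nth 0 z i.
have ml i : measurable_fun setT (l i).
{ have [iN|iN] := ltnP i N.
  - have := @measurable_tnth _ (measurableTypeR R) N (Ordinal iN).
    by congr measurable_fun; apply/funext => z; rewrite (tnth_nth 0).
  - rewrite (_ : l i = cst 0); first exact: measurable_cst.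
    by apply/funext => z; rewrite /l nth_default// size_tuple. }
pose V d (T : measurableType d) (X : nat -> T -> R) w : N.-tuple (measurableTypeR R) :=
  [tuple X i w | i < N].
have mV d (T : measurableType d) (X : nat -> T -> R) :
   (forall i, measurable_fun setT (X i)) -> measurable_fun setT (V _ _ X).
{ move=> mX; apply/measurable_fun_tnthP => i.
  rewrite (_ : _ \o _ = X i); first exact: mX.
  by apply/funext => w /=; rewrite tnth_mktuple. }
have lV d (T : measurableType d) (X : nat -> T -> R) w i : (i < N)%N -> l i (V _ _ X w) = X i w.
  by move=> iN; rewrite /l -(tnth_nth 0 _ (Ordinal iN)) tnth_mktuple.
have law d (T : measurableType d) (P : probability T R) (X : nat -> T -> R) :
  (forall i, measurable_fun setT (X i)) ->
  exists P' : probability (N.-tuple (measurableTypeR R)) R, forall h : N.-tuple (measurableTypeR R) -> R,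
    bounded_mfun h -> \int[P']_z h z = \int[P]_w h (V _ _ X w).
{ move=> mX; pose f := mfun_Sub (mem_set (mV _ _ _ mX)).
  exists (distribution P f) => h bh; apply: Rint_law => //; exact: mV _ _ _ mX. }
have [Q1 Q1E] := law _ _ P1 X1 m1; have [Q2 Q2E] := law _ _ P2 X2 m2.
have bS t c : bounded_mfun (fun z => cos (\sum_(i < N) t i * l i z + c)).
{ split; last by exists 1 => w; exact: cos_max.
  apply: measurableT_comp; first by apply: continuous_mfun; exact: continuous_cos.
  by apply: measurable_funD => //; apply: measurable_sum => i; exact: measurable_funM. }
have SE d (T : measurableType d) (X : nat -> T -> R) t c w :
  cos (\sum_(i < N) t i * l i (V _ _ X w) + c) = cos (\sum_(i < N) t i * X i w + c).
  by congr (cos (_ + _)); apply: eq_bigr => i _; rewrite lV.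
have := @levy_lip _ _ _ (fun=> Q1) Q2 l N ml _ K M G K0 GK GM.
have bG : bounded_mfun (fun z => G (l ^~ z)).
  by split; [exact: (lip_measurable ml K0 GK GM)|exists M].
have GE d (T : measurableType d) (X : nat -> T -> R) w : G (l ^~ (V _ _ X w)) = G (X ^~ w).
  apply/eqP; rewrite -subr_eq0 -normr_le0; apply: (le_trans (GK _ _)).
  by rewrite big1 ?mulr0// => i _; rewrite lV// subrr normr0.
rewrite Q1E// Q2E//.
move=> H; have := fun hc => cvg_lim (@Rhausdorff R) (H hc); rewrite lim_cst; last exact: Rhausdorff.
have -> : \int[P1]_w G (l ^~ (V _ _ X1 w)) = \int[P1]_w G (X1 ^~ w).
  by apply: eq_Rintegral => w _; exact: GE.
have -> : \int[P2]_w G (l ^~ (V _ _ X2 w)) = \int[P2]_w G (X2 ^~ w).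
  by apply: eq_Rintegral => w _; exact: GE.
apply => t c; rewrite Q1E// Q2E//.
have -> : \int[P2]_w cos (\sum_(i < N) t i * l i (V _ _ X2 w) + c) = \int[P1]_w cos (\sum_(i < N) t i * l i (V _ _ X1 w) + c).
  under eq_Rintegral do rewrite SE; under [in RHS]eq_Rintegral do rewrite SE.
  by rewrite charE.
exact: cvg_cst.
Qed.

(** * Characteristic function of a sum of independent variables *)

Section independence.
Context (R : realType) d (Om : measurableType d) (P : probability Om R).
Context d' (S : measurableType d').

(** The identity is linear in [f]: it passes from indicators to staircase functions and, by bounded
    convergence, to [f]. An affine change of [f] first brings its values into [0, 1). *)
Lemma indep_ext (Y : Om -> R) (Z : Om -> S) (c : R) (f : S -> R) :
  bounded_mfun Y -> measurable_fun setT Z -> bounded_mfun f ->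
  (forall A, measurable A -> \int[P]_w (Y w * \1_A (Z w)) = c * \int[P]_w \1_A (Z w)) ->
  \int[P]_w (Y w * f (Z w)) = c * \int[P]_w f (Z w).
Proof.
move=> bY mZ [mf [M fM]] H.
have bfZ (h : S -> R) : bounded_mfun h -> bounded_mfun (fun w => h (Z w)).
  by move=> [mh [B hB]]; split; [exact: measurableT_comp|exists B].
have bf : bounded_mfun f by split => //; exists M.
have M0 : 0 <= M by apply: le_trans (fM point).
wlog f01 : f M mf fM bf M0 / forall x, 0 <= f x < 1 => [wl|].
{ pose h x := (f x + M) / (2 * M + 1).
  have bh : bounded_mfun h.
    rewrite /h; under eq_fun do rewrite mulrC.
    by apply: bmfZ; apply: bmfD => //; exact: bmf_cst.
  have h01 x : 0 <= h x < 1.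
    have := fM x; rewrite ler_norml => /andP[f1 f2].
    rewrite divr_ge0; [|lra|lra].
    by rewrite ltr_pdivrMr; lra.
  have fE x : f x = (2 * M + 1) * h x + - M by rewrite /h; field; lra.
  under eq_Rintegral do rewrite fE mulrDr mulrCA (mulrC _ (- M)).
  under [in RHS]eq_Rintegral do rewrite fE.
  rewrite RintD ?RintZ//; [|exact: bmfM (bfZ _ bh)|by apply: bmfZ; exact: bmfM (bfZ _ bh)|exact: bmfZ].
  rewrite RintD ?RintZ ?Rint_cst//; [|exact: bfZ|by apply: bmfZ; exact: bfZ|exact: bmf_cst].
  have [mh _] := bh.
  rewrite (wl h 1)//; last by move=> x; have /andP[a b] := h01 x; rewrite ger0_norm// ltW.
  have := H setT measurableT.
  have -> : \int[P]_w (Y w * \1_setT (Z w)) = \int[P]_w Y w.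
    by apply: eq_Rintegral => w _; rewrite indicT mulr1.
  have -> : \int[P]_w (\1_setT (Z w) : R) = 1.
    by rewrite -[RHS](Rint_cst P); apply: eq_Rintegral => w _; rewrite indicT.
  by move=> ->; ring. }
have [MY YM] : exists M, forall w, `|Y w| <= M by case: bY.
have aux (a b k : R) : 0 <= b < 1 -> k <= 1 -> `|a - b| <= k -> `|a| <= 2.
  by rewrite !ler_norml => /andP[b0 b1] k1 /andP[h1 h2]; apply/andP; split; lra.
pose q (K : nat) x : R := K.+1%:R^-1 * \sum_(i < K.+1) \1_[set y | i.+1%:R / K.+1%:R <= f y] x.
have mA (t : R) : measurable [set y | t <= f y].
  rewrite (_ : [set y | _] = setT `&` f @^-1` `[t, +oo[%classic).
    by apply: mf => //; exact: measurable_itv.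
  by rewrite setTI; apply/seteqP; split => x /=; rewrite in_itv/= andbT.
have bq K : bounded_mfun (q K).
  by apply: bmfZ; apply: bmf_sum => i; apply: bmf_indic; exact: mA.
have qE K : \int[P]_w (Y w * q K (Z w)) = c * \int[P]_w q K (Z w).
{ have b1 (i : 'I_K.+1) : bounded_mfun (fun w => \1_[set y | i.+1%:R / K.+1%:R <= f y] (Z w) : R).
    by apply: (bfZ (\1__)); apply: bmf_indic; exact: mA.
  rewrite RintZ; last by apply: bmf_sum.
  rewrite Rint_sum// mulrCA mulr_sumr.
  under eq_Rintegral do rewrite mulrCA.
  rewrite RintZ; last by apply: bmfM => //; exact: bmf_sum.
  congr (_ * _); under eq_Rintegral do rewrite mulr_sumr.
  rewrite Rint_sum; last by move=> i; exact: bmfM.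
  by apply: eq_bigr => i _; apply: H; exact: mA. }
have qf K x : `|q K x - f x| <= K.+1%:R^-1.
{ have K0 : 0 < K.+1%:R :> R by [].
  have /andP[f0 f1] := f01 x.
  have [n nf] : exists2 n : nat, (n <= K)%N & (n%:R <= f x * K.+1%:R < n.+1%:R).
    exists (Num.truncn (f x * K.+1%:R)); last by rewrite truncn_itv// mulr_ge0.
    rewrite -ltnS truncn_lt_nat ?mulr_ge0//.
    by rewrite gtr_pMl.
  move=> /andP[n1 n2].
  have -> : q K x = n%:R / K.+1%:R.
    rewrite mulrC /q; congr (_ * _).
    rewrite (eq_bigr (fun i : 'I_K.+1 => if (i < n)%N then 1 else 0)).
      rewrite -big_mkcond/= -(big_ord_widen _ (fun=> 1)) ?(leq_trans nf)//.
      by rewrite sumr_const card_ord.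
    move=> i _; rewrite indicE; case: ltnP => [iN|iN].
    - rewrite mem_set//= ler_pdivrMr//; apply: le_trans n1; by rewrite ler_nat.
    - rewrite memNset//= ler_pdivrMr// => h; have := lt_le_trans n2 (le_trans _ h); rewrite ltxx.
      have : n.+1%:R <= f x * K.+1%:R by apply: le_trans h; rewrite ler_nat.
      by rewrite leNgt n2.
  rewrite ler_norml; apply/andP; split.
  - rewrite -subr_ge0.
    have -> : n%:R / K.+1%:R - f x - - K.+1%:R^-1 = (n.+1%:R - f x * K.+1%:R) / K.+1%:R.
      by rewrite -[n.+1]addn1 natrD; move: (K.+1%:R) K0 => k k0; field; rewrite gt_eqF.
    by rewrite divr_ge0// subr_ge0 ltW.
  - rewrite (@le_trans _ _ 0)// subr_le0 ler_pdivrMr//. }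
have h0 : K.+1%:R^-1 @[K --> \oo] --> (0 : R) by exact: cvg_harmonic.
have cq x : q K x @[K --> \oo] --> f x.
  apply/cvgrPdist_le => e e0; near=> K; rewrite distrC; apply: (le_trans (qf K x)).
  near: K; have /cvgrPdist_le/(_ _ e0) := h0; apply: filterS => K.
  by rewrite sub0r normrN ger0_norm.
have q1 K x : `|q K x| <= 2.
  apply: aux (f01 x) _ (qf K x).
  by rewrite invf_le1// ler1n.
have [mY _] := bY.
have L1 : \int[P]_w (Y w * q K (Z w)) @[K --> \oo] --> \int[P]_w (Y w * f (Z w)).
{ apply: (@bounded_cvg _ _ _ P _ _ (MY * 2)).
  - by move=> K; apply: measurable_funM => //; case: (bfZ _ (bq K)).
  - by move=> K w; rewrite normrM ler_pM.
  - by move=> w; apply: cvgM; [exact: cvg_cst|exact: cq]. }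
have L2 : c * \int[P]_w q K (Z w) @[K --> \oo] --> c * \int[P]_w f (Z w).
{ apply: cvgM; first exact: cvg_cst.
  apply: (@bounded_cvg _ _ _ P _ _ 2) => //.
  by move=> K; case: (bfZ _ (bq K)). }
move: L1; under eq_fun do rewrite qE.
by move=> L1; exact: (cvg_unique _ L1 L2).
Unshelve. all: by end_near. Qed.

Variables (Z : nat -> Om -> S) (n : nat).
Hypothesis mZ : forall i, measurable_fun setT (Z i).
Hypothesis indZ : forall A : nat -> set S, (forall i, measurable (A i)) ->
  \int[P]_w (\prod_(0 <= j < n) \1_(A j) (Z j w)) = \prod_(0 <= j < n) \int[P]_w (\1_(A j) (Z j w) : R).
Variables (X : nat -> S -> R) (rho : nat -> R).
Hypothesis mX : forall i, measurable_fun setT (X i).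
Hypothesis charX : forall i c, \int[P]_w cos (X i (Z i w) + c) = rho i * cos c.

(** The indicators of the independence hypothesis are replaced by cosines one variable at a time.
    Arbitrary phases let the induction close: cos (S + X) = cos S cos X - sin S sin X, and a sine is
    a cosine with its phase moved by pi / 2. The sine terms have mean 0. *)
Lemma indep_char c :
  \int[P]_w cos (\sum_(i < n) X i (Z i w) + c) = (\prod_(i < n) rho i) * cos c.
Proof.
have mXZ i : measurable_fun setT (fun w => X i (Z i w)) by exact: measurableT_comp.
have bcos (h : Om -> R) : measurable_fun setT h -> bounded_mfun (fun w => cos (h w)).
  move=> mh; split; last by exists 1 => w; exact: cos_max.
  by apply: measurableT_comp => //; apply: continuous_mfun; exact: continuous_cos.
have bS m c' : bounded_mfun (fun w => cos (\sum_(i < m) X i (Z i w) + c')).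
  by apply: bcos; apply: measurable_funD => //; exact: measurable_sum.
have bI (A : nat -> set S) m : (forall i, measurable (A i)) ->
   bounded_mfun (fun w => \prod_(m <= j < n) \1_(A j) (Z j w) : R).
{ move=> mA; elim: (index_iota m n) => [|j s IHs].
    by under eq_fun do rewrite big_nil; exact: bmf_cst.
  under eq_fun do rewrite big_cons; apply: bmfM => //.
  have [mI _] := @bmf_indic _ _ R _ (mA j).
  split; first exact: (measurableT_comp mI (mZ j)).
  by exists 1 => w; rewrite indicE; case: (_ \in _); rewrite ?normr1 ?normr0 ?ler01. }
have main m (A : nat -> set S) c' : (m <= n)%N -> (forall i, measurable (A i)) ->
  \int[P]_w (cos (\sum_(i < m) X i (Z i w) + c') * \prod_(m <= j < n) \1_(A j) (Z j w)) =
  (\prod_(i < m) rho i) * cos c' * \prod_(m <= j < n) \int[P]_w (\1_(A j) (Z j w) : R).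
{ elim: m A c' => [|m IHm] A c' mn mA.
    under eq_Rintegral do rewrite big_ord0 add0r.
    by rewrite RintZ ?indZ ?big_ord0 ?mul1r//; exact: bI.
  pose B w : R := \prod_(m.+1 <= j < n) \1_(A j) (Z j w).
  pose pB : R := \prod_(m.+1 <= j < n) \int[P]_w (\1_(A j) (Z j w) : R).
  have bB : bounded_mfun B by exact: bI.
  have ext c1 (f : S -> R) : bounded_mfun f ->
    \int[P]_w (cos (\sum_(i < m) X i (Z i w) + c1) * B w * f (Z m w)) =
    (\prod_(i < m) rho i) * cos c1 * pB * \int[P]_w f (Z m w).
  { move=> bf; apply: indep_ext => //; first exact: bmfM.
    move=> D mD; pose A' i := if i == m then D else A i.
    have mA' i : measurable (A' i) by rewrite /A'; case: eqP.
    have := IHm A' c1 (ltnW mn) mA'.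
    rewrite big_ltn// /A' eqxx => E.
    transitivity (\prod_(i < m) rho i * cos c1 * (\int[P]_w \1_D (Z m w) * pB)); last by ring.
    rewrite -[X in _ * X](_ : \int[P]_w (\1_D (Z m w)) * \prod_(m.+1 <= j < n) \int[P]_w \1_(if j == m then D else A j) (Z j w) = _).
      rewrite -E; apply: eq_Rintegral => w _; rewrite big_ltn// eqxx -mulrA; congr (_ * _).
      rewrite mulrC; congr (_ * _); apply: eq_big_nat => j /andP[mj _].
      by rewrite gtn_eqF.
    congr (_ * _); apply: eq_big_nat => j /andP[mj _].
    by rewrite gtn_eqF. }
  have bX c1 : bounded_mfun (fun x => cos (X m x + c1)).
    split; last by exists 1 => w; exact: cos_max.
    apply: measurableT_comp; first by apply: continuous_mfun; exact: continuous_cos.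
    exact: measurable_funD.
  have bXZ c1 : bounded_mfun (fun w => cos (X m (Z m w) + c1)).
    by apply: bcos; exact: measurable_funD.
  have E w : cos (\sum_(i < m.+1) X i (Z i w) + c') * B w =
     cos (\sum_(i < m) X i (Z i w) + 0) * B w * cos (X m (Z m w) + c') -
     cos (\sum_(i < m) X i (Z i w) + - (pi / 2)) * B w * cos (X m (Z m w) + (c' - pi / 2)).
  { have h y : cos (y - pi / 2) = sin y :> R.
      by rewrite cosB cos_pihalf sin_pihalf mulr0 add0r mulr1.
    rewrite big_ord_recr/= (addrA (X m _)) !h -addrA (cosD (\sum_(i < m) _)) addr0.
    by ring. }
  under eq_Rintegral do rewrite -/(B _) E.
  rewrite RintB; [|by do 2 apply: bmfM => //|by do 2 apply: bmfM => //].
  rewrite (ext 0 (fun x => cos (X m x + c')))// (ext _ (fun x => cos (X m x + (c' - pi / 2))))// cos0 cosN cos_pihalf charX big_ord_recr/= -/pB.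
  by ring. }
have := main n (fun=> setT) c (leqnn n) (fun=> measurableT).
rewrite big_geq// mulr1 => <-; apply: eq_Rintegral => w _.
by rewrite big_geq// mulr1.
Qed.

End independence.

(** * Local Lipschitz functionals on path space *)

Section path_space_topology.
Context (R : realType).
Notation C := (Rcomplex R).
Implicit Types (phi psi : path_space R) (f g : R -> C).

Lemma segment_normE (A : R) x : `[- A, A]%classic x = (`|x| <= A) :> Prop.
Proof. by rewrite /= in_itv/= ler_norml. Qed.

Lemma compact_open_uniform (F : set_system (R -> C)) f (A e : R) : Filter F -> continuous f ->
  {compact-open, F --> f} -> 0 < e ->
  F [set g | forall x : R, `|x| <= A -> `|f x - g x| < e].
Proof.
move=> FF cf /(compact_open_fam_compactP cf FF)/fam_cvgP/(_ `[- A, A]%classic (@segment_compact _ (- A) A)) H e0.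
have : nbhs (f : {uniform` `[- A, A]%classic -> C}) [set h | forall y, `[- A, A]%classic y -> ball (f y) e (h y)].
  by apply/uniform_nbhs; exists [set xy | ball xy.1 e xy.2]; split => //; rewrite -entourage_ballE; exists e.
move=> /H; apply: filterS => g h x xA; have := h x.
by rewrite segment_normE => /(_ xA); rewrite -ball_normE.
Qed.

Lemma compact_open_of_uniform (F : set_system (R -> C)) f : Filter F -> continuous f ->
  (forall A e : R, 0 < e -> F [set g | forall x : R, `|x| <= A -> `|f x - g x| < e]) ->
  {compact-open, F --> f}.
Proof.
move=> FF cf H; apply/(compact_open_fam_compactP cf FF)/fam_cvgP => K cK.
move=> Q /uniform_nbhs [E [/=]]; rewrite -entourage_ballE => -[e /= e0 eE] EQ.
have [A [_ KA]] := compact_bounded cK.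
have := H (A + 1) e e0; apply: filterS => g h; apply: EQ => x Kx; apply: eE => /=.
rewrite -ball_normE/=; apply: h; apply: KA => //; by rewrite ltrDl.
Qed.

Lemma path_continuous phi : continuous (phi : R -> C).
Proof. exact: cts_fun. Qed.

Lemma path_nbhs_uniform phi (A e : R) : 0 < e ->
  nbhs phi [set psi : path_space R | forall x : R, `|x| <= A -> `|phi x - psi x| < e].
Proof.
move=> e0; pose ev := (fun phi : path_space R => phi : R -> C) : path_space R -> {compact-open, R -> C}.
have c : {for phi, continuous ev} by exact: initial_continuous.
have FF : Filter (nbhs phi) by exact: nbhs_filter.
exact: (@compact_open_uniform (ev @ phi) phi A e _ (@path_continuous phi) c e0).
Qed.

Lemma path_cvg_uniform (u : nat -> path_space R) phi :
  (forall A e : R, 0 < e -> \forall n \near \oo, forall x : R, `|x| <= A -> `|phi x - u n x| < e) ->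
  u n @[n --> \oo] --> phi.
Proof.
move=> H; have : {compact-open, ((fun n => u n : R -> C) @ \oo) --> (phi : R -> C)}.
  by apply: compact_open_of_uniform => //; exact: path_continuous.
move=> c U [_ [/= [B oB <-] Bphi] BU].
have /c : nbhs (phi : {compact-open, R -> C}) B by exact: open_nbhs_nbhs.
move=> h; apply: (@filterS _ (u n @[n --> \oo]) _ B) h => //; exact: BU.
Qed.

(** The functional acts on all functions and not only on paths, because it is also evaluated at
    finite Fourier sums and at dyadic step functions, which are discontinuous. *)
Definition lip_local (A K M : R) (F : (R -> C) -> R) :=
  (forall f, `|F f| <= M) /\
  forall f g d, (forall x : R, `|x| <= A -> `|f x - g x| <= d) -> `|F f - F g| <= K * d.

Lemma lip_local_continuous A K M F : 0 <= K -> lip_local A K M F ->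
  continuous (fun phi : path_space R => F phi).
Proof.
move=> K0 [_ FK] phi; have FF : Filter (nbhs phi) by exact: nbhs_filter.
apply/cvgrPdist_le => e e0.
have e1 : 0 < e / (K + 1) by rewrite divr_gt0// ltr_wpDl.
have := path_nbhs_uniform phi A e1; apply: filterS => psi h.
apply: (@le_trans _ _ (K * (e / (K + 1)))).
  by apply: FK => x xA; exact/ltW/h.
by rewrite mulrCA -[leRHS]mulr1 ler_wpM2l ?(ltW e0)// -/(K / (K + 1)) ler_pdivrMr ?ltr_wpDl// mul1r lerDl.
Qed.

Lemma borel_continuous_measurable (T : ptopologicalType) (F : T -> R) : continuous F ->
  measurable_fun setT (F : borel T -> R).
Proof.
move=> cF; apply: (measurability _ (RGenOInfty.measurableE R)).
move=> /= _ [_ [a ->]] <-; rewrite setTI; apply: sub_sigma_algebra.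
apply: open_comp; last exact: rray_open.
by move=> x _; exact: cF.
Qed.

Lemma lip_local_measurable A K M F : 0 <= K -> lip_local A K M F ->
  measurable_fun setT (fun phi : borel (path_space R) => F phi).
Proof. by move=> K0 FL; apply: borel_continuous_measurable; exact: lip_local_continuous FL. Qed.

Lemma bmf_lip_local A K M F : 0 <= K -> lip_local A K M F ->
  bounded_mfun (fun phi : borel (path_space R) => F phi).
Proof. by move=> K0 FL; split; [exact: lip_local_measurable FL|exists M => phi; case: FL]. Qed.

Definition lower_semi (F : path_space R -> R) :=
  forall phi (e : R), 0 < e -> \forall psi \near phi, F phi - e < F psi.

Lemma continuous_lower_semi (F : path_space R -> R) : continuous F -> lower_semi F.
Proof.
move=> cF phi e e0; have FF : Filter (nbhs phi) by exact: nbhs_filter.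
have /cvgrPdist_lt/(_ e e0) := cF phi; apply: filterS => psi.
by rewrite ltr_norml => /andP[_]; rewrite ltrBlDr ltrBlDl.
Qed.

Section inf_convolution.
Variables (F : path_space R -> R) (M : R).
Hypotheses (cF : lower_semi F) (FM : forall phi, `|F phi| <= M).

(** The values whose infimum is the inf-convolution of [F] with k times the sup distance on [-k, k].
    The value [M] is adjoined because a function [f] that is not a path may be at finite distance
    from no path. *)
Let cand (k : nat) f : set R := [set r | exists psi d,
  (forall x : R, `|x| <= k%:R -> `|f x - psi x| <= d) /\ r = F psi + k%:R * d] `|` [set M].

Definition inf_conv k f := inf (cand k f).

Let M0 : 0 <= M. Proof. exact: le_trans (FM (cst 0 : path_space R)). Qed.

Let cand_lb k f r : cand k f r -> - M <= r.
Proof.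
case=> [[psi [d [h ->]]]|->]; last by rewrite (le_trans _ M0)// oppr_le0.
have d0 : 0 <= d by apply: le_trans (h 0 _); rewrite ?normr0.
have := FM psi; rewrite ler_norml => /andP[h1 _]; apply: (le_trans h1).
by rewrite lerDl mulr_ge0.
Qed.

Let cand_lbd k f : has_lbound (cand k f).
Proof. by exists (- M) => r; exact: cand_lb. Qed.

Let cand_inf k f : has_inf (cand k f).
Proof. by split; [exists M; right|exact: cand_lbd]. Qed.

Lemma inf_conv_lip k : lip_local k%:R k%:R M (inf_conv k).
Proof.
split=> [f|].
  rewrite ler_norml; apply/andP; split.
    by apply: lb_le_inf => [|r]; [exists M; right|exact: cand_lb].
  by apply: ge_inf; [exact: cand_lbd|right].
have one f g d : (forall x : R, `|x| <= k%:R -> `|f x - g x| <= d) -> inf_conv k f <= inf_conv k g + k%:R * d.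
  move=> fg; rewrite -lerBlDr; apply: lb_le_inf; first by exists M; right.
  have d0 : 0 <= d by apply: le_trans (fg 0 _); rewrite ?normr0.
  move=> r [[psi [d' [h ->]]]|->].
    rewrite lerBlDr -addrA -mulrDr; apply: ge_inf; first exact: cand_lbd.
    left; exists psi, (d' + d); split => // x xk.
    rewrite -[f x](subrK (g x)) -addrA addrC; apply: (le_trans (ler_normD _ _)).
    by apply: lerD; [exact: h|exact: fg].
  rewrite lerBlDr (@le_trans _ _ M)//; first by apply: ge_inf; [exact: cand_lbd|right].
  by rewrite lerDl mulr_ge0.
move=> f g d fg; rewrite ler_norml; apply/andP; split.
  rewrite lerNl opprB lerBlDl; apply: one => x xk; rewrite distrC; exact: fg.
by rewrite lerBlDl; exact: one.
Qed.

Lemma inf_conv_le k phi : inf_conv k phi <= F phi.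
Proof.
apply: ge_inf; first exact: cand_lbd.
by left; exists phi, 0; split => [x _|]; rewrite ?subrr ?normr0// mulr0 addr0.
Qed.

(** Otherwise there are near-minimisers psi with [F psi] at most [F phi - e]. Since [F] is bounded,
    the penalty puts psi within 2 M / k of phi on [-k, k], so these psi converge to phi, against
    lower semicontinuity. *)
Lemma inf_conv_cvg phi : inf_conv k phi @[k --> \oo] --> F phi.
Proof.
apply/cvgrPdist_le => e e0; apply: contrapT => H.
have H' k : exists k', (k <= k')%N /\ inf_conv k' phi < F phi - e.
  apply: contrapT => nk; apply: H; exists k => // k' /= kk'.
  rewrite ger0_norm ?subr_ge0 ?inf_conv_le// lerBlDl -lerBlDr leNgt; apply/negP => lt.
  by apply: nk; exists k'.
have W k : exists psi : path_space R, F psi <= F phi - e /\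
     forall x : R, `|x| <= k%:R -> `|phi x - psi x| * k%:R <= 2 * M.
{ have [k' [kk' /(inf_lt (cand_inf k' phi).1)]] := H' k.
  move=> [r cr rlt].
  have Fphi : F phi <= M by apply: le_trans (FM phi); exact: ler_norm.
  case: cr rlt => [[psi [d [h ->]]] rlt|-> rlt]; last by exfalso; lra.
  have d0 : 0 <= d by apply: le_trans (h 0 _); rewrite ?normr0.
  have kd : 0 <= k'%:R * d by rewrite mulr_ge0.
  exists psi; split; first lra.
  have kk : k%:R <= k'%:R :> R by rewrite ler_nat.
  move=> x xk; apply: (@le_trans _ _ (d * k'%:R)).
    by rewrite ler_pM//; apply: h; exact: le_trans kk.
  have := FM psi; rewrite ler_norml mulrC => /andP[h1 _]; lra. }
have /choice[psi psiP] := W.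
have cpsi : psi k @[k --> \oo] --> phi.
{ apply: path_cvg_uniform => A d d0; near=> k => x xA.
  have kA : A <= k%:R by near: k; exact: nbhs_infty_ger.
  have kM : 2 * M / d < k%:R by near: k; exact: nbhs_infty_gtr.
  have k0 : 0 < k%:R :> R by apply: le_lt_trans kM; rewrite !mulr_ge0// invr_ge0 ltW.
  have [_ /(_ x (le_trans xA kA))] := psiP k.
  rewrite -ler_pdivlMr// => h; apply: (le_lt_trans h).
  by rewrite ltr_pdivrMr// -ltr_pdivrMl// mulrC. }
have [k _ /(_ k (leqnn k))] /= := cpsi _ (cF phi e0).
by have [h _] := psiP k; rewrite ltNge h.
Unshelve. all: by end_near. Qed.

Lemma inf_conv_integral (m : probability (borel (path_space R)) R) :
  \int[m]_phi inf_conv k phi @[k --> \oo] --> \int[m]_phi F phi.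
Proof.
apply: (@bounded_cvg _ _ _ m _ _ M) => [k|k phi|phi].
- by apply: lip_local_measurable (inf_conv_lip k); rewrite ler0n.
- by have [h _] := inf_conv_lip k; exact: h.
- exact: inf_conv_cvg.
Qed.

End inf_convolution.

End path_space_topology.

(** * The free field *)

Section real_coordinates.
Context (R : realType).
Notation C := (Rcomplex R).

Definition part (b : bool) (z : C) : R := if b then complex.Im z else complex.Re z.

Lemma Rcomplex_normE (z : C) : `|z| = Num.sqrt (complex.Re z ^+ 2 + complex.Im z ^+ 2).
Proof. by case: z. Qed.

Lemma Rcomplex_norm2E (z : C) : `|z| ^+ 2 = complex.Re z ^+ 2 + complex.Im z ^+ 2.
Proof. by rewrite Rcomplex_normE sqr_sqrtr// addr_ge0 ?sqr_ge0. Qed.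

Lemma Re_add (z w : C) : complex.Re (z + w) = complex.Re z + complex.Re w.
Proof. by case: z; case: w. Qed.

Lemma Im_add (z w : C) : complex.Im (z + w) = complex.Im z + complex.Im w.
Proof. by case: z; case: w. Qed.

Lemma partB b (z w : C) : part b (z - w) = part b z - part b w.
Proof. by case: z; case: w; case: b. Qed.

Lemma part_sum b (I : Type) (s : seq I) (F : I -> C) :
  part b (\sum_(i <- s) F i) = \sum_(i <- s) part b (F i).
Proof.
elim: s => [|i s IHs]; first by rewrite !big_nil; case: b.
by rewrite !big_cons -IHs; clear IHs; case: b => /=; rewrite ?Re_add ?Im_add.
Qed.

Lemma normr_part_le b (z : C) : `|part b z| <= `|z|.
Proof.
rewrite -ler_sqr ?nnegrE// Rcomplex_norm2E real_normK ?num_real//.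
by case: b => /=; rewrite ?lerDl ?lerDr sqr_ge0.
Qed.

Lemma norm_le_parts (z : C) : `|z| <= `|complex.Re z| + `|complex.Im z|.
Proof.
rewrite -ler_sqr ?nnegrE ?addr_ge0// Rcomplex_norm2E sqrrD !real_normK ?num_real//.
by rewrite lerD2r lerDl mulrn_wge0// mulr_ge0.
Qed.

Lemma part_continuous b : continuous (part b : C -> R).
Proof.
move=> z; have FF : Filter (nbhs z) by exact: nbhs_filter.
apply/cvgrPdist_le => e e0.
near=> w; rewrite -partB; apply: (le_trans (normr_part_le _ _)).
near: w; exact: cvgr_dist_le.
Unshelve. all: by end_near. Qed.

Lemma part_measurable b : measurable_fun setT (part b : borel C -> R).
Proof. by apply: borel_continuous_measurable; exact: part_continuous. Qed.

Lemma sum_double (m : nat) (F : nat -> R) :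
  \sum_(i < m.*2) F i = \sum_(j < m) (F j.*2 + F j.*2.+1).
Proof. by elim: m => [|m IHm]; rewrite ?big_ord0// doubleS !big_ord_recr/= IHm addrA. Qed.

End real_coordinates.

Section trigonometric_polynomial.
Context (R : realType) (alpha L : R).
Notation C := (Rcomplex R).
Hypotheses (alpha0 : 0 < alpha) (L0 : 0 < L).

Definition fmode (n j : nat) : int := j%:Z - n%:Z.
Definition fdenom (k : int) : R := alpha + 4 * pi ^+ 2 * (k%:~R / L) ^+ 2.
Definition fscale (k : int) : R := (Num.sqrt (fdenom k))^-1 * (Num.sqrt L)^-1.
Definition fangle (k : int) (x : R) : R := 2 * pi * k%:~R * x / L.

(* [a] lists the real and imaginary parts of the Fourier coefficients: those of mode [j - n]
   stand at the places [2j] and [2j + 1]. *)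
Definition trig (n : nat) (a : nat -> R) : R -> C := fun x =>
  \sum_(j < n.*2.+1) fourier_term alpha L (Complex (a j.*2) (a j.*2.+1)) (fmode n j) x.

Lemma fdenom_ge k : alpha <= fdenom k.
Proof. by rewrite lerDl mulr_ge0 ?sqr_ge0// mulr_ge0 ?sqr_ge0. Qed.

Lemma fdenom_gt0 k : 0 < fdenom k.
Proof. exact: lt_le_trans (fdenom_ge k). Qed.

Lemma fscale_ge0 k : 0 <= fscale k.
Proof. by rewrite mulr_ge0// invr_ge0 sqrtr_ge0. Qed.

Lemma fscale2 k : fscale k ^+ 2 = (L * fdenom k)^-1.
Proof.
rewrite exprMn !exprVn !sqr_sqrtr ?ltW ?fdenom_gt0// invfM mulrC//.
Qed.

Lemma part_fourier_term b (x y : R) k z : part b (fourier_term alpha L (Complex x y) k z) =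
  fscale k * (if b then x * sin (fangle k z) + y * cos (fangle k z)
              else x * cos (fangle k z) - y * sin (fangle k z)).
Proof. by rewrite /fourier_term /cexpi -/(fangle k z); case: b => /=; rewrite /fscale /fdenom; ring.
Qed.

Lemma part_trig b n a x : part b (trig n a x) = \sum_(j < n.*2.+1)
  fscale (fmode n j) * (if b then a j.*2 * sin (fangle (fmode n j) x) + a j.*2.+1 * cos (fangle (fmode n j) x)
              else a j.*2 * cos (fangle (fmode n j) x) - a j.*2.+1 * sin (fangle (fmode n j) x)).
Proof. by rewrite part_sum; apply: eq_bigr => j _; rewrite part_fourier_term. Qed.

Lemma C_ext (z w : C) : (forall b, part b z = part b w) -> z = w.
Proof. by case: z w => [x y] [x' y'] H; have /= -> := H true; have /= -> := H false. Qed.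

Lemma trigB n a b x : trig n a x - trig n b x = trig n (fun i => a i - b i) x.
Proof.
apply: C_ext => c; rewrite partB !part_trig -sumrB.
by apply: eq_bigr => j _; case: c; ring.
Qed.

(** A crude bound, all modes being estimated like mode 0. It serves to make functionals of the
    partial sums Lipschitz in finitely many coefficients; the sharp dependence on the coefficients
    is measured by the Cameron-Martin norm instead. *)
Lemma trig_lip n a b x : `|trig n a x - trig n b x| <=
  2 * ((Num.sqrt alpha)^-1 * (Num.sqrt L)^-1 * \sum_(i < n.*2.+1.*2) `|a i - b i|).
Proof.
have H c : `|part c (trig n (fun i => a i - b i) x)| <=
   (Num.sqrt alpha)^-1 * (Num.sqrt L)^-1 * \sum_(i < n.*2.+1.*2) `|a i - b i|.
{ rewrite part_trig (sum_double _ (fun i => `|a i - b i|)) mulr_sumr; apply: (le_trans (ler_norm_sum _ _ _)).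
  apply: ler_sum => j _; rewrite normrM (ger0_norm (fscale_ge0 _)); apply: ler_pM => //.
  - exact: fscale_ge0.
  - rewrite ler_wpM2r ?invr_ge0 ?sqrtr_ge0// lef_pV2 ?posrE ?sqrtr_gt0 ?fdenom_gt0//.
    exact: ler_wsqrtr (fdenom_ge _).
  - have hs := sin_max (fangle (fmode n j) x); have hc := cos_max (fangle (fmode n j) x).
    case: c; (apply: (le_trans (ler_normD _ _)); rewrite ?normrN !normrM; apply: lerD;
      rewrite -[leRHS]mulr1 ler_wpM2l//). }
rewrite trigB; apply: (le_trans (norm_le_parts _)).
by rewrite [2]/(1 + 1) mulrDl mul1r; apply: lerD; [exact: (H false)|exact: (H true)].
Qed.

End trigonometric_polynomial.

Lemma gaussian_second_moment d (Om : measurableType d) (R : realType) (P : probability Om R) (X : Om -> R) s : measurable_fun setT X -> 0 <= s ->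
  (forall t c, \int[P]_w cos (t * X w + c) = expR (- (s * t ^+ 2 / 2)) * cos c) ->
  P.-integrable setT (fun w => (X w ^+ 2)%:E) /\ \int[P]_w (X w ^+ 2) = s.
Proof.
move=> mX s0 ch.
have H : (\int[P]_w (X w ^+ 2)%:E = s%:E)%E.
  apply: gaussian_moment2 => // t; have := ch t 0; rewrite cos0 mulr1 => <-.
  by apply: eq_Rintegral => w _; rewrite addr0.
split; last by rewrite /Rintegral H.
apply/integrableP; split; first by apply/measurable_EFinP; exact: measurable_funX.
under eq_integral do rewrite gee0_abs ?lee_fin ?sqr_ge0//.
by rewrite H ltry.
Qed.

Section free_field_coefficients.
Context (R : realType) d (Om : measurableType d) (P : probability Om R).
Notation C := (Rcomplex R).
Variable g : int -> {mfun Om >-> borel C}.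
Hypotheses (indg : mutual_independence P g) (stdg : forall k, standard_complex_gaussian P (g k)).

Let mpart b k : measurable_fun setT (fun w => part b (g k w)).
Proof. by apply: (measurableT_comp (@part_measurable R b)); exact: measurable_funP. Qed.

(** E |g|^2 = 1 and E g^2 = 0 give both parts the variance 1/2 and covariance 0, so a Re g + b Im g
    is centred Gaussian of variance (a^2 + b^2) / 2. *)
Lemma standard_complex_char k a b c :
  \int[P]_w cos (a * complex.Re (g k w) + b * complex.Im (g k w) + c) =
    expR (- ((a ^+ 2 + b ^+ 2) / 4)) * cos c.
Proof.
have [gau n1 c0] := stdg k.
have mlin (a' b' : R) : measurable_fun setT (fun w => a' * complex.Re (g k w) + b' * complex.Im (g k w)).
  by case: (gau a' b').
pose x w := complex.Re (g k w); pose y w := complex.Im (g k w).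
have [sx [sx0 [ix Ex]]] : exists s, 0 <= s /\ P.-integrable setT (fun w => (x w ^+ 2)%:E) /\ \int[P]_w (x w ^+ 2) = s.
{ have [s s0 ch] := centred_gaussian_char (gau 1 0); exists s; split => //.
  apply: gaussian_second_moment => //; first exact: (mpart false).
  by move=> t c'; rewrite -ch; apply: eq_Rintegral => w _; congr cos; rewrite /x; ring. }
have [sy [sy0 [iy Ey]]] : exists s, 0 <= s /\ P.-integrable setT (fun w => (y w ^+ 2)%:E) /\ \int[P]_w (y w ^+ 2) = s.
{ have [s s0 ch] := centred_gaussian_char (gau 0 1); exists s; split => //.
  apply: gaussian_second_moment => //; first exact: (mpart true).
  by move=> t c'; rewrite -ch; apply: eq_Rintegral => w _; congr cos; rewrite /y; ring. }
have mxy : measurable_fun setT (fun w => x w * y w).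
  by apply: measurable_funM; [exact: (mpart false)|exact: (mpart true)].
have ixy : P.-integrable setT (fun w => (x w * y w)%:E).
{ apply: (@le_integrable _ _ _ P setT measurableT _ (fun w => (x w ^+ 2 + y w ^+ 2)%:E)).
  - exact/measurable_EFinP.
  - move=> w _; rewrite !abse_EFin lee_fin [leRHS]ger0_norm ?addr_ge0 ?sqr_ge0// ler_norml.
    have := sqr_ge0 (x w + y w); rewrite sqrrD.
    by have := sqr_ge0 (x w - y w); rewrite sqrrB; lra.
  - by apply: eq_integrable (integrableD measurableT ix iy) => // w _. }
have E1 : sx + sy = 1.
{ rewrite -Ex -Ey -RintegralD//; have := n1; rewrite unlock => h.
  rewrite /Rintegral; apply/eqP; rewrite -(inj_eq (@EFin_inj R)); apply/eqP.
  have -> : (\int[P]_w (x w ^+ 2 + y w ^+ 2)%:E = 1)%E.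
    by rewrite -h; apply: eq_integral => w _; rewrite /= Rcomplex_norm2E.
  by []. }
have [E2 E3] : sx - sy = 0 /\ \int[P]_w (x w * y w) = 0.
{ move: c0; rewrite /cintegral => -[h1 h2]; split.
  - rewrite -Ex -Ey -RintegralB// -[RHS]h1; apply: eq_Rintegral => w _.
    by rewrite /x /y expr2; case: (g k w) => u v /=; rewrite !expr2.
  - have h3 : \int[P]_w (2 * (x w * y w)) = 0.
      rewrite -[RHS]h2; apply: eq_Rintegral => w _.
      by rewrite /x /y expr2; case: (g k w) => u v /=; ring.
    by move: h3; rewrite RintegralZl// => /eqP; rewrite mulf_eq0 pnatr_eq0/= => /eqP. }
have Esx : sx = 2^-1 by lra.
have Esy : sy = 2^-1 by lra.
have [s s0 ch] := centred_gaussian_char (gau a b).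
have [ia Es] := gaussian_second_moment (mlin a b) s0 ch.
have -> : expR (- ((a ^+ 2 + b ^+ 2) / 4)) = expR (- (s * 1 ^+ 2 / 2)).
{ congr (expR (- _)); rewrite -Es.
  have -> : \int[P]_w ((a * complex.Re (g k w) + b * complex.Im (g k w)) ^+ 2) =
     \int[P]_w (a ^+ 2 * x w ^+ 2 + (b ^+ 2 * y w ^+ 2 + 2 * a * b * (x w * y w))).
    by apply: eq_Rintegral => w _; rewrite /x /y; ring.
  have iZ (c' : R) (h : Om -> R) : P.-integrable setT (fun w => (h w)%:E) ->
     P.-integrable setT (fun w => (c' * h w)%:E).
    by move=> ih; apply: eq_integrable (integrableZl measurableT c' ih) => // w _.
  rewrite RintegralD//; [|exact: iZ|].
    rewrite RintegralD//; [|exact: iZ|exact: iZ].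
    by rewrite !RintegralZl// E3 Ex Ey Esx Esy; field.
  by apply: eq_integrable (integrableD measurableT (iZ _ _ iy) (iZ _ _ ixy)) => // w _. }
rewrite -ch; apply: eq_Rintegral => w _; by rewrite mul1r.
Qed.

Definition gcoord (n i : nat) (w : Om) : R := part (odd i) (g (fmode n i./2) w).

Lemma measurable_gcoord n i : measurable_fun setT (gcoord n i).
Proof. exact: mpart. Qed.

Lemma gcoord_char n (t : nat -> R) c :
  \int[P]_w cos (\sum_(i < n.*2.+1.*2) t i * gcoord n i w + c) =
    expR (- (\sum_(i < n.*2.+1.*2) t i ^+ 2 / 4)) * cos c.
Proof.
set m := n.*2.+1.
pose X j (z : borel C) := t j.*2 * complex.Re z + t j.*2.+1 * complex.Im z.
have mX j : measurable_fun setT (X j).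
  apply: measurable_funD; apply: measurable_funM => //; [exact: (@part_measurable R false)|exact: (@part_measurable R true)].
pose Z j (w : Om) : borel C := g (fmode n j) w.
pose rho j := expR (- ((t j.*2 ^+ 2 + t j.*2.+1 ^+ 2) / 4)).
have mZ j : measurable_fun setT (Z j) by exact: measurable_funP.
have indZ (A : nat -> set (borel C)) : (forall i, measurable (A i)) ->
  \int[P]_w (\prod_(0 <= j < m) \1_(A j) (Z j w)) = \prod_(0 <= j < m) \int[P]_w (\1_(A j) (Z j w) : R).
{ move=> mA.
  (* Independence concerns events indexed by modes; |k + n| recovers the place j from the mode j -
     n. *)
  pose A' (k : int) := A `|(k + n%:Z)%R|%N.
  have kK j : (`|(fmode n j + n%:Z)%R|)%N = j by rewrite /fmode subrK absz_nat.
  have fI : injective (fmode n) by move=> i j h; rewrite -(kK i) h kK.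
  pose ks := [seq fmode n j | j <- iota 0 m].
  have uks : uniq ks by rewrite map_inj_uniq ?iota_uniq.
  pose J : {fset int} := seq_fset tt ks.
  have pJ : perm_eq J ks by have := seq_fset_perm tt ks; rewrite undup_id.
  have mS k : measurable (g k @^-1` A' k) by have mg : measurable_fun setT (g k) by []; have := mg measurableT _ (mA `|(k + n%:Z)%R|%N); rewrite setTI.
  have pE k : (P (g k @^-1` A' k)) = (\int[P]_w (\1_(A' k) (g k w) : R))%:E.
  { rewrite EFin_Rint; last by apply: (@bmf_indic _ _ R (g k @^-1` A' k)).
    by have := integral_indic P measurableT (mS k); rewrite setIT => <-. }
  have := indg J (fun k => mA _ : measurable (A' k)).
  rewrite (perm_big _ pJ)/= big_map.
  under eq_bigr do rewrite pE.
  rewrite -(big_morph EFin (@EFinM R) erefl).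
  set B := \bigcap_(i in [set` J]) _.
  have memJ k : (k \in J) = (k \in ks) by exact: perm_mem.
  have fJ j : (j < m)%N -> fmode n j \in J by move=> jm; rewrite memJ map_f// mem_iota.
  have prodE w : \prod_(0 <= j < m) \1_(A j) (Z j w) = \1_B w :> R.
  { have [Bw|nBw] := pselect (B w).
    - rewrite [RHS]indicE mem_set// big_nat big1// => j jm; rewrite indicE mem_set//.
      by have := Bw (fmode n j); rewrite /= /A' kK; apply; exact: fJ.
    - rewrite [RHS]indicE memNset//.
      have [j [jm nA]] : exists j, (j < m)%N /\ ~ A j (Z j w).
        apply: contrapT => h; apply: nBw => k /=; rewrite memJ => /mapP[j]; rewrite mem_iota => /= jm ->.
        by rewrite /A' kK; apply: contrapT => hh; apply: h; exists j.
      rewrite (bigD1_seq j) ?mem_index_iota ?iota_uniq//.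
      have -> : \1_(A j) (Z j w) = 0 :> R by rewrite indicE memNset.
      exact: mul0r. }
  have mB : measurable B by apply: fin_bigcap_measurable => [|k _]; [exact: finite_fset|exact: mS].
  under eq_Rintegral do rewrite prodE.
  move=> h; apply: (@EFin_inj R); rewrite EFin_Rint; last exact: bmf_indic.
  apply: (etrans (integral_indic P measurableT mB)); rewrite setIT; apply: (etrans h); congr EFin.
  rewrite /index_iota subn0; apply: eq_bigr => j _; apply: eq_Rintegral => w _.
  by rewrite /A' kK. }
have charX i c' : \int[P]_w cos (X i (Z i w) + c') = rho i * cos c'.
  exact: standard_complex_char.
have := @indep_char R _ Om P _ (borel C) Z m mZ indZ X rho mX charX c.
rewrite (sum_double m (fun i => t i ^+ 2 / 4)) (_ : \prod_(i < m) rho i = expR (- \sum_(j < m) (t j.*2 ^+ 2 / 4 + t j.*2.+1 ^+ 2 / 4))).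
  move=> <-; apply: eq_Rintegral => w _; congr (cos (_ + _)).
  rewrite (sum_double m (fun i => t i * gcoord n i w)); apply: eq_bigr => j _.
  by rewrite /gcoord/= odd_double/= uphalf_double doubleK.
rewrite -sumrN expR_sum; apply: eq_bigr => j _; congr expR; by field.
Qed.

End free_field_coefficients.

Lemma normr_cosB (R : realType) (x y : R) : `|cos x - cos y| <= `|x - y|.
Proof.
have -> : x = (x + y) / 2 + (x - y) / 2 by field.
have -> : cos y = cos ((x + y) / 2 - (x - y) / 2) :> R by congr cos; field.
have -> : (x + y) / 2 + (x - y) / 2 - y = (x - y) by field.
rewrite cosD cosB.
have -> : cos ((x + y) / 2) * cos ((x - y) / 2) - sin ((x + y) / 2) * sin ((x - y) / 2) -
  (cos ((x + y) / 2) * cos ((x - y) / 2) + sin ((x + y) / 2) * sin ((x - y) / 2)) =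
  - (sin ((x + y) / 2) * (2 * sin ((x - y) / 2))) by ring.
rewrite normrN normrM -[leRHS]mul1r ler_pM ?sin_max// normrM ger0_norm//.
have := normr_sin_le ((x - y) / 2); rewrite normrM (@ger0_norm _ (2^-1)) ?invr_ge0//; lra.
Qed.

Lemma lip_local_close (R : realType) (A K M e : R) (F : (R -> Rcomplex R) -> R) f g : 0 <= K -> lip_local A K M F -> 0 < e ->
  (forall x : R, `|x| <= A -> `|f x - g x| < e / (K + 1)) -> `|F f - F g| <= e.
Proof.
move=> K0 [_ FK] e0 fg; apply: (@le_trans _ _ (K * (e / (K + 1)))).
  by apply: FK => x xA; exact/ltW/fg.
by rewrite mulrCA -[leRHS]mulr1 ler_wpM2l ?(ltW e0)// ler_pdivrMr ?ltr_wpDl// mul1r lerDl.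
Qed.

Lemma eval_continuous (R : realType) b (x : R) : continuous (fun phi : path_space R => part b (phi x)).
Proof.
move=> phi; have FF : Filter (nbhs phi) by exact: nbhs_filter.
apply/cvgrPdist_le => e e0; have := path_nbhs_uniform phi `|x| e0.
apply: filterS => psi h; rewrite -partB; apply: (le_trans (normr_part_le _ _)).
exact/ltW/h.
Qed.

Section free_field_law.
Context (R : realType) (alpha L : R).
Notation C := (Rcomplex R).
Hypotheses (alpha0 : 0 < alpha) (L0 : 0 < L).
Notation trig := (trig alpha L).

Definition periodic_paths : set (path_space R) := [set phi | forall x : R, phi (x + L) = phi x].

Lemma trig_periodic n a x : trig n a (x + L) = trig n a x.
Proof.
apply: C_ext => b; rewrite !part_trig; apply: eq_bigr => j _.
have -> : fangle L (fmode n j) (x + L) = fangle L (fmode n j) x + (fmode n j)%:~R * (pi *+ 2).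
  by rewrite /fangle; field; rewrite gt_eqF.
have H (f : R -> R) (k : int) y : periodic f (pi *+ 2) -> f (y + k%:~R * (pi *+ 2)) = f y.
{ move=> pf; case: k => k.
    by rewrite -[_%:~R]/(k%:R) mulr_natl periodicn.
  rewrite NegzE mulrNz mulNr -[in RHS](subrK (k.+1%:~R * (pi *+ 2)) y).
  by rewrite -[_%:~R]/(k.+1%:R) mulr_natl (periodicn pf). }
by rewrite (H _ _ _ (@cosD2pi R)) (H _ _ _ (@sinD2pi R)).
Qed.

(** The conditions are uncountably many, so measurability comes from the set being closed,
    evaluations being continuous. *)
Lemma measurable_periodic_paths : measurable (periodic_paths : set (borel (path_space R))).
Proof.
have -> : periodic_paths = \bigcap_(z in [set: R * bool])
    ((fun phi : path_space R => part z.2 (phi (z.1 + L)) - part z.2 (phi z.1)) @^-1` [set 0]).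
  apply/seteqP; split => phi h; first by move=> z _ /=; rewrite h subrr.
  by move=> x; apply: C_ext => b; have /= /eqP := h (x, b) I; rewrite subr_eq0 => /eqP.
rewrite -[X in measurable X]setCK; apply: measurableC; apply: sub_sigma_algebra.
apply: closed_openC; apply: closed_bigI => z _; apply: preimage_closed; last exact: closed_eq.
move=> phi _; have FF : Filter (nbhs phi) by exact: nbhs_filter.
by apply: cvgB; exact: eval_continuous.
Qed.

Section field.
Variable m : probability (borel (path_space R)) R.
Hypothesis ff : is_free_field alpha L m.

(** The form in which the random series is used. Since the place of a mode depends on n, there is a
    separate coordinate sequence [X n] for each n. Only its characteristic function is recorded: it
    determines the means of Lipschitz functions of the coordinates. *)
Lemma free_field_rep : exists d (Om : measurableType d) (P : probability Om R) (X : nat -> nat -> Om -> R),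
  [/\ forall n i, measurable_fun setT (X n i),
    forall n (t : nat -> R) c, \int[P]_w cos (\sum_(i < n.*2.+1.*2) t i * X n i w + c) =
        expR (- (\sum_(i < n.*2.+1.*2) t i ^+ 2 / 4)) * cos c,
    (forall A K M F, 0 <= K -> lip_local A K M F ->
      \int[P]_w F (trig n (X n ^~ w)) @[n --> \oo] --> \int[m]_phi F phi) &
    m (~` periodic_paths) = 0%E].
Proof.
have [d [Om [P [g [phi [indg stdg cvgphi mE]]]]]] := ff.
pose U w n : R -> C := fun x => \sum_(j < n.*2.+1) fourier_term alpha L (g (j%:Z - n%:Z) w) (j%:Z - n%:Z) x.
have UE w n : U w n = trig n (gcoord g n ^~ w).
  apply/funext => x; apply: eq_bigr => j _; congr fourier_term.
  by rewrite /gcoord/= odd_double/= uphalf_double doubleK; case: (g _ w).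
have cU : {ae P, forall w A e, 0 < e -> \forall n \near \oo, forall x : R, `|x| <= A -> `|phi w x - U w n x| < e}.
{ apply: filterS cvgphi => w cw A e e0.
  exact: (@compact_open_uniform R (U w @ \oo) (phi w) A e _ (@path_continuous R (phi w)) cw e0). }
exists d, Om, P, (gcoord g); split.
- by move=> n i; exact: measurable_gcoord.
- by move=> n t c; exact: gcoord_char.
- move=> A K M F K0 FL.
  have mphi : measurable_fun setT (phi : Om -> borel (path_space R)) by [].
  rewrite (@Rint_law _ _ _ _ _ P m phi (fun phi : borel (path_space R) => F phi)) => //; [|by move=> B mB; rewrite mE|exact: bmf_lip_local FL].
  have mF n : measurable_fun setT (fun w => F (trig n (gcoord g n ^~ w))).
    apply: (@lip_measurable _ _ _ (gcoord g n) _ n.*2.+1.*2 (K * (2 * ((Num.sqrt alpha)^-1 * (Num.sqrt L)^-1))) M (fun a => F (trig n a))).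
    + by move=> i; exact: measurable_gcoord.
    + by rewrite !mulr_ge0// invr_ge0 sqrtr_ge0.
    + move=> a b; rewrite -!mulrA; have [_ h] := FL; apply: h => x _.
      by have := trig_lip L alpha0 n a b x; rewrite -!mulrA.
    + by move=> a; have [h _] := FL.
  apply: (@bounded_cvg_ae _ _ _ P _ _ M) => //.
  + exact: (measurableT_comp (lip_local_measurable K0 FL) mphi).
  + by move=> n w; have [h _] := FL.
  + apply: filterS cU => w cw; apply/cvgrPdist_le => e e0.
    have e1 : 0 < e / (K + 1) by rewrite divr_gt0// ltr_wpDl.
    have := cw A _ e1; apply: filterS => n h; rewrite -UE.
    exact: (lip_local_close K0 FL e0).
- have mB : measurable (phi @^-1` (~` periodic_paths)).
    rewrite -[X in measurable X]setTI; have mphi : measurable_fun setT (phi : Om -> borel (path_space R)) by [].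
    by apply: mphi => //; apply: measurableC; exact: measurable_periodic_paths.
  rewrite mE; last by apply: measurableC; exact: measurable_periodic_paths.
  suff Z : P (phi @^-1` (~` periodic_paths)) = 0%E by exact: Z.
  apply: measure_negligible => //.
  apply: negligibleS cU => w /= nper cw; apply: nper => x.
  apply/eqP; rewrite -subr_eq0 -normr_le0; apply/ler_addgt0Pr => e e0; rewrite add0r.
  have e2 : 0 < e / 2 by rewrite divr_gt0.
  have [n _ /(_ n (leqnn n)) /= h] := cw (`|x| + `|L|) _ e2.
  have h1 := h x _; have h2 := h (x + L) _.
  have TL : U w n (x + L) = U w n x by rewrite UE trig_periodic.
  have -> : phi w (x + L) - phi w x = (phi w (x + L) - U w n (x + L)) - (phi w x - U w n x).
    by rewrite TL opprB addrA subrK.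
  apply: (le_trans (ler_normB _ _)); rewrite [leRHS](splitr e) lerD// ltW//.
  + by apply: h2; exact: ler_normD.
  + by apply: h1; rewrite lerDl.
Qed.

(** For each n the coefficients have the characteristic function of the product model, so
    [law_transfer] exchanges the two; the inequality holds in the model and passes to the limit in
    n. *)
Lemma free_field_tau A K M u v : 0 <= K -> lip_local A K M u -> lip_local A K M v ->
  (forall f, 0 <= u f) -> (forall f, 0 <= v f) ->
  (forall n a b, u (trig n a) * v (trig n b) <=
     expR ((\sum_(i < n.*2.+1.*2) (a i - b i) ^+ 2) / 2)) ->
  (\int[m]_phi u phi) * (\int[m]_phi v phi) <= 1.
Proof.
move=> K0 uL vL u0 v0 uv.
have [d [Om [P [X [mX charX limX _]]]]] := free_field_rep.
have h : (\int[P]_w u (trig n (X n ^~ w))) * (\int[P]_w v (trig n (X n ^~ w))) @[n --> \oo] -->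
    (\int[m]_phi u phi) * (\int[m]_phi v phi).
  by apply: cvgM; [exact: limX uL|exact: limX vL].
rewrite -(cvg_lim (@Rhausdorff R) h); apply: limr_le; first by apply/cvg_ex; eexists; exact: h.
apply: nearW => n.
pose N := n.*2.+1.*2.
have [d' [T [Q [xi [mxi charxi tau]]]]] := iid_normal_model R N.
pose K' := K * (2 * ((Num.sqrt alpha)^-1 * (Num.sqrt L)^-1)).
have K'0 : 0 <= K' by rewrite !mulr_ge0// invr_ge0 sqrtr_ge0.
have lip F : lip_local A K M F -> lip_in N K' (fun a => F (trig n a)).
  move=> FL a b; rewrite -!mulrA; have [_ hF] := FL; apply: hF => x _.
  by have := trig_lip L alpha0 n a b x; rewrite -!mulrA.
have tr F : lip_local A K M F -> \int[P]_w F (trig n (X n ^~ w)) = \int[Q]_w F (trig n (xi ^~ w)).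
  move=> FL; apply: (@law_transfer _ _ _ _ _ P Q (X n) xi N K' M (fun a => F (trig n a))) => //.
  + by move=> t c; rewrite charX charxi.
  + exact: lip.
  + by move=> a; have [hF _] := FL.
rewrite !tr//; apply: (tau (fun a => u (trig n a)) (fun a => v (trig n a)) K' M) => //.
- exact: lip.
- exact: lip.
- by move=> a; rewrite u0/=; have [hF _] := uL; apply: le_trans (hF _); exact: ler_norm.
- by move=> a; rewrite v0/=; have [hF _] := vL; apply: le_trans (hF _); exact: ler_norm.
Qed.

(** The covariance of the n-th partial sum between two points at distance y. Its imaginary part
    cancels between the modes k and - k, see [sine_kern]. *)
Definition kern (n : nat) (y : R) : R :=
  \sum_(j < n.*2.+1) (L * fdenom alpha L (fmode n j))^-1 * cos (fangle L (fmode n j) y).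

(* Even indices stand for real parts, odd ones for imaginary parts. *)
Definition path_coord (x : nat -> R) (i : nat) (f : R -> C) : R := part (odd i) (f (x i)).

Lemma lip_local_cos N (x t : nat -> R) c :
  lip_local (\sum_(i < N) `|x i|) (\sum_(i < N) `|t i|) 1
    (fun f => cos (\sum_(i < N) t i * path_coord x i f + c)).
Proof.
split; first by move=> f; exact: cos_max.
move=> f g d fg.
apply: (le_trans (normr_cosB _ _)).
rewrite opprD addrACA subrr addr0 -sumrB; apply: (le_trans (ler_norm_sum _ _ _)).
rewrite mulr_suml; apply: ler_sum => i _; rewrite -mulrBr normrM ler_wpM2l// /path_coord -partB.
apply: (le_trans (normr_part_le _ _)); apply: fg.
by rewrite (bigD1 i)//= lerDl sumr_ge0.
Qed.

Lemma sine_kern n y : \sum_(j < n.*2.+1) (L * fdenom alpha L (fmode n j))^-1 * sin (fangle L (fmode n j) y) = 0.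
Proof.
set S := LHS; suff : S = - S by move=> h; lra.
rewrite {1}/S (reindex_inj rev_ord_inj)/= -sumrN; apply: eq_bigr => j _.
have -> : fmode n (n.*2.+1 - j.+1) = - fmode n j.
  rewrite /fmode subSS -subzn; last by have := ltn_ord j; rewrite ltnS.
  have -> : (n.*2)%:Z = n%:Z + n%:Z by rewrite -addnn PoszD.
  by ring.
rewrite /fdenom /fangle mulrNz mulNr sqrrN mulrN !mulNr sinN mulrN//.
Qed.

(** A linear combination of point values of the n-th partial sum is a combination of Gaussian
    coordinates with coefficients [T]. Each coordinate has variance 1/2, whence the exponent - sum
    T^2 / 4, and expanding the squares gives the covariance. *)
Lemma free_field_char N (x t : nat -> R) c :
  expR (- (\sum_(i < N) \sum_(j < N) t i * t j * ((odd i == odd j)%:R * kern n (x i - x j)) / 4)) * cos c @[n --> \oo] -->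
  \int[m]_phi cos (\sum_(i < N) t i * path_coord x i phi + c).
Proof.
have [d [Om [P [X [mX charX limX _]]]]] := free_field_rep.
have := limX _ _ _ _ _ (lip_local_cos N x t c).
have h0 : 0 <= \sum_(i < N) `|t i| by apply: sumr_ge0.
move=> /(_ h0).
have E n : \int[P]_w cos (\sum_(i < N) t i * path_coord x i (trig n (X n ^~ w)) + c) =
  expR (- (\sum_(i < N) \sum_(j < N) t i * t j * ((odd i == odd j)%:R * kern n (x i - x j)) / 4)) * cos c.
{ pose th j i := fangle L (fmode n j) (x i).
  pose T (k : nat) : R := let j := k./2 in fscale alpha L (fmode n j) *
    (if odd k then \sum_(i < N) t i * (if odd i then cos (th j i) else - sin (th j i))
     else \sum_(i < N) t i * (if odd i then sin (th j i) else cos (th j i))).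
  transitivity (\int[P]_w cos (\sum_(i < n.*2.+1.*2) T i * X n i w + c)).
    apply: eq_Rintegral => w _; congr (cos (_ + _)).
    rewrite (sum_double _ (fun i => T i * X n i w)).
    under eq_bigr do rewrite /path_coord part_trig mulr_sumr.
    rewrite exchange_big/=; apply: eq_bigr => j _.
    rewrite /T/= odd_double/= uphalf_double doubleK.
    rewrite !mulr_sumr !mulr_suml -big_split/=; apply: eq_bigr => i _.
    by case: ifP => _; rewrite /th; ring.
  rewrite charX; congr (expR (- _) * _).
  rewrite (sum_double _ (fun i => T i ^+ 2 / 4)).
  pose w j := (L * fdenom alpha L (fmode n j))^-1.
  (* Equal parts produce a cosine, different parts a sine; after summation over the modes only the
     cosines are left. *)
  pose q j (i i' : nat) : R := (odd i == odd i')%:R * cos (fangle L (fmode n j) (x i - x i')) +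
     ((odd i)%:R - (odd i')%:R) * sin (fangle L (fmode n j) (x i - x i')).
  transitivity (\sum_(j < n.*2.+1) \sum_(i < N) \sum_(i' < N) t i * t i' / 4 * (w j * q j i i')).
  - apply: eq_bigr => j _; rewrite /T/= odd_double/= uphalf_double doubleK.
    rewrite !(exprMn _ (fscale _ _ _)) -mulrDl -mulrDr fscale2// -/(w j) !expr2 !mulr_suml -big_split/= mulr_sumr mulr_suml.
    apply: eq_bigr => i _; rewrite !mulr_sumr -big_split/= mulr_sumr mulr_suml; apply: eq_bigr => i' _.
    have -> : q j i i' = (if odd i then sin (th j i) else cos (th j i)) * (if odd i' then sin (th j i') else cos (th j i')) +
       (if odd i then cos (th j i) else - sin (th j i)) * (if odd i' then cos (th j i') else - sin (th j i')).
      rewrite /q; have -> : fangle L (fmode n j) (x i - x i') = th j i - th j i'.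
        by rewrite /th /fangle -mulrBl -mulrBr.
      by rewrite sinB cosB; case: (odd i); case: (odd i') => /=; ring.
    by field.
  - rewrite exchange_big/=; apply: eq_bigr => i _; rewrite exchange_big/=; apply: eq_bigr => i' _.
    rewrite -mulr_sumr [RHS]mulrAC; congr (_ * _).
    rewrite /q; under eq_bigr do rewrite mulrDr mulrCA (mulrCA (w _)).
    by rewrite big_split/= -!mulr_sumr sine_kern mulr0 addr0. }
by under eq_fun do rewrite E.
Qed.

End field.
End free_field_law.

(** * The covariance of the free field and its limit *)

Section periodic_kernel.
Context (R : realType) (alpha L : R).
Hypotheses (alpha0 : 0 < alpha) (L0 : 0 < L).
Notation kern := (kern alpha L).

Definition mass_par : R := Num.sqrt alpha.
Notation ka := mass_par.

Lemma mass_par_gt0 : 0 < ka. Proof. by rewrite sqrtr_gt0. Qed.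
Lemma mass_par2 : ka ^+ 2 = alpha. Proof. by rewrite sqr_sqrtr// ltW. Qed.

Definition freq (k : nat) : R := 2 * pi * k.+1%:R / L.
Definition kcoef (k : nat) : R := 2 * (L * (alpha + freq k ^+ 2))^-1.

Lemma freq_gt0 k : 0 < freq k.
Proof. by rewrite divr_gt0// !mulr_gt0// pi_gt0. Qed.

Lemma kcoef_ge0 k : 0 <= kcoef k.
Proof. by rewrite mulr_ge0// invr_ge0 mulr_ge0 ?ltW// ltr_wpDr ?sqr_ge0. Qed.

Lemma kern_series n y : kern n y = (L * alpha)^-1 + \sum_(k < n) kcoef k * cos (freq k * y).
Proof.
have D (k : int) : fdenom alpha L k = alpha + (2 * pi * k%:~R / L) ^+ 2.
  by rewrite /fdenom; congr (_ + _); ring.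
elim: n => [|n IHn].
  rewrite /kern big_ord_recl !big_ord0 !addr0 D /fangle/= /fmode subrr.
  by rewrite mulr0 !mul0r expr0n/= addr0 cos0 mulr1.
rewrite /kern doubleS big_ord_recr big_ord_recl/=.
have -> : fmode n.+1 0 = - (n.+1%:Z) by rewrite /fmode sub0r.
have -> : fmode n.+1 n.*2.+2 = n.+1%:Z.
  rewrite /fmode; have -> : n.*2.+2%:Z = n.+1%:Z + n.+1%:Z by rewrite -PoszD addnn doubleS.
  by ring.
have -> : \sum_(i < n.*2.+1) (L * fdenom alpha L (fmode n.+1 (bump 0 i)))^-1 * cos (fangle L (fmode n.+1 (bump 0 i)) y) = kern n y.
  apply: eq_bigr => j _; have -> // : fmode n.+1 (bump 0 j) = fmode n j.
  by rewrite /fmode /bump leq0n !add1n -[j.+1]addn1 -[n.+1]addn1 !PoszD; ring.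
rewrite IHn [in RHS]big_ord_recr/= !D /fangle !mulrNz !(mulrN, mulNr) sqrrN cosN.
have -> : 2 * pi * n.+1%:~R * y / L = freq n * y by rewrite /freq -[n.+1%:~R]/(n.+1%:R); ring.
rewrite /kcoef /freq -[n.+1%:~R]/(n.+1%:R).
by ring.
Qed.

Lemma is_derive_bigsum (n : nat) (f : nat -> R -> R) (df : nat -> R) (x : R) :
  (forall k, is_derive x (1 : R) (f k) (df k)) ->
  is_derive x (1 : R) (fun y => \sum_(k < n) f k y) (\sum_(k < n) df k).
Proof.
move=> fd; elim: n => [|n IHn].
  by under eq_fun do rewrite big_ord0; rewrite big_ord0; exact: is_derive_cst.
by under eq_fun do rewrite big_ord_recr/=; rewrite big_ord_recr/=; exact: is_deriveD.
Qed.

Lemma is_derive_cosM (a x : R) : is_derive x (1 : R) (fun y => cos (a * y)) (- a * sin (a * x)).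
Proof. by apply: is_derive_eq; rewrite /GRing.scale/=; ring. Qed.

Lemma is_derive_sinM (a x : R) : is_derive x (1 : R) (fun y => sin (a * y)) (a * cos (a * x)).
Proof. by apply: is_derive_eq; rewrite /GRing.scale/=; ring. Qed.

(* The partial sums [S_n] of the covariance solve [S_n'' = alpha S_n - dirichlet n]; variation of
   constants and the Riemann-Lebesgue lemma give the closed form of the limit. *)
Definition dkern n y : R := \sum_(k < n) kcoef k * (- freq k * sin (freq k * y)).
Definition dirichlet n y : R := L^-1 + \sum_(k < n) 2 / L * cos (freq k * y).
Definition ikern n y : R := (L * alpha)^-1 * y + \sum_(k < n) kcoef k / freq k * sin (freq k * y).

Lemma is_derive_kern n (x : R) : is_derive x (1 : R) (kern n) (dkern n x).
Proof.
have -> : kern n = fun y => (L * alpha)^-1 + \sum_(k < n) kcoef k * cos (freq k * y).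
  by apply/funext => y; exact: kern_series.
have h : is_derive x (1 : R) (fun y => \sum_(k < n) kcoef k * cos (freq k * y)) (dkern n x).
  apply: (@is_derive_bigsum n (fun k y => kcoef k * cos (freq k * y)) (fun k => kcoef k * (- freq k * sin (freq k * x)))).
  move=> k; have := is_derive_cosM (freq k) x => d.
  by apply: is_derive_eq; rewrite /GRing.scale/=; ring.
by have := is_deriveD (is_derive_cst (L * alpha)^-1 x (1 : R)) h; rewrite add0r.
Qed.

Lemma is_derive_dkern n (x : R) : is_derive x (1 : R) (dkern n) (alpha * kern n x - dirichlet n x).
Proof.
have := @is_derive_bigsum n (fun k y => kcoef k * (- freq k * sin (freq k * y)))
  (fun k => kcoef k * (- freq k * (freq k * cos (freq k * x)))) x.
have -> : \sum_(k < n) kcoef k * (- freq k * (freq k * cos (freq k * x))) = alpha * kern n x - dirichlet n x.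
{ rewrite kern_series /dirichlet mulrDr invfM mulrCA mulfV ?gt_eqF// mulr1 opprD addrACA subrr add0r.
  rewrite mulr_sumr -sumrB; apply: eq_bigr => k _; rewrite /kcoef.
  have h : alpha + freq k ^+ 2 != 0 by rewrite gt_eqF// ltr_wpDr ?sqr_ge0.
  field; rewrite gt_eqF//=. }
apply=> k; have := is_derive_sinM (freq k) x => d.
by apply: is_derive_eq; rewrite /GRing.scale/=; ring.
Qed.

Lemma is_derive_ikern n (x : R) : is_derive x (1 : R) (ikern n) (kern n x).
Proof.
have h : is_derive x (1 : R) (fun y => \sum_(k < n) kcoef k / freq k * sin (freq k * y))
   (\sum_(k < n) kcoef k * cos (freq k * x)).
  apply: (@is_derive_bigsum n (fun k y => kcoef k / freq k * sin (freq k * y)) (fun k => kcoef k * cos (freq k * x))).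
  move=> k; have := is_derive_sinM (freq k) x => d.
  by apply: is_derive_eq; rewrite /GRing.scale/=; field; rewrite gt_eqF// freq_gt0.
apply: is_derive_eq; rewrite kern_series /GRing.scale/=; ring.
Qed.

Lemma dirichletE n y : sin (pi * y / L) * (L * dirichlet n y) = sin ((2 * n + 1)%:R * pi / L * y).
Proof.
elim: n => [|n IHn].
  rewrite /dirichlet big_ord0 addr0 mulfV ?gt_eqF// mulr1 muln0 add0n mul1r; congr sin; ring.
have -> : L * dirichlet n.+1 y = L * dirichlet n y + 2 * cos (freq n * y).
  by rewrite /dirichlet big_ord_recr/=; field; rewrite gt_eqF.
rewrite mulrDr IHn.
set a := pi * y / L.
have -> : (2 * n + 1)%:R * pi / L * y = freq n * y - a.
  by rewrite /freq /a -natr1 natrD natrM; field; rewrite gt_eqF.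
have -> : (2 * n.+1 + 1)%:R * pi / L * y = freq n * y + a.
  by rewrite /freq /a -natr1 natrD natrM -natr1; field; rewrite gt_eqF.
rewrite sinB (sinD (freq n * y) a); ring.
Qed.

Lemma sin_freq_half k : sin (freq k * (L / 2)) = 0.
Proof.
have -> : freq k * (L / 2) = 0 + pi *+ k.+1 by rewrite /freq -mulr_natr; field; rewrite gt_eqF.
by rewrite alternatingn ?sin0 ?mulr0//; exact: sinDpi.
Qed.

(** The bound is uniform in y. The coefficients are of order 1 / k^2 and dominated by the
    telescoping terms L (1 / (k + 1) - 1 / (k + 2)), as 2 pi^2 >= 1. *)
Lemma kern_cauchy n m y : (n <= m)%N -> `|kern m.+1 y - kern n.+1 y| <= L / n.+1%:R.
Proof.
move=> nm; have bk k : kcoef k.+1 <= L * (k.+1%:R^-1 - k.+2%:R^-1).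
{ have h1 : kcoef k.+1 <= 2 * (L * freq k.+1 ^+ 2)^-1.
    have f2 : 0 < freq k.+1 ^+ 2 by exact: exprn_gt0 (freq_gt0 _).
    have d1 := mulr_gt0 L0 f2; have d2 := mulr_gt0 L0 (addr_gt0 alpha0 f2).
    by rewrite ler_wpM2l// lef_pV2 ?posrE// ler_pM2l// lerDr ltW.
  apply: (le_trans h1).
  have -> : 2 * (L * freq k.+1 ^+ 2)^-1 = L * ((2 * pi ^+ 2)^-1 * k.+2%:R ^- 2).
    by rewrite /freq; move: (k.+2%:R : R) (ltr0Sn R k.+1) (pi : R) (pi_gt0 R) => a a0 p p0; field; rewrite (gt_eqF L0) (gt_eqF p0) (gt_eqF a0).
  rewrite ler_pM2l//.
  have -> : k.+1%:R^-1 - k.+2%:R^-1 = (k.+1%:R * k.+2%:R)^-1 :> R.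
    have -> : k.+2%:R = k.+1%:R + 1 :> R by rewrite natr1.
    by move: (k.+1%:R : R) (ltr0Sn R k) => a a0; field; rewrite !gt_eqF// ltr_wpDl// ltW.
  have pi1 : 1 <= 2 * pi ^+ 2 :> R by have := pi_ge2 R; nra.
  have p2 : 0 < 2 * pi ^+ 2 :> R by exact: lt_le_trans pi1.
  rewrite -invfM lef_pV2 ?posrE; [|exact: mulr_gt0|by apply: mulr_gt0 => //; exact: exprn_gt0].
  rewrite (@le_trans _ _ (1 * k.+2%:R ^+ 2))// ?ler_wpM2r ?exprn_ge0// mul1r expr2.
  by rewrite ler_wpM2r// ler_nat. }
have sum_le j : `|\sum_(n.+1 <= k < n.+1 + j) kcoef k * cos (freq k * y)| <= L * (n.+1%:R^-1 - (n.+1 + j)%:R^-1).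
{ elim: j => [|j IHj]; first by rewrite addn0 big_geq// normr0 subrr mulr0.
  rewrite addnS big_nat_recr ?leq_addr//=; apply: (le_trans (ler_normD _ _)).
  apply: (@le_trans _ _ (L * (n.+1%:R^-1 - (n.+1 + j)%:R^-1) + L * ((n.+1 + j)%:R^-1 - (n.+1 + j).+1%:R^-1))).
    apply: lerD => //; rewrite normrM (ger0_norm (kcoef_ge0 _)) -[leRHS]mulr1.
    by apply: ler_pM => //; [exact: kcoef_ge0|rewrite addSn; exact: bk|exact: cos_max].
  by rewrite -mulrDr addrA subrK. }
rewrite !kern_series opprD addrACA subrr add0r -!(big_mkord xpredT (fun k => kcoef k * cos (freq k * y))).
rewrite (@big_cat_nat _ _ _ n.+1)//= addrAC subrr add0r.
have := sum_le (m - n)%N; rewrite addSn subnKC// => h; apply: (le_trans h).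
by rewrite ler_pM2l// gerBl invr_ge0.
Qed.

Definition hsinh (x : R) : R := (expR (ka * x) - expR (- (ka * x))) / 2.
Definition hcosh (x : R) : R := (expR (ka * x) + expR (- (ka * x))) / 2.

Lemma is_derive_hsinh (x : R) : is_derive x (1 : R) hsinh (ka * hcosh x).
Proof. by apply: is_derive_eq; rewrite /hcosh /GRing.scale/=; ring. Qed.

Lemma is_derive_hcosh (x : R) : is_derive x (1 : R) hcosh (ka * hsinh x).
Proof. by apply: is_derive_eq; rewrite /hsinh /GRing.scale/=; ring. Qed.

Lemma hcosh_gt0 x : 0 < hcosh x.
Proof. by rewrite divr_gt0// addr_gt0// expR_gt0. Qed.

Lemma hcoshN x : hcosh (- x) = hcosh x.
Proof. by rewrite /hcosh mulrN opprK addrC. Qed.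

Lemma hsinh_le_cosh x : `|hsinh x| <= hcosh x.
Proof.
have := expR_gt0 (ka * x); have := expR_gt0 (- (ka * x)); rewrite /hsinh /hcosh ler_norml; lra.
Qed.

Lemma hcosh_le x y : 0 <= x -> x <= y -> hcosh x <= hcosh y.
Proof.
move=> x0 xy; apply: (ge0_derive_homo is_derive_hcosh) xy => z /andP[xz _].
have z0 := le_trans x0 xz.
rewrite mulr_ge0 ?(ltW mass_par_gt0)// divr_ge0// subr_ge0 ler_expR.
have := mulr_ge0 (ltW mass_par_gt0) z0; lra.
Qed.

(** The mean value theorem on [x, L / 2] for a variation of constants expression whose derivative is
    of order 1 / n. At y = x it is ka times the kernel; at L / 2 the derivative of the kernel
    vanishes, which leaves the hyperbolic cosine. *)
Lemma kern_ode x : 0 < x <= L / 2 -> exists B, forall n,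
  `|kern n x - kern n (L / 2) * hcosh (L / 2 - x)| <= B / n.+1%:R.
Proof.
move=> /andP[x0 xL].
have k0 := mass_par_gt0.
have sg0 y : x <= y <= L / 2 -> sin (pi * x / L) <= sin (pi * y / L).
{ move=> /andP[xy yL].
  have w z : 0 <= z -> z <= L / 2 -> pi * z / L \in `[(- (pi / 2)), (pi / 2)].
    move=> z0 zL; rewrite in_itv/=; apply/andP; split.
      apply: (@le_trans _ _ 0); first by rewrite oppr_le0 divr_ge0// pi_ge0.
      by rewrite !mulr_ge0 ?pi_ge0// invr_ge0 ltW.
    by rewrite -mulrA ler_wpM2l ?pi_ge0// ler_pdivrMr// mulrC.
  have [->//|xy'] := eqVneq x y.
  rewrite ltW// ltr_sin; first by rewrite ltr_pM2r ?invr_gt0// ltr_pM2l ?pi_gt0// lt_neqAle xy' xy.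
    by apply: w => //; exact: ltW.
  by apply: w => //; exact: le_trans (ltW x0) xy. }
have sx : 0 < sin (pi * x / L).
{ apply: sin_gt0_pi; apply/andP; split; first by rewrite !mulr_gt0 ?pi_gt0// invr_gt0.
  by rewrite -mulrA gtr_pMr ?pi_gt0// ltr_pdivrMr// mul1r (le_lt_trans xL)// ltr_pdivrMr// ltr_pMr// ltr1n. }
set sg := sin (pi * x / L) in sx.
pose h y := hsinh (x - y) / sin (pi * y / L).
pose dh y := (- ka * hcosh (x - y) * sin (pi * y / L) - hsinh (x - y) * (pi / L * cos (pi * y / L))) / sin (pi * y / L) ^+ 2.
pose ch := hcosh (L / 2).
have hb y : x <= y <= L / 2 -> `|h y| <= ch / sg.
{ move=> xyL; have /andP[xy yL] := xyL; rewrite normrM normfV.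
  have s0 : 0 < sin (pi * y / L) by exact: lt_le_trans (sg0 _ xyL).
  rewrite ler_pM ?invr_ge0//; last by rewrite gtr0_norm// lef_pV2 ?posrE// sg0.
  apply: (le_trans (hsinh_le_cosh _)); rewrite -hcoshN opprB; apply: hcosh_le; lra. }
have dhb y : x <= y <= L / 2 -> `|dh y| <= (ka * ch + ch * (pi / L)) / sg ^+ 2.
{ move=> xyL; have /andP[xy yL] := xyL; rewrite normrM normfV.
  have s0 : 0 < sin (pi * y / L) by exact: lt_le_trans (sg0 _ xyL).
  have c1 : hcosh (x - y) <= ch by rewrite -hcoshN opprB; apply: hcosh_le; lra.
  have ch0 : 0 <= ch by apply: ltW; exact: hcosh_gt0.
  have pL : 0 <= pi / L by rewrite divr_ge0 ?pi_ge0 ?ltW.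
  rewrite ler_pM ?invr_ge0//; last first.
    rewrite gtr0_norm ?exprn_gt0// lef_pV2 ?posrE ?exprn_gt0//.
    by rewrite ler_sqr ?nnegrE; [exact: sg0|exact: ltW|exact: ltW].
  apply: (le_trans (ler_normB _ _)); apply: lerD.
  - rewrite 2!normrM normrN (gtr0_norm k0) (gtr0_norm (hcosh_gt0 _)) -[leRHS]mulr1.
    apply: ler_pM => //; [|by rewrite ler_pM2l|exact: sin_max].
    by apply: mulr_ge0; [exact: ltW|exact/ltW/hcosh_gt0].
  - rewrite normrM; apply: ler_pM => //; first by apply: le_trans c1; exact: hsinh_le_cosh.
    rewrite normrM (ger0_norm pL) -[leRHS]mulr1 ler_wpM2l//; exact: cos_max. }
pose lam (n : nat) : R := (2 * n + 1)%:R * pi / L.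
have lam0 n : 0 < lam n by rewrite divr_gt0// mulr_gt0 ?pi_gt0// ltr0n addn1.
(* The first two terms have derivative - hsinh (x - y) times the Dirichlet kernel, that is - h(y)
   sin (lam y) / L. The last one performs the integration by parts of Riemann and Lebesgue: it
   cancels this and leaves a factor 1 / lam. *)
pose Q n y := dkern n y * hsinh (x - y) + kern n y * (ka * hcosh (x - y)) - h y * cos (lam n * y) / (lam n * L).
have dQ n y : x <= y <= L / 2 -> is_derive y (1 : R) (Q n) (- (dh y * cos (lam n * y) / (lam n * L))).
{ move=> xyL; have s0 : 0 < sin (pi * y / L) by exact: lt_le_trans (sg0 _ xyL).
  have d1 := is_derive_kern n y; have d2 := is_derive_dkern n y.
  have d3 : is_derive y (1 : R) (fun y => hsinh (x - y)) (- (ka * hcosh (x - y))).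
    have d := is_derive_hsinh (x - y); apply: is_derive_eq; rewrite /GRing.scale/=; ring.
  have d4 : is_derive y (1 : R) (fun y => hcosh (x - y)) (- (ka * hsinh (x - y))).
    have d := is_derive_hcosh (x - y); apply: is_derive_eq; rewrite /GRing.scale/=; ring.
  have d5 : is_derive y (1 : R) (fun y => sin (pi * y / L)) (pi / L * cos (pi * y / L)).
    apply: is_derive_eq; rewrite /GRing.scale/=; ring.
  have d6 : is_derive y (1 : R) (fun y => (sin (pi * y / L))^-1) (- (pi / L * cos (pi * y / L)) / sin (pi * y / L) ^+ 2).
    have d5' := @is_deriveV _ _ _ _ _ (lt0r_neq0 s0) d5; apply: (is_derive_eq d5').
    by rewrite /GRing.scale/= -exprVn; ring.
  have d7 := is_derive_cosM (lam n) y.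
  have DE := dirichletE n y; rewrite -/(lam n) in DE.
  apply: is_derive_eq; rewrite /GRing.scale/=.
  have -> : dirichlet n y = sin (lam n * y) / (L * sin (pi * y / L)) by rewrite -DE; field; rewrite !gt_eqF.
  rewrite -mass_par2 /h /dh; field.
  by rewrite !gt_eqF. }
set H := (ka * ch + ch * (pi / L)) / sg ^+ 2 in dhb.
exists ((ch / sg + H * (L / 2)) / ka) => n.
have [||c cin QE] := @MVT_segment _ (Q n) (fun y => - (dh y * cos (lam n * y) / (lam n * L))) x (L / 2) xL.
- move=> y; rewrite in_itv/= => /andP[y1 y2]; apply: dQ; lra.
- apply: derivable_within_continuous => y; rewrite in_itv/= => yin.
  by have [] := dQ n y yin.
move: cin; rewrite in_itv/= => cin.
have lL : lam n * L = (2 * n + 1)%:R * pi by rewrite /lam; field; rewrite gt_eqF.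
have hs0 : hsinh 0 = 0 by rewrite /hsinh mulr0 oppr0 subrr mul0r.
have hc0 : hcosh 0 = 1 by rewrite /hcosh mulr0 oppr0 expR0; field.
have Qx : Q n x = kern n x * ka by rewrite /Q /h subrr hs0 hc0 !(mul0r, mulr0) subr0 add0r mulr1.
have dk0 : dkern n (L / 2) = 0.
  by rewrite /dkern big1// => k _; rewrite sin_freq_half !mulr0.
have lL0 : 0 < lam n * L by rewrite mulr_gt0.
have E : ka * (kern n x - kern n (L / 2) * hcosh (L / 2 - x)) =
   (dh c * cos (lam n * c) * (L / 2 - x) - h (L / 2) * cos (lam n * (L / 2))) / (lam n * L).
{ have -> : hcosh (L / 2 - x) = hcosh (x - L / 2) by rewrite -hcoshN opprB.
  have := QE; rewrite Qx /Q dk0 mul0r add0r => /eqP; rewrite subr_eq => /eqP e.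
  transitivity (kern n x * ka - kern n (L / 2) * (ka * hcosh (x - L / 2))); first by ring.
  move: e; set A := kern n (L / 2) * _; set B := kern n x * ka => e.
  have -> : B - A = - (A - h (L / 2) * cos (lam n * (L / 2)) / (lam n * L) - B) - h (L / 2) * cos (lam n * (L / 2)) / (lam n * L) by ring.
  by rewrite e; ring. }
have H0 : 0 <= H.
  by apply: le_trans (dhb x _); rewrite ?lexx.
have c0 : 0 <= ch / sg by apply: le_trans (hb x _); rewrite ?lexx.
rewrite -(ler_pM2l k0) -[X in X * `|_|](gtr0_norm k0) -normrM E normrM normfV (gtr0_norm lL0).
have -> : ka * ((ch / sg + H * (L / 2)) / ka / n.+1%:R) = (ch / sg + H * (L / 2)) / n.+1%:R.
  by move: (n.+1%:R : R) (ltr0Sn R n) => a a0; move: (ch / sg + _) => b; field; rewrite !gt_eqF.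
apply: ler_pM => //; first by rewrite invr_ge0 ltW.
- apply: (le_trans (ler_normB _ _)); rewrite addrC; apply: lerD.
    rewrite normrM -[leRHS]mulr1 ler_pM//; first by apply: hb; rewrite xL lexx.
    exact: cos_max.
  rewrite 2!normrM; apply: ler_pM => //.
  + rewrite -[leRHS]mulr1 ler_pM//; [exact: dhb|exact: cos_max].
  + rewrite ger0_norm; lra.
- rewrite lef_pV2 ?posrE// lL (@le_trans _ _ ((2 * n + 1)%:R * 1))//.
    by rewrite mulr1 ler_nat addn1 ltnS leq_pmull.
  by rewrite ler_wpM2l//; have := pi_ge2 R; lra.
Qed.

(** The Green function of alpha - d^2 / dx^2 on the circle of length L, in the range |y| <= L /
    2. *)
Definition periodic_cov (y : R) : R := hcosh (L / 2 - `|y|) / (2 * ka * hsinh (L / 2)).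

Lemma hsinh_gt0 x : 0 < x -> 0 < hsinh x.
Proof.
move=> x0; rewrite divr_gt0// subr_gt0 ltr_expR.
have := mulr_gt0 mass_par_gt0 x0; lra.
Qed.

Lemma cvg_div_n (B : R) : B / n.+1%:R @[n --> \oo] --> (0 : R).
Proof.
rewrite -[X in _ --> X](mulr0 B); apply: cvgM; [exact: cvg_cst|exact: cvg_harmonic].
Qed.

(** The factor a is the limit at L / 2, not yet identified. [kern_ode] gives the limit for y > 0 and
    the uniform Cauchy bound its rate; the rate reaches y = 0 because each partial sum is
    continuous. *)
Lemma kern_cvg_ge0 : exists a, (forall y, 0 <= y <= L / 2 -> forall n,
   `|kern n.+1 y - a * hcosh (L / 2 - y)| <= L / n.+1%:R).
Proof.
have [a acvg] : exists a : R, kern n.+1 (L / 2) @[n --> \oo] --> a.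
{ apply/cvg_ex; apply/cauchy_cvgP; apply: cauchy_exP => e e0.
  have /cvgrPdist_lt/(_ _ e0)[n _ /(_ n (leqnn n))] /= := cvg_div_n L.
  rewrite sub0r normrN ger0_norm ?divr_ge0 ?(ltW L0)// => Le.
  exists (kern n.+1 (L / 2)); exists n => // m /= nm; rewrite -ball_normE/= distrC.
  exact: le_lt_trans (kern_cauchy _ nm) Le. }
exists a.
have pos y : 0 < y <= L / 2 -> forall n, `|kern n.+1 y - a * hcosh (L / 2 - y)| <= L / n.+1%:R.
{ move=> yL n; have [B HB] := kern_ode yL.
  have c : kern m.+1 y @[m --> \oo] --> a * hcosh (L / 2 - y).
  { have d : kern m.+1 y - kern m.+1 (L / 2) * hcosh (L / 2 - y) @[m --> \oo] --> (0 : R).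
      apply: (@norm_cvg0 _ R); apply: (@squeeze_cvgr _ _ _ _ (cst 0) (fun m => B / m.+2%:R)).
      - by apply: nearW => m; rewrite normr_ge0/=; exact: HB.
      - exact: cvg_cst.
      - by have := cvg_div_n B; rewrite -(cvg_shiftS (fun n => B / n.+1%:R)).
    have -> : (fun m => kern m.+1 y) = fun m => (kern m.+1 y - kern m.+1 (L / 2) * hcosh (L / 2 - y)) + kern m.+1 (L / 2) * hcosh (L / 2 - y).
      by apply/funext => m; rewrite subrK.
    rewrite -[X in _ --> X]add0r; apply: cvgD => //; apply: cvgM => //; exact: cvg_cst. }
  have h : `|kern n.+1 y - kern m.+1 y| @[m --> \oo] --> `|kern n.+1 y - a * hcosh (L / 2 - y)|.
    by apply: cvg_norm; apply: cvgB => //; exact: cvg_cst.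
  rewrite -(cvg_lim (@Rhausdorff R) h); apply: limr_le; first by apply/cvg_ex; eexists; exact: h.
  by exists n => // m /= nm; rewrite distrC; exact: kern_cauchy. }
move=> y /andP[y0 yL] n; move: y0; rewrite le_eqVlt => /predU1P[<-|y0]; last by apply: pos; rewrite y0.
pose G (y : R) := `|kern n.+1 y - a * hcosh (L / 2 - y)|.
have cG : continuous G.
{ move=> z; apply: cvg_norm; apply: cvgB.
    exact: (is_derive_continuous (is_derive_kern n.+1)).
  apply: cvgM; first exact: cvg_cst.
  apply: (@continuous_comp _ _ _ (fun z => L / 2 - z) hcosh).
    by apply: cvgB; [exact: cvg_cst|exact: cvg_id].
  exact: (is_derive_continuous is_derive_hcosh). }
have h : G (L / 2 / j.+1%:R) @[j --> \oo] --> G 0.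
  by apply: continuous_cvg; [exact: cG|exact: cvg_div_n].
rewrite -/(G 0) -(cvg_lim (@Rhausdorff R) h); apply: limr_le; first by apply/cvg_ex; eexists; exact: h.
apply: nearW => j; apply: pos; rewrite !divr_gt0//= ler_pdivrMr// ler_pMr ?divr_gt0//.
by rewrite ler1n.
Qed.

Lemma kern_cvg y : `|y| <= L / 2 -> kern n y @[n --> \oo] --> periodic_cov y.
Proof.
move=> yL; have [a aP] := kern_cvg_ge0.
(* The factor is found by integration over [0, L / 2]: every cosine integrates to 0 there, so the
   partial sums have integral 1 / (2 alpha), whereas the limit has integral (a / ka) hsinh (L /
   2). *)
have ak : a = (2 * ka * hsinh (L / 2))^-1.
{ have k0 := mass_par_gt0; have s0 : 0 < hsinh (L / 2) by rewrite hsinh_gt0// divr_gt0.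
  suff : (2 * alpha)^-1 - a / ka * hsinh (L / 2) = 0.
    move=> /eqP; rewrite subr_eq0 -mass_par2 => /eqP e.
    have -> : a = (a / ka * hsinh (L / 2)) * (ka / hsinh (L / 2)) by field; rewrite !gt_eqF.
    by rewrite -e; field; rewrite !gt_eqF.
  apply/eqP; rewrite -normr_le0.
  have bd n : `|(2 * alpha)^-1 - a / ka * hsinh (L / 2)| <= (L * (L / 2)) / n.+1%:R.
  { pose D (y : R) := ikern n.+1 y + a / ka * hsinh (L / 2 - y).
    have dD (z : R) : is_derive z (1 : R) D (kern n.+1 z - a * hcosh (L / 2 - z)).
      have d1 := is_derive_ikern n.+1 z; have d2 := is_derive_hsinh (L / 2 - z).
      have d3 : is_derive z (1 : R) (fun y => hsinh (L / 2 - y)) (- (ka * hcosh (L / 2 - z))).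
        apply: is_derive_eq; rewrite /GRing.scale/=; ring.
      by apply: is_derive_eq; rewrite /GRing.scale/=; field; rewrite gt_eqF.
    have L2 : 0 <= L / 2 by rewrite divr_ge0// ltW.
    have [|c cin DE] := @MVT_segment _ D _ _ _ L2 (fun x _ => dD x).
      exact/continuous_subspaceT/(is_derive_continuous dD).
    have -> : (2 * alpha)^-1 - a / ka * hsinh (L / 2) = D (L / 2) - D 0.
    { rewrite /D /ikern subrr subr0.
      have -> : hsinh 0 = 0 by rewrite /hsinh mulr0 oppr0 subrr mul0r.
      rewrite big1 => [|k _]; last by rewrite sin_freq_half mulr0.
      rewrite big1 => [|k _]; last by rewrite mulr0 sin0 mulr0.
      by field; rewrite !gt_eqF. }
    rewrite DE subr0 normrM (ger0_norm L2) mulrAC ler_wpM2r//; apply: aP.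
    by rewrite in_itv/= in cin. }
  have h := cvg_div_n (L * (L / 2)).
  rewrite -(cvg_lim (@Rhausdorff R) h); apply: limr_ge; first by apply/cvg_ex; eexists; exact: h.
  exact: nearW. }
have pos z : 0 <= z <= L / 2 -> kern n z @[n --> \oo] --> periodic_cov z.
{ move=> /andP[z0 zL]; rewrite -cvg_shiftS; apply/cvgrPdist_le => e e0.
  have /cvgrPdist_lt/(_ _ e0) := cvg_div_n L; apply: filterS => n.
  rewrite sub0r normrN ger0_norm ?divr_ge0 ?(ltW L0)// => h.
  rewrite distrC; apply/ltW/(le_lt_trans _ h).
  rewrite /periodic_cov (ger0_norm z0) mulrC -ak; apply: aP; by rewrite z0. }
have [y0|y0] := leP 0 y; first by apply: pos; rewrite y0 -(ger0_norm y0).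
have -> : periodic_cov y = periodic_cov (- y) by rewrite /periodic_cov normrN.
have kN n : kern n y = kern n (- y).
  by rewrite !kern_series; congr (_ + _); apply: eq_bigr => k _; rewrite mulrN cosN.
under eq_fun do rewrite kN; apply: pos; rewrite oppr_ge0 ltW//=.
by rewrite -(ltr0_norm y0).
Qed.

(** On [0, L / 2] the function is convex with slope - 1/2 at 0, whatever L is. This uniformity
    controls the increments of the field for all periods at once. *)
Lemma periodic_cov_lip y : `|y| <= L / 2 -> periodic_cov 0 - periodic_cov y <= `|y| / 2.
Proof.
move=> yL; have k0 := mass_par_gt0; have s0 : 0 < hsinh (L / 2) by rewrite hsinh_gt0// divr_gt0.
pose F (z : R) := z * (ka * hsinh (L / 2)) + hcosh (L / 2 - z).
have dF (z : R) : is_derive z (1 : R) F (ka * (hsinh (L / 2) - hsinh (L / 2 - z))).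
  have d2 := is_derive_hcosh (L / 2 - z).
  have d3 : is_derive z (1 : R) (fun y => hcosh (L / 2 - y)) (- (ka * hsinh (L / 2 - z))).
    apply: is_derive_eq; rewrite /GRing.scale/=; ring.
  by apply: is_derive_eq; rewrite /GRing.scale/=; ring.
have : F 0 <= F `|y|.
{ apply: (ge0_derive_homo dF) => // z /andP[z0 zy].
  rewrite mulr_ge0 ?(ltW k0)// subr_ge0.
  apply: (@ge0_derive_homo _ _ _ _ _ is_derive_hsinh); last by rewrite gerBl.
  by move=> w _; rewrite mulr_ge0 ?(ltW k0)//; exact/ltW/hcosh_gt0. }
rewrite /F mul0r add0r subr0 => h.
have d0 : 0 < 2 * ka * hsinh (L / 2) by exact: mulr_gt0 (mulr_gt0 (ltr0Sn R 1) k0) s0.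
rewrite /periodic_cov normr0 subr0 -mulrBl ler_pdivrMr//.
have -> : `|y| / 2 * (2 * ka * hsinh (L / 2)) = `|y| * (ka * hsinh (L / 2)) by field.
lra.
Qed.

Lemma periodic_covE y : let q := expR (- (ka * L)) in
  periodic_cov y = (expR (- (ka * `|y|)) + expR (ka * `|y|) * q) / (2 * ka * (1 - q)).
Proof.
move=> q; have k0 := mass_par_gt0.
have q1 : q < 1 by rewrite -expR0 ltr_expR oppr_lt0 mulr_gt0.
pose E := expR (- (ka * (L / 2))).
have E0 : 0 < E by exact: expR_gt0.
have qE : q = E ^+ 2.
  by rewrite /q /E expr2 -expRD; congr expR; field.
have e1 : expR (ka * (L / 2 - `|y|)) = E^-1 * expR (- (ka * `|y|)) by rewrite -expRN -expRD; congr expR; ring.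
have e2 : expR (- (ka * (L / 2 - `|y|))) = E * expR (ka * `|y|) by rewrite -expRD; congr expR; ring.
have e3 : expR (ka * (L / 2)) = E^-1 by rewrite -expRN opprK.
rewrite /periodic_cov /hcosh /hsinh e1 e2 e3 -/E.
move: q1; rewrite qE => q1.
move: (expR (- (ka * `|y|))) (expR (ka * `|y|)) => A B.
have n1 : 1 - E ^+ 2 != 0 by rewrite gt_eqF// subr_gt0.
have n2 : - E ^+ 2 + 1 != 0 by rewrite addrC.
by field; rewrite ?n1 ?n2 ?gt_eqF.
Qed.

End periodic_kernel.

Definition line_cov (R : realType) (alpha y : R) : R :=
  expR (- (mass_par alpha * `|y|)) / (2 * mass_par alpha).

Lemma periodic_cov_cvg (R : realType) (alpha y : R) (L : nat -> R) : 0 < alpha -> (forall n, 0 < L n) ->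
  (L n @[n --> \oo] --> +oo) -> periodic_cov alpha (L n) y @[n --> \oo] --> line_cov alpha y.
Proof.
move=> alpha0 L0 Ly; have k0 := mass_par_gt0 alpha0.
have q0 : expR (- (mass_par alpha * L n)) @[n --> \oo] --> (0 : R).
{ apply/cvgrPdist_le => e e0; near=> n; rewrite sub0r normrN gtr0_norm ?expR_gt0//.
  have Ln : (e^-1 / mass_par alpha) <= L n by near: n; move/cvgryPge : Ly; exact.
  have h2 : 1 + mass_par alpha * L n <= expR (mass_par alpha * L n) by exact: expR_ge1Dx.
  have h1 : e^-1 <= mass_par alpha * L n by rewrite mulrC -ler_pdivrMr.
  rewrite expRN -[leRHS]invrK lef_pV2 ?posrE ?expR_gt0 ?invr_gt0//; lra. }
under eq_fun do rewrite periodic_covE//.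
have -> : line_cov alpha y = (expR (- (mass_par alpha * `|y|)) + expR (mass_par alpha * `|y|) * 0) / (2 * mass_par alpha * (1 - 0)).
  by rewrite mulr0 addr0 subr0 mulr1.
apply: cvgM; first by apply: cvgD; [exact: cvg_cst|apply: cvgM => //; exact: cvg_cst].
apply: cvgV; first by rewrite subr0 mulr1 mulf_neq0// gt_eqF.
by apply: cvgM; [exact: cvg_cst|apply: cvgB => //; exact: cvg_cst].
Unshelve. all: by end_near. Qed.

(** * The covariance of the Ornstein-Uhlenbeck measure *)

Section bump_family.
Context (R : realType).
Notation mu := (@lebesgue_measure R).

(** The standard bump is q = 1, k = 0. The family is closed under differentiation, with numerator
    [bump_dpoly q k] and exponent k + 2, so smoothness of the bump is an induction. *)
Definition bump_fun (q : {poly R}) (k : nat) (x : R) : R :=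
  if `|x| < 1 then q.[x] / (1 - x ^+ 2) ^+ k * expR (- (1 - x ^+ 2)^-1) else 0.

Definition bump_dpoly (q : {poly R}) (k : nat) : {poly R} :=
  q^`() * (1 - 'X ^+ 2) ^+ 2 + (2 * k%:R)%:P * 'X * q * (1 - 'X ^+ 2) - 2%:P * 'X * q.

Lemma onem_sqr_gt0 (x : R) : `|x| < 1 -> 0 < 1 - x ^+ 2.
Proof. by move=> x1; rewrite subr_gt0 -real_normK ?num_real// expr_lt1. Qed.

Lemma expRN_inv_le (w : R) k : 0 < w -> expR (- w^-1) <= (k.+1)`!%:R * w ^+ k.+1.
Proof.
move=> w0; have f0 : 0 < (k.+1)`!%:R :> R by rewrite ltr0n fact_gt0.
have h : (w ^+ k.+1)^-1 / (k.+1)`!%:R <= expR w^-1.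
  have := @expR_ge1Dxn R w^-1 k; rewrite invr_ge0 (ltW w0) exprVn => /(_ isT); lra.
have p0 : 0 < (w ^+ k.+1)^-1 / (k.+1)`!%:R by rewrite divr_gt0// invr_gt0 exprn_gt0.
rewrite expRN -[leRHS]invrK lef_pV2 ?posrE ?expR_gt0//.
  by rewrite invfM mulrC.
by rewrite invr_gt0 mulr_gt0// exprn_gt0.
Qed.

Lemma is_derive_square_bound (F : R -> R) (x C : R) : F x = 0 ->
  (forall y, `|F y| <= C * (y - x) ^+ 2) -> is_derive x (1 : R) F 0.
Proof.
move=> Fx FC.
have C0 : 0 <= C by have := le_trans (normr_ge0 _) (FC (x + 1)); rewrite addrAC subrr add0r expr1n mulr1.
suff h : h^-1 *: (F (h *: 1 + x) - F x) @[h --> 0^'] --> (0 : R).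
  apply: DeriveDef; first by apply/cvg_ex; exists 0; exact: h.
  by apply: cvg_lim => //; exact: Rhausdorff.
apply/cvgrPdist_le => e e0.
near=> h; have h0 : h != 0 by near: h; exact: nbhs_dnbhs_neq.
rewrite sub0r Fx subr0 normrN /GRing.scale/= normrM normfV.
rewrite mulrC ler_pdivrMr ?normr_gt0//; apply: (le_trans (FC _)).
rewrite mulr1 addrK -real_normK ?num_real// expr2 mulrA ler_wpM2r//.
rewrite (@le_trans _ _ ((C + 1) * `|h|))// ?ler_wpM2r// ?lerDl// mulrC -ler_pdivlMr ?ltr_wpDl//.
near: h; apply: dnbhs0_le; by rewrite divr_gt0// ltr_wpDl.
Unshelve. all: by end_near. Qed.

Lemma horner_bounded (q : {poly R}) : exists C, 0 <= C /\ forall x, `|x| <= 1 -> `|q.[x]| <= C.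
Proof.
exists (\sum_(i < size q) `|q`_i|); split; first exact: sumr_ge0.
move=> x x1; rewrite horner_coef; apply: (le_trans (ler_norm_sum _ _ _)); apply: ler_sum => i _.
by rewrite normrM normrX -[leRHS]mulr1 ler_pM// exprn_ile1.
Qed.

Lemma is_derive_bump_fun q k (x : R) : is_derive x (1 : R) (bump_fun q k) (bump_fun (bump_dpoly q k) k.+2 x).
Proof.
have [x1|x1] := ltP `|x| 1.
- have w0 := onem_sqr_gt0 x1.
  pose g (y : R) : R := q.[y] * ((1 - y ^+ 2)^-1) ^+ k * expR (- (1 - y ^+ 2)^-1).
  suff dg : is_derive x (1 : R) g (bump_fun (bump_dpoly q k) k.+2 x).
    apply: near_eq_is_derive dg; near=> y.
    have y1 : `|y| < 1 by near: y; apply: (@cvgr_lt _ _ _ _ (fun y : R => `|y|) `|x|) => //; apply: cvg_norm; exact: cvg_id.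
    by rewrite /g /bump_fun y1 exprVn.
  pose v (y : R) : R := (1 - y ^+ 2)^-1.
  have dw : is_derive x (1 : R) (fun y : R => 1 - y ^+ 2) (- (2 * x)).
    by apply: is_derive_eq; rewrite /GRing.scale/=; ring.
  have dv : is_derive x (1 : R) v (2 * x * v x ^+ 2).
    have d := @is_deriveV R (fun y : R => 1 - y ^+ 2) x _ 1 (lt0r_neq0 w0) dw.
    by apply: (is_derive_eq d); rewrite /GRing.scale/= /v exprVn; ring.
  have dk : is_derive x (1 : R) (fun y => v y ^+ k) (k%:R * (2 * x) * v x ^+ k.+1).
    elim: (k) => [|j IHj].
      by under eq_fun do rewrite expr0; rewrite !mul0r; exact: is_derive_cst.
    under eq_fun do rewrite exprS; apply: is_derive_eq.
    by rewrite /GRing.scale/= -natr1 !exprS; ring.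
  have de : is_derive x (1 : R) (fun y => expR (- v y)) (- (2 * x * v x ^+ 2) * expR (- v x)).
    by apply: is_derive_eq; rewrite /GRing.scale/=; ring.
  have dq : is_derive x (1 : R) (horner q) (q^`()).[x] by exact: is_derive_poly.
  have -> : g = fun y => (horner q y * v y ^+ k) * expR (- v y) by [].
  apply: is_derive_eq; rewrite /GRing.scale/=.
  rewrite /bump_fun x1 /bump_dpoly !hornerE /= -exprVn -/(v x).
  have vw : 1 - x ^+ 2 = (v x)^-1 by rewrite /v invrK.
  have v0 : v x != 0 by rewrite invr_neq0// lt0r_neq0.
  rewrite vw !exprS.
  by move: (v x ^+ k) (expR _) => a b; field.
(* At |x| >= 1 the function is O((y - x)^2), hence has derivative 0: with w = 1 - y^2 one has w <= 2
   |y - x|, and exp(- 1 / w) <= (k + 2)! w^(k + 2) leaves w^2 after division by w^k. *)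
- have -> : bump_fun (bump_dpoly q k) k.+2 x = 0 by rewrite /bump_fun ltNge x1.
  have [C [C0 qC]] := horner_bounded q.
  apply: (@is_derive_square_bound _ _ (C * (k.+2)`!%:R * 4)); first by rewrite /bump_fun ltNge x1.
  move=> y; rewrite /bump_fun; case: ltP => y1; last first.
    by rewrite normr0; apply: mulr_ge0; [do 2 apply: mulr_ge0 => //|exact: sqr_ge0].
  have w0 := onem_sqr_gt0 y1; have wk : 0 < (1 - y ^+ 2) ^+ k by exact: exprn_gt0.
  have wle : 1 - y ^+ 2 <= 2 * `|y - x|.
    have h1 : `|x| - `|y| <= `|y - x| by rewrite distrC; exact: lerB_dist.
    by rewrite -real_normK ?num_real//; have := normr_ge0 y; nra.
  rewrite 2!normrM normfV (gtr0_norm wk) (gtr0_norm (expR_gt0 _)).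
  have h := expRN_inv_le k.+1 w0.
  apply: (@le_trans _ _ (C / (1 - y ^+ 2) ^+ k * ((k.+2)`!%:R * (1 - y ^+ 2) ^+ k.+2))).
    apply: ler_pM => //; first by rewrite divr_ge0// ltW.
    by rewrite ler_wpM2r ?invr_ge0 ?(ltW wk)// qC// ltW.
  have -> : C / (1 - y ^+ 2) ^+ k * ((k.+2)`!%:R * (1 - y ^+ 2) ^+ k.+2) = C * (k.+2)`!%:R * (1 - y ^+ 2) ^+ 2.
    move: ((k.+2)`!%:R : R) (1 - y ^+ 2) (lt0r_neq0 w0) => f w wn0.
    have wkn0 : w ^+ k != 0 by rewrite expf_neq0.
    by rewrite (exprS w k.+1) (exprS w k); field.
  rewrite -(mulrA (C * _) 4) ler_wpM2l//; first exact: mulr_ge0.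
  have -> : 4 * (y - x) ^+ 2 = (2 * `|y - x|) ^+ 2 by rewrite exprMn real_normK ?num_real//; ring.
  by rewrite ler_sqr ?nnegrE// ltW.
Unshelve. all: by end_near. Qed.

Lemma bump_fun_continuous q k : continuous (bump_fun q k).
Proof. exact: is_derive_continuous (is_derive_bump_fun q k). Qed.

Lemma bump_fun_ge0 x : 0 <= bump_fun 1 0 x.
Proof. by rewrite /bump_fun; case: ifP => // _; rewrite hornerC divr1 mul1r expR_ge0. Qed.

Definition bump_mass (c e : R) : R := \int[mu]_y bump_fun 1 0 ((y - c) / e).
Definition mollifier (c e y : R) : R := (bump_mass c e)^-1 * bump_fun 1 0 ((y - c) / e).

Section mollifier.
Variables (c e : R).
Hypothesis e0 : 0 < e.

Lemma bump_shift_eq0 q k y : e <= `|y - c| -> bump_fun q k ((y - c) / e) = 0.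
Proof.
move=> h; rewrite /bump_fun ifF//; apply/negbTE; rewrite -leNgt normrM normfV (gtr0_norm e0).
by rewrite ler_pdivlMr// mul1r.
Qed.

Lemma bump_shift_continuous q k : continuous (fun y => bump_fun q k ((y - c) / e)).
Proof.
move=> y; apply: (@continuous_comp _ _ _ (fun y => (y - c) / e) (bump_fun q k)); last exact: bump_fun_continuous.
by apply: cvgM; [apply: cvgB; [exact: cvg_id|exact: cvg_cst]|exact: cvg_cst].
Qed.

Lemma integrable_compact_support (f : R -> R) (A : R) : continuous f -> (forall y, A < `|y| -> f y = 0) ->
  mu.-integrable setT (EFin \o f).
Proof.
move=> cf f0; have := continuous_itv_integrable (- A) A cf.
rewrite integrable_mkcond//; apply: eq_integrable => // y _ /=.
rewrite patchE; case: ifPn => //; rewrite notin_setE/= in_itv/= -ler_norml => /negP.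
by rewrite -ltNge => /f0 ->.
Qed.

Lemma mollifier_support y : e <= `|y - c| -> mollifier c e y = 0.
Proof. by move=> h; rewrite /mollifier bump_shift_eq0// mulr0. Qed.

Lemma mollifier_continuous : continuous (mollifier c e).
Proof. by move=> y; apply: cvgM; [exact: cvg_cst|exact: bump_shift_continuous]. Qed.

Lemma mollifier_compact y : `|c| + e < `|y| -> mollifier c e y = 0.
Proof.
move=> h; apply: mollifier_support; have := lerB_dist y c; lra.
Qed.

Lemma bump_mass_gt0 : 0 < bump_mass c e.
Proof.
have cb := @bump_shift_continuous 1 0.
have ib : mu.-integrable setT (EFin \o (fun y => bump_fun 1 0 ((y - c) / e))).
  apply: (@integrable_compact_support _ (`|c| + e)) => // y h; apply: bump_shift_eq0.
  have := lerB_dist y c; lra.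
pose d := expR (- (3 / 4)^-1) : R.
have d0 : 0 < d by exact: expR_gt0.
apply: (@lt_le_trans _ _ (d * e)); first exact: mulr_gt0.
rewrite -lee_fin /bump_mass /Rintegral fineK; last exact: integrable_fin_num.
have -> : (d * e)%:E = (\int[mu]_(y in `[(c - e / 2)%R, (c + e / 2)%R]) (cst d%:E y))%E.
  rewrite integral_cst//= lebesgue_measure_itv/= ifT.
    by rewrite -EFinM; congr (_ * _)%:E; field.
  by rewrite lte_fin ltrD2l (@lt_trans _ _ 0)// ?oppr_lt0 divr_gt0.
rewrite [leLHS]integral_mkcond; apply: ge0_le_integral => //.
- by move=> y _; rewrite erestrict_ge0// => z _; rewrite lee_fin ltW.
- by apply/(measurable_restrictT _ _).1 => //; exact: measurable_cst.
- by apply/measurable_EFinP; exact: continuous_mfun.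
- move=> y _; rewrite patchE; case: ifPn => [|_]; last by rewrite lee_fin bump_fun_ge0.
  rewrite inE/= in_itv/= => /andP[y1 y2]; rewrite lee_fin /bump_fun.
  have z1 : `|(y - c) / e| <= 2^-1.
    by rewrite normrM normfV (gtr0_norm e0) ler_pdivrMr// ler_norml; lra.
  have z2 : ((y - c) / e) ^+ 2 <= 4^-1.
    rewrite -real_normK ?num_real//; apply: (@le_trans _ _ (2^-1 ^+ 2)); last by rewrite exprVn; lra.
    by rewrite ler_sqr ?nnegrE.
  rewrite ifT; last by apply: le_lt_trans z1 _; lra.
  rewrite hornerC divr1 mul1r ler_expR lerN2 lef_pV2 ?posrE; lra.
Qed.

Lemma mollifier_ge0 y : 0 <= mollifier c e y.
Proof. by rewrite mulr_ge0 ?bump_fun_ge0// invr_ge0 ltW// bump_mass_gt0. Qed.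

Lemma mollifierM_integrable (g : R -> R) : continuous g ->
  mu.-integrable setT (EFin \o (fun y => g y * mollifier c e y)).
Proof.
move=> cg; apply: (@integrable_compact_support _ (`|c| + e)).
  by move=> y; apply: cvgM; [exact: cg|exact: mollifier_continuous].
by move=> y h; rewrite mollifier_compact// mulr0.
Qed.

Lemma mollifier_integral : \int[mu]_y mollifier c e y = 1.
Proof.
rewrite /mollifier RintegralZl//; first by rewrite mulVf// gt_eqF// bump_mass_gt0.
apply: (@integrable_compact_support _ (`|c| + e)); first exact: bump_shift_continuous.
move=> y h; apply: bump_shift_eq0; have := lerB_dist y c; lra.
Qed.

Lemma mollifier_integrable : mu.-integrable setT (EFin \o mollifier c e).
Proof.
have := @mollifierM_integrable (cst 1) (@cst_continuous _ _ _).
by apply: eq_integrable => // y _ /=; rewrite mul1r.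
Qed.

Lemma mollifier_average (g : R -> R) (v d : R) : continuous g ->
  (forall y, `|y - c| <= e -> `|g y - v| <= d) ->
  `|\int[mu]_y (g y * mollifier c e y) - v| <= d.
Proof.
move=> cg gv.
have -> : \int[mu]_y (g y * mollifier c e y) - v = \int[mu]_y ((g y - v) * mollifier c e y).
{ rewrite -[X in _ - X]mulr1 -mollifier_integral -RintegralZl//; last exact: mollifier_integrable.
  rewrite -RintegralB//; [|exact: mollifierM_integrable|].
    by apply: eq_Rintegral => y _; rewrite mulrBl.
  by have := @mollifierM_integrable (cst v) (@cst_continuous _ _ _). }
have cgv : continuous (fun y => g y - v) by move=> y; apply: cvgB; [exact: cg|exact: cvg_cst].
have igv := mollifierM_integrable cgv.
apply: (le_trans (le_normr_Rintegral measurableT igv)).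
rewrite -[leRHS]mulr1 -mollifier_integral -RintegralZl//; last exact: mollifier_integrable.
apply: le_Rintegral => //.
- by have := integrable_abse igv; apply: eq_integrable => // y _.
- by have := @mollifierM_integrable (cst d) (@cst_continuous _ _ _).
- move=> y _; rewrite normrM (ger0_norm (mollifier_ge0 _)).
  have [yc|yc] := leP `|y - c| e; first by rewrite ler_wpM2r ?mollifier_ge0// gv.
  by rewrite mollifier_support ?mulr0// ltW.
Qed.

End mollifier.

End bump_family.

Section complex_derivative.
Context (R : realType).
Notation C := (Rcomplex R).

Lemma is_derive_cvgP (V : normedModType R) (f : R -> V) (x : R) (df : V) :
  (fun h : R => h^-1 *: (f (h *: 1 + x) - f x)) @ 0^' --> df -> is_derive x (1 : R) f df.
Proof.
move=> h; apply: DeriveDef; first by apply/cvg_ex; exists df; exact: h.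
exact: cvg_lim h.
Qed.

Lemma is_derive_cvg (V : normedModType R) (f : R -> V) (x : R) (df : V) :
  is_derive x (1 : R) f df -> (fun h : R => h^-1 *: (f (h *: 1 + x) - f x)) @ 0^' --> df.
Proof. by case=> /cvg_ex[l hl] <-; rewrite /derive (cvg_lim _ hl). Qed.

Lemma is_derive_scale (g : R -> R) (dg : R) (z : C) (x : R) :
  is_derive x (1 : R) g dg -> is_derive x (1 : R) (fun y => g y *: z) (dg *: z).
Proof.
move=> /is_derive_cvg dgx; apply: is_derive_cvgP.
under eq_fun do rewrite -scalerBl scalerA.
exact: cvgZr_tmp dgx.
Qed.

Lemma is_derive_csum (n : nat) (f : nat -> R -> C) (df : nat -> C) (x : R) :
  (forall k, is_derive x (1 : R) (f k) (df k)) ->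
  is_derive x (1 : R) (fun y => \sum_(k < n) f k y) (\sum_(k < n) df k).
Proof.
move=> fd; elim: n => [|n IHn].
  by under eq_fun do rewrite big_ord0; rewrite big_ord0; exact: is_derive_cst.
by under eq_fun do rewrite big_ord_recr/=; rewrite big_ord_recr/=; exact: is_deriveD.
Qed.

Lemma partZ b (a : R) (z : C) : part b (a *: z) = a * part b z.
Proof. by case: z; case: b. Qed.

Lemma is_derive_part b (u : R -> C) (du : C) (x : R) :
  is_derive x (1 : R) u du -> is_derive x (1 : R) (fun y => part b (u y)) (part b du).
Proof.
move=> /is_derive_cvg dux; apply: is_derive_cvgP.
rewrite (_ : (fun h => _) = part b \o (fun h : R => h^-1 *: (u (h *: 1 + x) - u x))); last first.
  by apply/funext => h /=; rewrite partZ partB.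
by apply: cvg_comp dux _; exact: part_continuous.
Qed.

Lemma derivable_is_derive1 (f : R -> C) (x : R) : derivable f x 1 -> is_derive x (1 : R) f ((f^`())%classic x).
Proof. by move=> df; rewrite derive1E; exact: derivableP. Qed.

Lemma is_derive1_eq (f df : R -> C) : (forall x : R, is_derive x (1 : R) f (df x)) -> (f^`() = df)%classic.
Proof. by move=> h; apply/funext => x; rewrite derive1E; case: (h x). Qed.

End complex_derivative.

Section test_functions.
Context (R : realType).
Notation C := (Rcomplex R).
Variables (N : nat) (c : nat -> R) (e : R) (z : nat -> C).
Hypothesis e0 : 0 < e.

Definition bump_comb (q : {poly R}) (k : nat) (s : nat -> R) (y : R) : C :=
  \sum_(i < N) (s i * bump_fun q k ((y - c i) / e)) *: z i.

Lemma is_derive_bump_comb q k s (y : R) :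
  is_derive y (1 : R) (bump_comb q k s) (bump_comb (bump_dpoly q k) k.+2 (fun i => s i / e) y).
Proof.
apply: (@is_derive_csum R N (fun i y => (s i * bump_fun q k ((y - c i) / e)) *: z i)
  (fun i => (s i / e * bump_fun (bump_dpoly q k) k.+2 ((y - c i) / e)) *: z i)) => i.
apply: is_derive_scale.
have d1 : is_derive y (1 : R) (fun y => (y - c i) / e) e^-1.
  by apply: is_derive_eq; rewrite /GRing.scale/=; ring.
have d2 := @is_derive1_comp R (bump_fun q k) (fun y => (y - c i) / e) y _ _ (is_derive_bump_fun q k ((y - c i) / e)) d1.
have d3 : is_derive y (1 : R) (fun y => bump_fun q k ((y - c i) / e)) (bump_fun (bump_dpoly q k) k.+2 ((y - c i) / e) * e^-1).
  exact: d2.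
by apply: is_derive_eq; rewrite /GRing.scale/=; ring.
Qed.

(** A smooth approximation of the sum of the masses z_i at the points c_i. The Ornstein-Uhlenbeck
    measure is specified through test functions, whereas the convergence theorem asks for the joint
    law of point values. *)
Definition moll_comb (y : R) : C := \sum_(i < N) mollifier (c i) e y *: z i.

Lemma moll_comb_test : test_function moll_comb.
Proof.
have E : moll_comb = bump_comb 1 0 (fun i => (bump_mass (c i) e)^-1) by [].
split.
- move=> n x; have [q [k [s ->]]] : exists q k s, derive1n n moll_comb = bump_comb q k s.
    elim: n => [|n [q [k [s IHn]]]]; first by exists 1, 0%N, (fun i => (bump_mass (c i) e)^-1).
    exists (bump_dpoly q k), k.+2, (fun i => s i / e); rewrite derive1nS IHn.
    by apply: is_derive1_eq; exact: is_derive_bump_comb.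
  by case: (is_derive_bump_comb q k s x).
- pose A := \sum_(i < N) `|c i| + e.
  apply: (@subclosed_compact _ _ `[- A, A]%classic); [exact: closed_closure|exact: segment_compact|].
  have cE : `[- A, A]%classic = closure `[- A, A]%classic by apply/closure_id; exact: itv_closed.
  rewrite cE.
  apply: closureS => y /=; rewrite in_itv/= -ler_norml => fy; rewrite leNgt; apply/negP => Ay.
  move/negP: fy; apply; apply/eqP; apply: big1 => i _.
  rewrite mollifier_compact ?scale0r//; apply: le_lt_trans Ay; rewrite lerD2r.
  by rewrite (bigD1 i)//= lerDl sumr_ge0.
Qed.

End test_functions.

(** * The Green function of the line and the resolvent *)

Section line_green_function.
Context (R : realType) (alpha : R).
Hypothesis alpha0 : 0 < alpha.
Notation mu := (@lebesgue_measure R).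
Notation ka := (mass_par alpha).
Notation K := (line_cov alpha).

Let k0 : 0 < ka := mass_par_gt0 alpha0.

Lemma expRN_lip (a b : R) : 0 <= a -> 0 <= b -> `|expR (- a) - expR (- b)| <= `|a - b|.
Proof.
wlog ab : a b / a <= b.
  move=> H a0 b0; have [ab|/ltW ba] := leP a b; first exact: H.
  by rewrite distrC (distrC a); exact: H.
move=> a0 b0; rewrite ger0_norm ?subr_ge0 ?ler_expR ?lerN2// distrC ger0_norm ?subr_ge0//.
have -> : expR (- a) - expR (- b) = expR (- a) * (1 - expR (- (b - a))).
  by rewrite mulrBr mulr1 -expRD; congr (_ - expR _); ring.
rewrite -[leRHS]mul1r ler_pM ?expR_ge0//.
- by rewrite subr_ge0 -expR0 ler_expR oppr_le0 subr_ge0.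
- by rewrite -expR0 ler_expR oppr_le0.
- by have := expR_ge1Dx (- (b - a)); lra.
Qed.

Lemma line_cov_lip x y : `|K x - K y| <= `|x - y| / 2.
Proof.
rewrite /line_cov -mulrBl normrM normfV (gtr0_norm (mulr_gt0 (ltr0Sn R 1) k0)) ler_pdivrMr ?mulr_gt0//.
have -> : `|x - y| / 2 * (2 * ka) = ka * `|x - y| by field.
apply: (le_trans (expRN_lip (mulr_ge0 (ltW k0) (normr_ge0 _)) (mulr_ge0 (ltW k0) (normr_ge0 _)))).
rewrite -mulrBr normrM (gtr0_norm k0) ler_pM2l//.
by have h1 := lerB_dist x y; have := lerB_dist y x; rewrite (distrC y) ler_norml; lra.
Qed.

Lemma line_cov_continuous : continuous K.
Proof.
move=> x; apply/cvgrPdist_le => e e1; near=> y; apply: (le_trans (line_cov_lip _ _)).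
rewrite ler_pdivrMr//; near: y; apply: cvgr_dist_le; [exact: cvg_id|by rewrite mulr_gt0].
Unshelve. all: by end_near. Qed.

Lemma line_cov_shift_continuous x : continuous (fun y => K (x - y)).
Proof.
move=> y; apply: (@continuous_comp _ _ _ (fun y => x - y) K); last exact: line_cov_continuous.
by apply: cvgB; [exact: cvg_cst|exact: cvg_id].
Qed.

Variables (c e : R).
Hypothesis e0 : 0 < e.
Notation eta := (mollifier c e).

(** The Green function convolved with a mollifier; it solves alpha u - u'' = [eta] and is one term
    of the resolvent of a test function [moll_comb]. *)
Definition green (x : R) : R := \int[mu]_y (K (x - y) * eta y).

Let gp (s x : R) : R := \int[mu]_(y in `]-oo, x]) (expR (s * y) * eta y).

Let igp s : mu.-integrable setT (EFin \o (fun y => expR (s * y) * eta y)).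
Proof.
apply: mollifierM_integrable => // y; apply: continuous_comp; last exact: continuous_expR.
exact: mulrl_continuous.
Qed.

Let is_derive_gp s (x : R) : is_derive x (1 : R) (gp s) (expR (s * x) * eta x).
Proof.
have [||||d dE] := @continuous_FTC1 R (fun y => expR (s * y) * eta y) -oo%O x (x + 1).
- by rewrite ltrDl.
- exact: integrableS (igp s).
- by rewrite ltNyr.
- apply: cvgM; last exact: mollifier_continuous.
  by apply: continuous_comp; [exact: mulrl_continuous|exact: continuous_expR].
by rewrite -dE derive1E; exact: derivableP.
Qed.

Let tot : R := \int[mu]_y (expR (- ka * y) * eta y).

(** On either side of x the kernel factors into an exponential in x and one in y, so that
    differentiation reduces to the fundamental theorem of calculus for [gp]. *)
Let greenE x : green x = (2 * ka)^-1 * (expR (- ka * x) * gp ka x + expR (ka * x) * (tot - gp (- ka) x)).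
Proof.
have iK : mu.-integrable setT (EFin \o (fun y => K (x - y) * eta y)).
  by apply: mollifierM_integrable => //; exact: line_cov_shift_continuous.
have T : [set` `]-oo, +oo[] = [set: R] by apply/seteqP; split => // y _; rewrite /= in_itv.
have split_ (f : R -> R) : mu.-integrable setT (EFin \o f) ->
  \int[mu]_y f y - \int[mu]_(y in `]-oo, x]) f y = \int[mu]_(y in `]x, +oo[) f y.
  by move=> intf; rewrite -T; apply: Rintegral_itvB; rewrite ?T// ltNyr.
rewrite /green -[LHS](subrK (\int[mu]_(y in `]-oo, x]) (K (x - y) * eta y))) split_//.
rewrite /tot split_; last exact: igp.
have -> : \int[mu]_(y in `]-oo, x]) (K (x - y) * eta y) = (2 * ka)^-1 * expR (- ka * x) * gp ka x.
{ rewrite /gp -RintegralZl//; last exact: integrableS (igp ka).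
  apply: eq_Rintegral => y; rewrite inE/= in_itv/= => yx.
  rewrite /line_cov ger0_norm ?subr_ge0// mulrA; congr (_ * _); rewrite mulrC -mulrA -expRD.
  by congr (_ * expR _); ring. }
have -> : \int[mu]_(y in `]x, +oo[) (K (x - y) * eta y) = (2 * ka)^-1 * expR (ka * x) * \int[mu]_(y in `]x, +oo[) (expR (- ka * y) * eta y).
{ rewrite -RintegralZl//; last exact: integrableS (igp (- ka)).
  apply: eq_Rintegral => y; rewrite inE/= in_itv/= andbT => yx.
  rewrite /line_cov distrC gtr0_norm ?subr_gt0// mulrA; congr (_ * _); rewrite mulrC -mulrA -expRD.
  by congr (_ * expR _); ring. }
by ring.
Qed.

Definition dgreen (x : R) : R := 2^-1 * (- expR (- ka * x) * gp ka x + expR (ka * x) * (tot - gp (- ka) x)).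

Let dexp (s x : R) : is_derive x (1 : R) (fun x => expR (s * x)) (s * expR (s * x)).
Proof. by apply: is_derive_eq; rewrite /GRing.scale/=; ring. Qed.

Lemma is_derive_green (x : R) : is_derive x (1 : R) green (dgreen x).
Proof.
have -> : green = fun x => (2 * ka)^-1 * (expR (- ka * x) * gp ka x + expR (ka * x) * (tot - gp (- ka) x)).
  by apply/funext => y; exact: greenE.
have d1 := dexp ka x; have d2 := dexp (- ka) x; have d3 := is_derive_gp ka x; have d4 := is_derive_gp (- ka) x.
apply: is_derive_eq; rewrite /GRing.scale/= /dgreen.
have E : expR (ka * x) * expR (- ka * x) = 1 by rewrite -expRD mulNr subrr expR0.
move: E; move: (expR (ka * x)) (expR (- ka * x)) => A B AB.
move: (gp ka x) (gp (- ka) x) (eta x) tot => G H h t.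
apply/eqP; rewrite -subr_eq0; apply/eqP; transitivity ((2 * ka)^-1 * h * (A * B - A * B)); last by ring.
by field; rewrite gt_eqF.
Qed.

Lemma is_derive_dgreen (x : R) : is_derive x (1 : R) dgreen (alpha * green x - eta x).
Proof.
suff : is_derive x (1 : R) dgreen (ka ^+ 2 * green x - eta x) by rewrite mass_par2.
have d1 := dexp ka x; have d2 := dexp (- ka) x; have d3 := is_derive_gp ka x; have d4 := is_derive_gp (- ka) x.
apply: is_derive_eq; rewrite /GRing.scale/= greenE.
have E : expR (ka * x) * expR (- ka * x) = 1 by rewrite -expRD mulNr subrr expR0.
move: E; move: (expR (ka * x)) (expR (- ka * x)) => A B AB.
move: (gp ka x) (gp (- ka) x) (eta x) tot => G H h t.
apply/eqP; rewrite -subr_eq0; apply/eqP; transitivity (h * (1 - A * B)); last by rewrite AB subrr mulr0.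
by field; rewrite gt_eqF.
Qed.

Lemma green_close x : `|green x - K (x - c)| <= e / 2.
Proof.
apply: mollifier_average => //.
  exact: line_cov_shift_continuous.
move=> y yc; apply: (le_trans (line_cov_lip _ _)); rewrite ler_pM2r//.
by apply: le_trans yc; rewrite opprB addrC addrA subrK distrC.
Qed.

Lemma green_continuous : continuous green.
Proof. exact: is_derive_continuous is_derive_green. Qed.

Lemma green_decay : exists2 B, 0 <= B & forall x, `|green x| <= B * expR (- (ka * `|x|)).
Proof.
exists ((2 * ka)^-1 * expR (ka * (`|c| + e))); first by rewrite mulr_ge0 ?expR_ge0// invr_ge0 mulr_ge0// ltW.
move=> x; rewrite -[green x]subr0; apply: mollifier_average => //.
  exact: line_cov_shift_continuous.
move=> y yc; rewrite subr0 /line_cov ger0_norm; last by rewrite divr_ge0 ?expR_ge0// mulr_ge0// ltW.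
rewrite mulrC -mulrA ler_pM2l ?invr_gt0 ?mulr_gt0// -expRD ler_expR -mulrBr -mulrN ler_pM2l//.
have h1 : `|y| <= `|c| + e by rewrite -[y](subrK c) addrC; apply: (le_trans (ler_normD _ _)); rewrite lerD2l.
have h2 := lerB_dist x y; lra.
Qed.

End line_green_function.

Section exponential_integrability.
Context (R : realType).
Notation mu := (@lebesgue_measure R).

Lemma integral_exp_abs_fin (s : R) : 0 < s -> (\int[mu]_x (expR (- (s * `|x|)))%:E < +oo)%E.
Proof.
move=> s0; rewrite ge0_symfun_integralT.
- have -> : (\int[mu]_(x in [set x | (0 <= x)%R]) (expR (- (s * `|x|)))%:E =
     \int[mu]_(x in `[0%R, +oo[) (expR (- s * x))%:E)%E.
    by rewrite -set_itvcy; apply: eq_integral => x; rewrite inE/= in_itv/= andbT => x0; rewrite ger0_norm// mulNr.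
  have dF (x : R) : is_derive x (1 : R) (fun x => - (s^-1 * expR (- s * x))) (expR (- s * x)).
    by apply: is_derive_eq; rewrite /GRing.scale/=; field; rewrite gt_eqF.
  have cf : continuous (fun x : R => expR (- s * x)).
    by move=> x; apply: continuous_comp; [exact: mulrl_continuous|exact: continuous_expR].
  have lim0 : - (s^-1 * expR (- s * x)) @[x --> +oo] --> (0 : R).
  { apply/cvgrPdist_le => e e0; near=> x; rewrite sub0r opprK ger0_norm ?mulr_ge0 ?expR_ge0 ?invr_ge0 ?(ltW s0)//.
    rewrite ler_pdivrMl// mulNr expRN invf_ple ?posrE ?expR_gt0 ?mulr_gt0//.
    apply: le_trans (expR_ge1Dx _); rewrite (@le_trans _ _ (s * x))// ?lerDr//.
    by rewrite -ler_pdivrMl//; near: x; apply: nbhs_pinfty_ge; exact: num_real. }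
  rewrite (ge0_continuous_FTC2y _ _ lim0).
  + by rewrite -EFinB -EFinM ltry.
  + by move=> x _; exact: expR_ge0.
  + exact: continuous_subspaceT.
  + by move=> x _; case: (dF x).
  + by apply: cvg_at_right_filter; exact: (is_derive_continuous dF).
  + by move=> x _; rewrite derive1E; case: (dF x).
- by move=> x; exact: expR_ge0.
- move=> x; apply: (@continuous_comp _ _ _ (fun x => - (s * `|x|)) expR); last exact: continuous_expR.
  by apply: cvgN; apply: cvgM; [exact: cvg_cst|exact: norm_continuous].
- by move=> x /=; rewrite normrN.
Unshelve. all: by end_near. Qed.

End exponential_integrability.

Section resolvent_uniqueness.
Context (R : realType) (alpha : R).
Hypothesis alpha0 : 0 < alpha.
Notation mu := (@lebesgue_measure R).
Notation C := (Rcomplex R).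

Lemma nonneg_integral_unbounded (v : R -> R) (A : set R) (d : R) : measurable A -> mu A = +oo%E ->
  measurable_fun setT v -> (forall x, 0 <= v x) -> 0 < d -> (forall x, A x -> d <= v x) ->
  (\int[mu]_x (v x)%:E = +oo)%E.
Proof.
move=> mA Ay mv v0 d0 vd; apply/eqP; rewrite -leye_eq.
have -> : +oo%E = (\int[mu]_(x in A) (cst d%:E x))%E.
  by rewrite integral_cst// [X in (_ * X)%E]Ay gt0_muley// lte_fin.
rewrite [leLHS]integral_mkcond; apply: ge0_le_integral => //.
- by move=> y _; rewrite erestrict_ge0// => z _; rewrite lee_fin ltW.
- by apply/(measurable_restrictT _ _).1 => //; exact: measurable_cst.
- exact/measurable_EFinP.
- move=> y _; rewrite patchE; case: ifPn => [|_]; last by rewrite lee_fin.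
  by rewrite inE => yA; rewrite lee_fin vd.
Qed.

Lemma ray_measure_ge (x : R) : mu `[x, +oo[%classic = +oo%E.
Proof. by rewrite lebesgue_measure_itv/= ltry. Qed.

Lemma ray_measure_le (x : R) : mu `]-oo, x]%classic = +oo%E.
Proof. by rewrite lebesgue_measure_itv/= ltNyr. Qed.

(* [d^2] is convex, so an integrable square forces [d = 0]. *)
Lemma homogeneous_resolvent (d d1 : R -> R) : (forall x : R, is_derive x (1 : R) d (d1 x)) ->
  (forall x : R, is_derive x (1 : R) d1 (alpha * d x)) ->
  (\int[mu]_x (d x ^+ 2)%:E < +oo)%E -> forall x, d x = 0.
Proof.
move=> dd dd1 fin x; apply/eqP; apply: contraT => dx.
pose v (x : R) := d x ^+ 2; pose w (x : R) := 2 * d x * d1 x.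
have dv (y : R) : is_derive y (1 : R) v (w y).
  by have h := dd y; apply: is_derive_eq; rewrite /GRing.scale/= /w; ring.
have dw (y : R) : is_derive y (1 : R) w (2 * d1 y ^+ 2 + 2 * alpha * d y ^+ 2).
  by have h := dd y; have h1 := dd1 y; apply: is_derive_eq; rewrite /GRing.scale/=; ring.
have w2 (y : R) : 0 <= 2 * d1 y ^+ 2 + 2 * alpha * d y ^+ 2.
  by rewrite addr_ge0// mulr_ge0 ?sqr_ge0// mulr_ge0// ltW.
have mono a b : a <= b -> w a <= w b by move=> ab; exact: (ge0_derive_homo dw).
have v0 : 0 < v x by rewrite exprn_even_gt0.
have mv : measurable_fun setT v by apply: continuous_mfun; exact: is_derive_continuous dv.
suff : (\int[mu]_x (v x)%:E = +oo)%E by move=> h; move: fin; rewrite h ltxx.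
have [w0|w0] := leP 0 (w x).
- apply: (nonneg_integral_unbounded (measurable_itv _) (ray_measure_ge x) mv _ v0).
    by move=> y; exact: sqr_ge0.
  move=> y /=; rewrite in_itv/= andbT => xy; apply: (ge0_derive_homo dv) => // z /andP[xz _].
  exact: le_trans w0 (mono _ _ xz).
- apply: (nonneg_integral_unbounded (measurable_itv _) (ray_measure_le x) mv _ v0).
    by move=> y; exact: sqr_ge0.
  move=> y /=; rewrite in_itv/= => yx; rewrite -lerN2.
  have dNv (z : R) : is_derive z (1 : R) (fun z => - v z) (- w z) by have h := dv z; exact: is_deriveN.
  apply: (ge0_derive_homo dNv) => // z /andP[_ zx]; rewrite oppr_ge0.
  exact: le_trans (mono _ _ zx) (ltW w0).
Qed.

Definition resolvent_set (h : R -> C) : set (R -> C) := [set u : R -> C |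
    [/\ forall x, derivable u x 1,
        forall x, derivable (derive1n 1 u) x 1,
        forall x, alpha *: u x - derive1n 2 u x = h x
      & (\int[mu]_x (`|u x| ^+ 2)%:E < +oo)%E]].

Lemma resolvent_set_derive h u : resolvent_set h u -> forall b,
  (forall x : R, is_derive x (1 : R) (fun y => part b (u y)) (part b ((u^`())%classic x))) /\
  (forall x : R, is_derive x (1 : R) (fun y => part b ((u^`())%classic y)) (alpha * part b (u x) - part b (h x))).
Proof.
move=> [d1 d2 eqn _] b; split => x; first by apply: is_derive_part; exact: derivable_is_derive1.
have dx := derivable_is_derive1 (d2 x); rewrite derive1n1 in dx.
have := is_derive_part b dx; congr is_derive.
rewrite -partZ -partB -eqn opprB addrC subrK.
by rewrite derive1nS derive1n1.
Qed.

Lemma resolvent_set_unique h u u' : resolvent_set h u -> resolvent_set h u' -> u = u'.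
Proof.
move=> su su'; apply/funext => x; apply: C_ext => b; apply/eqP; rewrite -subr_eq0; apply/eqP.
have [du du1] := resolvent_set_derive su b; have [dv dv1] := resolvent_set_derive su' b.
apply: (@homogeneous_resolvent (fun x => part b (u x) - part b (u' x)) (fun x => part b ((u^`())%classic x) - part b ((u'^`())%classic x))).
- move=> y; have h1 := du1 y; have h2 := dv1 y; apply: is_derive_eq; rewrite /GRing.scale/=; ring.
- have [_ _ _ f1] := su; have [_ _ _ f2] := su'.
  have cp (w : R -> C) : resolvent_set h w -> forall b', measurable_fun setT (fun x => part b' (w x)).
    move=> sw b'; have [dw _] := resolvent_set_derive sw b'.
    by apply: continuous_mfun; exact: is_derive_continuous dw.
  have mn (w : R -> C) : resolvent_set h w -> measurable_fun setT (fun x => `|w x| ^+ 2).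
    move=> sw; under eq_fun do rewrite Rcomplex_norm2E.
    by apply: measurable_funD; apply: measurable_funX; [exact: (cp w sw false)|exact: (cp w sw true)].
  apply: (@le_lt_trans _ _ (\int[mu]_x (2%:E * (`|u x| ^+ 2)%:E + 2%:E * (`|u' x| ^+ 2)%:E))%E).
    apply: ge0_le_integral => //.
    + by move=> y _; rewrite lee_fin sqr_ge0.
    + by apply/measurable_EFinP; apply: measurable_funX; apply: measurable_funB; exact: cp.
    + by apply: emeasurable_funD; apply: emeasurable_funM => //; apply/measurable_EFinP; exact: mn.
    + move=> y _; rewrite -!EFinM -EFinD lee_fin.
      have h1 := normr_part_le b (u y); have h2 := normr_part_le b (u' y).
      have e1 : part b (u y) ^+ 2 <= `|u y| ^+ 2 by rewrite -real_normK ?num_real// ler_sqr ?nnegrE.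
      have e2 : part b (u' y) ^+ 2 <= `|u' y| ^+ 2 by rewrite -real_normK ?num_real// ler_sqr ?nnegrE.
      have e3 := sqr_ge0 (part b (u y) + part b (u' y)).
      by move: e3; rewrite sqrrD sqrrB; lra.
  rewrite ge0_integralD//=; last 2 first.
  + by apply: emeasurable_funM => //; apply/measurable_EFinP; exact: mn.
  + by apply: emeasurable_funM => //; apply/measurable_EFinP; exact: mn.
  rewrite !ge0_integralZl//; [|by apply/measurable_EFinP; exact: mn|by apply/measurable_EFinP; exact: mn].
  by apply: lte_add_pinfty; rewrite lte_mul_pinfty.
Qed.

Variables (N : nat) (c : nat -> R) (e : R) (z : nat -> C).
Hypothesis e0 : 0 < e.

Definition green_comb (x : R) : C := \sum_(i < N) green alpha (c i) e x *: (conjc (z i) : C).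
Definition dgreen_comb (x : R) : C := \sum_(i < N) dgreen alpha (c i) e x *: (conjc (z i) : C).

Lemma part_conjc b (w : C) : part b (conjc w) = (if b then -1 else 1) * part b w.
Proof. by case: w => x' y'; case: b => /=; rewrite ?mulN1r ?mul1r. Qed.

Lemma conjc_moll_comb y :
  (conjc (moll_comb N c e z y) : C) = \sum_(i < N) mollifier (c i) e y *: (conjc (z i) : C).
Proof.
apply: C_ext => b.
rewrite part_conjc !part_sum mulr_sumr; apply: eq_bigr => i _.
by rewrite !partZ part_conjc mulrCA.
Qed.

Lemma is_derive_green_comb (x : R) : is_derive x (1 : R) green_comb (dgreen_comb x).
Proof.
apply: (@is_derive_csum R N (fun i y => green alpha (c i) e y *: (conjc (z i) : C))
  (fun i => dgreen alpha (c i) e x *: (conjc (z i) : C))) => i.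
by apply: is_derive_scale; exact: is_derive_green.
Qed.

Lemma is_derive_dgreen_comb (x : R) : is_derive x (1 : R) dgreen_comb
  (\sum_(i < N) (alpha * green alpha (c i) e x - mollifier (c i) e x) *: (conjc (z i) : C)).
Proof.
apply: (@is_derive_csum R N (fun i y => dgreen alpha (c i) e y *: (conjc (z i) : C))
  (fun i => (alpha * green alpha (c i) e x - mollifier (c i) e x) *: (conjc (z i) : C))) => i.
by apply: is_derive_scale; exact: is_derive_dgreen.
Qed.

Lemma green_comb_decay : exists2 B, 0 <= B & forall x, `|green_comb x| <= B * expR (- (mass_par alpha * `|x|)).
Proof.
have /choice[B BP] : forall i, exists B, 0 <= B /\ forall x, `|green alpha (c i) e x| <= B * expR (- (mass_par alpha * `|x|)).
  by move=> i; have [B B0 H] := green_decay alpha0 (c i) e0; exists B.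
exists (\sum_(i < N) B i * `|conjc (z i) : C|).
  by apply: sumr_ge0 => i _; rewrite mulr_ge0//; have [] := BP i.
move=> x; rewrite mulr_suml; apply: (le_trans (ler_norm_sum _ _ _)); apply: ler_sum => i _.
by rewrite Rcomplex_normrZ mulrAC ler_wpM2r//; have [] := BP i.
Qed.

(** [resolvent] picks an element of a set of solutions. Square-integrable solutions being unique,
    one explicit solution with exponential decay determines the choice. *)
Lemma green_comb_resolvent :
  resolvent alpha (fun y => conjc (moll_comb N c e z y)) = green_comb.
Proof.
suff S : resolvent_set (fun y => conjc (moll_comb N c e z y)) green_comb.
  by apply: xget_unique => // u su; exact: resolvent_set_unique su S.
have D1 : (green_comb^`() = dgreen_comb)%classic by apply: is_derive1_eq; exact: is_derive_green_comb.
split.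
- by move=> x; case: (is_derive_green_comb x).
- by move=> x; rewrite derive1n1 D1; case: (is_derive_dgreen_comb x).
- move=> x; rewrite derive1nS derive1n1 D1 (is_derive1_eq is_derive_dgreen_comb) conjc_moll_comb.
  rewrite scaler_sumr -sumrB; apply: eq_bigr => i _.
  by rewrite scalerA -scalerBl; congr (_ *: _); ring.
- have [B B0 uB] := green_comb_decay; have k0 := mass_par_gt0 alpha0.
  have fin := integral_exp_abs_fin (mulr_gt0 (ltr0Sn R 1) k0).
  apply: (@le_lt_trans _ _ (\int[mu]_x ((B ^+ 2)%:E * (expR (- (2 * mass_par alpha * `|x|)))%:E))%E).
    apply: ge0_le_integral => //.
    + apply/measurable_EFinP; under eq_fun do rewrite Rcomplex_norm2E.
      by apply: measurable_funD; apply: measurable_funX; apply: continuous_mfun;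
        [exact: (is_derive_continuous (fun x => is_derive_part false (is_derive_green_comb x)))|
         exact: (is_derive_continuous (fun x => is_derive_part true (is_derive_green_comb x)))].
    + apply: emeasurable_funM => //; apply/measurable_EFinP; apply: continuous_mfun => x.
      apply: (@continuous_comp _ _ _ (fun x => - (2 * mass_par alpha * `|x|)) expR); last exact: continuous_expR.
      by apply: cvgN; apply: cvgM; [exact: cvg_cst|exact: norm_continuous].
    + move=> x _; rewrite -EFinM lee_fin.
      have -> : B ^+ 2 * expR (- (2 * mass_par alpha * `|x|)) = (B * expR (- (mass_par alpha * `|x|))) ^+ 2.
        by rewrite exprMn -expRM_natl; congr (_ * expR _); rewrite -mulrN mulr_natl; ring.
      by rewrite ler_sqr ?nnegrE// mulr_ge0// expR_ge0.
  rewrite ge0_integralZl//; [|apply/measurable_EFinP; apply: continuous_mfun => x|by rewrite lee_fin sqr_ge0].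
    by rewrite lte_mul_pinfty// lee_fin sqr_ge0.
  apply: (@continuous_comp _ _ _ (fun x => - (2 * mass_par alpha * `|x|)) expR); last exact: continuous_expR.
  by apply: cvgN; apply: cvgM; [exact: cvg_cst|exact: norm_continuous].
Qed.

End resolvent_uniqueness.

Section mollified_pairing.
Context (R : realType).
Notation mu := (@lebesgue_measure R).
Notation C := (Rcomplex R).

Lemma Rintegral_bigsum (N : nat) (f : nat -> R -> R) :
  (forall i, mu.-integrable setT (EFin \o f i)) ->
  mu.-integrable setT (EFin \o (fun y => \sum_(i < N) f i y)) /\
  \int[mu]_y (\sum_(i < N) f i y) = \sum_(i < N) \int[mu]_y f i y.
Proof.
move=> fi; elim: N => [|N [iN EN]].
  split; last by rewrite big_ord0 -[RHS](@Rintegral_set0 _ _ _ mu (cst 0)) /Rintegral integral_set0 integral0_eq// => y _; rewrite big_ord0.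
  by apply: (eq_integrable measurableT (cst 0%E)) => [y _ /=|]; [rewrite big_ord0|exact: integrable0].
split.
  by apply: eq_integrable (integrableD measurableT iN (fi N)) => // y _ /=; rewrite big_ord_recr.
rewrite big_ord_recr/= -EN -RintegralD//.
by apply: eq_Rintegral => y _; rewrite big_ord_recr.
Qed.

Lemma part_mul b (w z : C) : part b (w * z) =
  if b then part false w * part true z + part true w * part false z
  else part false w * part false z - part true w * part true z.
Proof. by case: w z => [a b'] [a' b'']; case: b. Qed.

Variables (N : nat) (c : nat -> R) (e : R) (z : nat -> C).
Hypothesis e0 : 0 < e.

Definition parts_continuous (phi : R -> C) := forall b, continuous (fun y => part b (phi y)).

Lemma parts_continuous_mul phi b w : parts_continuous phi -> continuous (fun y => part b (phi y * w)).
Proof.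
move=> cphi y; under eq_fun do rewrite part_mul.
case: b; [apply: cvgD|apply: cvgB]; apply: cvgM; try exact: cvg_cst; exact: cphi.
Qed.

Lemma pairing_mollE b phi : parts_continuous phi ->
  part b (pairing phi (moll_comb N c e z)) = \sum_(i < N) \int[mu]_y (part b (phi y * z i) * mollifier (c i) e y).
Proof.
move=> cphi.
have -> : part b (pairing phi (moll_comb N c e z)) = \int[mu]_y part b (phi y * moll_comb N c e z y) by case: b.
rewrite -(Rintegral_bigsum N (fun i => mollifierM_integrable (c i) e0 (@parts_continuous_mul phi b (z i) cphi))).2.
apply: eq_Rintegral => y _; rewrite /moll_comb mulr_sumr part_sum; apply: eq_bigr => i _.
by rewrite !part_mul !partZ; case: (b); ring.
Qed.

Definition moll_bound : R := \sum_(i < N) 2 * (`|complex.Re (z i)| + `|complex.Im (z i)|).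

Lemma normr_part_mul b (w v : C) : `|part b (w * v)| <= 2 * (`|complex.Re v| + `|complex.Im v|) * `|w|.
Proof.
have h1 := normr_part_le false w; have h2 := normr_part_le true w; have w0 := normr_ge0 w.
have r0 := normr_ge0 (complex.Re v); have i0 := normr_ge0 (complex.Im v).
rewrite part_mul; case: b; (apply: (le_trans (ler_normD _ _)); rewrite ?normrN !normrM /=; rewrite /= in h1 h2; nra).
Qed.

Lemma pairing_moll_close b phi psi d : parts_continuous phi -> parts_continuous psi ->
  (forall y : R, `|y| <= \sum_(i < N) `|c i| + e -> `|phi y - psi y| <= d) ->
  `|part b (pairing phi (moll_comb N c e z)) - part b (pairing psi (moll_comb N c e z))| <= moll_bound * d.
Proof.
move=> cphi cpsi h; rewrite !pairing_mollE// -sumrB /moll_bound mulr_suml.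
apply: (le_trans (ler_norm_sum _ _ _)); apply: ler_sum => i _.
have i1 := mollifierM_integrable (c i) e0 (@parts_continuous_mul phi b (z i) cphi).
have i2 := mollifierM_integrable (c i) e0 (@parts_continuous_mul psi b (z i) cpsi).
rewrite -RintegralB// -[X in `|X|]subr0.
under eq_Rintegral do rewrite -mulrBl.
apply: mollifier_average => //.
  by move=> y; apply: cvgB; exact: parts_continuous_mul.
move=> y yc; rewrite subr0 -partB -mulrBl; apply: (le_trans (normr_part_mul _ _ _)).
rewrite ler_wpM2l//.
apply: h; rewrite -[y](subrK (c i)) addrC; apply: (le_trans (ler_normD _ _)); apply: lerD => //.
by rewrite (bigD1 i)//= lerDl sumr_ge0.
Qed.

Lemma pairing_moll_linear b a phi psi chi : parts_continuous phi -> parts_continuous psi -> parts_continuous chi ->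
  (forall x, chi x = a *: phi x + psi x) ->
  part b (pairing chi (moll_comb N c e z)) = a * part b (pairing phi (moll_comb N c e z)) + part b (pairing psi (moll_comb N c e z)).
Proof.
move=> cphi cpsi cchi h; rewrite !pairing_mollE// mulr_sumr -big_split/=; apply: eq_bigr => i _.
have i1 := mollifierM_integrable (c i) e0 (@parts_continuous_mul phi b (z i) cphi).
have i2 := mollifierM_integrable (c i) e0 (@parts_continuous_mul psi b (z i) cpsi).
rewrite -RintegralZl// -RintegralD//; last by apply: eq_integrable (integrableZl measurableT a i1) => // y _.
apply: eq_Rintegral => y _; rewrite h !part_mul.
have pD b' : part b' (a *: phi y + psi y) = a * part b' (phi y) + part b' (psi y).
  by rewrite -partZ; case: b'; rewrite /= ?Re_add ?Im_add.
by rewrite !pD; case: (b); ring.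
Qed.

End mollified_pairing.

(** * Finite-dimensional laws of the Ornstein-Uhlenbeck measure *)

Section ornstein_uhlenbeck.
Context (R : realType) (alpha : R) (nu : probability (borel (path_space R)) R).
Hypotheses (alpha0 : 0 < alpha) (ou : is_ornstein_uhlenbeck alpha nu).
Notation mu := (@lebesgue_measure R).
Notation C := (Rcomplex R).

Lemma path_parts_continuous (phi : path_space R) : parts_continuous phi.
Proof.
move=> b y; apply: (@continuous_comp _ _ _ (phi : R -> C) (part b)).
  exact: path_continuous.
exact: part_continuous.
Qed.

Lemma green_comb_parts_continuous N c e z : 0 < e -> parts_continuous (green_comb alpha N c e z).
Proof.
by move=> e0 b; apply: (is_derive_continuous (fun x => is_derive_part b (is_derive_green_comb alpha0 N c z e0 x))).
Qed.

Definition green_pair (ci cj e : R) : R := \int[mu]_y (green alpha cj e y * mollifier ci e y).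

Lemma green_pair_close ci cj e : 0 < e -> `|green_pair ci cj e - line_cov alpha (ci - cj)| <= e.
Proof.
move=> e0; apply: mollifier_average => //; first exact: green_continuous.
move=> y yc; have h1 := green_close alpha0 cj e0 y.
have h2 := line_cov_lip alpha0 (y - cj) (ci - cj).
have -> : green alpha cj e y - line_cov alpha (ci - cj) = (green alpha cj e y - line_cov alpha (y - cj)) +
   (line_cov alpha (y - cj) - line_cov alpha (ci - cj)) by ring.
apply: (le_trans (ler_normD _ _)); rewrite [leRHS](splitr e) lerD//.
apply: (le_trans h2); rewrite ler_pM2r//.
by have -> : y - cj - (ci - cj) = y - ci by ring.
Qed.

Lemma ou_moll_gaussian N c e z b : 0 < e ->
  centred_gaussian nu (fun phi : path_space R => part b (pairing phi (moll_comb N c e z))).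
Proof.
move=> e0; have [gau _] := ou; apply: gau.
- move=> phi; have FF : Filter (nbhs phi) by exact: nbhs_filter.
  apply/cvgrPdist_le => d d0.
  have B0 : 0 <= moll_bound N z by apply: sumr_ge0 => i _; rewrite mulr_ge0// addr_ge0.
  have d1 : 0 < d / (moll_bound N z + 1) by rewrite divr_gt0// ltr_wpDl.
  have := path_nbhs_uniform phi (\sum_(i < N) `|c i| + e) d1; apply: filterS => psi h.
  apply: (@le_trans _ _ (moll_bound N z * (d / (moll_bound N z + 1)))).
    apply: pairing_moll_close => //; [exact: path_parts_continuous|exact: path_parts_continuous|].
    by move=> y yA; exact/ltW/h.
  by rewrite mulrCA -[leRHS]mulr1 ler_wpM2l ?(ltW d0)// ler_pdivrMr ?ltr_wpDl// mul1r lerDl.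
- by move=> a phi psi chi h; apply: pairing_moll_linear => //; exact: path_parts_continuous.
Qed.

(** The mean of the square of the complex variable vanishes, so its real and imaginary parts have
    equal variances; the covariance gives their sum. The real part is therefore centred Gaussian
    with half of that variance. *)
Lemma ou_moll_char N c e z c0 : 0 < e ->
  \int[nu]_phi cos (complex.Re (pairing (phi : path_space R) (moll_comb N c e z)) + c0) =
  expR (- (\sum_(i < N) \sum_(j < N) complex.Re (z i * conjc (z j)) * green_pair (c i) (c j) e) / 4) * cos c0.
Proof.
move=> e0; have [_ cov] := ou.
pose l b (phi : path_space R) := part b (pairing phi (moll_comb N c e z)).
have gl b : centred_gaussian nu (l b) by exact: ou_moll_gaussian.
have mom b : exists s, [/\ 0 <= s, forall t c1, \int[nu]_w cos (t * l b w + c1) = expR (- (s * t ^+ 2 / 2)) * cos c1,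
   nu.-integrable setT (fun w => (l b w ^+ 2)%:E) & \int[nu]_w (l b w ^+ 2) = s].
  have [s s0 ch] := centred_gaussian_char (gl b); exists s; have [ml _] := gl b.
  by have [i Es] := gaussian_second_moment ml s0 ch; split.
have [s [s0 ch i0 Es]] := mom false; have [s' [s'0 ch' i1 Es']] := mom true.
have tf := moll_comb_test N c z e0.
have [cov1 cov2] := cov _ _ tf tf.
have E1 : s - s' = 0.
{ rewrite -Es -Es' -RintegralB//; have /(congr1 (@complex.Re R)) := cov2; rewrite /cintegral /= => h; rewrite -[RHS]h.
  apply: eq_Rintegral => w _; rewrite /l /=.
  by rewrite !expr2. }
have E2 : s + s' = \sum_(i < N) \sum_(j < N) complex.Re (z i * conjc (z j)) * green_pair (c i) (c j) e.
{ rewrite -Es -Es' -RintegralD//; have /(congr1 (@complex.Re R)) := cov1; rewrite /cintegral => h.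
  transitivity (complex.Re (pairing (moll_comb N c e z) (resolvent alpha (fun x => conjc (moll_comb N c e z x))))).
    rewrite -h /=; apply: eq_Rintegral => w _; rewrite /l /=.
    by rewrite !expr2 mulrN opprK.
  rewrite (green_comb_resolvent alpha0 N c z e0).
  transitivity (part false (pairing (green_comb alpha N c e z) (moll_comb N c e z))).
    by rewrite /= /pairing/=; apply: eq_Rintegral => y _; rewrite mulrC.
  rewrite pairing_mollE//; last exact: green_comb_parts_continuous.
  apply: eq_bigr => i _.
  have ii (j : nat) : mu.-integrable setT (EFin \o (fun y => complex.Re (z i * conjc (z j)) * (green alpha (c j) e y * mollifier (c i) e y))).
    have i2 := mollifierM_integrable (c i) e0 (green_continuous alpha0 e0 (c := c j)).
    by apply: eq_integrable (integrableZl measurableT (complex.Re (z i * conjc (z j))) i2) => // y _.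
  transitivity (\sum_(j < N) \int[mu]_y (complex.Re (z i * conjc (z j)) * (green alpha (c j) e y * mollifier (c i) e y))).
    rewrite -(Rintegral_bigsum N ii).2; apply: eq_Rintegral => y _.
    rewrite /green_comb part_mul !part_sum !mulr_suml -sumrB mulr_suml; apply: eq_bigr => j _.
    by rewrite !partZ; case: (z i) (z j) => [a b] [a' b'] /=; ring.
  apply: eq_bigr => j _; rewrite RintegralZl//.
  exact: (mollifierM_integrable (c i) e0 (green_continuous alpha0 e0 (c := c j))). }
have Es4 : s * 1 ^+ 2 / 2 = (\sum_(i < N) \sum_(j < N) complex.Re (z i * conjc (z j)) * green_pair (c i) (c j) e) / 4.
  by rewrite -E2; have -> : s' = s by [lra]; field.
have := ch 1 c0; rewrite Es4 mulNr => <-; apply: eq_Rintegral => w _; by rewrite mul1r.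
Qed.

Lemma ou_char N (x t : nat -> R) c0 :
  \int[nu]_phi cos (\sum_(i < N) t i * path_coord x i phi + c0) =
  expR (- (\sum_(i < N) \sum_(j < N) t i * t j * ((odd i == odd j)%:R * line_cov alpha (x i - x j)) / 4)) * cos c0.
Proof.
(* Chosen so that Re (w z_i) is t_i Re w or t_i Im w according to the parity of i; the mollifiers
   then concentrate at the points x_i. *)
pose z i : C := if odd i then Complex 0 (- t i) else Complex (t i) 0.
pose e n : R := n.+1%:R^-1.
have e0 n : 0 < e n by rewrite invr_gt0.
have ec : e n @[n --> \oo] --> (0 : R) by exact: cvg_harmonic.
have zz i j : complex.Re (z i * conjc (z j)) = t i * t j * (odd i == odd j)%:R.
  by rewrite /z; case: (odd i); case: (odd j) => /=; ring.
have zc i (w : C) : complex.Re (w * z i) = t i * part (odd i) w.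
  by rewrite /z; case: w => a b; case: (odd i) => /=; ring.
have L1 : \int[nu]_phi cos (complex.Re (pairing (phi : path_space R) (moll_comb N x (e n) z)) + c0) @[n --> \oo] -->
  \int[nu]_phi cos (\sum_(i < N) t i * path_coord x i phi + c0).
{ apply: (@bounded_cvg _ _ _ nu _ _ 1).
  - move=> n; have [ml _] := ou_moll_gaussian N x z false (e0 n).
    apply: measurableT_comp; first by apply: continuous_mfun; exact: continuous_cos.
    exact: measurable_funD.
  - by move=> n phi; exact: cos_max.
  - move=> phi; apply: continuous_cvg; first exact: continuous_cos.
    apply: cvgD; last exact: cvg_cst.
    have E n : complex.Re (pairing (phi : path_space R) (moll_comb N x (e n) z)) =
      \sum_(i < N) \int[mu]_y (part false (phi y * z i) * mollifier (x i) (e n) y).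
      by rewrite -pairing_mollE//; exact: path_parts_continuous.
    under eq_fun do rewrite E; apply: cvg_sumr => i.
    rewrite /path_coord -zc; apply/cvgrPdist_le => d d0.
    have cg := @parts_continuous_mul R phi false (z i) (@path_parts_continuous phi).
    have /cvgrPdist_le/(_ _ d0)/nbhs_ballP[r /= r0 rP] := cg (x i).
    have /cvgrPdist_lt/(_ _ r0) := ec; apply: filterS => n; rewrite sub0r normrN gtr0_norm// => nr.
    rewrite distrC; apply: mollifier_average => // y yx; rewrite distrC; apply: rP.
    by rewrite -ball_normE/= distrC; exact: le_lt_trans nr. }
have L2 : \int[nu]_phi cos (complex.Re (pairing (phi : path_space R) (moll_comb N x (e n) z)) + c0) @[n --> \oo] -->
  expR (- (\sum_(i < N) \sum_(j < N) t i * t j * ((odd i == odd j)%:R * line_cov alpha (x i - x j)) / 4)) * cos c0.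
{ under eq_fun do rewrite ou_moll_char//.
  apply: cvgM; last exact: cvg_cst.
  apply: continuous_cvg; first exact: continuous_expR.
  have E n : - (\sum_(i < N) \sum_(j < N) complex.Re (z i * conjc (z j)) * green_pair (x i) (x j) (e n)) / 4 =
    - \sum_(i < N) \sum_(j < N) complex.Re (z i * conjc (z j)) * green_pair (x i) (x j) (e n) / 4.
    by rewrite mulNr mulr_suml; congr (- _); apply: eq_bigr => i _; rewrite mulr_suml.
  under eq_fun do rewrite E; apply: cvgN; apply: cvg_sumr => i; apply: cvg_sumr => j.
  apply: cvgM; last exact: cvg_cst.
  rewrite zz mulrA; apply: cvgM; first exact: cvg_cst.
  apply/cvgrPdist_le => d d0; have /cvgrPdist_lt/(_ _ d0) := ec; apply: filterS => n.
  rewrite sub0r normrN gtr0_norm// => nd; rewrite distrC.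
  exact: le_trans (green_pair_close (x i) (x j) (e0 n)) (ltW nd). }
exact: (cvg_unique _ L1 L2).
Qed.

End ornstein_uhlenbeck.

(** * Convergence of stationary Gaussian fields *)

(** Uniform continuity in a form where [y] may leave the segment, as a dyadic point next to a point
    of the segment may lie outside it. *)
Lemma heine (R : realType) (V : normedModType R) (f : R -> V) (a b e : R) : continuous f -> 0 < e ->
  exists2 d, 0 < d & forall x y : R, x \in `[a, b] -> `|x - y| < d -> `|f x - f y| < e.
Proof.
move=> cf e0; pose Q (m : nat) (x : R) := forall y : R, `|x - y| < m.+1%:R^-1 -> `|f x - f y| < e.
have /compact_near_coveringP/(_ nat \oo Q _) : compact (`[a, b]%classic : set R) by exact: segment_compact.
case.
- move=> x _; have e2 : 0 < e / 2 by rewrite divr_gt0.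
  have /cvgrPdist_lt/(_ _ e2)/nbhs_ballP[d /= d0 hd] := cf x.
  have d2 : 0 < d / 2 by rewrite divr_gt0.
  have [N1 _ HN] : \forall m \near \oo, m.+1%:R^-1 < d / 2.
    have /cvgrPdist_lt/(_ _ d2) := @cvg_harmonic R; apply: filterS => m.
    by rewrite sub0r normrN ger0_norm// invr_ge0.
  exists (ball x (d / 2), [set m | (N1 <= m)%N]).
    by split; [exact: nbhsx_ballx|exists N1].
  move=> [x' m] [/= bx Nm] y xy.
  have hm := HN m Nm; have yx := lt_trans xy hm; rewrite -ball_normE/= in bx.
  rewrite -[X in `|X|](subrKA (f x)) [ltRHS]splitr (le_lt_trans (ler_normD _ _))// ltrD//.
    by rewrite distrC; apply: hd; rewrite -ball_normE/=; apply: lt_le_trans bx _; rewrite ler_pdivrMr// ler_peMr ?(ltW d0)// ler1n.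
  by apply: hd; rewrite -ball_normE/= -[X in `|X|](subrKA x') [ltRHS]splitr (le_lt_trans (ler_normD _ _))// ltrD.
- move=> N1 _ HN; exists N1.+1%:R^-1; first by rewrite invr_gt0.
  by move=> x y xab; apply: (HN N1 (leqnn N1)).
Qed.

Section gaussian_field.
Context (R : realType).
Notation C := (Rcomplex R).

(** Circular complex Gaussian values with covariance [cov (x - y)]: the real and imaginary parts are
    independent with half of this covariance each, whence the 4. The parity of the index selects the
    part, as in [path_coord]. *)
Definition gaussian_field (P : probability (borel (path_space R)) R) (cov : R -> R) :=
  forall N (x t : nat -> R) c,
    \int[P]_phi cos (\sum_(i < N) t i * path_coord x i phi + c) =
    expR (- (\sum_(i < N) \sum_(j < N) t i * t j * ((odd i == odd j)%:R * cov (x i - x j)) / 4)) * cos c.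

Lemma path_coord_measurable x i : measurable_fun setT (fun phi : borel (path_space R) => path_coord x i phi).
Proof. by apply: borel_continuous_measurable; exact: eval_continuous. Qed.

Section increments.
Variables (P : probability (borel (path_space R)) R) (cov : R -> R).
Hypothesis gf : gaussian_field P cov.

Lemma increment_char b (x y t c : R) :
  \int[P]_phi cos (t * (part b (phi x) - part b (phi y)) + c) =
  expR (- ((2 * cov 0 - cov (x - y) - cov (y - x)) / 2 * t ^+ 2 / 2)) * cos c.
Proof.
(* Four coordinates, the two parts at x and the two parts at y; those of the wrong parity get the
   coefficient 0. *)
pose xs (i : nat) := if (i < 2)%N then x else y.
pose ts (i : nat) := if odd i == b then (if (i < 2)%N then t else - t) else 0.
transitivity (\int[P]_phi cos (\sum_(i < 4%N) ts i * path_coord xs i phi + c)).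
  apply: eq_Rintegral => phi _; congr (cos (_ + _)).
  by rewrite !big_ord_recr big_ord0 /= /ts /xs /path_coord /=; case: (b) => /=; ring.
rewrite gf; congr (expR (- _) * _).
by rewrite !big_ord_recr !big_ord0 /= /ts /xs /= !subrr; case: (b) => /=; field.
Qed.

Lemma increment_moment4 b (x y : R) : 0 <= 2 * cov 0 - cov (x - y) - cov (y - x) ->
  (\int[P]_phi ((part b (phi x) - part b (phi y)) ^+ 4)%:E <=
     ((2 * cov 0 - cov (x - y) - cov (y - x)) ^+ 2)%:E)%E.
Proof.
move=> s0; have mX : measurable_fun setT (fun phi : borel (path_space R) => part b (phi x) - part b (phi y)).
  by apply: measurable_funB; apply: borel_continuous_measurable; exact: eval_continuous.
have s1 : 0 <= (2 * cov 0 - cov (x - y) - cov (y - x)) / 2 by rewrite divr_ge0.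
have := @gaussian_moment4 _ _ _ P _ _ mX s1.
have -> : 4 * ((2 * cov 0 - cov (x - y) - cov (y - x)) / 2) ^+ 2 = (2 * cov 0 - cov (x - y) - cov (y - x)) ^+ 2 by field.
apply=> t; have := increment_char b x y t 0; rewrite cos0 mulr1 => <-.
by apply: eq_Rintegral => phi _; rewrite addr0.
Qed.

End increments.

Section dyadic.
Variables (A K M : R) (F : (R -> C) -> R) (A' : nat).
Hypotheses (K0 : 0 <= K) (FL : lip_local A K M F) (AA' : A <= A'%:R).

Definition dyadic_pt (m i : nat) : R := i%:R / (2 ^ m)%:R - A'%:R.
Definition dyadic_ix (m : nat) (x : R) : nat := Num.truncn ((x + A'%:R) * (2 ^ m)%:R).
Definition dyadic_nb (m : nat) : nat := (2 * A' * 2 ^ m).+1.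
(** On [-A, A] this approximation depends on finitely many values of [f], so that functionals of it
    fall under [levy_lip]. *)
Definition dyadic_step (m : nat) (f : R -> C) : R -> C := fun x => f (dyadic_pt m (dyadic_ix m x)).

Let p0 m : 0 < (2 ^ m)%:R :> R. Proof. by rewrite ltr0n expn_gt0. Qed.

Lemma dyadic_ix_itv m x : `|x| <= A ->
  (dyadic_ix m x)%:R <= (x + A'%:R) * (2 ^ m)%:R < (dyadic_ix m x).+1%:R.
Proof.
move=> xA; apply: truncn_itv; rewrite mulr_ge0 ?(ltW (p0 _))//.
by have := le_trans xA AA'; rewrite ler_norml; lra.
Qed.

Lemma dyadic_ix_lt m x : `|x| <= A -> (dyadic_ix m x < dyadic_nb m)%N.
Proof.
move=> xA; have /andP[h _] := dyadic_ix_itv m xA.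
rewrite ltnS -(ler_nat R); apply: (le_trans h); rewrite !natrM ler_pM2r//.
by have := le_trans xA AA'; rewrite ler_norml; lra.
Qed.

Lemma dyadic_pt_close m x : `|x| <= A -> dyadic_pt m (dyadic_ix m x) <= x < dyadic_pt m (dyadic_ix m x) + (2 ^ m)%:R^-1.
Proof.
move=> xA; have /andP[h1 h2] := dyadic_ix_itv m xA.
have e : (dyadic_ix m x).+1%:R / (2 ^ m)%:R = (dyadic_ix m x)%:R / (2 ^ m)%:R + (2 ^ m)%:R^-1 :> R.
  by rewrite -natr1 mulrDl mul1r.
rewrite /dyadic_pt lerBlDr ler_pdivrMr// h1/= addrAC -e ltrBrDr.
by rewrite ltr_pdivlMr.
Qed.

Lemma dyadic_ixS m x : `|x| <= A -> exists b : bool, dyadic_ix m.+1 x = ((dyadic_ix m x).*2 + b)%N.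
Proof.
move=> xA; have /andP[h1 h2] := dyadic_ix_itv m xA; have /andP[h3 h4] := dyadic_ix_itv m.+1 xA.
move: h3 h4; rewrite expnS natrM mulrCA => h3 h4.
set i := dyadic_ix m x in h1 h2 *; set j := dyadic_ix m.+1 x in h3 h4 *.
have l1 : (i.*2 < j.+1)%N.
  by rewrite -(ltr_nat R) -mul2n natrM; apply: le_lt_trans h4; rewrite ler_pM2l.
have l2 : (j < i.+1.*2)%N.
  by rewrite -(ltr_nat R) -mul2n natrM; apply: le_lt_trans h3 _; rewrite ltr_pM2l.
exists (i.*2 < j)%N; move: l1 l2; rewrite doubleS !ltnS => l1 l2.
have [lt|ge] := ltnP i.*2 j; last by rewrite addn0; apply/eqP; rewrite eqn_leq ge l1.
by rewrite addn1; apply/eqP; rewrite eqn_leq l2 lt.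
Qed.

Lemma dyadic_ptS m i b : dyadic_pt m.+1 (i.*2 + b) = dyadic_pt m i + (b%:R / (2 ^ m.+1)%:R).
Proof.
rewrite /dyadic_pt natrD -mul2n natrM expnS natrM; have := lt0r_neq0 (p0 m).
by move: ((2 ^ m)%:R : R) => q q0; field.
Qed.

Lemma dyadic_step_cvg (phi : path_space R) : F (dyadic_step m phi) @[m --> \oo] --> F phi.
Proof.
apply/cvgrPdist_le => e e0.
have e1 : 0 < e / (K + 1) by rewrite divr_gt0// ltr_wpDl.
have [d d0 hd] := heine (- A) A (@path_continuous _ phi) e1.
have [N1 _ HN] : \forall m \near \oo, m.+1%:R^-1 < d.
  have /cvgrPdist_lt/(_ _ d0) := @cvg_harmonic R; apply: filterS => m.
  by rewrite sub0r normrN ger0_norm// invr_ge0.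
exists N1 => // m /= Nm; apply: (lip_local_close K0 FL e0) => x xA.
apply: hd; first by rewrite in_itv/= -ler_norml.
have /andP[h1 h2] := dyadic_pt_close m xA.
have h3 : (2 ^ m)%:R^-1 <= m.+1%:R^-1 :> R.
  by rewrite lef_pV2 ?posrE ?ltr0n ?expn_gt0// ler_nat ltn_expl.
apply: le_lt_trans (HN m Nm); apply: le_trans h3.
by rewrite ger0_norm ?subr_ge0// lerBlDl ltW.
Qed.

Let coords m i : R := dyadic_pt m i./2.
Let G m (a : nat -> R) : R := F (fun x => Complex (a (dyadic_ix m x).*2) (a (dyadic_ix m x).*2.+1)).

Let GE m (phi : path_space R) : G m (path_coord (coords m) ^~ phi) = F (dyadic_step m phi).
Proof.
congr F; apply/funext => x; rewrite /path_coord /coords /= odd_double/= uphalf_double doubleK.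
by rewrite /dyadic_step; case: (phi _).
Qed.

Let Glip m : lip_in (dyadic_nb m).*2 K (G m).
Proof.
move=> a b; have [_ h] := FL; apply: h => x xA.
have ix := dyadic_ix_lt m xA.
apply: (le_trans (norm_le_parts _)); rewrite (sum_double _ (fun i => `|a i - b i|)) (bigD1 (Ordinal ix))//= lerDl.
by apply: sumr_ge0 => i _; rewrite addr_ge0.
Qed.

Lemma bmf_dyadic m : bounded_mfun (fun phi : borel (path_space R) => F (dyadic_step m phi)).
Proof.
split; last by exists M => phi; have [h _] := FL.
under eq_fun do rewrite -GE.
apply: (@lip_measurable _ _ _ (fun i (phi : borel (path_space R)) => path_coord (coords m) i phi) _ (dyadic_nb m).*2 K M (G m)) => //.
- by move=> i; exact: path_coord_measurable.
- by move=> a; have [h _] := FL; exact: h.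
Qed.

Lemma dyadic_cvg m (P : nat -> probability (borel (path_space R)) R) P0 (cov : nat -> R -> R) cov0 :
  (forall n, gaussian_field (P n) (cov n)) -> gaussian_field P0 cov0 ->
  (forall y, cov n y @[n --> \oo] --> cov0 y) ->
  \int[P n]_phi F (dyadic_step m phi) @[n --> \oo] --> \int[P0]_phi F (dyadic_step m phi).
Proof.
move=> gP g0 covc.
have E (Q : probability (borel (path_space R)) R) :
  \int[Q]_phi F (dyadic_step m phi) = \int[Q]_phi G m (path_coord (coords m) ^~ phi).
  by apply: eq_Rintegral => phi _; rewrite GE.
rewrite E; under eq_fun do rewrite E.
apply: (@levy_lip _ _ _ P P0 (fun i (phi : borel (path_space R)) => path_coord (coords m) i phi) (dyadic_nb m).*2 _ _ K M (G m)) => //.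
- by move=> i; exact: path_coord_measurable.
- move=> t c; rewrite g0; under eq_fun do rewrite gP.
  apply: cvgM; last exact: cvg_cst.
  apply: continuous_cvg; first exact: continuous_expR.
  apply: cvgN; apply: cvg_sumr => i; apply: cvg_sumr => j; apply: cvgM; last exact: cvg_cst.
  by do 2 (apply: cvgM; first exact: cvg_cst); exact: covc.
- by move=> a; have [h _] := FL; exact: h.
Qed.

(** The supremum over x is handled by a dichotomy: an increment X is at most d or at most d^-3 X^4,
    and X^4 is at most the sum over all dyadic points. Taking means then involves only fourth
    moments at pairs of points. *)
Lemma dyadic_succ_le m (d : R) (phi : path_space R) : 0 < d ->
  `|F (dyadic_step m.+1 phi) - F (dyadic_step m phi)| <=
  K * (d + (d ^+ 3)^-1 * \sum_(i < dyadic_nb m) `|phi (dyadic_pt m i + (2 ^ m.+1)%:R^-1) - phi (dyadic_pt m i)| ^+ 4).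
Proof.
move=> d0; have [_ h] := FL; apply: h => x xA.
have S0 : 0 <= \sum_(i < dyadic_nb m) `|phi (dyadic_pt m i + (2 ^ m.+1)%:R^-1) - phi (dyadic_pt m i)| ^+ 4.
  by apply: sumr_ge0 => i _; exact: exprn_ge0.
have d3 : 0 < (d ^+ 3)^-1 by rewrite invr_gt0 exprn_gt0.
have [b bE] := dyadic_ixS m xA; rewrite /dyadic_step bE dyadic_ptS.
case: b bE => bE; last by rewrite mul0r addr0 subrr normr0 addr_ge0 ?(ltW d0)// mulr_ge0// ltW.
rewrite mul1r (bigD1 (Ordinal (dyadic_ix_lt m xA)))//=.
set X := `|_|; set Y := \sum_(i < _ | _) _.
have X0 : 0 <= X by exact: normr_ge0.
have Y0 : 0 <= Y by apply: sumr_ge0 => i _; exact: exprn_ge0.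
have [Xd|dX] := leP X d.
  by rewrite (le_trans Xd)// lerDl mulr_ge0 ?(ltW d3)// addr_ge0 ?exprn_ge0.
apply: (@le_trans _ _ (d ^- 3 * X ^+ 4)).
  rewrite ler_pdivlMl ?exprn_gt0// [leRHS]exprSr ler_wpM2r//.
  by rewrite lerXn2r ?nnegrE ?(ltW d0)// ltW.
rewrite (@le_trans _ _ (d ^- 3 * (X ^+ 4 + Y)))//; last by rewrite lerDr ltW.
by rewrite ler_wpM2l ?(ltW d3)// lerDl.
Qed.

Section uniform.
Variables (P : probability (borel (path_space R)) R) (cov : R -> R).
Hypotheses (gf : gaussian_field P cov).
Hypothesis inc : forall y : R, `|y| <= 1 -> 0 <= 2 * cov 0 - cov y - cov (- y) <= `|y|.

Lemma increment_norm4 (x y : R) : `|x - y| <= 1 ->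
  (\int[P]_phi (`|phi x - phi y| ^+ 4)%:E <= (4 * `|x - y| ^+ 2)%:E)%E.
Proof.
move=> xy; have /andP[s0 s1] := inc xy; rewrite opprB in s0 s1.
have m b : measurable_fun setT (fun phi : borel (path_space R) => ((part b (phi x) - part b (phi y)) ^+ 4)%:E).
  apply/measurable_EFinP; apply: measurable_funX.
  by apply: measurable_funB; apply: borel_continuous_measurable; exact: eval_continuous.
have p b (phi : path_space R) : (0 <= ((part b (phi x) - part b (phi y)) ^+ 4)%:E)%E by rewrite lee_fin exprn_even_ge0.
apply: (@le_trans _ _ (2%:E * (\int[P]_phi ((part false (phi x) - part false (phi y)) ^+ 4)%:E +
   \int[P]_phi ((part true (phi x) - part true (phi y)) ^+ 4)%:E))%E).
- rewrite -ge0_integralD// -ge0_integralZl//; [|exact: emeasurable_funD|by move=> phi _; rewrite adde_ge0].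
  apply: ge0_le_integral => //.
  + apply/measurable_EFinP; under eq_fun do rewrite -[4%N]/(2 * 2)%N exprM Rcomplex_norm2E.
    have mp b : measurable_fun setT (fun phi : borel (path_space R) => part b (phi x - phi y)).
      under eq_fun do rewrite partB.
      by apply: measurable_funB; apply: borel_continuous_measurable; exact: eval_continuous.
    by apply: measurable_funX; apply: measurable_funD; apply: measurable_funX; [exact: (mp false)|exact: (mp true)].
  + by apply: emeasurable_funM => //; exact: emeasurable_funD.
  + move=> phi _; rewrite -EFinD -EFinM lee_fin -[4%N]/(2 * 2)%N !exprM Rcomplex_norm2E.
    rewrite -!partB; move: (phi x - phi y) => w /=.
    have := sqr_ge0 (complex.Re w ^+ 2 - complex.Im w ^+ 2); rewrite sqrrB sqrrD; lra.
- have h b := increment_moment4 gf b s0.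
  have -> : (4 * `|x - y| ^+ 2)%:E = (2%:E * ((`|x - y| ^+ 2)%:E + (`|x - y| ^+ 2)%:E))%E.
    by rewrite -EFinD -EFinM; congr EFin; ring.
  rewrite lee_pmul2l//; apply: leeD; apply: (le_trans (h _)); rewrite lee_fin ler_sqr ?nnegrE//.
Qed.

Definition dyadic_const : R := 2 * A'%:R + 1.

Lemma dyadic_succ_int m : `|\int[P]_phi F (dyadic_step m.+1 phi) - \int[P]_phi F (dyadic_step m phi)| <=
  K * (1 + dyadic_const) * (9 / 10) ^+ m.
Proof.
(* The sum has about 2^m terms of mean at most 2^(- 2 m), so after division by d^3 it is of order
   2^(- m) d^-3. This is at most d as soon as q^4 >= 1/2, which 9/10 satisfies while being below
   1. *)
pose q : R := 9 / 10; pose d := q ^+ m.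
have q0 : 0 < q by rewrite divr_gt0.
have d0 : 0 < d by exact: exprn_gt0.
have d3 : 0 < d ^- 3 by rewrite invr_gt0 exprn_gt0.
pose u : R := (2 ^ m.+1)%:R^-1.
have u0 : 0 < u by rewrite invr_gt0 ltr0n expn_gt0.
have u1 : u <= 1 by rewrite invf_le1 ?ltr0n ?expn_gt0// ler1n expn_gt0.
pose S i (phi : path_space R) := `|phi (dyadic_pt m i + u) - phi (dyadic_pt m i)| ^+ 4.
have mS i : measurable_fun setT (S i : borel (path_space R) -> R).
{ rewrite /S; under eq_fun do rewrite -[4%N]/(2 * 2)%N exprM Rcomplex_norm2E.
  have mp b : measurable_fun setT (fun phi : borel (path_space R) => part b (phi (dyadic_pt m i + u) - phi (dyadic_pt m i))).
    under eq_fun do rewrite partB.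
    by apply: measurable_funB; apply: borel_continuous_measurable; exact: eval_continuous.
  by apply: measurable_funX; apply: measurable_funD; apply: measurable_funX; [exact: (mp false)|exact: (mp true)]. }
have S0 i phi : 0 <= S i phi by exact: exprn_ge0.
have ES i : (\int[P]_phi (S i phi)%:E <= (4 * u ^+ 2)%:E)%E.
{ have := @increment_norm4 (dyadic_pt m i + u) (dyadic_pt m i).
  by rewrite addrAC subrr add0r gtr0_norm//; apply. }
have b1 := bmf_dyadic m.+1; have b2 := bmf_dyadic m; have b12 := bmfB b1 b2.
rewrite -lee_fin -RintB//.
apply: (@le_trans _ _ (\int[P]_phi `|F (dyadic_step m.+1 phi) - F (dyadic_step m phi)|%:E)%E).
{ apply: (@le_trans _ _ (\int[P]_phi `|F (dyadic_step m.+1 phi) - F (dyadic_step m phi)|)%:E).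
    by rewrite lee_fin; apply: le_normr_Rintegral => //; exact: bmf_integrable.
  rewrite EFin_Rint//; split; first by apply: measurableT_comp => //; case: b12.
  by have [_ [B HB]] := b12; exists B => w; rewrite normr_id. }
apply: (@le_trans _ _ (\int[P]_phi (K%:E * (d%:E + (d ^- 3)%:E * \sum_(i < dyadic_nb m) (S i phi)%:E)))%E).
{ have mb : measurable_fun setT (fun phi : borel (path_space R) => (d%:E + (d ^- 3)%:E * \sum_(i < dyadic_nb m) (S i phi)%:E)%E).
    apply: emeasurable_funD => //; apply: emeasurable_funM => //.
    by apply: emeasurable_sum => i; exact/measurable_EFinP.
  apply: ge0_le_integral => //.
  - by apply/measurable_EFinP; apply: measurableT_comp => //; case: b12.
  - exact: emeasurable_funM.
  - move=> phi _; rewrite (_ : (\sum_(i < dyadic_nb m) (S i phi)%:E = (\sum_(i < dyadic_nb m) S i phi)%:E)%E); last by rewrite -sumEFin.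
    by have := dyadic_succ_le m phi d0; rewrite -lee_fin. }
have mSum : measurable_fun setT (fun phi : borel (path_space R) => (\sum_(i < dyadic_nb m) (S i phi)%:E)%E).
  by apply: emeasurable_sum => i; exact/measurable_EFinP.
have Sum0 phi : (0 <= \sum_(i < dyadic_nb m) (S i phi)%:E)%E.
  by apply: sume_ge0 => i _; rewrite lee_fin.
rewrite ge0_integralZl//; last 2 first.
- by apply: emeasurable_funD => //; exact: emeasurable_funM.
- by move=> phi _; rewrite adde_ge0 ?lee_fin ?(ltW d0)// mule_ge0// lee_fin ltW.
rewrite ge0_integralD//; last 3 first.
- by move=> phi _; rewrite lee_fin ltW.
- by move=> phi _; rewrite mule_ge0// lee_fin ltW.
- exact: emeasurable_funM.
have Ed : (\int[P]_phi d%:E = d%:E)%E.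
  by rewrite integral_cst// -[RHS]mule1; congr (_ * _)%E; exact: probability_setT.
rewrite Ed ge0_integralZl//; last by rewrite lee_fin ltW.
rewrite ge0_integral_sum//; [|by move=> i; apply/measurable_EFinP; exact: mS|by move=> i phi _; rewrite lee_fin].
apply: (@le_trans _ _ (K%:E * (d%:E + (d ^- 3)%:E * \sum_(i < dyadic_nb m) (4 * u ^+ 2)%:E))%E).
  rewrite lee_wpmul2l ?lee_fin// leeD2l// lee_wpmul2l ?lee_fin ?(ltW d3)//.
  by apply: lee_sum => i _; exact: ES.
rewrite (_ : (\sum_(i < dyadic_nb m) (4 * u ^+ 2)%:E = (\sum_(i < dyadic_nb m) 4 * u ^+ 2)%:E)%E); last by rewrite -sumEFin.
suff h : K * (d + d ^- 3 * (\sum_(i < dyadic_nb m) 4 * u ^+ 2)) <= K * (1 + dyadic_const) * q ^+ m by rewrite -lee_fin in h.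
rewrite -mulrA ler_wpM2l//.
rewrite (mulrDl 1 dyadic_const) mul1r -/d lerD2l sumr_const card_ord -(mulr_natl (4 * u ^+ 2)).
pose w : R := (2 ^ m)%:R.
have w0 : 0 < w by rewrite ltr0n expn_gt0.
have w1 : 1 <= w by rewrite ler1n expn_gt0.
have uE : 4 * u ^+ 2 = w ^- 2.
  by rewrite /u expnS natrM -/w; field; rewrite gt_eqF.
have nbw : (dyadic_nb m)%:R <= dyadic_const * w.
  by rewrite /dyadic_nb /dyadic_const -natr1 !natrM -/w (mulrDl (2 * A'%:R)) mul1r lerD2l.
have qw : 1 <= q ^+ 4 ^+ m * w.
  rewrite /w natrX -exprMn exprn_ege1//; rewrite /q !exprS expr0; lra.
rewrite uE ler_pdivrMl ?exprn_gt0//.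
apply: (@le_trans _ _ (dyadic_const * w * w ^- 2)).
  by rewrite ler_wpM2r// invr_ge0 exprn_ge0// ltW.
have -> : dyadic_const * w * w ^- 2 = dyadic_const * w^-1 by field; rewrite gt_eqF.
have -> : d ^+ 3 * (dyadic_const * d) = dyadic_const * (q ^+ 4 ^+ m).
  by rewrite /d -[q ^+ 4 ^+ m]exprM mulnC exprM !exprS expr0; ring.
rewrite ler_wpM2l ?addr_ge0 ?mulr_ge0//.
by rewrite -[leLHS]mul1r ler_pdivrMr.
Qed.

Lemma dyadic_approx m : `|\int[P]_phi F phi - \int[P]_phi F (dyadic_step m phi)| <=
  10 * K * (1 + dyadic_const) * (9 / 10) ^+ m.
Proof.
pose B := K * (1 + dyadic_const); pose q : R := 9 / 10.
have B0 : 0 <= B by rewrite mulr_ge0// !addr_ge0// mulr_ge0.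
have q0 : 0 <= q by rewrite divr_ge0.
(* Summation of the geometric series of increments; 10 is 1 / (1 - q). *)
have step j : `|\int[P]_phi F (dyadic_step (m + j) phi) - \int[P]_phi F (dyadic_step m phi)| <= 10 * B * q ^+ m * (1 - q ^+ j).
{ elim: j => [|j IHj]; first by rewrite addn0 subrr normr0 expr0 subrr mulr0.
  rewrite addnS -[X in `|X|](subrKA (\int[P]_phi F (dyadic_step (m + j) phi))).
  apply: (le_trans (ler_normD _ _)).
  apply: (@le_trans _ _ (B * q ^+ (m + j) + 10 * B * q ^+ m * (1 - q ^+ j))).
    by apply: lerD => //; exact: dyadic_succ_int.
  rewrite exprD exprSr le_eqVlt; apply/orP; left; apply/eqP.
  move: (q ^+ m) (q ^+ j) => a b; by rewrite /q; field. }
have lim : `|\int[P]_phi F (dyadic_step (m + j) phi) - \int[P]_phi F (dyadic_step m phi)| @[j --> \oo] -->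
   `|\int[P]_phi F phi - \int[P]_phi F (dyadic_step m phi)|.
{ apply: cvg_norm; apply: cvgB; last exact: cvg_cst.
  apply: (@bounded_cvg _ _ _ P _ _ M).
  - by move=> j; case: (bmf_dyadic (m + j)).
  - by move=> j phi; have [h _] := FL.
  - move=> phi; have := @dyadic_step_cvg phi; rewrite -(cvg_shiftn m).
    by under eq_fun do rewrite addnC. }
have -> : 10 * K * (1 + dyadic_const) * (9 / 10) ^+ m = 10 * B * q ^+ m by rewrite /B !mulrA.
rewrite -(cvg_lim (@Rhausdorff R) lim); apply: limr_le; first by apply/cvg_ex; eexists; exact: lim.
apply: nearW => j; apply: (le_trans (step j)); rewrite -[leRHS]mulr1 ler_wpM2l//.
  by apply: mulr_ge0; [exact: mulr_ge0|exact: exprn_ge0].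
by rewrite gerBl exprn_ge0.
Qed.

End uniform.
End dyadic.

(** Kolmogorov's criterion in quantitative form: increments have variance at most of order |y|,
    uniformly in n, hence fourth moments of order |y|^2. The dyadic approximation is therefore
    uniform in n, and for finitely many point values the convergence of the covariances suffices. *)
Theorem gaussian_field_cvg A K M F (P : nat -> probability (borel (path_space R)) R) P0 (cov : nat -> R -> R) cov0 :
  0 <= K -> lip_local A K M F ->
  (forall n, gaussian_field (P n) (cov n)) -> gaussian_field P0 cov0 ->
  (forall y, cov n y @[n --> \oo] --> cov0 y) ->
  (forall n (y : R), `|y| <= 1 -> 0 <= 2 * cov n 0 - cov n y - cov n (- y) <= `|y|) ->
  (forall y : R, `|y| <= 1 -> 0 <= 2 * cov0 0 - cov0 y - cov0 (- y) <= `|y|) ->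
  \int[P n]_phi F phi @[n --> \oo] --> \int[P0]_phi F phi.
Proof.
move=> K0 FL gP g0 covc incP inc0.
pose A' := (Num.truncn A).+1.
have AA' : A <= A'%:R by apply/ltW; exact: truncnS_gt.
pose B m := 10 * K * (1 + dyadic_const A') * (9 / 10) ^+ m.
have Bc : B m @[m --> \oo] --> 0.
  rewrite -[X in _ --> X](mulr0 (10 * K * (1 + dyadic_const A'))); apply: cvgM; first exact: cvg_cst.
  by apply: cvg_expr; rewrite ger0_norm ?divr_ge0//; lra.
apply: approx_cvg => e e0; move/cvgrPdist_le : Bc => /(_ _ e0) [m _ /(_ m (leqnn m))]/=.
rewrite sub0r normrN => /(le_trans (ler_norm _)) Bm.
exists (fun n => \int[P n]_phi F (dyadic_step A' m phi)), (\int[P0]_phi F (dyadic_step A' m phi)); split.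
- exact: (dyadic_cvg K0 FL AA' gP g0 covc).
- by apply: le_trans Bm; exact: (dyadic_approx K0 FL AA' g0 inc0).
- by apply: nearW => n; apply: le_trans Bm; exact: (dyadic_approx K0 FL AA' (gP n) (incP n)).
Qed.

End gaussian_field.

(** * Laws on path space: identification, weak convergence, translations *)

Section path_law.
Context (R : realType).
Notation C := (Rcomplex R).
Notation prob := (probability (borel (path_space R)) R).

Lemma lower_semi_open (U : set (path_space R)) : open U -> lower_semi (\1_U : path_space R -> R).
Proof.
move=> oU phi e e0; have FF : Filter (nbhs phi) by exact: nbhs_filter.
rewrite !indicE; have [/set_mem Uphi|nU] := boolP (phi \in U).
  have : nbhs phi U by exact: open_nbhs_nbhs.
  by apply: filterS => psi Upsi; rewrite indicE mem_set//= ltrBlDr ltrDl.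
by apply: (@filterE _ _ FF) => psi; rewrite indicE sub0r; apply: lt_le_trans (ler0n _ _); rewrite oppr_lt0.
Qed.

(** Open sets form a pi-system generating the Borel sets, and the indicator of an open set is lower
    semicontinuous, hence a pointwise limit of local Lipschitz functionals. *)
Lemma path_law_eq (m1 m2 : prob) :
  (forall A K M F, 0 <= K -> lip_local A K M F -> \int[m1]_phi F phi = \int[m2]_phi F phi) ->
  forall A, measurable A -> m1 A = m2 A.
Proof.
move=> H; apply: (@measure_unique _ R (borel (path_space R)) (@open (path_space R)) (fun=> setT)) => //.
- exact: openI.
- by move=> n; exact: openT.
- by rewrite bigcup_const.
- move=> U oU; have mU : measurable (U : set (borel (path_space R))) by exact: sub_sigma_algebra.
  have U1 phi : `|\1_U phi : R| <= 1.
    by rewrite indicE; case: (_ \in _); rewrite ?normr1 ?normr0.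
  have E (m : prob) : m U = (\int[m]_phi (\1_U phi))%:E.
    by rewrite EFin_Rint ?integral_indic ?setIT//; exact: bmf_indic.
  transitivity ((\int[m1]_phi (\1_U phi))%:E); first exact: E.
  transitivity ((\int[m2]_phi (\1_U phi))%:E); last exact/esym/E.
  congr EFin.
  have L1 := inf_conv_integral (lower_semi_open oU) U1 (m := m1).
  have L2 := inf_conv_integral (lower_semi_open oU) U1 (m := m2).
  have L3 : \int[m2]_phi inf_conv (\1_U) 1 k phi @[k --> \oo] --> \int[m1]_phi \1_U phi.
    by under eq_fun do rewrite -(H _ _ _ _ (ler0n _ _) (inf_conv_lip U1 _)).
  exact: (cvg_unique _ L3 L2).
- by move=> n; apply: le_lt_trans (probability_le1 _ _) _; rewrite ?ltry.
Qed.

(** Inf-convolutions approximate from below and so yield a lower bound on the limit inferior; the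
    same bound for - F is the upper one for F. *)
Lemma path_weak_cvg (P : nat -> prob) (P0 : prob) (F : path_space R -> R) M :
  (forall A K M F, 0 <= K -> lip_local A K M F ->
     \int[P n]_phi F phi @[n --> \oo] --> \int[P0]_phi F phi) ->
  continuous F -> (forall phi, `|F phi| <= M) ->
  \int[P n]_phi F phi @[n --> \oo] --> \int[P0]_phi F phi.
Proof.
have half G (e : R) : (forall A K M F, 0 <= K -> lip_local A K M F ->
     \int[P n]_phi F phi @[n --> \oo] --> \int[P0]_phi F phi) ->
  continuous G -> (forall phi, `|G phi| <= M) -> 0 < e ->
  \forall n \near \oo, \int[P0]_phi G phi - e <= \int[P n]_phi G phi.
{ move=> H cG GM e0; have e2 : 0 < e / 2 by rewrite divr_gt0.
  have lG := continuous_lower_semi cG.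
  have [k _ /(_ k (leqnn k))/=] : \forall k \near \oo,
    `|\int[P0]_phi G phi - \int[P0]_phi inf_conv G M k phi| <= e / 2.
    by have /cvgrPdist_le/(_ _ e2) := inf_conv_integral lG GM (m := P0).
  move=> h1; have /cvgrPdist_le/(_ _ e2) := H _ _ _ _ (ler0n _ _) (inf_conv_lip GM k).
  apply: filterS => n h2.
  have h3 : \int[P n]_phi inf_conv G M k phi <= \int[P n]_phi G phi.
    apply: Rint_le; first by apply: bmf_lip_local (inf_conv_lip GM k); rewrite ler0n.
      by split; [exact: borel_continuous_measurable|exists M].
    by move=> phi; exact: inf_conv_le.
  move: h1 h2; rewrite !ler_norml => /andP[_ h1] /andP[_ h2]; lra. }
move=> H cF FM; apply/cvgrPdist_le => e e0.
have cNF : continuous (fun phi => - F phi) by move=> phi; apply: (@continuous_comp _ _ _ F (fun x : R => - x)); [exact: cF|exact: opp_continuous].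
have NFM phi : `|- F phi| <= M by rewrite normrN.
have h1 := half F e H cF FM e0; have h2 := half _ e H cNF NFM e0.
near=> n.
have g1 : \int[P0]_phi F phi - e <= \int[P n]_phi F phi by near: n.
have g2 : \int[P0]_phi (- F phi) - e <= \int[P n]_phi (- F phi) by near: n.
have bF (Q : prob) : Q.-integrable setT (EFin \o F).
  by apply: bmf_integrable; split; [exact: borel_continuous_measurable|exists M].
have NE (Q : prob) : \int[Q]_phi (- F phi) = - \int[Q]_phi F phi.
  under eq_Rintegral do rewrite -mulN1r.
  by rewrite RintZ ?mulN1r//; split; [exact: borel_continuous_measurable|exists M].
rewrite !NE in g2; rewrite ler_norml; apply/andP; split; lra.
Unshelve. all: by end_near. Qed.

Lemma path_shift_continuous (a : R) (phi : path_space R) : continuous (fun x : R => phi (x + a)).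
Proof.
move=> x; apply: (@continuous_comp _ _ _ (fun x : R => x + a) phi); last exact: path_continuous.
by apply: cvgD; [exact: cvg_id|exact: cvg_cst].
Qed.

Definition path_shift (a : R) (phi : path_space R) : path_space R :=
  mkcts (@path_shift_continuous a phi).

Lemma measurable_path_shift a :
  measurable_fun setT (path_shift a : borel (path_space R) -> borel (path_space R)).
Proof.
apply: (@measurability _ _ _ (borel (path_space R)) setT _ (@open (path_space R)) erefl) => _ [U oU <-]; rewrite setTI; apply: sub_sigma_algebra.
apply: open_comp => // phi _; have FF : Filter (nbhs phi) by exact: nbhs_filter.
have c : {compact-open, ((fun psi : path_space R => path_shift a psi : R -> C) @ phi) --> (path_shift a phi : R -> C)}.
  apply: compact_open_of_uniform; first exact: path_continuous.
  move=> A e e0; have := path_nbhs_uniform phi (A + `|a|) e0.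
  apply: filterS => psi h x xA; apply: h.
  by rewrite (le_trans (ler_normD _ _))// lerD2r.
move=> V [_ [/= [B oB <-] Bphi] BV].
have /c : nbhs (path_shift a phi : {compact-open, R -> C}) B by exact: open_nbhs_nbhs.
move=> h; change (nbhs phi (path_shift a @^-1` V)).
by apply: (@filterS _ _ FF _ _ _ h) => psi hp; exact: BV.
Qed.

Section shift_invariance.
Variables (m : prob) (cov : R -> R).
Hypotheses (gf : gaussian_field m cov).
Hypothesis inc : forall y : R, `|y| <= 1 -> 0 <= 2 * cov 0 - cov y - cov (- y) <= `|y|.

Lemma gaussian_field_shift a (B : set (borel (path_space R))) : measurable B ->
  m (path_shift a @^-1` B) = m B.
Proof.
move=> mB; pose mf := isMeasurableFun.Build _ _ _ _ _ (measurable_path_shift a).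
pose T : {mfun borel (path_space R) >-> borel (path_space R)} := HB.pack (path_shift a) mf.
pose m' : prob := distribution m T.
have m'E (F : path_space R -> R) : bounded_mfun (F : borel (path_space R) -> R) ->
    \int[m']_phi F phi = \int[m]_phi F (path_shift a phi).
  by move=> bF; apply: Rint_law => //; exact: measurable_path_shift.
apply: esym; apply: (@path_law_eq m m') => //.
move=> A K M F K0 FL.
have gf' : gaussian_field m' cov.
{ move=> N x t c; rewrite m'E; last first.
    by apply: bmf_lip_local (lip_local_cos N x t c); exact: sumr_ge0.
  have := gf N (fun i => x i + a) t c.
  have -> : \sum_(i < N) \sum_(j < N) t i * t j * ((odd i == odd j)%:R * cov (x i + a - (x j + a))) / 4 =
    \sum_(i < N) \sum_(j < N) t i * t j * ((odd i == odd j)%:R * cov (x i - x j)) / 4.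
    by apply: eq_bigr => i _; apply: eq_bigr => j _; do 3 congr (_ * _); congr cov; ring.
  by move=> <-. }
(* Applied to a constant sequence, the convergence theorem shows that two fields with the same
   covariance give local Lipschitz functionals the same means. *)
have := @gaussian_field_cvg _ A K M F (fun=> m') m (fun=> cov) cov K0 FL (fun=> gf') gf _ (fun=> inc) inc.
move=> /(_ (fun=> cvg_cst _)) c1.
by apply: (@cvg_unique _ _ (\int[m']_phi F phi @[n --> \oo])) => //; exact: cvg_cst.
Qed.

Lemma shift_integral a (f : borel (path_space R) -> \bar R) : measurable_fun setT f ->
  (forall phi, 0 <= f phi)%E -> (\int[m]_phi f (path_shift a phi) = \int[m]_phi f phi)%E.
Proof.
move=> mf f0.
pose mx := isMeasurableFun.Build _ _ _ _ _ (measurable_path_shift a).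
pose T : {mfun borel (path_space R) >-> borel (path_space R)} := HB.pack (path_shift a) mx.
transitivity (\int[distribution m T]_phi f phi)%E.
  rewrite ge0_integral_pushforward//; exact: measurable_path_shift.
by apply: eq_measure_integral => A mA _; exact: gaussian_field_shift.
Qed.

End shift_invariance.

Section free_field.
Variables (alpha : R).
Hypothesis alpha0 : 0 < alpha.

(** The covariance is the limit of the partial sums at every y, while the closed form is available
    on |y| <= L / 2; the assumption 2 <= L puts the increments |y| <= 1 in this range. *)
Lemma free_field_gaussian L (m : prob) : 2 <= L -> is_free_field alpha L m ->
  exists cov, [/\ gaussian_field m cov,
    forall y, `|y| <= L / 2 -> cov y = periodic_cov alpha L y &
    forall y : R, `|y| <= 1 -> 0 <= 2 * cov 0 - cov y - cov (- y) <= `|y|].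
Proof.
move=> L2 ff; have L0 : 0 < L by apply: lt_le_trans L2.
have cauchy y : exists c : R, kern alpha L n y @[n --> \oo] --> c.
{ have [c cP] : exists c : R, kern alpha L n.+1 y @[n --> \oo] --> c.
    apply/cvg_ex; apply/cauchy_cvgP; apply: cauchy_exP => e e0.
    have /cvgrPdist_lt/(_ _ e0)[n _ /(_ n (leqnn n))] /= := cvg_div_n L.
    rewrite sub0r normrN ger0_norm ?divr_ge0 ?(ltW L0)// => Le.
    exists (kern alpha L n.+1 y); exists n => // k /= nk; rewrite -ball_normE/= distrC.
    exact: le_lt_trans (kern_cauchy alpha0 L0 _ nk) Le.
  by exists c; rewrite -cvg_shiftS. }
have [cov covP] := choice cauchy.
have covE y : `|y| <= L / 2 -> cov y = periodic_cov alpha L y.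
  by move=> yL; exact: (cvg_unique _ (covP y) (kern_cvg alpha0 L0 yL)).
exists cov; split => //.
- move=> N x t c;
  suff L1 : expR (- (\sum_(i < N) \sum_(j < N) t i * t j * ((odd i == odd j)%:R * kern alpha L n (x i - x j)) / 4)) * cos c @[n --> \oo] -->
    expR (- (\sum_(i < N) \sum_(j < N) t i * t j * ((odd i == odd j)%:R * cov (x i - x j)) / 4)) * cos c.
    have L3 := @free_field_char R alpha L alpha0 L0 m ff N x t c. exact: (cvg_unique _ L3 L1).
  apply: cvgM; last exact: cvg_cst.
  apply: continuous_cvg; first exact: continuous_expR.
  apply: cvgN; apply: cvg_sumr => i; apply: cvg_sumr => j; apply: cvgM; last exact: cvg_cst.
  by do 2 (apply: cvgM; first exact: cvg_cst); exact: covP.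
- move=> y y1; have yL : `|y| <= L / 2 by apply: (le_trans y1); rewrite ler_pdivlMr// mul1r.
  rewrite !covE ?normrN ?normr0 ?divr_ge0 ?(ltW L0)//.
  have -> : periodic_cov alpha L (- y) = periodic_cov alpha L y by rewrite /periodic_cov normrN.
  have h1 := periodic_cov_lip alpha0 L0 yL.
  suff : periodic_cov alpha L y <= periodic_cov alpha L 0 by lra.
  rewrite /periodic_cov normr0 subr0 ler_wpM2r//.
    have hs : 0 < hsinh alpha (L / 2) by apply: hsinh_gt0 => //; rewrite divr_gt0.
    rewrite invr_ge0; apply: mulr_ge0; last exact: ltW.
    by apply: mulr_ge0 => //; apply/ltW/mass_par_gt0.
  by apply: hcosh_le => //; rewrite ?subr_ge0// lerBlDr lerDl.
Qed.

Lemma free_field_shift L (m : prob) a (f : borel (path_space R) -> \bar R) :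
  2 <= L -> is_free_field alpha L m -> measurable_fun setT f ->
  (forall phi, 0 <= f phi)%E -> (\int[m]_phi f (path_shift a phi) = \int[m]_phi f phi)%E.
Proof.
by move=> L2 ff; have [cov [gf _ inc]] := free_field_gaussian L2 ff; exact: shift_integral gf inc a f.
Qed.

Lemma free_field_cvg (L : nat -> R) (m : nat -> prob) (nu : prob) (F : path_space R -> R) M :
  (forall n, 2 <= L n) -> (L n @[n --> \oo] --> +oo) ->
  (forall n, is_free_field alpha (L n) (m n)) -> is_ornstein_uhlenbeck alpha nu ->
  continuous F -> (forall phi, `|F phi| <= M) ->
  \int[m n]_phi F phi @[n --> \oo] --> \int[nu]_phi F phi.
Proof.
move=> L2 Loo ff ou cF FM; apply: path_weak_cvg cF FM => {F M} A K M F K0 FL.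
have /choice[cov covP] : forall n, exists cov, [/\ gaussian_field (m n) cov,
    forall y, `|y| <= L n / 2 -> cov y = periodic_cov alpha (L n) y &
    forall y : R, `|y| <= 1 -> 0 <= 2 * cov 0 - cov y - cov (- y) <= `|y|].
  by move=> n; exact: free_field_gaussian (L2 n) (ff n).
have covc y : cov n y @[n --> \oo] --> line_cov alpha y.
{ have L0 n : 0 < L n by apply: lt_le_trans (L2 n).
  have := periodic_cov_cvg (y := y) alpha0 L0 Loo; apply: cvg_trans; apply: near_eq_cvg.
  have /cvgryPge/(_ (2 * `|y|)) := Loo; apply: filterS => n h.
  by have [_ h2 _] := covP n; rewrite h2// ler_pdivlMr// (mulrC `|y|). }
apply: (gaussian_field_cvg K0 FL _ _ covc) => //.
- by move=> n; have [] := covP n.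
- by move=> N x t c; exact: ou_char.
- by move=> n; have [] := covP n.
- have k0 := mass_par_gt0 alpha0.
  move=> y _; rewrite /line_cov normrN normr0 mulr0 oppr0 expR0.
  have h1 : expR (- (mass_par alpha * `|y|)) <= 1.
    by rewrite -expR0 ler_expR oppr_le0 mulr_ge0// ltW.
  have h2 := expR_ge1Dx (- (mass_par alpha * `|y|)).
  have -> : 2 * (1 / (2 * mass_par alpha)) - expR (- (mass_par alpha * `|y|)) / (2 * mass_par alpha) -
    expR (- (mass_par alpha * `|y|)) / (2 * mass_par alpha) = (1 - expR (- (mass_par alpha * `|y|))) / mass_par alpha.
    by field; rewrite gt_eqF.
  by rewrite divr_ge0 ?subr_ge0 ?(ltW k0)//= ler_pdivrMr// (mulrC `|y|); lra.
Qed.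

End free_field.
End path_law.

(** * Trigonometric polynomials *)

Section interval_calculus.
Context (R : realType).
Notation mu := (@lebesgue_measure R).
Implicit Types (f g k : R -> R).

Lemma Rint_itvD f g a b : continuous f -> continuous g ->
  \int[mu]_(x in `[a, b]) (f x + g x) = \int[mu]_(x in `[a, b]) f x + \int[mu]_(x in `[a, b]) g x.
Proof. by move=> cf cg; rewrite RintegralD//; exact: continuous_itv_integrable. Qed.

Lemma Rint_itvZ c f a b : continuous f ->
  \int[mu]_(x in `[a, b]) (c * f x) = c * \int[mu]_(x in `[a, b]) f x.
Proof. by move=> cf; rewrite RintegralZl//; exact: continuous_itv_integrable. Qed.

Lemma Rint_itv_le f g a b : continuous f -> continuous g -> (forall x, x \in `[a, b] -> f x <= g x) ->
  \int[mu]_(x in `[a, b]) f x <= \int[mu]_(x in `[a, b]) g x.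
Proof.
move=> cf cg fg; apply: le_Rintegral => //; exact: continuous_itv_integrable.
Qed.

Lemma Rint_itv_cst c a b : a <= b -> \int[mu]_(x in `[a, b]) c = c * (b - a).
Proof.
move=> ab; rewrite Rintegral_cst//= lebesgue_measure_itv/= lte_fin.
by case: ltgtP ab => // -> _; rewrite subrr.
Qed.

Lemma continuous_sum (n : nat) (F : nat -> R -> R) : (forall i, continuous (F i)) ->
  continuous (fun x => \sum_(i < n) F i x).
Proof.
move=> cF; elim: n => [|n IHn] x.
  by under eq_fun do rewrite big_ord0; exact: cvg_cst.
under eq_fun do rewrite big_ord_recr/=.
by apply: cvgD; [exact: IHn|exact: cF].
Qed.

Lemma Rint_itv_sum (n : nat) (F : nat -> R -> R) a b : (forall i, continuous (F i)) ->
  \int[mu]_(x in `[a, b]) (\sum_(i < n) F i x) = \sum_(i < n) \int[mu]_(x in `[a, b]) F i x.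
Proof.
move=> cF; elim: n => [|n IHn].
  rewrite big_ord0; under eq_Rintegral do rewrite big_ord0.
  by rewrite /Rintegral integral0.
under eq_Rintegral do rewrite big_ord_recr/=.
rewrite Rint_itvD// ?IHn ?big_ord_recr//.
exact: continuous_sum.
Qed.

Lemma Rint_itv_split f a b c : continuous f -> a <= b -> b <= c ->
  \int[mu]_(x in `[a, c]) f x = \int[mu]_(x in `[a, b]) f x + \int[mu]_(x in `[b, c]) f x.
Proof.
move=> cf ab bc.
have := @Rintegral_itvB R f (BLeft a) (BRight c) b (continuous_itv_integrable _ _ cf).
rewrite !bnd_simp => /(_ ab bc).
rewrite (@Rintegral_itv_obnd_cbnd _ b) => [<-|]; first by rewrite addrC subrK.
apply: integrableS (continuous_itv_integrable b c cf) => //.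
by apply: subset_itvr; rewrite bnd_simp.
Qed.

Lemma Rint_itv_tiles f a s (M : nat) : continuous f -> 0 <= s ->
  \sum_(j < M) \int[mu]_(y in `[a + s * j%:R, a + s * j.+1%:R]) f y = \int[mu]_(y in `[a, a + s * M%:R]) f y.
Proof.
move=> cf s0; elim: M => [|M IHM]; first by rewrite big_ord0 mulr0 addr0 set_itv1 Rintegral_set1.
rewrite big_ord_recr/= IHM -Rint_itv_split//; first by rewrite lerDl mulr_ge0.
by rewrite lerD2l ler_wpM2l// ler_nat.
Qed.

Lemma Rint_itv_ge0 f a b : (forall x, 0 <= f x) -> 0 <= \int[mu]_(x in `[a, b]) f x.
Proof. by move=> f0; apply: Rintegral_ge0. Qed.

Lemma Rint_itv_sub f a b c d : continuous f -> (forall x, 0 <= f x) -> a <= b -> b <= c -> c <= d ->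
  \int[mu]_(x in `[b, c]) f x <= \int[mu]_(x in `[a, d]) f x.
Proof.
move=> cf f0 ab bc cd.
rewrite (@Rint_itv_split f a b d)// ?(le_trans bc)// (@Rint_itv_split f b c d)//.
by rewrite -[leLHS]add0r lerD ?Rint_itv_ge0// lerDl Rint_itv_ge0.
Qed.

Lemma derive_le_bound g dg k a b x y : (forall x : R, is_derive x (1 : R) g (dg x)) ->
  continuous dg -> continuous k -> (forall x, `|dg x| <= k x) -> x \in `[a, b] -> y \in `[a, b] ->
  g x <= g y + \int[mu]_(t in `[a, b]) k t.
Proof.
move=> gd cdg ck dk; rewrite !in_itv/= => /andP[ax xb] /andP[ay yb].
have k0 t : 0 <= k t by apply: le_trans (dk t).
have cN : continuous (fun t => -1 * dg t) by move=> t; apply: cvgM; [exact: cvg_cst|exact: cdg].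
rewrite -lerBlDl; have [yx|xy] := leP y x.
  rewrite -(FTC_Rint yx gd)//; apply: le_trans (Rint_itv_sub ck k0 ay yx xb).
  by apply: Rint_itv_le => // t _; apply: le_trans (dk t); exact: ler_norm.
have xy' := ltW xy; have -> : g x - g y = - 1 * (g y - g x) by ring.
rewrite -(FTC_Rint xy' gd)// -Rint_itvZ//; apply: le_trans (Rint_itv_sub ck k0 ax xy' yb).
by apply: Rint_itv_le => // t _; apply: le_trans (dk t); rewrite mulN1r -normrN; exact: ler_norm.
Qed.

(** The average over y of the bound g x <= g y + int k. *)
Lemma derive_mean_bound g dg k a b x : (forall x : R, is_derive x (1 : R) g (dg x)) ->
  continuous dg -> continuous k -> (forall x, `|dg x| <= k x) -> x \in `[a, b] ->
  (b - a) * g x <= \int[mu]_(t in `[a, b]) g t + (b - a) * \int[mu]_(t in `[a, b]) k t.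
Proof.
move=> gd cdg ck dk xab; have ab : a <= b by move: xab; rewrite in_itv/= => /andP[]; exact: le_trans.
rewrite -[leLHS]mulrC -Rint_itv_cst// [X in _ + X]mulrC -Rint_itv_cst//.
have cg := is_derive_continuous gd.
rewrite -Rint_itvD//; last by move=> z; exact: cvg_cst.
apply: Rint_itv_le.
- by move=> z; exact: cvg_cst.
- by move=> z; apply: cvgD; [exact: cg|exact: cvg_cst].
- by move=> y yab; exact: (derive_le_bound gd cdg ck dk).
Qed.

End interval_calculus.

Section trig_calculus.
Context (R : realType) (alpha L : R).
Hypotheses (alpha0 : 0 < alpha) (L0 : 0 < L).
Notation C := (Rcomplex R).
Notation mu := (@lebesgue_measure R).
Notation trig := (trig alpha L).
Notation fdenom := (fdenom alpha L).
Notation fscale := (fscale alpha L).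

Definition wfreq (n j : nat) : R := 2 * pi * (fmode n j)%:~R / L.

Definition wave (p q : nat -> R) n (b : bool) (j : nat) (x : R) : R :=
  if b then p j * sin (wfreq n j * x) + q j * cos (wfreq n j * x)
  else p j * cos (wfreq n j * x) - q j * sin (wfreq n j * x).

Definition waves p q n b x : R := \sum_(j < n.*2.+1) wave p q n b j x.

Lemma is_derive_wave p q n b j (x : R) : is_derive x (1 : R) (wave p q n b j)
  (wave (fun j => - (wfreq n j * q j)) (fun j => wfreq n j * p j) n b j x).
Proof.
have ds := is_derive_sinM (wfreq n j) x; have dc := is_derive_cosM (wfreq n j) x.
by rewrite /wave; case: b; apply: is_derive_eq; rewrite /GRing.scale/=; ring.
Qed.

Lemma is_derive_waves p q n b (x : R) : is_derive x (1 : R) (waves p q n b)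
  (waves (fun j => - (wfreq n j * q j)) (fun j => wfreq n j * p j) n b x).
Proof. apply: (@is_derive_bigsum _ _ (wave p q n b)
  (fun j => wave (fun j => - (wfreq n j * q j)) (fun j => wfreq n j * p j) n b j x)) => j.
exact: is_derive_wave. Qed.

Lemma continuous_waves p q n b : continuous (waves p q n b).
Proof. exact: is_derive_continuous (is_derive_waves p q n b). Qed.

Lemma sin_int_pi (k : int) : sin (pi * k%:~R : R) = 0.
Proof.
have H (n : nat) : sin (pi * n%:R : R) = 0.
  have -> : pi * n%:R = 0 + pi *+ n :> R by rewrite mulr_natr add0r.
  by rewrite alternatingn ?sin0 ?mulr0//; exact: sinDpi.
case: k => k; first exact: H.
by rewrite NegzE mulrNz mulrN sinN H oppr0.
Qed.

Lemma Rint_period (k : int) A B :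
  \int[mu]_(x in `[- L / 2, L / 2]) (A * cos (2 * pi * k%:~R / L * x) + B * sin (2 * pi * k%:~R / L * x)) =
  if k == 0 then A * L else 0.
Proof.
have LL : - L / 2 <= L / 2 by rewrite ler_pM2r// ge0_cp// ltW.
case: eqP => [->|/eqP k0].
  under eq_Rintegral do rewrite mulr0 !mul0r cos0 sin0 mulr0 addr0 mulr1.
  by rewrite Rint_itv_cst//; field.
set w := 2 * pi * k%:~R / L.
have w0 : w != 0.
  by rewrite /w !mulf_neq0 ?invr_neq0 ?intr_eq0 ?(gt_eqF L0)// gt_eqF// pi_gt0.
have dF (x : R) : is_derive x (1 : R) (fun x => A / w * sin (w * x) - B / w * cos (w * x))
   (A * cos (w * x) + B * sin (w * x)).
  have ds := is_derive_sinM w x; have dc := is_derive_cosM w x.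
  by apply: is_derive_eq; rewrite /GRing.scale/=; field.
have d2 (x : R) : is_derive x (1 : R) (fun x => A * cos (w * x) + B * sin (w * x))
   (A * (- w * sin (w * x)) + B * (w * cos (w * x))).
  have ds := is_derive_sinM w x; have dc := is_derive_cosM w x.
  by apply: is_derive_eq; rewrite /GRing.scale/=; ring.
rewrite (FTC_Rint LL dF); last exact: is_derive_continuous d2.
have E1 : w * (L / 2) = pi * k%:~R by rewrite /w; field; rewrite gt_eqF.
have E2 : w * (- L / 2) = - (pi * k%:~R) by rewrite -E1; ring.
by rewrite E1 E2 sinN cosN sin_int_pi; ring.
Qed.

Lemma parseval p q n :
  \int[mu]_(x in `[- L / 2, L / 2]) (waves p q n false x ^+ 2 + waves p q n true x ^+ 2) =
  L * \sum_(j < n.*2.+1) (p j ^+ 2 + q j ^+ 2).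
Proof.
pose k i j : int := fmode n i - fmode n j.
pose T i j x : R := (p i * p j + q i * q j) * cos (2 * pi * (k i j)%:~R / L * x) +
  (p i * q j - q i * p j) * sin (2 * pi * (k i j)%:~R / L * x).
have cT i j : continuous (T i j).
{ have d2 (x : R) : is_derive x (1 : R) (T i j)
   ((p i * p j + q i * q j) * (- (2 * pi * (k i j)%:~R / L) * sin (2 * pi * (k i j)%:~R / L * x)) +
    (p i * q j - q i * p j) * (2 * pi * (k i j)%:~R / L * cos (2 * pi * (k i j)%:~R / L * x))).
    have ds := is_derive_sinM (2 * pi * (k i j)%:~R / L) x; have dc := is_derive_cosM (2 * pi * (k i j)%:~R / L) x.
    by apply: is_derive_eq; rewrite /GRing.scale/=; ring.
  exact: is_derive_continuous d2. }
transitivity (\int[mu]_(x in `[- L / 2, L / 2]) \sum_(i < n.*2.+1) \sum_(j < n.*2.+1) T i j x).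
{ apply: eq_Rintegral => x _; rewrite !expr2 /waves !big_distrlr/= -big_split/=.
  apply: eq_bigr => i _; rewrite -big_split/=; apply: eq_bigr => j _.
  rewrite /wave /T.
  have -> : 2 * pi * (k i j)%:~R / L * x = wfreq n i * x - wfreq n j * x.
    by rewrite /wfreq /k mulrzBr/=; ring.
  by rewrite cosB sinB; ring. }
rewrite (Rint_itv_sum _ (F := fun i x => \sum_(j < n.*2.+1) T i j x)); last first.
  by move=> i; exact: continuous_sum.
rewrite mulr_sumr; apply: eq_bigr => i _; rewrite Rint_itv_sum//.
rewrite (bigD1 i)//= big1 ?addr0 => [|j ji].
  rewrite Rint_period /k subrr eqxx; ring.
have kk : k i j = i%:Z - j%:Z by rewrite /k /fmode; ring.
rewrite /T Rint_period kk subr_eq0.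
case: eqP => // -[e]; move: ji; rewrite -val_eqE/= e eqxx//.
Qed.

Section one_poly.
Variables (n : nat) (a : nat -> R).
(** By Parseval this is alpha int |f|^2 + int |f'|^2 over a period, f being the trigonometric
    polynomial; it dominates both terms separately. *)
Let D2 := \sum_(i < n.*2.+1.*2) a i ^+ 2.
Let p j := fscale (fmode n j) * a j.*2.
Let q j := fscale (fmode n j) * a j.*2.+1.
Let P b := waves p q n b.
Let dp j := - (wfreq n j * q j).
Let dq j := wfreq n j * p j.
Let Q b := waves dp dq n b.

Let trigE b x : part b (trig n a x) = P b x.
Proof.
rewrite part_trig; apply: eq_bigr => j _; rewrite /wave.
have -> : fangle L (fmode n j) x = wfreq n j * x by rewrite /fangle /wfreq; ring.
by case: b; rewrite /p /q; ring.
Qed.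

Lemma trig_continuous : continuous (trig n a).
Proof.
move=> x; apply/cvgrPdist_le => e e0.
have e2 : 0 < e / 2 by rewrite divr_gt0.
have c b : \forall y \near x, `|P b x - P b y| <= e / 2.
  by have /cvgrPdist_le/(_ _ e2) := (@continuous_waves p q n b) x.
have c0 := c false; have c1 := c true; near=> y.
apply: (le_trans (norm_le_parts _)); rewrite -[X in `|X| + _]/(part false _) -[X in _ + `|X|]/(part true _) !partB !trigE [leRHS]splitr.
by apply: lerD; near: y.
Unshelve. all: by end_near. Qed.

Definition trig_path : path_space R := mkcts trig_continuous.

Let G x := P false x ^+ 2 + P true x ^+ 2.
Let H x := Q false x ^+ 2 + Q true x ^+ 2.

Let normE x : `|trig n a x| ^+ 2 = G x.
Proof. by rewrite Rcomplex_norm2E /G -!trigE. Qed.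

Let cG : continuous G.
Proof.
by move=> x; apply: cvgD; apply: cvgM; exact: continuous_waves.
Qed.

Let cH : continuous H.
Proof.
by move=> x; apply: cvgD; apply: cvgM; exact: continuous_waves.
Qed.

Let G0 x : 0 <= G x. Proof. by rewrite addr_ge0 ?sqr_ge0. Qed.
Let H0 x : 0 <= H x. Proof. by rewrite addr_ge0 ?sqr_ge0. Qed.

Let massE : mass L trig_path = \int[mu]_(x in `[- L / 2, L / 2]) G x.
Proof. by apply: eq_Rintegral => x _; exact: normE. Qed.

Lemma mass_trigE : mass L trig_path =
  \sum_(j < n.*2.+1) (fdenom (fmode n j))^-1 * (a j.*2 ^+ 2 + a j.*2.+1 ^+ 2).
Proof.
rewrite massE parseval mulr_sumr; apply: eq_bigr => j _.
rewrite /p /q !(exprMn _ (fscale _)) -mulrDr fscale2// mulrA invfM mulrA mulfV ?gt_eqF// mul1r//.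
Qed.

Lemma mass_trig_le : mass L trig_path <= D2 / alpha.
Proof.
rewrite mass_trigE /D2 (sum_double _ (fun i => a i ^+ 2)) mulr_suml.
apply: ler_sum => j _; rewrite mulrC ler_wpM2l ?addr_ge0 ?sqr_ge0// lef_pV2 ?posrE ?fdenom_gt0//.
exact: fdenom_ge.
Qed.

Let dmass_le : \int[mu]_(x in `[- L / 2, L / 2]) H x <= D2.
Proof.
rewrite parseval /D2 (sum_double _ (fun i => a i ^+ 2)) mulr_sumr.
apply: ler_sum => j _; rewrite /dp /dq /p /q sqrrN !(exprMn _ (wfreq n j)) !(exprMn _ (fscale _)) fscale2//.
have -> : wfreq n j ^+ 2 = fdenom (fmode n j) - alpha by rewrite /fdenom /wfreq; ring.
have f0 := fdenom_gt0 L alpha0 (fmode n j).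
have -> : L * ((fdenom (fmode n j) - alpha) * ((L * fdenom (fmode n j))^-1 * a j.*2.+1 ^+ 2) +
  (fdenom (fmode n j) - alpha) * ((L * fdenom (fmode n j))^-1 * a j.*2 ^+ 2)) =
  (a j.*2 ^+ 2 + a j.*2.+1 ^+ 2) - alpha / fdenom (fmode n j) * (a j.*2 ^+ 2 + a j.*2.+1 ^+ 2).
  by field; rewrite !gt_eqF.
rewrite lerBlDr lerDl mulr_ge0 ?addr_ge0 ?sqr_ge0// divr_ge0// ltW//.
Qed.

Let dG (x : R) : is_derive x (1 : R) G (2 * (P false x * Q false x + P true x * Q true x)).
Proof.
have d0 := is_derive_waves p q n false x; have d1 := is_derive_waves p q n true x.
rewrite (_ : G = (fun x => P false x * P false x + P true x * P true x)); last first.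
  by apply/funext => y; rewrite /G !expr2.
by apply: is_derive_eq; rewrite /GRing.scale/= -/(P false x) -/(P true x) -/(Q false x) -/(Q true x); ring.
Qed.

Let cdG : continuous (fun x => 2 * (P false x * Q false x + P true x * Q true x)).
Proof.
move=> x; apply: cvgM; first exact: cvg_cst.
by apply: cvgD; apply: cvgM; exact: continuous_waves.
Qed.

Let dG_le t x : 0 < t -> `|2 * (P false x * Q false x + P true x * Q true x)| <= t * G x + t^-1 * H x.
Proof.
move=> t0; rewrite /G /H; move: (P _ x) (P _ x) (Q _ x) (Q _ x) => u v y z.
have [s s0 ts] : exists2 s : R, 0 < s & t = s ^+ 2.
  by exists (Num.sqrt t); rewrite ?sqrtr_gt0// sqr_sqrtr// ltW.
rewrite ts; set r := (s ^+ 2)^-1.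
have E1 : s ^+ 2 * (u ^+ 2 + v ^+ 2) + r * (y ^+ 2 + z ^+ 2) - 2 * (u * y + v * z) =
   (s * u - s^-1 * y) ^+ 2 + (s * v - s^-1 * z) ^+ 2 by rewrite /r; field; rewrite gt_eqF.
have E2 : s ^+ 2 * (u ^+ 2 + v ^+ 2) + r * (y ^+ 2 + z ^+ 2) + 2 * (u * y + v * z) =
   (s * u + s^-1 * y) ^+ 2 + (s * v + s^-1 * z) ^+ 2 by rewrite /r; field; rewrite gt_eqF.
have F1 := addr_ge0 (sqr_ge0 (s * u - s^-1 * y)) (sqr_ge0 (s * v - s^-1 * z)).
have F2 := addr_ge0 (sqr_ge0 (s * u + s^-1 * y)) (sqr_ge0 (s * v + s^-1 * z)).
rewrite -E1 in F1; rewrite -E2 in F2.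
rewrite ler_norml; apply/andP; split; lra.
Qed.

Let mean_bound t A B x : 0 < t -> x \in `[A, B] ->
  (B - A) * G x <= \int[mu]_(y in `[A, B]) G y + (B - A) *
    (t * \int[mu]_(y in `[A, B]) G y + t^-1 * \int[mu]_(y in `[A, B]) H y).
Proof.
move=> t0 xAB; rewrite -!Rint_itvZ// -Rint_itvD.
- apply: (derive_mean_bound dG cdG) => //; last by move=> y; exact: dG_le.
  move=> y; apply: cvgD.
    by apply: cvgM; [exact: cvg_cst|exact: cG].
  by apply: cvgM; [exact: cvg_cst|exact: cH].
- by move=> y; apply: cvgM; [exact: cvg_cst|exact: cG].
- by move=> y; apply: cvgM; [exact: cvg_cst|exact: cH].
Qed.

(** An inequality of Gagliardo-Nirenberg type: |f|^2 exceeds its mean over the period by at most the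
    integral of |(|f|^2)'|, hence by t int |f|^2 + (1 / t) int |f'|^2 for every t > 0. A positive
    bound [mh] replaces the mass, by which one could not divide if it vanished. *)
Lemma sobolev_trig (mh : R) x : 0 < mh -> mass L trig_path <= mh -> - L / 2 <= x <= L / 2 ->
  (`|trig n a x| ^+ 2) ^+ 2 <= 2 * (mh / L) ^+ 2 + 8 * mh * D2.
Proof.
move=> mh0 mhG xL; rewrite normE.
have D20 : 0 <= D2 by apply: sumr_ge0 => i _; exact: sqr_ge0.
have h t : 0 < t -> G x <= mh / L + t * mh + D2 / t.
{ move=> t0; have := @mean_bound t (- L / 2) (L / 2) x t0.
  rewrite in_itv/= => /(_ xL); have -> : L / 2 - - L / 2 = L by field.
  rewrite massE in mhG; have dm := dmass_le.
  set I1 := (X in X + _) in mhG *; set I2 := (X in X <= _) in dm => h1.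
  rewrite -(ler_pM2l L0); apply: (le_trans h1).
  have -> : L * (mh / L + t * mh + D2 / t) = mh + L * (t * mh + t^-1 * D2) by field; rewrite !gt_eqF.
  apply: lerD => //; rewrite ler_wpM2l ?(ltW L0)//; apply: lerD; first by rewrite ler_wpM2l// ltW.
  by rewrite ler_wpM2l// invr_ge0 ltW. }
have mL : 0 < mh / L by rewrite divr_gt0.
have [le|gt] := leP (G x) (mh / L).
  apply: (@le_trans _ _ ((mh / L) ^+ 2)); first by rewrite lerXn2r ?nnegrE ?(ltW mL).
  have := sqr_ge0 (mh / L); have := mulr_ge0 (mulr_ge0 (ler0n R 8) (ltW mh0)) D20; lra.
pose X := G x - mh / L; have X0 : 0 < X by rewrite subr_gt0.
(* X is the excess over the mean. For this t the mass term is X / 2, which the left side absorbs. *)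
have := h (X / (2 * mh)); rewrite divr_gt0 ?mulr_gt0// => /(_ isT).
have -> : X / (2 * mh) * mh = X / 2 by field; rewrite gt_eqF.
have -> : D2 / (X / (2 * mh)) = 2 * mh * D2 / X by field; rewrite !gt_eqF.
have -> : G x = X + mh / L by rewrite subrK.
move=> h1; have h2 : X / 2 <= 2 * mh * D2 / X by lra.
have h3 : X ^+ 2 <= 4 * mh * D2.
  by move: h2; rewrite ler_pdivlMr// -(ler_pM2l (ltr0n R 2)); rewrite expr2; lra.
have h4 := sqr_ge0 (X - mh / L); rewrite sqrrB in h4; rewrite sqrrD; lra.
Qed.

(** On one tile |f|^2 is at most (1 / s + 1) int |f|^2 + int |f'|^2 over that tile. These local
    norms add up, so the squared suprema sum to at most a multiple of D2 that depends on s but not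
    on the number of tiles. *)
Lemma tile_bound (N : nat) (s : R) : 0 < s -> s * N%:R = L ->
  exists e : nat -> R, [/\ forall j, 0 <= e j,
    forall j, (j < N)%N -> forall x, - L / 2 + s * j%:R <= x <= - L / 2 + s * j.+1%:R -> `|trig n a x| ^+ 2 <= e j &
    \sum_(j < N) e j <= ((s^-1 + 1) / alpha + 1) * D2].
Proof.
move=> s0 sN; pose pt (j : nat) := - L / 2 + s * j%:R.
pose e j := (s^-1 + 1) * \int[mu]_(y in `[pt j, pt j.+1]) G y + \int[mu]_(y in `[pt j, pt j.+1]) H y.
have s1 : 0 <= s^-1 + 1 by rewrite addr_ge0// invr_ge0 ltW.
exists e; split.
- by move=> j; rewrite addr_ge0 ?mulr_ge0 ?Rint_itv_ge0.
- move=> j jN x xj; rewrite normE.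
  have := @mean_bound 1 (pt j) (pt j.+1) x ltr01; rewrite in_itv/= => /(_ xj).
  have -> : pt j.+1 - pt j = s by rewrite /pt -natr1; ring.
  move=> h; rewrite -(ler_pM2l s0); apply: (le_trans h).
  rewrite /e invr1 !mul1r le_eqVlt; apply/orP; left; apply/eqP; field; rewrite gt_eqF//.
- have pt0 : pt 0%N = - L / 2 by rewrite /pt mulr0 addr0.
  have ptN : pt N = L / 2 by rewrite /pt sN; field.
  have tel f : continuous f -> \sum_(j < N) \int[mu]_(y in `[pt j, pt j.+1]) f y = \int[mu]_(y in `[pt 0%N, pt N]) f y.
    by move=> cf; rewrite pt0; exact: Rint_itv_tiles cf (ltW s0).
  rewrite big_split/= -mulr_sumr !tel// pt0 ptN -massE (mulrDl _ 1 D2) mul1r; apply: lerD; last exact: dmass_le.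
  by rewrite -mulrA ler_wpM2l// mulrC mass_trig_le.
Qed.

End one_poly.
End trig_calculus.

(** * Mass and potential *)

Section riemann_sums.
Context (R : realType).
Notation mu := (@lebesgue_measure R).
Implicit Types (f : R -> R).

Lemma Rint_itv_near f a b c e : continuous f -> a <= b -> (forall x, x \in `[a, b] -> `|f x - c| <= e) ->
  `|\int[mu]_(x in `[a, b]) f x - (b - a) * c| <= (b - a) * e.
Proof.
move=> cf ab fc; have cc d : continuous (fun _ : R => d : R) by move=> x; exact: cvg_cst.
have h1 : \int[mu]_(x in `[a, b]) (c - e) <= \int[mu]_(x in `[a, b]) f x.
  by apply: Rint_itv_le => // x /fc; rewrite ler_norml; lra.
have h2 : \int[mu]_(x in `[a, b]) f x <= \int[mu]_(x in `[a, b]) (c + e).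
  by apply: Rint_itv_le => // x /fc; rewrite ler_norml; lra.
by move: h1 h2; rewrite !Rint_itv_cst// ler_norml mulrBl mulrDl (mulrC c) (mulrC e) => h1 h2; apply/andP; split; lra.
Qed.

Lemma riemann_cvg f a b : continuous f -> a <= b ->
  \sum_(i < n.+1) (b - a) / n.+1%:R * f (a + (b - a) / n.+1%:R * i%:R) @[n --> \oo] -->
  \int[mu]_(x in `[a, b]) f x.
Proof.
move=> cf ab; apply/cvgrPdist_le => e e0.
have ba0 : 0 <= b - a by rewrite subr_ge0.
have e1 : 0 < e / (b - a + 1) by rewrite divr_gt0// ltr_wpDl.
have [d d0 hd] := heine a b cf e1.
have /cvgrPdist_lt/(_ _ d0) := cvg_div_n (b - a); apply: filterS => n.
have s0 : 0 <= (b - a) / n.+1%:R by rewrite divr_ge0.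
rewrite sub0r normrN ger0_norm//; move: s0; set s := (b - a) / n.+1%:R => s0 sd.
have sE : a + s * n.+1%:R = b by rewrite /s divfK// addrC subrK.
rewrite -{1}sE -Rint_itv_tiles// -sumrB; apply: (le_trans (ler_norm_sum _ _ _)).
have dE (i : nat) : a + s * i.+1%:R - (a + s * i%:R) = s by rewrite -natr1; ring.
apply: (@le_trans _ _ (\sum_(i < n.+1) s * (e / (b - a + 1)))).
{ apply: ler_sum => i _; have := @Rint_itv_near f (a + s * i%:R) (a + s * i.+1%:R) (f (a + s * i%:R)) (e / (b - a + 1)) cf.
  rewrite dE; apply; first by rewrite lerD2l ler_wpM2l// ler_nat.
  move=> x; rewrite in_itv/= => /andP[x1 x2]; apply/ltW; rewrite distrC; apply: hd.
    rewrite in_itv/= lerDl mulr_ge0//= -sE lerD2l ler_wpM2l// ler_nat; exact/ltnW/ltn_ord.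
  rewrite distrC ger0_norm ?subr_ge0//; apply: le_lt_trans sd.
  by have := dE i; lra. }
rewrite sumr_const card_ord -mulr_natl mulrA.
have -> : n.+1%:R * s = b - a by rewrite /s mulrC divfK.
by rewrite mulrCA -[leRHS]mulr1 ler_wpM2l ?(ltW e0)// ler_pdivrMr ?ltr_wpDl// mul1r lerDl.
Qed.

(** Both sides are limits of the same Riemann sums. *)
Lemma Rint_itv_shift f a b r : continuous f -> a <= b ->
  \int[mu]_(x in `[a, b]) f (x + r) = \int[mu]_(x in `[a + r, b + r]) f x.
Proof.
move=> cf ab.
have cfr : continuous (fun x => f (x + r)).
  move=> x; apply: (@continuous_comp _ _ _ (fun x => x + r) f); last exact: cf.
  by apply: cvgD; [exact: cvg_id|exact: cvg_cst].
have ab' : a + r <= b + r by rewrite lerD2r.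
have L1 := riemann_cvg cfr ab; have L2 := riemann_cvg cf ab'.
suff L3 : \sum_(i < n.+1) (b - a) / n.+1%:R * f (a + (b - a) / n.+1%:R * i%:R + r) @[n --> \oo] -->
    \int[mu]_(x in `[a + r, b + r]) f x by exact: (cvg_unique _ L1 L3).
have e : b + r - (a + r) = b - a by ring.
rewrite e in L2; apply: cvg_trans L2; apply: near_eq_cvg; apply: nearW => n.
by apply: eq_bigr => i _; rewrite addrAC.
Qed.

Lemma Rint_periodic_shift f L r : continuous f -> 0 <= L -> `|r| <= L -> (forall x, f (x + L) = f x) ->
  \int[mu]_(x in `[- L / 2, L / 2]) f (x + r) = \int[mu]_(x in `[- L / 2, L / 2]) f x.
Proof.
move=> cf L0.
have LL : - L / 2 <= L / 2 by lra.
have pos r' g : continuous g -> (forall x, g (x + L) = g x) -> 0 <= r' <= L ->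
  \int[mu]_(x in `[- L / 2, L / 2]) g (x + r') = \int[mu]_(x in `[- L / 2, L / 2]) g x.
{ move=> cg pg /andP[r0 rL].
  rewrite Rint_itv_shift//.
  rewrite (@Rint_itv_split _ g (- L / 2 + r') (L / 2))//; [|lra|lra].
  rewrite (@Rint_itv_split _ g (- L / 2) (- L / 2 + r') (L / 2))//; [|lra|lra].
  rewrite addrC; congr (_ + _).
  have -> : L / 2 = - L / 2 + L by field.
  have -> : - L / 2 + L + r' = - L / 2 + r' + L by ring.
  rewrite -Rint_itv_shift//; last lra.
  by apply: eq_Rintegral => x _. }
move=> rL pf; have [r0|r0] := leP 0 r.
  by apply: pos => //; rewrite r0/=; apply: le_trans rL; exact: ler_norm.
have cfr : continuous (fun x => f (x + r)).
  move=> x; apply: (@continuous_comp _ _ _ (fun x => x + r) f); last exact: cf.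
  by apply: cvgD; [exact: cvg_id|exact: cvg_cst].
rewrite -(pos (- r) (fun x => f (x + r)))//.
- by apply: eq_Rintegral => x _; rewrite addrNK.
- by move=> x; rewrite addrAC.
- by rewrite oppr_ge0 (ltW r0)/= -(ltr0_norm r0).
Qed.

Lemma continuous_norm_powR (p : R) : 0 < p -> continuous (fun y : R => `|y| `^ p).
Proof.
move=> p0 y; have [->|y0] := eqVneq y 0.
- apply/cvgrPdist_le => e e0; rewrite normr0 powR0 ?gt_eqF//.
  have d0 : 0 < e `^ p^-1 by exact: powR_gt0.
  have /cvgrPdist_lt/(_ _ d0) : (x @[x --> (0 : R)]) --> (0 : R) by exact: cvg_id.
  apply: filterS => x; rewrite !sub0r !normrN => xd.
  rewrite ger0_norm ?powR_ge0//.
  have -> : e = (e `^ p^-1) `^ p by rewrite -powRrM mulVf ?gt_eqF// powRr1// ltW.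
  by rewrite ge0_ler_powR ?nnegrE ?(ltW p0) ?(ltW d0)// ltW.
- have ny : 0 < `|y| by rewrite normr_gt0.
  have cl : {for y, continuous (fun x : R => ln `|x|)}.
    by move=> U /(continuous_ln ny) h; exact: (@norm_continuous _ R y _ h).
  have E (x : R) : x != 0 -> `|x| `^ p = expR (p * ln `|x|) by move=> x0; rewrite /powR normr_eq0 (negPf x0).
  rewrite /continuous_at (E y)//; apply: (@cvg_trans _ (expR (p * ln `|x|) @[x --> y])).
    apply: near_eq_cvg; have /cvgrPdist_lt/(_ _ ny) : (x @[x --> y]) --> y by exact: cvg_id.
    apply: filterS => x h; rewrite E//; apply: contraTneq h => ->; by rewrite subr0 ltxx.
  apply: (@cvg_comp _ _ _ (fun x : R => p * ln `|x|) expR _ (nbhs (p * ln `|y|))); last exact: continuous_expR.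
  apply: cvgM; first exact: cvg_cst.
  exact: cl.
Qed.

End riemann_sums.

Section energies.
Context (R : realType).
Notation mu := (@lebesgue_measure R).
Notation prob := (probability (borel (path_space R)) R).
Implicit Types (g : R -> R) (phi psi : path_space R).

Definition energy g (L : R) phi : R := \int[mu]_(x in `[- L / 2, L / 2]) g `|phi x|.

Lemma norm_path_continuous phi : continuous (fun x : R => `|phi x|).
Proof. by move=> x; apply: cvg_norm; exact: (@path_continuous _ phi). Qed.

Lemma energy_fun_continuous g phi : continuous g -> continuous (fun x : R => g `|phi x|).
Proof.
move=> cg x; apply: (@continuous_comp _ _ _ (fun x => `|phi x|) g); first exact: norm_path_continuous.
exact: cg.
Qed.

Lemma energy_continuous g L : continuous g -> 0 <= L -> continuous (energy g L).
Proof.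
move=> cg L0 phi; have FF : Filter (nbhs phi) by exact: nbhs_filter.
apply/cvgrPdist_le => e e0.
have LL : - L / 2 <= L / 2 by lra.
have [c _ hc] := @EVT_max _ (fun x => `|phi x|) (- L / 2) (L / 2) LL (continuous_subspaceT (@norm_path_continuous phi)).
have e1 : 0 < e / (L + 1) by rewrite divr_gt0// ltr_wpDl.
have [d d0 hd] := heine (- `|phi c|) `|phi c| cg e1.
have := path_nbhs_uniform phi L d0; apply: filterS => psi h.
have cphi := @energy_fun_continuous g phi cg; have cpsi := @energy_fun_continuous g psi cg.
have cN : continuous (fun x => -1 * g `|psi x|) by move=> x; apply: cvgM; [exact: cvg_cst|exact: cpsi].
have -> : energy g L phi - energy g L psi = \int[mu]_(x in `[- L / 2, L / 2]) (g `|phi x| + -1 * g `|psi x|).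
  by rewrite Rint_itvD// Rint_itvZ// mulN1r.
have := @Rint_itv_near R (fun x => g `|phi x| + -1 * g `|psi x|) (- L / 2) (L / 2) 0 (e / (L + 1)).
rewrite mulr0 subr0; have -> : L / 2 - - L / 2 = L by field.
move=> H; apply: (le_trans (H _ LL _)).
- by move=> x; apply: cvgD; [exact: cphi|exact: cN].
- move=> x xL; rewrite subr0 mulN1r; apply/ltW/hd.
    by rewrite in_itv/= hc// andbT (le_trans _ (normr_ge0 _))// oppr_le0.
  apply: le_lt_trans (ler_dist_dist _ _) _; apply: h.
  by move: xL; rewrite in_itv/= => xL; rewrite ler_norml; lra.
- by rewrite mulrCA -[leRHS]mulr1 ler_wpM2l ?(ltW e0)// ler_pdivrMr ?ltr_wpDl// mul1r lerDl.
Qed.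

Lemma measurable_energy g L : continuous g -> 0 <= L ->
  measurable_fun setT (energy g L : borel (path_space R) -> R).
Proof. by move=> cg L0; apply: borel_continuous_measurable; exact: energy_continuous. Qed.

Lemma energy_shift g L r phi : continuous g -> 0 <= L -> `|r| <= L -> periodic_paths L phi ->
  energy g L (path_shift r phi) = energy g L phi.
Proof.
move=> cg L0 rL pphi; apply: (@Rint_periodic_shift _ (fun x => g `|phi x|)) => //.
  exact: energy_fun_continuous.
by move=> x; rewrite pphi.
Qed.

(** Riemann sums and Fatou's lemma replace Fubini's theorem, which would involve joint measurability
    in the point and the path. *)
Lemma energy_integral_le g L (m : prob) c : continuous g -> (forall y, 0 <= g y) -> 0 <= L ->
  (forall x, \int[m]_phi (g `|phi x|)%:E <= c%:E)%E ->
  (\int[m]_phi (energy g L phi)%:E <= (L * c)%:E)%E.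
Proof.
move=> cg g0 L0 gc.
have LL : - L / 2 <= L / 2 by lra.
pose s n : R := L / n.+1%:R; have s0 n : 0 <= s n by rewrite divr_ge0.
pose f n (phi : borel (path_space R)) := \sum_(i < n.+1) s n * g `|phi (- L / 2 + s n * i%:R)|.
have mg x : measurable_fun setT (fun phi : borel (path_space R) => g `|phi x|).
{ apply: measurableT_comp; first exact: continuous_mfun.
  under eq_fun do rewrite Rcomplex_normE.
  apply: measurableT_comp; first exact: continuous_mfun (@sqrt_continuous R).
  by apply: measurable_funD; apply: measurable_funX; apply: borel_continuous_measurable;
    [exact: (@eval_continuous R false)|exact: (@eval_continuous R true)]. }
apply: (@fatou_bound _ _ R m f) => [n||n x|x||n].
- by apply: measurable_sum => i; apply: measurable_funM.
- exact: measurable_energy.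
- by apply: sumr_ge0 => i _; rewrite mulr_ge0.
- exact: Rint_itv_ge0.
- apply: aeW => phi; have := riemann_cvg (@energy_fun_continuous g phi cg) LL.
  by have -> : L / 2 - - L / 2 = L by field.
- rewrite /f; under eq_integral do rewrite -sumEFin.
  rewrite ge0_integral_sum//; last 2 first.
    by move=> i; apply/measurable_EFinP; apply: measurable_funM.
    by move=> i phi _; rewrite lee_fin mulr_ge0.
  apply: (@le_trans _ _ (\sum_(i < n.+1) (s n * c)%:E)%E).
    apply: lee_sum => i _; under eq_integral do rewrite EFinM.
    rewrite ge0_integralZl// ?lee_fin//; last 2 first.
    - exact/measurable_EFinP.
    - by move=> phi _; rewrite lee_fin.
    by apply: (@le_trans _ _ ((s n)%:E * c%:E)%E); [apply: lee_wpmul2l; rewrite ?lee_fin|].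
  rewrite sumEFin lee_fin sumr_const card_ord -mulr_natl mulrA.
  by have -> : n.+1%:R * s n = L by rewrite /s mulrC divfK.
Qed.

Section gaussian.
Variables (m : prob) (cov : R -> R).
Hypotheses (gf : gaussian_field m cov) (cov0 : 0 <= cov 0).

Lemma part_char b (x t c : R) :
  \int[m]_phi cos (t * part b (phi x) + c) = expR (- (cov 0 / 2 * t ^+ 2 / 2)) * cos c.
Proof.
pose ts (i : nat) := if odd i == b then t else 0.
transitivity (\int[m]_phi cos (\sum_(i < 2%N) ts i * path_coord (fun=> x) i phi + c)).
  apply: eq_Rintegral => phi _; congr (cos (_ + _)).
  by rewrite !big_ord_recr big_ord0 /= /ts /path_coord /=; case: (b) => /=; ring.
rewrite gf; congr (expR (- _) * _).
by rewrite !big_ord_recr !big_ord0 /= /ts /= !subrr; case: (b) => /=; field.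
Qed.

Let mpart b x : measurable_fun setT (fun phi : borel (path_space R) => part b (phi x)).
Proof. by apply: borel_continuous_measurable; exact: eval_continuous. Qed.

Let ch b x (t : R) : \int[m]_phi cos (t * part b (phi x)) = expR (- (cov 0 / 2 * t ^+ 2 / 2)).
Proof. by have := part_char b x t 0; rewrite cos0 mulr1 => <-; apply: eq_Rintegral => phi _; rewrite addr0. Qed.

Let s0 : 0 <= cov 0 / 2. Proof. by rewrite divr_ge0. Qed.

Lemma norm2_moment x : (\int[m]_phi (`|phi x| ^+ 2)%:E <= (cov 0)%:E)%E.
Proof.
under eq_integral do rewrite Rcomplex_norm2E EFinD.
rewrite ge0_integralD//; last 4 first.
- by move=> phi _; rewrite lee_fin sqr_ge0.
- by apply/measurable_EFinP/measurable_funX; exact: (mpart false).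
- by move=> phi _; rewrite lee_fin sqr_ge0.
- by apply/measurable_EFinP/measurable_funX; exact: (mpart true).
rewrite (gaussian_moment2 (mpart false x) s0 (ch false x)) (gaussian_moment2 (mpart true x) s0 (ch true x)).
by rewrite -EFinD lee_fin -splitr.
Qed.

Lemma norm6_moment x : (\int[m]_phi (1 + `|phi x| ^+ 6)%:E <= (1 + 31 * cov 0 ^+ 3)%:E)%E.
Proof.
have me b : measurable_fun setT (fun phi : borel (path_space R) => (part b (phi x) ^+ 6)%:E).
  by apply/measurable_EFinP/measurable_funX; exact: mpart.
have ge b (phi : path_space R) : (0 <= (part b (phi x) ^+ 6)%:E)%E by rewrite lee_fin exprn_even_ge0.
apply: (@le_trans _ _ (\int[m]_phi (1%:E + 4%:E * ((part false (phi x) ^+ 6)%:E + (part true (phi x) ^+ 6)%:E)))%E).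
  apply: ge0_le_integral => //.
  - apply/measurable_EFinP; apply: measurable_funD => //.
    under eq_fun do rewrite -[6%N]/(2 * 3)%N exprM Rcomplex_norm2E.
    by apply: measurable_funX; apply: measurable_funD; apply: measurable_funX; [exact: (mpart false)|exact: (mpart true)].
  - by apply: emeasurable_funD => //; apply: emeasurable_funM => //; exact: emeasurable_funD.
  - move=> phi _; suff h : 1 + `|phi x| ^+ 6 <= 1 + 4 * (part false (phi x) ^+ 6 + part true (phi x) ^+ 6).
      by rewrite -lee_fin in h.
    rewrite lerD2l -[6%N]/(2 * 3)%N !exprM Rcomplex_norm2E /part.
    move: (complex.Re _ ^+ 2) (complex.Im _ ^+ 2) (sqr_ge0 (complex.Re (phi x))) (sqr_ge0 (complex.Im (phi x))) => u v u0 v0.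
    have -> : 4 * (u ^+ 3 + v ^+ 3) = (u + v) ^+ 3 + 3 * ((u + v) * (u - v) ^+ 2) by ring.
    by rewrite lerDl; apply: mulr_ge0 => //; apply: mulr_ge0; [exact: addr_ge0|exact: sqr_ge0].
have mD : measurable_fun setT (fun phi : borel (path_space R) => ((part false (phi x) ^+ 6)%:E + (part true (phi x) ^+ 6)%:E)%E).
  exact: emeasurable_funD.
rewrite ge0_integralD//; last 2 first.
- by move=> phi _; rewrite mule_ge0// ?adde_ge0.
- exact: emeasurable_funM.
rewrite ge0_integralZl//; last by move=> phi _; rewrite adde_ge0.
rewrite ge0_integralD//.
have -> : (\int[m]_phi 1%:E = 1%:E)%E.
  by rewrite integral_cst// -[RHS]mule1; congr (_ * _)%E; exact: probability_setT.
have h b := gaussian_moment6 (mpart b x) s0 (ch b x).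
apply: (@le_trans _ _ (1%:E + 4%:E * ((31 * (cov 0 / 2) ^+ 3)%:E + (31 * (cov 0 / 2) ^+ 3)%:E))%E).
  by apply: leeD => //; apply: lee_wpmul2l => //; apply: leeD; exact: h.
suff h' : 1 + 4 * (31 * (cov 0 / 2) ^+ 3 + 31 * (cov 0 / 2) ^+ 3) <= 1 + 31 * cov 0 ^+ 3 by rewrite -lee_fin in h'.
rewrite lerD2l le_eqVlt; apply/orP; left; apply/eqP; by field.
Qed.

End gaussian.
End energies.

(** * Exponential moments of the potential *)

Section potential_estimate.
Context (R : realType).

Lemma powRD_le64 (p x y : R) : 0 <= p <= 6 -> 0 <= x -> 0 <= y ->
  (x + y) `^ p <= 64 * (x `^ p + y `^ p).
Proof.
move=> /andP[p0 p6].
have key (u v : R) : 0 <= u -> u <= v -> (u + v) `^ p <= 64 * (u `^ p + v `^ p).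
{ move=> u0 uv; have v0 := le_trans u0 uv.
  apply: (@le_trans _ _ ((2 * v) `^ p)).
    by apply: ge0_ler_powR => //; rewrite ?nnegrE ?addr_ge0 ?mulr_ge0//; lra.
  rewrite powRM//; apply: ler_pM; rewrite ?powR_ge0//; last by rewrite lerDr powR_ge0.
  apply: (@le_trans _ _ (2 `^ 6)); first by apply: ler_powR => //; lra.
  by rewrite powR_mulrn//; rewrite -natrX. }
move=> x0 y0; have [xy|yx] := leP x y; first exact: key.
by rewrite addrC [_ `^ p + _]addrC; apply: key => //; exact: ltW.
Qed.

(** Below T the first term suffices; above T, z^q = z^(q - 2) z^2 with q < 2. For q = p / 2 - 1 and
    z a squared modulus, the Sobolev bound on z^2 enters linearly, with a factor T^(q - 2) that is
    small for large T. *)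
Lemma powR_split_le (q T Y z : R) : 0 < q < 2 -> 0 < T -> 0 <= z -> z ^+ 2 <= Y ->
  z `^ q <= T `^ q + T `^ (q - 2) * Y.
Proof.
move=> /andP[q0 q2] T0 z0 zY; have Y0 : 0 <= Y by apply: le_trans zY; exact: sqr_ge0.
have [zT|Tz] := leP z T.
  apply: (@le_trans _ _ (T `^ q)); last by rewrite lerDl mulr_ge0 ?powR_ge0.
  by apply: ge0_ler_powR => //; rewrite ?nnegrE// ltW.
have zp := lt_trans T0 Tz.
apply: (@le_trans _ _ (T `^ (q - 2) * Y)); last by rewrite lerDr powR_ge0.
have -> : z `^ q = z `^ (q - 2) * z ^+ 2.
  rewrite -powR_mulrn// -powRD; last by rewrite (gt_eqF zp)/= implybT.
  by rewrite subrK.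
apply: ler_pM; rewrite ?powR_ge0 ?sqr_ge0//.
have -> : q - 2 = - (2 - q) by ring.
rewrite !powRN lef_pV2 ?posrE ?powR_gt0//.
by apply: ge0_ler_powR; rewrite ?nnegrE ?(ltW T0) ?(ltW zp) ?(ltW Tz)//; lra.
Qed.

Lemma powR_sqr_split (p T Y x : R) : 2 < p < 6 -> 0 < T -> 0 <= x -> (x ^+ 2) ^+ 2 <= Y ->
  x `^ p <= (T `^ (p / 2 - 1) + T `^ (p / 2 - 3) * Y) * x ^+ 2.
Proof.
move=> /andP[p2 p6] T0 x0 xY.
have h := @powR_split_le (p / 2 - 1) T Y (x ^+ 2) _ T0 (sqr_ge0 x) xY.
have -> : x `^ p = (x ^+ 2) `^ (p / 2 - 1) * x ^+ 2.
  have [->|xn0] := eqVneq x 0; first by rewrite powR0 ?expr0n/= ?mulr0//; lra.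
  rewrite -powR_mulrn// -powRrM -powRD; last by rewrite xn0 implybT.
  by congr (_ `^ _); field.
rewrite ler_wpM2r ?sqr_ge0//.
have -> : p / 2 - 3 = p / 2 - 1 - 2 by ring.
by apply: h; apply/andP; split; lra.
Qed.

Variables (alpha L : R).
Hypotheses (alpha0 : 0 < alpha) (L0 : 0 < L).
Notation mu := (@lebesgue_measure R).
Notation trig_path := (trig_path alpha L).

Let csq : continuous (fun y : R => y ^+ 2). Proof. by move=> y; apply: exprn_continuous. Qed.

Let LL : - L / 2 <= L / 2. Proof. by move: (ltW L0); lra. Qed.

Lemma massE_energy (phi : path_space R) : mass L phi = energy (fun y => y ^+ 2) L phi.
Proof. by []. Qed.

Lemma potentialE_energy p (phi : path_space R) : potential p L phi = energy (fun y => `|y| `^ p) L phi.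
Proof. by apply: eq_Rintegral => x _; rewrite normr_id. Qed.

(** A single functional that dominates both the mass and the potential for every 2 < p < 6; its mean
    is of order L. *)
Definition moment6 (phi : path_space R) : R := energy (fun y => 1 + y ^+ 6) L phi.

Lemma continuous_one_sixth : continuous (fun y : R => 1 + y ^+ 6).
Proof. by move=> y; apply: cvgD; [exact: cvg_cst|exact: exprn_continuous]. Qed.

Lemma mass_le_moment6 phi : mass L phi <= moment6 phi.
Proof.
apply: Rint_itv_le.
- exact: energy_fun_continuous csq.
- exact: energy_fun_continuous continuous_one_sixth.
- move=> x _; move: `|phi x| => y.
  have -> : y ^+ 6 = (y ^+ 2) ^+ 3 by rewrite -exprM.
  move: (y ^+ 2) (sqr_ge0 y) => z z0; have [z1|z1] := leP z 1.
    by rewrite (le_trans z1)// lerDl exprn_ge0.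
  by apply: (@le_trans _ _ (z ^+ 3)); [rewrite -[leLHS]expr1 ler_eXn2l|rewrite lerDr].
Qed.

Lemma potential_le_moment6 p phi : 2 < p < 6 -> potential p L phi <= moment6 phi.
Proof.
move=> /andP[p2 p6]; have p0 : 0 < p by lra.
rewrite potentialE_energy; apply: Rint_itv_le.
- exact: energy_fun_continuous (continuous_norm_powR p0).
- exact: energy_fun_continuous continuous_one_sixth.
- move=> x _; rewrite normr_id; move: `|phi x| (normr_ge0 (phi x)) => y y0.
  have [y1|y1] := leP y 1.
    apply: (@le_trans _ _ (1 `^ p)); last by rewrite powR1 lerDl exprn_ge0.
    by apply: ge0_ler_powR => //; rewrite ?nnegrE// ltW.
  apply: (@le_trans _ _ (y `^ 6)); first by apply: ler_powR; rewrite ltW.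
  by rewrite powR_mulrn// lerDr.
Qed.

Lemma mass_ge0 (phi : path_space R) : 0 <= mass L phi.
Proof. by apply: Rint_itv_ge0 => x; exact: sqr_ge0. Qed.

Lemma mass_diff_le (phi psi chi : path_space R) : (forall x, chi x = phi x - psi x) ->
  mass L chi <= 2 * mass L phi + 2 * mass L psi.
Proof.
move=> E; rewrite !massE_energy /energy.
have c (f : path_space R) : continuous (fun x : R => `|f x| ^+ 2) by exact: energy_fun_continuous csq.
have c2 (f : path_space R) : continuous (fun x : R => 2 * `|f x| ^+ 2).
  by move=> x; apply: cvgM; [exact: cvg_cst|exact: c].
rewrite -!Rint_itvZ// -Rint_itvD//; apply: Rint_itv_le => //.
  by move=> x; apply: cvgD; exact: c2.
move=> x _; rewrite E; apply: (@le_trans _ _ ((`|phi x| + `|psi x|) ^+ 2)).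
  by rewrite lerXn2r ?nnegrE ?addr_ge0// ler_normB.
have := sqr_ge0 (`|phi x| - `|psi x|); rewrite sqrrB sqrrD; lra.
Qed.

(** |phi|^p is at most 64 (|psi|^p + |phi - psi|^p), and the last term is |phi - psi|^2 times a
    power controlled by the Sobolev inequality. The witness [ms] is the mass of the difference. Of
    its two bounds, D2 / alpha is used where no factor D2 is present yet, and [mh] elsewhere. *)
Lemma potential_diff (p : R) n (a b : nat -> R) (T mh : R) : 2 < p < 6 -> 0 < T -> 0 < mh ->
  let D2 := \sum_(i < n.*2.+1.*2) (a i - b i) ^+ 2 in
  let phi := trig_path n a in let psi := trig_path n b in
  2 * mass L phi + 2 * mass L psi <= mh ->
  exists ms, [/\ 0 <= ms, ms <= mh, ms <= D2 / alpha &
   potential p L phi <= 64 * (potential p L psi +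
     (T `^ (p / 2 - 1) + T `^ (p / 2 - 3) * (2 * (mh / L) ^+ 2 + 8 * mh * D2)) * ms)].
Proof.
move=> p26 T0 mh0 D2 phi psi mhP; have /andP[p2 p6] := p26.
pose chi := trig_path n (fun i => a i - b i).
have E x : chi x = phi x - psi x by rewrite /chi /phi /psi /=; exact/esym/trigB.
have mchi : mass L chi <= mh by apply: le_trans mhP; exact: mass_diff_le.
exists (mass L chi); split => //; first exact: mass_ge0.
  exact: mass_trig_le.
have p0 : 0 < p by lra.
set Q := (X in X * mass L chi).
have c1 (f : path_space R) : continuous (fun x : R => `|f x| `^ p).
  have := @energy_fun_continuous R (fun y => `|y| `^ p) f (continuous_norm_powR p0).
  by under eq_fun do rewrite normr_id.
have cm (f : path_space R) : continuous (fun x : R => `|f x| ^+ 2) by exact: energy_fun_continuous csq.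
have cZ (c : R) f : continuous f -> continuous (fun x : R => c * f x).
  by move=> cf x; apply: cvgM; [exact: cvg_cst|exact: cf].
have c3 : continuous (fun x : R => `|psi x| `^ p + Q * `|chi x| ^+ 2).
  by move=> x; apply: cvgD; [exact: c1|exact: (cZ Q _ (cm chi))].
rewrite /potential massE_energy /energy -Rint_itvZ// -Rint_itvD//; last exact: (cZ Q _ (cm chi)).
rewrite -Rint_itvZ//; apply: Rint_itv_le => //; first exact: cZ.
move=> x xL; apply: (@le_trans _ _ ((`|psi x| + `|chi x|) `^ p)).
  apply: ge0_ler_powR; rewrite ?nnegrE ?addr_ge0 ?(ltW p0)//.
  have -> : phi x = psi x + chi x by rewrite E addrC subrK.
  exact: ler_normD.
apply: (le_trans (powRD_le64 _ _ _)); rewrite ?(ltW p0) ?(ltW p6)//.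
rewrite ler_wpM2l// lerD2l; apply: powR_sqr_split => //.
by rewrite in_itv/= in xL; exact: sobolev_trig.
Qed.

End potential_estimate.

Section exponential_moment.
Context (R : realType) (alpha L : R) (m : probability (borel (path_space R)) R).
Hypotheses (alpha0 : 0 < alpha) (L0 : 0 < L) (ff : is_free_field alpha L m).
Notation trig_path := (trig_path alpha L).
Implicit Types (u v : path_space R -> R).

Lemma inf_conv_ge0 u M k f : (forall phi, 0 <= u phi) -> 0 <= M -> 0 <= inf_conv u M k f.
Proof.
move=> u0 M0; apply: lb_le_inf; first by exists M; right.
move=> r [[psi [d [h ->]]]|->] //.
have d0 : 0 <= d by apply: le_trans (h 0 _); rewrite ?normr0.
by rewrite addr_ge0// mulr_ge0.
Qed.

(** The inf-convolutions of u and v are Lipschitz and lie below u and v, so they satisfy the same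
    product inequality; their integrals converge to those of u and v. *)
Lemma free_field_tau_lower_semi u v M : lower_semi u -> lower_semi v ->
  (forall phi, 0 <= u phi <= M) -> (forall phi, 0 <= v phi <= M) ->
  (forall n (a b : nat -> R), u (trig_path n a) * v (trig_path n b) <=
     expR ((\sum_(i < n.*2.+1.*2) (a i - b i) ^+ 2) / 2)) ->
  (\int[m]_phi u phi) * (\int[m]_phi v phi) <= 1.
Proof.
move=> lu lv uM vM uv.
have u0 phi : 0 <= u phi by case/andP: (uM phi).
have v0 phi : 0 <= v phi by case/andP: (vM phi).
have M0 : 0 <= M by apply: le_trans (u0 (cst 0 : path_space R)) _; case/andP: (uM (cst 0 : path_space R)).
have nu phi : `|u phi| <= M by rewrite ger0_norm//; case/andP: (uM phi).
have nv phi : `|v phi| <= M by rewrite ger0_norm//; case/andP: (vM phi).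
have lim : (\int[m]_phi inf_conv u M k phi) * (\int[m]_phi inf_conv v M k phi) @[k --> \oo] -->
   (\int[m]_phi u phi) * (\int[m]_phi v phi).
  by apply: cvgM; [exact: (inf_conv_integral lu nu)|exact: (inf_conv_integral lv nv)].
rewrite -(cvg_lim (@Rhausdorff R) lim); apply: limr_le; first by apply/cvg_ex; eexists; exact: lim.
apply: nearW => k.
apply: (free_field_tau alpha0 L0 ff (ler0n _ _) (inf_conv_lip nu k) (inf_conv_lip nv k)).
- by move=> f; exact: inf_conv_ge0.
- by move=> f; exact: inf_conv_ge0.
- move=> n a b; apply: le_trans (uv n a b); apply: ler_pM; rewrite ?inf_conv_ge0//.
  + exact: (inf_conv_le nu k (trig_path n a)).
  + exact: (inf_conv_le nv k (trig_path n b)).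
Qed.

Lemma lower_semi_indicM (g : path_space R -> R) (A : set (path_space R)) : continuous g ->
  (forall phi, 0 <= g phi) -> open A -> lower_semi (fun phi => g phi * \1_A phi).
Proof.
move=> cg g0 oA phi e e0; have FF : Filter (nbhs phi) by exact: nbhs_filter.
rewrite indicE; have [/set_mem Aphi|nA] := boolP (phi \in A).
  have nA : nbhs phi A by exact: open_nbhs_nbhs.
  have h := continuous_lower_semi cg phi e0.
  apply: filterS2 nA h => psi Apsi h.
  by rewrite indicE (mem_set Apsi) !mulr1.
apply: (@filterE _ _ FF) => psi; rewrite mulr0 sub0r.
apply: (@lt_le_trans _ _ 0); first by rewrite oppr_lt0.
by rewrite mulr_ge0// indicE.
Qed.

Lemma exp_moment_bound (V : path_space R -> R) (A B : set (path_space R)) (c0 : R) :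
  continuous V -> open A -> open B ->
  (forall n (a b : nat -> R), A (trig_path n a) -> B (trig_path n b) ->
    V (trig_path n a) <= c0 + (\sum_(i < n.*2.+1.*2) (a i - b i) ^+ 2) / 2) ->
  (\int[m]_phi (expR (V phi) * \1_A phi)%:E * m B <= (expR c0)%:E)%E.
Proof.
move=> cV oA oB VAB.
have mA : measurable (A : set (borel (path_space R))) by exact: sub_sigma_algebra.
have mB : measurable (B : set (borel (path_space R))) by exact: sub_sigma_algebra.
have cE : continuous (fun phi => expR (V phi)).
  by move=> phi; apply: (@continuous_comp _ _ _ V expR); [exact: cV|exact: continuous_expR].
(* The product inequality asks for bounded functions: exp V is truncated at j, and Fatou's lemma
   removes the truncation at the end. *)
pose g (j : nat) phi := Num.min (expR (V phi)) j%:R.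
have g0 j phi : 0 <= g j phi by rewrite le_min (ltW (expR_gt0 _))/=.
have cg j : continuous (g j).
  by move=> phi; apply: (@continuous_min _ _ (fun phi : path_space R => expR (V phi)) (fun=> j%:R)); [exact: cE|exact: cst_continuous].
pose u j phi := g j phi * \1_A phi.
have u0 j phi : 0 <= u j phi by rewrite mulr_ge0// indicE.
have uj j phi : u j phi <= j%:R.
  rewrite /u indicE; case: (_ \in _); rewrite ?mulr1 ?mulr0//.
  by rewrite ge_min lexx orbT.
pose v phi := expR (- c0) * \1_B phi.
have v0 phi : 0 <= v phi by rewrite mulr_ge0 ?expR_ge0// indicE.
have bB : bounded_mfun (\1_B : borel (path_space R) -> R) by exact: bmf_indic.
have vE : \int[m]_phi v phi = expR (- c0) * fine (m B).
  rewrite /v RintZ//; congr (_ * _).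
  by rewrite /Rintegral integral_indic ?setIT.
have mu j : measurable_fun setT (u j : borel (path_space R) -> R).
  apply: measurable_funM; first by apply: borel_continuous_measurable; exact: cg.
  exact: measurable_indic.
have key j : \int[m]_phi u j phi * (expR (- c0) * fine (m B)) <= 1.
{ rewrite -vE; apply: (@free_field_tau_lower_semi _ _ (Num.max j%:R (expR (- c0)))).
  - exact: lower_semi_indicM.
  - apply: lower_semi_indicM => //; first by move=> phi; exact: cst_continuous.
  - by move=> phi; rewrite u0 le_max uj.
  - move=> phi; rewrite v0 le_max /v indicE; case: (_ \in _); rewrite ?mulr1 ?mulr0 ?lexx ?orbT//.
    by rewrite expR_ge0 orbT.
  - move=> n a b; rewrite /u /v !indicE.
    have [/set_mem Aa|_] := boolP (trig_path n a \in A); last by rewrite mulr0 mul0r expR_ge0.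
    have [/set_mem Bb|_] := boolP (trig_path n b \in B); last by rewrite !mulr0 expR_ge0.
    rewrite !mulr1; apply: (@le_trans _ _ (expR (V (trig_path n a)) * expR (- c0))).
      by rewrite ler_wpM2r ?expR_ge0// /g ge_min lexx.
    by rewrite -expRD ler_expR; have := VAB n a b Aa Bb; lra. }
have PB0 : 0 <= fine (m B) by exact: fine_ge0.
have mBE : (m B = (fine (m B))%:E)%E by rewrite fineK// fin_num_measure.
have key2 j : (\int[m]_phi (u j phi * fine (m B))%:E <= (expR c0)%:E)%E.
{ have bu : bounded_mfun (u j : borel (path_space R) -> R).
    by split => //; exists j%:R => phi; rewrite ger0_norm.
  have bub : bounded_mfun (fun phi : borel (path_space R) => u j phi * fine (m B)).
    split; first exact: measurable_funM.
    by exists (j%:R * fine (m B)) => phi; rewrite ger0_norm ?mulr_ge0// ler_wpM2r.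
  rewrite -EFin_Rint// lee_fin.
  have -> : \int[m]_phi (u j phi * fine (m B)) = fine (m B) * \int[m]_phi u j phi.
    by rewrite -RintZ//; apply: eq_Rintegral => phi _; rewrite mulrC.
  have := key j; rewrite mulrCA expRN mulrC ler_pdivrMr ?expR_gt0// mul1r.
  by rewrite mulrC. }
rewrite mBE muleC -ge0_integralZl//; last first.
  apply/measurable_EFinP; apply: measurable_funM; last exact: measurable_indic.
  by apply: borel_continuous_measurable; exact: cE.
under eq_integral do rewrite -EFinM mulrC.
apply: (@fatou_bound _ _ R m (fun j phi => u j phi * fine (m B))) => //.
- by move=> j; apply: measurable_funM.
- apply: measurable_funM => //; apply: measurable_funM; last exact: measurable_indic.
  by apply: borel_continuous_measurable; exact: cE.
- by move=> j phi; rewrite mulr_ge0.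
- by move=> phi; rewrite !mulr_ge0 ?expR_ge0// indicE.
- apply: aeW => phi; apply: cvgM; last exact: cvg_cst.
  apply: cvgM; last exact: cvg_cst.
  apply: (@cvg_trans _ (expR (V phi) @[j --> \oo])); last exact: cvg_cst.
  apply: near_eq_cvg; near=> j; apply/esym; rewrite /g; apply/min_idPl.
  by near: j; exact: nbhs_infty_ger.
Unshelve. all: by end_near. Qed.

End exponential_moment.

Lemma markov_ge d (T : measurableType d) (R : realType) (m : probability T R) (f : T -> R) (t c : R) :
  measurable_fun setT f -> (forall x, 0 <= f x) -> 0 < t -> (\int[m]_x (f x)%:E <= c%:E)%E ->
  (m [set x | (t <= f x)%R] <= (c / t)%:E)%E.
Proof.
move=> mf f0 t0 fc.
have mA : measurable [set x | t <= f x].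
  by rewrite -[X in measurable X]setTI; apply: measurable_fun_le.
have h : (t%:E * m [set x | (t <= f x)%R] <= c%:E)%E.
{ apply: le_trans fc; rewrite -[X in m X]setIT -integral_indic// -ge0_integralZl//; last 2 first.
  - exact/measurable_EFinP/measurable_indic.
  - by rewrite lee_fin ltW.
  apply: ge0_le_integral => //.
  - by move=> x _; rewrite mule_ge0 ?lee_fin ?(ltW t0)// indicE.
  - by apply: emeasurable_funM => //; exact/measurable_EFinP/measurable_indic.
  - exact/measurable_EFinP.
  - move=> x _; rewrite -EFinM lee_fin indicE.
    have [/set_mem/= xA|_] := boolP (x \in _); rewrite ?mulr1 ?mulr0//. }
have mE : m [set x | (t <= f x)%R] = (fine (m [set x | t <= f x]))%:E by rewrite fineK// fin_num_measure.
by move: h; rewrite mE -EFinM !lee_fin ler_pdivlMr// mulrC.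
Qed.

Section moments.
Context (R : realType) (alpha L p : R) (m : probability (borel (path_space R)) R).
Hypotheses (alpha0 : 0 < alpha) (L0 : 0 < L) (p26 : 2 < p < 6) (ff : is_free_field alpha L m).
Implicit Types phi psi : path_space R.

Lemma potential_continuous : continuous (potential p L : path_space R -> R).
Proof.
have p0 : 0 < p by case/andP: p26; lra.
have -> : potential p L = energy (fun y => `|y| `^ p) L.
  by apply/funext => phi; exact: potentialE_energy.
by apply: energy_continuous; [exact: continuous_norm_powR|exact: ltW].
Qed.

Lemma mass_continuous : continuous (mass L : path_space R -> R).
Proof.
apply: (@energy_continuous R (fun y => y ^+ 2)); last exact: ltW.
by move=> y; exact: exprn_continuous.
Qed.

Lemma moment6_continuous : continuous (moment6 L : path_space R -> R).
Proof. by apply: energy_continuous; [exact: continuous_one_sixth|exact: ltW]. Qed.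

Lemma open_mass_lt (t : R) : open [set phi : path_space R | mass L phi < t].
Proof.
apply: (@open_comp _ _ (mass L) [set y | y < t]); last exact: open_lt.
by move=> phi _; exact: mass_continuous.
Qed.

Lemma open_moment6_lt (t : R) : open [set phi : path_space R | moment6 L phi < t].
Proof.
apply: (@open_comp _ _ (moment6 L) [set y | y < t]); last exact: open_lt.
by move=> phi _; exact: moment6_continuous.
Qed.

Lemma potential_ge0 phi : 0 <= potential p L phi.
Proof. by apply: Rint_itv_ge0 => x; exact: powR_ge0. Qed.

Lemma gibbs_moment (theta m1 w T c0 : R) : 0 <= theta -> 0 < m1 -> 0 < w -> 0 < T ->
  let mh := 2 * m1 + 2 * w in
  (forall ms D2, 0 <= D2 -> 0 <= ms -> ms <= mh -> ms <= D2 / alpha ->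
    theta * (64 * (w + (T `^ (p / 2 - 1) + T `^ (p / 2 - 3) * (2 * (mh / L) ^+ 2 + 8 * mh * D2)) * ms)) <=
    c0 + D2 / 2) ->
  (\int[m]_phi (expR (theta * potential p L phi) * \1_[set phi | (mass L phi < m1)%R] phi)%:E *
     m [set phi | (moment6 L phi < w)%R] <= (expR c0)%:E)%E.
Proof.
move=> th0 m10 w0 T0 mh H.
have mh0 : 0 < mh by rewrite addr_gt0// mulr_gt0.
apply: (exp_moment_bound alpha0 L0 ff).
- move=> phi; apply: (@continuous_comp _ _ _ (potential p L) (fun y => theta * y)).
    exact: potential_continuous.
  exact: mulrl_continuous.
- exact: open_mass_lt.
- exact: open_moment6_lt.
- move=> n a b /= Aa Bb; set D2 := \sum_(i < _) _.
  have mb : mass L (trig_path alpha L n b) < w by apply: le_lt_trans Bb; exact: mass_le_moment6.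
  have [|ms [ms0 msh msD pot]] := @potential_diff R alpha L alpha0 L0 p n a b T mh p26 T0 mh0.
    by rewrite /mh; apply: lerD; apply: ler_wpM2l => //; exact: ltW.
  apply: le_trans (H ms D2 _ ms0 msh msD); last by apply: sumr_ge0 => i _; exact: sqr_ge0.
  rewrite ler_wpM2l//; apply: (le_trans pot); rewrite ler_wpM2l// lerD2r.
  by apply: le_trans (ltW Bb); exact: potential_le_moment6.
Qed.

Lemma gibbs_moment_finite (theta m1 : R) : 0 <= theta -> 0 < m1 -> exists c : R,
  (\int[m]_phi (expR (theta * potential p L phi) * \1_[set phi | (mass L phi < m1)%R] phi)%:E <= c%:E)%E.
Proof.
move=> th0 m10.
pose B (k : nat) : set (borel (path_space R)) := [set phi | moment6 L phi < k.+1%:R].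
have mB k : measurable (B k) by apply: sub_sigma_algebra; exact: open_moment6_lt.
(* The sets [B k] exhaust the space, so one of them has positive measure, which is enough for
   finiteness. *)
have [k Bk] : exists k, (0 < m (B k))%E.
{ apply: contrapT => nk.
  have : m.-negligible (\bigcup_k B k).
    apply: negligible_bigcup => k; apply/negligibleP => //; apply/eqP.
    by rewrite eq_le measure_ge0 andbT leNgt; apply/negP => h; apply: nk; exists k.
  have -> : \bigcup_k B k = setT.
    apply/seteqP; split => // phi _; exists (Num.truncn (moment6 L phi)) => //=.
    exact: truncnS_gt.
  move=> /(negligibleP _ measurableT) h.
  have := etrans (esym h) (probability_setT m).
  by case=> /esym/eqP; rewrite oner_eq0. }
pose w : R := k.+1%:R; pose mh := 2 * m1 + 2 * w.
have mh0 : 0 < mh by rewrite addr_gt0// mulr_gt0.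
(* With T^(p / 2 - 3) = 1 / X, possible because p < 6, the coefficient of D2 / 2 becomes (X - 1) /
   X, which is below 1. *)
have [X [X1 XE]] : exists X : R, 1 <= X /\ 1024 * theta * mh ^+ 2 = X - 1.
  exists (1 + 1024 * theta * mh ^+ 2); split; last by ring.
  by have := mulr_ge0 th0 (sqr_ge0 mh); lra.
have X0 : 0 < X by apply: lt_le_trans X1.
have r0 : 3 - p / 2 != 0 by case/andP: p26 => _ p6; rewrite subr_eq0 eq_sym lt_eqF// ltr_pdivrMr//; lra.
pose T := X `^ ((3 - p / 2)^-1).
have T0 : 0 < T by exact: powR_gt0.
have TX : T `^ (p / 2 - 3) = X^-1.
  have -> : p / 2 - 3 = - (3 - p / 2) by ring.
  by rewrite powRN -powRrM mulVf// powRr1// ltW.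
pose c0 := theta * (64 * (w + (T `^ (p / 2 - 1) + T `^ (p / 2 - 3) * (2 * (mh / L) ^+ 2)) * mh)).
have := @gibbs_moment theta m1 w T c0 th0 m10 (ltr0Sn _ _) T0; rewrite -/mh => H.
have {}H := H _; exists (expR c0 / fine (m (B k))).
have Pk : 0 < fine (m (B k)) by rewrite fine_gt0// Bk/= (le_lt_trans (probability_le1 _ (mB k)))// ltry.
have mBE : (m (B k) = (fine (m (B k)))%:E)%E by rewrite fineK// fin_num_measure.
rewrite EFinM lee_pdivlMr// -mBE; apply: H => ms D2 D20 ms0 msh _.
set T1 := T `^ (p / 2 - 1) in c0 *; rewrite TX in c0 *.
have T10 : 0 <= T1 by exact: powR_ge0.
have Y0 : 0 <= 2 * (mh / L) ^+ 2 by rewrite mulr_ge0// sqr_ge0.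
have Z0 : 0 <= 8 * mh * D2 by rewrite !mulr_ge0// ltW.
have iX : 0 <= X^-1 by rewrite invr_ge0 ltW.
apply: (@le_trans _ _ (theta * (64 * (w + (T1 + X^-1 * (2 * (mh / L) ^+ 2 + 8 * mh * D2)) * mh)))).
  rewrite ler_wpM2l// ler_wpM2l// lerD2l ler_wpM2l// addr_ge0//.
  by apply: mulr_ge0 => //; apply: addr_ge0.
have D2E : D2 = 2 * (D2 / 2) by field.
have -> : theta * (64 * (w + (T1 + X^-1 * (2 * (mh / L) ^+ 2 + 8 * mh * D2)) * mh)) =
  c0 + (1024 * theta * mh ^+ 2) / X * (D2 / 2) by rewrite {1}D2E /c0; ring.
rewrite XE lerD2l -[leRHS]mul1r ler_wpM2r ?divr_ge0// ler_pdivrMr// mul1r.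
by rewrite gerBl.
Qed.

End moments.

(** * Estimates uniform in the period *)

Section large_period.
Context (R : realType) (alpha p : R).
Hypotheses (alpha0 : 0 < alpha) (p26 : 2 < p < 6).

(** With q = exp(- ka L) and ka = [mass_par alpha], the variance is (1 + q) / (2 ka (1 - q)); for L
    >= 2 the numerator is at most 2 and q at most exp(- 2 ka). *)
Definition cov_bound : R := (mass_par alpha * (1 - expR (- (2 * mass_par alpha))))^-1.

Lemma cov_bound_gt0 : 0 < cov_bound.
Proof.
have k0 := mass_par_gt0 alpha0.
by rewrite invr_gt0 mulr_gt0// subr_gt0 -[ltRHS]expR0 ltr_expR oppr_lt0 mulr_gt0.
Qed.

Lemma periodic_cov0_bound (L : R) : 2 <= L -> 0 <= periodic_cov alpha L 0 <= cov_bound.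
Proof.
move=> L2; have k0 := mass_par_gt0 alpha0; have L0 : 0 < L by apply: lt_le_trans L2.
have /= -> := periodic_covE alpha0 L0 0; rewrite normr0 mulr0 oppr0 expR0 mul1r.
have q0 := expR_ge0 (- (mass_par alpha * L)).
have q1 : expR (- (mass_par alpha * L)) <= expR (- (2 * mass_par alpha)).
  by rewrite ler_expR lerN2 mulrC ler_wpM2l// ltW.
have q2 : expR (- (2 * mass_par alpha)) < 1 by rewrite -[ltRHS]expR0 ltr_expR oppr_lt0 mulr_gt0.
move: (expR (- (mass_par alpha * L))) q0 q1 => q q0 q1.
have q3 : 0 < 1 - q by lra.
have d0 : 0 < 2 * mass_par alpha * (1 - q) by rewrite !mulr_gt0.
apply/andP; split; first by rewrite divr_ge0 ?(ltW d0)//; lra.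
apply: (@le_trans _ _ (2 / (2 * mass_par alpha * (1 - q)))).
  by rewrite ler_wpM2r ?invr_ge0 ?(ltW d0)//; lra.
have -> : 2 / (2 * mass_par alpha * (1 - q)) = (mass_par alpha * (1 - q))^-1 by field; rewrite !gt_eqF.
rewrite lef_pV2 ?posrE ?mulr_gt0//; last by rewrite subr_gt0.
by rewrite ler_pM2l//; lra.
Qed.

(* Bounds the mean of [1 + |phi x|^6]. *)
Definition K6 : R := 1 + 31 * cov_bound ^+ 3.

Lemma K6_ge1 : 1 <= K6.
Proof. by rewrite lerDl mulr_ge0// exprn_ge0// ltW// cov_bound_gt0. Qed.

Variables (L : R) (m : probability (borel (path_space R)) R).
Hypotheses (L2 : 2 <= L) (ff : is_free_field alpha L m).

Let L0 : 0 < L. Proof. exact: lt_le_trans L2. Qed.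
Let K60 : 0 < K6. Proof. by apply: lt_le_trans K6_ge1. Qed.

Let cov0E : exists cov, [/\ gaussian_field m cov, cov 0 = periodic_cov alpha L 0 & 0 <= cov 0 <= cov_bound].
Proof.
have [cov [gf covE _]] := free_field_gaussian alpha0 L2 ff.
have e : cov 0 = periodic_cov alpha L 0 by apply: covE; rewrite normr0 divr_ge0// ltW.
by exists cov; split => //; rewrite e; exact: periodic_cov0_bound.
Qed.

Lemma mass_tail (N : R) : 0 < N ->
  (m [set phi | (N * L <= mass L phi)%R] <= (periodic_cov alpha L 0 / N)%:E)%E.
Proof.
move=> N0; have [cov [gf e /andP[c0 _]]] := cov0E.
have -> : periodic_cov alpha L 0 / N = L * cov 0 / (N * L) by rewrite e; field; rewrite !gt_eqF.
apply: markov_ge.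
- by apply: borel_continuous_measurable; exact: mass_continuous.
- by move=> phi; exact: mass_ge0.
- exact: mulr_gt0.
- apply: (@energy_integral_le R (fun y => y ^+ 2)) => //.
  + by move=> y; exact: exprn_continuous.
  + by move=> y; exact: sqr_ge0.
  + exact: ltW.
  + exact: norm2_moment.
Qed.

(** Markov's inequality at twice the bound K6 L of the mean. *)
Lemma moment6_half : (2^-1%:E <= m [set phi | (moment6 L phi < 2 * K6 * L)%R])%E.
Proof.
have [cov [gf e /andP[c0 cb]]] := cov0E.
have t0 : 0 < 2 * K6 * L by rewrite !mulr_gt0.
have h : (m [set phi | (2 * K6 * L <= moment6 L phi)%R] <= (L * K6 / (2 * K6 * L))%:E)%E.
{ apply: markov_ge => //.
  - by apply: borel_continuous_measurable; exact: moment6_continuous.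
  - by move=> phi; apply: Rint_itv_ge0 => x; rewrite addr_ge0// exprn_ge0.
  - apply: energy_integral_le.
    + exact: continuous_one_sixth.
    + by move=> y; rewrite addr_ge0// -[6%N]/(2 * 3)%N exprM exprn_ge0// sqr_ge0.
    + exact: ltW.
    + move=> x; apply: (le_trans (norm6_moment gf c0 x)); rewrite lee_fin /K6 lerD2l ler_wpM2l//.
      by rewrite lerXn2r ?nnegrE ?(ltW cov_bound_gt0). }
have e2 : L * K6 / (2 * K6 * L) = 2^-1 by field; rewrite !gt_eqF.
rewrite e2 in h.
have mA : measurable ([set phi | moment6 L phi < 2 * K6 * L] : set (borel (path_space R))).
  by apply: sub_sigma_algebra; exact: open_moment6_lt.
have hC : [set phi | 2 * K6 * L <= moment6 L phi] = ~` [set phi : borel (path_space R) | moment6 L phi < 2 * K6 * L].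
  by apply/seteqP; split => phi /=; rewrite leNgt => /negP.
rewrite hC probability_setC// in h.
have mE : m [set phi | moment6 L phi < 2 * K6 * L] = (fine (m [set phi | moment6 L phi < 2 * K6 * L]))%:E.
  by rewrite fineK// fin_num_measure.
by move: h; rewrite mE -EFinB !lee_fin; lra.
Qed.

Definition mass_cut (N : R) : R := 2 * (N + 1) + 4 * K6.
(* From [potential_diff] with [T = L]: [mass_cut N * L] bounds the mass of a difference of paths, and
   [beta L^(p / 2 - 1 - gamma) drift_const] is the factor of [D2] in the growth of the potential. *)
Definition drift_const (N : R) : R := 128 / p * (alpha^-1 + 8 * mass_cut N ^+ 2).

(** With T = L all parts of the difference estimate that carry D2 scale like L^(p / 2 - 1), and the
    smallness hypothesis makes them at most D2 / 2. The constant part of the Sobolev bound costs at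
    most [mass_cut N]. The potential of psi costs 2 (beta / (p L^gamma)) 64 (2 K6 L), whence the
    256. The leading 2 is the inverse of the lower bound 1/2 for the measure of B. *)
Lemma gibbs_moment_large (N beta gamma : R) : 0 < N -> 0 <= beta ->
  beta * L `^ (p / 2 - 1 - gamma) * drift_const N <= 2^-1 ->
  (\int[m]_phi (expR (2 * (beta / (p * L `^ gamma)) * potential p L phi) *
     \1_[set phi | (mass L phi < (N + 1) * L)%R] phi)%:E <=
   (2 * expR (256 * beta / p * K6 * L `^ (1 - gamma) + mass_cut N))%:E)%E.
Proof.
move=> N0 b0 hb; have /andP[p2 p6] := p26; have p0 : 0 < p by lra.
set k0 := mass_cut N; have k00 : 0 < k0 by apply: addr_gt0; apply: mulr_gt0 => //; exact: addr_gt0.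
set c0 := 256 * beta / p * K6 * L `^ (1 - gamma) + k0.
have th0 : 0 <= 2 * (beta / (p * L `^ gamma)) by rewrite mulr_ge0// divr_ge0// mulr_ge0 ?powR_ge0// ltW.
have m10 : 0 < (N + 1) * L by rewrite mulr_gt0// addr_gt0.
have w0 : 0 < 2 * K6 * L by rewrite !mulr_gt0.
have := @gibbs_moment R alpha L p m alpha0 L0 p26 ff _ ((N + 1) * L) (2 * K6 * L) L c0 th0 m10 w0 L0.
have -> : 2 * ((N + 1) * L) + 2 * (2 * K6 * L) = k0 * L by rewrite /k0 /mass_cut; ring.
move=> H; have {}H := H _.
suff H2 : (\int[m]_phi (expR (2 * (beta / (p * L `^ gamma)) * potential p L phi) *
     \1_[set phi | (mass L phi < (N + 1) * L)%R] phi)%:E * 2^-1%:E <= (expR c0)%:E)%E.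
  by rewrite lee_pdivrMr// in H2; rewrite EFinM muleC.
apply: le_trans (H _); first last.
- move=> ms D2 D20 ms0 msh msD.
  set q := p / 2 - 1.
  have -> : p / 2 - 3 = q - 2%:R by rewrite /q; ring.
  have E0 (q' : R) : L `^ (q' - 2) = L `^ q' / L ^+ 2.
    by rewrite powRB ?powR_mulrn ?(ltW L0)// (gt_eqF L0) implybT.
  rewrite E0.
  set Q := L `^ q; have Q0 : 0 < Q by exact: powR_gt0.
  have -> : k0 * L / L = k0 by field; rewrite gt_eqF.
  set Lg := L `^ gamma; have Lg0 : 0 < Lg by exact: powR_gt0.
  have E1 : L `^ (1 - gamma) = L / Lg by rewrite powRB ?powRr1 ?(ltW L0)// (gt_eqF L0) implybT.
  have E2 : L `^ (p / 2 - 1 - gamma) = Q / Lg by rewrite powRB// (gt_eqF L0) implybT.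
  move: hb; rewrite E2 /drift_const -/k0 => hb.
  have bQ : 0 <= 128 / p * (beta * (Q / Lg))
    by apply: mulr_ge0; [exact: divr_ge0 (ler0n _ _) (ltW p0)|apply: mulr_ge0 => //; exact: divr_ge0 (ltW Q0) (ltW Lg0)].
  set z := 128 / p * (beta * (Q / Lg)) in bQ *.
  have hz : z * (alpha^-1 + 8 * k0 ^+ 2) <= 2^-1.
    by apply: le_trans hb; rewrite /z le_eqVlt; apply/orP; left; apply/eqP; ring.
  have ia : 0 < alpha^-1 by rewrite invr_gt0.
  apply: (@le_trans _ _ (256 * beta / p * K6 * (L / Lg) + z * (ms + (2 * k0 ^+ 2 * ms / L ^+ 2 + 8 * k0 * D2 / L * ms)))).
    rewrite le_eqVlt; apply/orP; left; apply/eqP; rewrite /z; field; rewrite !gt_eqF//.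
  rewrite /c0 E1 -addrA lerD2l.
  have k2 : 0 <= 8 * k0 ^+ 2 by rewrite mulr_ge0// sqr_ge0.
  have L1 : 1 <= L by apply: le_trans L2; rewrite ler1n.
  have h1 : ms <= D2 * alpha^-1 by exact: msD.
  have h2 : 2 * k0 ^+ 2 * ms / L ^+ 2 <= 2 * k0 ^+ 3.
  { rewrite ler_pdivrMr ?exprn_gt0//.
    apply: (@le_trans _ _ (2 * k0 ^+ 2 * (k0 * L))); first by rewrite ler_wpM2l// mulr_ge0// sqr_ge0.
    have -> : 2 * k0 ^+ 2 * (k0 * L) = 2 * k0 ^+ 3 * L by ring.
    rewrite ler_wpM2l//; first by rewrite mulr_ge0// exprn_ge0// ltW.
    by rewrite expr2 ler_peMl// ltW. }
  have h3 : 8 * k0 * D2 / L * ms <= 8 * k0 ^+ 2 * D2.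
  { apply: (@le_trans _ _ (8 * k0 * D2 / L * (k0 * L))).
      by rewrite ler_wpM2l// divr_ge0 ?(ltW L0)// !mulr_ge0// ltW.
    by rewrite le_eqVlt; apply/orP; left; apply/eqP; field; rewrite gt_eqF. }
  apply: (@le_trans _ _ (z * (2 * k0 ^+ 3) + z * (alpha^-1 + 8 * k0 ^+ 2) * D2)).
    have -> : z * (2 * k0 ^+ 3) + z * (alpha^-1 + 8 * k0 ^+ 2) * D2 = z * (2 * k0 ^+ 3 + (alpha^-1 + 8 * k0 ^+ 2) * D2) by ring.
    rewrite ler_wpM2l//.
    have -> : 2 * k0 ^+ 3 + (alpha^-1 + 8 * k0 ^+ 2) * D2 = D2 * alpha^-1 + (2 * k0 ^+ 3 + 8 * k0 ^+ 2 * D2) by ring.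
    by apply: lerD => //; apply: lerD.
  apply: lerD; last by rewrite mulrC ler_wpM2l.
  have hz2 : z * (8 * k0 ^+ 2) <= 2^-1.
    by apply: le_trans hz; rewrite ler_wpM2l// lerDr ltW.
  have -> : z * (2 * k0 ^+ 3) = z * (8 * k0 ^+ 2) * (k0 / 4) by field.
  apply: (@le_trans _ _ (2^-1 * (k0 / 4))); first by rewrite ler_wpM2r// divr_ge0// ltW.
  by have := ltW k00; lra.
- apply: lee_wpmul2l; last exact: moment6_half.
  by apply: integral_ge0 => phi _; rewrite lee_fin mulr_ge0 ?expR_ge0// indicE.
Qed.

End large_period.

(** * Small balls of the mass *)

Section gaussian_damping.
Context (R : realType).
Notation N12 := (normal_prob (0 : R) (half_sd R)).

Definition kappa (c : R) : R := \int[N12]_x expR (- (c * x ^+ 2)).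

Lemma expRN_sqr_continuous (c : R) : continuous (fun x : R => expR (- (c * x ^+ 2))).
Proof.
move=> x; apply: (@continuous_comp _ _ _ (fun x : R => - (c * x ^+ 2)) expR); last exact: continuous_expR.
by apply: cvgN; apply: cvgM; [exact: cvg_cst|exact: exprn_continuous].
Qed.

Lemma kappaE c : 0 <= c -> kappa c = (Num.sqrt (1 + c))^-1.
Proof.
move=> c0; have c1 : 0 < 1 + c by rewrite ltr_wpDr.
have r0 : 0 < Num.sqrt (1 + c) by rewrite sqrtr_gt0.
pose s := half_sd R / Num.sqrt (1 + c).
have s0 : s != 0 by rewrite mulf_neq0 ?half_sd_neq0// invr_neq0// gt_eqF.
have s2 : s ^+ 2 = 2^-1 / (1 + c) by rewrite exprMn half_sd_sqr exprVn sqr_sqrtr// ltW.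
rewrite /kappa Rint_normal_prob; [|exact: continuous_mfun (@expRN_sqr_continuous c)|by move=> x; exact: expR_ge0].
transitivity (\int[lebesgue_measure]_x ((Num.sqrt (1 + c))^-1 * normal_pdf 0 s x)).
{ apply: eq_Rintegral => x _; rewrite !normal_pdfE ?half_sd_neq0// /normal_peak /normal_fun !subr0 s2 half_sd_sqr.
  have -> : 2^-1 * pi *+ 2 = pi :> R by field.
  have -> : 2^-1 / (1 + c) * pi *+ 2 = pi / (1 + c) :> R by field; rewrite gt_eqF.
  rewrite sqrtrM ?pi_ge0// sqrtrV ?(ltW c1)// invfM invrK.
  have -> : (Num.sqrt (1 + c))^-1 * ((Num.sqrt pi)^-1 * Num.sqrt (1 + c) * expR (- x ^+ 2 / (2^-1 / (1 + c) *+ 2))) =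
    (Num.sqrt pi)^-1 * expR (- x ^+ 2 / (2^-1 / (1 + c) *+ 2)).
    by field; rewrite !gt_eqF ?sqrtr_gt0 ?pi_gt0.
  rewrite mulrCA -expRD; congr (_ * expR _); field; rewrite gt_eqF//. }
rewrite RintegralZl//; last exact: integrable_normal_pdf.
by rewrite /Rintegral integral_normal_pdf mulr1.
Qed.

(** Of the two lower bounds for (1 + c)^(- 1/2), this one is accurate for small c, that is for high
    modes; the next one keeps the cost of low modes at sqrt c when c is large. *)
Lemma kappa_ge_exp c : 0 <= c -> expR (- (c / 2)) <= kappa c.
Proof.
move=> c0; rewrite kappaE// expRN lef_pV2 ?posrE ?expR_gt0 ?sqrtr_gt0 ?ltr_wpDr//.
rewrite -[leRHS]ger0_norm ?expR_ge0// -sqrtr_sqr ler_wsqrtr// expr2 -expRD -splitr.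
exact: expR_ge1Dx.
Qed.

Lemma kappa_ge_exp_sqrt c : 0 <= c -> expR (- Num.sqrt c) <= kappa c.
Proof.
move=> c0; rewrite kappaE// expRN lef_pV2 ?posrE ?expR_gt0 ?sqrtr_gt0 ?ltr_wpDr//.
have s0 := sqrtr_ge0 c.
apply: (@le_trans _ _ (1 + Num.sqrt c)); last exact: expR_ge1Dx.
rewrite -[leRHS]ger0_norm ?addr_ge0// -sqrtr_sqr ler_wsqrtr// sqrrD sqr_sqrtr// expr1n mul1r.
by rewrite -addrA lerD2l lerDr mulrn_wge0.
Qed.

Variables (d : measure_display) (T : measurableType d) (P : probability T R) (N : nat) (X : nat -> T -> R).
Hypotheses (mX : forall i, measurable_fun setT (X i))
  (Xchar : forall (t : nat -> R) c, \int[P]_w cos (\sum_(i < N) t i * X i w + c) =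
     expR (- (\sum_(i < N) t i ^+ 2 / 4)) * cos c).
Variable c_ : nat -> R.
Hypothesis c0 : forall i, 0 <= c_ i.

Let D j w := expR (- \sum_(i < j) c_ i * X i w ^+ 2).

Let mD j : measurable_fun setT (D j).
Proof.
apply: measurableT_comp => //; apply: measurableT_comp => //; apply: measurable_sum => i.
by apply: measurable_funM => //; exact: measurable_funX.
Qed.

Let D01 j w : 0 <= D j w <= 1.
Proof.
rewrite expR_ge0 -expR0 ler_expR oppr_le0; apply: sumr_ge0 => i _.
by rewrite mulr_ge0 ?sqr_ge0.
Qed.

Let Sc (t : nat -> R) c w := \sum_(i < N) t i * X i w + c.

Let mSc t c : measurable_fun setT (Sc t c).
Proof. by apply: measurable_funD => //; apply: measurable_sum => i; exact: measurable_funM. Qed.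

(* Each Gaussian factor [exp (- c_j x^2)] is the average of [cos (2 sqrt c_j x eta)] over an
   independent normal variable [eta], which only shifts the frequency [t_j]. *)
Let damped_char j (t : nat -> R) c : (j <= N)%N -> (forall i, (i < j)%N -> t i = 0) ->
  \int[P]_w (D j w * cos (Sc t c w)) =
  (\prod_(i < j) kappa (c_ i)) * (expR (- (\sum_(i < N) t i ^+ 2 / 4)) * cos c).
Proof.
elim: j t c => [|j IHj] t c jN t0.
  rewrite big_ord0 mul1r -Xchar; apply: eq_Rintegral => w _.
  by rewrite /D big_ord0 oppr0 expR0 mul1r.
pose a (y : R) := 2 * Num.sqrt (c_ j) * y.
pose t' y := fun i : nat => if i == j then a y else t i.
have St y w : Sc (t' y) c w = 2 * Num.sqrt (c_ j) * X j w * y + Sc t c w.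
{ rewrite /Sc (bigD1 (Ordinal jN))//= /t' eqxx [in RHS](bigD1 (Ordinal jN))//= t0// mul0r add0r.
  rewrite addrA; congr (_ + _ + _); first by rewrite /a; ring.
  by apply: eq_bigr => i ij; rewrite ifN. }
have E w : D j.+1 w * cos (Sc t c w) = \int[N12]_y (D j w * cos (Sc (t' y) c w)).
{ under eq_Rintegral do rewrite St.
  rewrite RintZ; last first.
    split; last by exists 1 => y; exact: cos_max.
    apply: continuous_mfun => y.
    apply: (@continuous_comp _ _ _ (fun y : R => 2 * Num.sqrt (c_ j) * X j w * y + Sc t c w) cos); last exact: continuous_cos.
    by apply: cvgD; [apply: cvgM; [exact: cvg_cst|exact: cvg_id]|exact: cvg_cst].
  rewrite normal_half_char /D big_ord_recr/= opprD expRD -mulrA; congr (_ * (expR _ * _)).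
  by rewrite !exprMn sqr_sqrtr//; field. }
under eq_Rintegral do rewrite E.
have bf : bounded_mfun (fun z : T * measurableTypeR R => D j z.1 * cos (Sc (t' z.2) c z.1)).
{ split; last first.
    exists 1 => z; have /andP[d0 d1] := D01 j z.1; rewrite normrM (ger0_norm d0).
    by rewrite -[leRHS]mulr1 ler_pM// cos_max.
  under eq_fun do rewrite St.
  apply: measurable_funM; first exact: measurableT_comp (mD j) measurable_fst.
  apply: (@measurableT_comp _ _ _ _ _ _ (cos : R -> R)); first exact: continuous_mfun (@continuous_cos R).
  apply: measurable_funD.
    apply: measurable_funM; last exact: measurable_snd.
    by apply: measurable_funM => //; exact: measurableT_comp (mX j) measurable_fst.
  exact: measurableT_comp (mSc t c) measurable_fst. }
have := Rint_fubini P N12 bf => /= ->.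
transitivity (\int[N12]_y ((\prod_(i < j) kappa (c_ i)) * (expR (- (\sum_(i < N) t i ^+ 2 / 4)) * cos c) *
   expR (- (c_ j * y ^+ 2)))).
{ apply: eq_Rintegral => y _; rewrite (IHj (t' y) c (ltnW jN)); last first.
    by move=> i ij; rewrite /t' ltn_eqF// t0// ltnS ltnW.
  rewrite -!mulrA; congr (_ * _); rewrite [RHS]mulrC -mulrA mulrC; congr (_ * _).
  rewrite -expRD; congr expR.
  rewrite (bigD1 (Ordinal jN))//= /t' eqxx [in RHS](bigD1 (Ordinal jN))//= t0// expr0n/= mul0r add0r.
  rewrite opprD; congr (_ + _); last by congr (- _); apply: eq_bigr => i ij; rewrite ifN.
  by congr (- _); rewrite /a !exprMn sqr_sqrtr//; field. }
rewrite RintZ; last first.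
  split; first exact: continuous_mfun (@expRN_sqr_continuous _).
  exists 1 => y; rewrite ger0_norm ?expR_ge0// -expR0 ler_expR oppr_le0.
  by rewrite mulr_ge0 ?sqr_ge0.
by rewrite -/(kappa _) big_ord_recr/= mulrAC.
Qed.

Lemma gaussian_damping : \int[P]_w expR (- \sum_(i < N) c_ i * X i w ^+ 2) = \prod_(i < N) kappa (c_ i).
Proof.
have := damped_char 0 (leqnn N) (t := fun=> 0) (fun _ _ => erefl).
rewrite cos0 mulr1 [X in expR (- X)]big1 => [|i _]; last by rewrite expr0n mul0r.
rewrite oppr0 expR0 mulr1 => <-; apply: eq_Rintegral => w _.
have -> : Sc (fun=> 0) 0 w = 0 by rewrite /Sc big1 ?addr0// => i _; exact: mul0r.
by rewrite cos0 mulr1.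
Qed.

End gaussian_damping.

Section small_mass.
Context (R : realType) (alpha L : R) (m : probability (borel (path_space R)) R).
Hypotheses (alpha0 : 0 < alpha) (L0 : 0 < L) (ff : is_free_field alpha L m).
Notation fdenom := (fdenom alpha L).

Lemma sum_fmode (F : int -> R) n :
  \sum_(j < n.*2.+1) F (fmode n j) = F 0 + \sum_(k < n) (F k.+1%:Z + F (- k.+1%:Z)).
Proof.
elim: n => [|n IHn]; first by rewrite big_ord_recl !big_ord0 !addr0 /fmode subrr.
rewrite doubleS big_ord_recr big_ord_recl/= [in RHS]big_ord_recr/= addrA -IHn.
have -> : fmode n.+1 0 = - n.+1%:Z by rewrite /fmode sub0r.
have -> : fmode n.+1 (n.*2.+2) = n.+1%:Z by rewrite /fmode -addnn; lia.
rewrite [F (- _) + _]addrC -addrA [F (- _) + _]addrC; congr (_ + _).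
by apply: eq_bigr => j _; congr F; rewrite /fmode /= /bump leq0n add1n; lia.
Qed.

(** The first K terms are bounded by a; the bounds b / (k + 1)^2 of the others telescope to b /
    K. *)
Lemma sum_inv_sqr_le (h : nat -> R) (a b : R) (K n : nat) : 0 <= a -> 0 <= b -> (0 < K)%N ->
  (forall k, 0 <= h k <= a) -> (forall k, h k <= b / k.+1%:R ^+ 2) ->
  \sum_(k < n) h k <= K%:R * a + b / K%:R.
Proof.
move=> a0 b0 K0 ha hb.
have K1 : 0 < K%:R :> R by rewrite ltr0n.
have head i : \sum_(k < i) h k <= i%:R * a.
  rewrite mulr_natl -[X in _ *+ X](card_ord i) -sumr_const; apply: ler_sum => k _.
  by case/andP: (ha k).
have [nK|Kn] := leqP n K.
  apply: (le_trans (head n)); apply: (@le_trans _ _ (K%:R * a)); first by rewrite ler_wpM2r// ler_nat.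
  by rewrite lerDl divr_ge0// ltW.
have : \sum_(k < K + (n - K)) h k <= K%:R * a + b * (K%:R^-1 - (K + (n - K))%:R^-1).
{ elim: (n - K)%N => [|i IHi]; first by rewrite addn0 subrr mulr0 addr0.
  rewrite addnS big_ord_recr/=; apply: (le_trans (lerD IHi (hb _))).
  rewrite -addrA lerD2l; move: (K + i)%N (ltn_addr i K0) => M M0.
  have m0 : 0 < M%:R :> R by rewrite ltr0n.
  have m1 : 0 < M.+1%:R :> R by [].
  have -> : b * (K%:R^-1 - M%:R^-1) + b / M.+1%:R ^+ 2 = b * (K%:R^-1 - M%:R^-1 + (M.+1%:R ^+ 2)^-1) by rewrite [RHS]mulrDr.
  rewrite ler_wpM2l// -addrA lerD2l.
  have : (M.+1%:R ^+ 2)^-1 <= M%:R^-1 - M.+1%:R^-1 :> R; last first.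
    by move: ((M.+1%:R ^+ 2)^-1 : R) (M%:R^-1 : R) (M.+1%:R^-1 : R) => x y z; lra.
  have -> : M%:R^-1 - M.+1%:R^-1 = (M%:R * M.+1%:R)^-1 :> R.
    by rewrite -natr1; move: (M%:R : R) m0 => x x0; field; rewrite !gt_eqF// addr_gt0.
  by rewrite lef_pV2 ?posrE ?exprn_gt0 ?mulr_gt0// expr2 ler_pM2r// ler_nat. }
rewrite subnKC ?(ltnW Kn)// => h1; apply: (le_trans h1).
by rewrite lerD2l ler_wpM2l// gerBl invr_ge0.
Qed.

(** Each mode contributes the smaller of the two exponents: at most sqrt (lam / alpha) for low modes
    and at most lam L^2 / (2 k^2) for the others. The total grows like sqrt lam, plus a term linear
    in lam whose factor L^2 / K is at disposal. The outer 2 counts real and imaginary parts. *)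
Lemma damping_lower (lam : R) (K n : nat) : 0 <= lam -> (0 < K)%N ->
  expR (- (2 * ((1 + 2 * K%:R) * Num.sqrt (lam / alpha) + lam * L ^+ 2 / K%:R))) <=
  \prod_(i < n.*2.+1.*2) kappa (lam / fdenom (fmode n i./2)).
Proof.
move=> l0 K0; pose s := Num.sqrt (lam / alpha).
have f0 k := fdenom_gt0 L alpha0 k.
pose h (k : int) := Num.min (Num.sqrt (lam / fdenom k)) (lam / fdenom k / 2).
have lf k : 0 <= lam / fdenom k by rewrite divr_ge0// ltW.
have h0 k : 0 <= h k by rewrite le_min sqrtr_ge0 divr_ge0.
have hk k : expR (- h k) <= kappa (lam / fdenom k).
  by rewrite /h minEle; case: ifP => _; [apply: kappa_ge_exp_sqrt|apply: kappa_ge_exp]; exact: lf.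
have hs k : h k <= s.
  rewrite ge_min; apply/orP; left; apply: ler_wsqrtr; rewrite ler_wpM2l// lef_pV2 ?posrE//.
  exact: fdenom_ge.
have hL (k : nat) (z : int) : (z = k.+1%:Z \/ z = - k.+1%:Z) -> h z <= lam * L ^+ 2 / 2 / k.+1%:R ^+ 2.
{ move=> zk; rewrite ge_min; apply/orP; right.
  have -> : lam * L ^+ 2 / 2 / k.+1%:R ^+ 2 = lam / (k.+1%:R ^+ 2 / L ^+ 2) / 2.
    by move: (k.+1%:R : R) (ltr0Sn R k) => x x0; field; rewrite !gt_eqF.
  rewrite ler_wpM2r// ler_wpM2l// lef_pV2 ?posrE ?divr_gt0 ?exprn_gt0//.
  have z2 : (z%:~R : R) ^+ 2 = k.+1%:R ^+ 2 by case: zk => ->; rewrite ?mulrNz ?sqrrN.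
  rewrite /fdenom expr_div_n z2; apply: (@le_trans _ _ (4 * pi ^+ 2 * (k.+1%:R ^+ 2 / L ^+ 2))).
    rewrite ler_peMl ?divr_ge0 ?exprn_ge0 ?(ltW L0)//.
    have p2 : 2 <= pi :> R by exact: pi_ge2.
    have : 2 ^+ 2 <= pi ^+ 2 :> R by rewrite lerXn2r ?nnegrE ?pi_ge0.
    lra.
  by rewrite lerDr ltW. }
have sum_h : \sum_(j < n.*2.+1) h (fmode n j) <= (1 + 2 * K%:R) * s + lam * L ^+ 2 / K%:R.
{ rewrite sum_fmode big_split/=.
  have b0 : 0 <= lam * L ^+ 2 / 2 by rewrite divr_ge0// mulr_ge0// sqr_ge0.
  have s0 : 0 <= s by exact: sqrtr_ge0.
  have h1 := @sum_inv_sqr_le (fun k => h k.+1%:Z) s _ K n s0 b0 K0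
    (fun k => introT andP (conj (h0 _) (hs _))) (fun k => hL k _ (or_introl erefl)).
  have h2 := @sum_inv_sqr_le (fun k => h (- k.+1%:Z)) s _ K n s0 b0 K0
    (fun k => introT andP (conj (h0 _) (hs _))) (fun k => hL k _ (or_intror erefl)).
  have := lerD (hs 0) (lerD h1 h2) => /le_trans; apply.
  by rewrite le_eqVlt; apply/orP; left; apply/eqP; field; rewrite gt_eqF// ltr0n. }
have -> : \prod_(i < n.*2.+1.*2) kappa (lam / fdenom (fmode n i./2)) =
    (\prod_(j < n.*2.+1) kappa (lam / fdenom (fmode n j))) ^+ 2.
{ elim: (n.*2.+1) => [|M IHM]; first by rewrite !big_ord0 expr1n.
  rewrite doubleS !big_ord_recr/= IHM /= uphalf_double doubleK; ring. }
apply: (@le_trans _ _ (expR (- \sum_(j < n.*2.+1) h (fmode n j)) ^+ 2)).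
  by rewrite [leRHS]expr2 -expRD ler_expR -/s; move: sum_h; lra.
rewrite lerXn2r ?nnegrE ?expR_ge0//.
  by apply: prodr_ge0 => j _; apply: le_trans (hk _); exact: expR_ge0.
elim: (n.*2.+1) => [|M IHM]; first by rewrite !big_ord0 oppr0 expR0.
rewrite !big_ord_recr/= opprD expRD; apply: ler_pM; rewrite ?expR_ge0//.
Qed.

Lemma mass_damping (lam : R) (K : nat) : 0 <= lam -> (0 < K)%N ->
  expR (- (2 * ((1 + 2 * K%:R) * Num.sqrt (lam / alpha) + lam * L ^+ 2 / K%:R))) <=
  \int[m]_phi expR (- (lam * mass L phi)).
Proof.
move=> l0 K0; set B := expR _.
have [d [Om [P [X [mX charX limX _]]]]] := free_field_rep alpha0 L0 ff.
(* The sign turns the desired lower bound into an upper bound on the mean of [F], which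
   inf-convolutions inherit because they lie below [F]. *)
pose F (phi : path_space R) := - expR (- (lam * mass L phi)).
have cF : continuous F.
{ move=> phi; apply: (@continuous_comp _ _ _ (mass L) (fun y : R => - expR (- (lam * y)))).
    exact: mass_continuous.
  apply: cvgN; apply: (@continuous_comp _ _ _ (fun y : R => - (lam * y)) expR); last exact: continuous_expR.
  by apply: cvgN; apply: cvgM; [exact: cvg_cst|exact: cvg_id]. }
have F1 phi : `|F phi| <= 1.
  rewrite normrN ger0_norm ?expR_ge0// -expR0 ler_expR oppr_le0 mulr_ge0//; exact: mass_ge0.
have lF := continuous_lower_semi cF.
have key n : \int[P]_w F (trig_path alpha L n (X n ^~ w)) <= - B.
{ have E w : F (trig_path alpha L n (X n ^~ w)) =
    - 1 * expR (- \sum_(i < n.*2.+1.*2) (lam / fdenom (fmode n i./2)) * X n i w ^+ 2).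
    rewrite mulN1r /F mass_trigE//; congr (- expR (- _)).
    rewrite (sum_double _ (fun i => lam / fdenom (fmode n i./2) * X n i w ^+ 2)) mulr_sumr.
    by apply: eq_bigr => j _; rewrite /= uphalf_double doubleK -mulrDr mulrA.
  under eq_Rintegral do rewrite E.
  have l1 i : 0 <= lam / fdenom (fmode n i./2) by rewrite divr_ge0// ltW// fdenom_gt0.
  rewrite RintZ; last first.
    split; last first.
      exists 1 => w; rewrite ger0_norm ?expR_ge0// -expR0 ler_expR oppr_le0.
      by apply: sumr_ge0 => i _; rewrite mulr_ge0 ?sqr_ge0.
    apply: measurableT_comp => //; apply: measurableT_comp => //; apply: measurable_sum => i.
    by apply: measurable_funM => //; exact: measurable_funX.
  rewrite (gaussian_damping (mX n) (charX n) l1) mulN1r lerN2.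
  exact: damping_lower. }
have mI k n : measurable_fun setT (fun w => inf_conv F 1 k (trig alpha L n (X n ^~ w))).
{ apply: (@lip_measurable _ _ _ (X n) _ n.*2.+1.*2 (k%:R * (2 * ((Num.sqrt alpha)^-1 * (Num.sqrt L)^-1))) 1
    (fun a => inf_conv F 1 k (trig alpha L n a))).
  + by move=> i; exact: mX.
  + by rewrite !mulr_ge0// invr_ge0 sqrtr_ge0.
  + move=> a b; rewrite -!mulrA; have [_ h] := inf_conv_lip F1 k; apply: h => x _.
    by have := trig_lip L alpha0 n a b x; rewrite -!mulrA.
  + by move=> a; have [h _] := inf_conv_lip F1 k. }
have Ik k : \int[m]_phi inf_conv F 1 k phi <= - B.
{ have lim := limX _ _ _ _ (ler0n _ k) (inf_conv_lip F1 k).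
  rewrite -(cvg_lim (@Rhausdorff R) lim); apply: limr_le; first by apply/cvg_ex; eexists; exact: lim.
  apply: nearW => n; apply: le_trans (key n); apply: Rint_le.
  - by split => //; exists 1 => w; have [h _] := inf_conv_lip F1 k; exact: h.
  - split; last by exists 1 => w; exact: F1.
    rewrite /F; apply: measurableT_comp => //; apply: measurableT_comp => //; apply: measurableT_comp => //.
    apply: measurable_funM => //.
    under eq_fun do rewrite mass_trigE//.
    apply: measurable_sum => j; apply: measurable_funM => //.
    by apply: measurable_funD; exact: measurable_funX.
  - move=> w; exact: (inf_conv_le F1 k (trig_path alpha L n (X n ^~ w))). }
have : \int[m]_phi F phi <= - B.
{ have lim := inf_conv_integral lF F1 (m := m).
  rewrite -(cvg_lim (@Rhausdorff R) lim); apply: limr_le; first by apply/cvg_ex; eexists; exact: lim.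
  by apply: nearW => k; exact: Ik. }
rewrite /F; under eq_Rintegral do rewrite -mulN1r.
rewrite RintZ ?mulN1r ?lerN2//; split; last first.
  by exists 1 => phi; have := F1 phi; rewrite normrN.
rewrite (_ : (fun phi : borel (path_space R) => expR (- (lam * mass L phi))) = (fun phi => - F phi)).
  by apply: measurableT_comp => //; exact: borel_continuous_measurable.
by apply/funext => phi; rewrite opprK.
Qed.

(** The mean of exp(- lam M) is at most P(M <= e) + exp(- lam e). [mass_damping] bounds it from
    below by exp(- lam e / 2) for a suitable lam, so the probability cannot vanish. *)
Lemma small_mass_gt0 (e : R) : 0 < e -> (0 < m [set phi | (mass L phi <= e)%R])%E.
Proof.
(* [K] makes the doubled cost of the high modes at most lam e / 8. Below, [r] is the square root of
   lam for which the low modes cost lam e / 8 before doubling, so that the total is at most lam e /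
   2. *)
move=> e0; pose K := (Num.truncn (16 * L ^+ 2 / e)).+1.
have K1 : 0 < K%:R :> R by [].
have KL : 2 * (L ^+ 2 / K%:R) <= e / 8.
{ have h : 16 * L ^+ 2 / e <= K%:R by apply/ltW; exact: truncnS_gt.
  rewrite mulrA ler_pdivrMr//; rewrite ler_pdivrMr// in h.
  by rewrite mulrAC ler_pdivlMr//; move: h; rewrite [K%:R * e]mulrC; lra. }
pose r := 8 * (1 + 2 * K%:R) / (e * Num.sqrt alpha).
have sa : 0 < Num.sqrt alpha by rewrite sqrtr_gt0.
have k1 : 0 < 1 + 2 * K%:R :> R by rewrite addr_gt0// mulr_gt0.
have r0 : 0 < r by rewrite divr_gt0// mulr_gt0.
pose lam := r ^+ 2; have l0 : 0 < lam by exact: exprn_gt0.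
have sl : Num.sqrt (lam / alpha) = r / Num.sqrt alpha.
  by rewrite sqrtrM ?sqr_ge0// sqrtr_sqr gtr0_norm// sqrtrV// ltW.
have := @mass_damping lam K (ltW l0) isT; rewrite sl => h.
have h1 : 2 * ((1 + 2 * K%:R) * (r / Num.sqrt alpha) + lam * L ^+ 2 / K%:R) <= lam * e / 2.
{ have -> : (1 + 2 * K%:R) * (r / Num.sqrt alpha) = lam * e / 8.
    rewrite /lam /r; field; rewrite !gt_eqF//.
  have -> : 2 * (lam * e / 8 + lam * L ^+ 2 / K%:R) = lam * (e / 4 + 2 * (L ^+ 2 / K%:R)) by field; rewrite gt_eqF.
  by rewrite -mulrA ler_wpM2l ?(ltW l0)//; lra. }
pose A : set (borel (path_space R)) := [set phi | mass L phi <= e].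
have cm : measurable_fun setT (mass L : borel (path_space R) -> R).
  by apply: borel_continuous_measurable; exact: mass_continuous.
have mA : measurable A by rewrite -[A]setTI; apply: measurable_fun_le.
have bA : bounded_mfun (\1_A : borel (path_space R) -> R) by exact: bmf_indic.
have bE : bounded_mfun (fun phi : borel (path_space R) => expR (- (lam * mass L phi))).
{ split.
    apply: measurableT_comp => //; apply: measurableT_comp => //; exact: measurable_funM.
  exists 1 => phi; rewrite ger0_norm ?expR_ge0// -expR0 ler_expR oppr_le0 mulr_ge0 ?(ltW l0)//.
  exact: mass_ge0. }
have h2 : \int[m]_phi expR (- (lam * mass L phi)) <= fine (m A) + expR (- (lam * e)).
{ have -> : fine (m A) + expR (- (lam * e)) = \int[m]_phi (\1_A phi + expR (- (lam * e))).
    rewrite RintD//; last exact: bmf_cst.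
    by rewrite Rint_cst /Rintegral integral_indic ?setIT.
  apply: Rint_le => //; first exact: (bmfD bA (bmf_cst _ _)).
  move=> phi; rewrite indicE; have [_|/negP nA] := boolP (phi \in A).
    rewrite -[leLHS]addr0; apply: lerD; last exact: expR_ge0.
    rewrite -expR0 ler_expR oppr_le0 mulr_ge0 ?(ltW l0)//; exact: mass_ge0.
  rewrite add0r ler_expR lerN2 ler_wpM2l ?(ltW l0)//; apply/ltW; rewrite ltNge; apply/negP => le.
  by apply: nA; rewrite inE. }
have h3 : expR (- (lam * e / 2)) <= fine (m A) + expR (- (lam * e)).
  by apply: le_trans h2; apply: le_trans h; rewrite ler_expR lerN2.
have h4 : expR (- (lam * e)) < expR (- (lam * e / 2)).
  by rewrite ltr_expR ltrN2; have := mulr_gt0 l0 e0; lra.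
have h5 : 0 < fine (m A) by lra.
by rewrite -[m A]fineK ?fin_num_measure// lte_fin.
Qed.

End small_mass.

(** * Gibbs measures *)

Lemma density_probability d (T : measurableType d) (R : realType) (m : probability T R) (w : T -> R) :
  measurable_fun setT w -> (forall x, 0 <= w x) -> (0 < \int[m]_x (w x)%:E < +oo)%E ->
  exists rho : probability T R, forall A, measurable A ->
    rho A = ((fine (\int[m]_x (w x)%:E))^-1%:E * \int[m]_(x in A) (w x)%:E)%E.
Proof.
move=> mw w0; set Z := (\int[m]_x (w x)%:E)%E => /andP[Z0 Zoo].
have z0 : 0 < fine Z by rewrite fine_gt0// Z0.
have zE : Z = (fine Z)%:E by rewrite fineK// ge0_fin_numE// ltW.
pose nu (A : set T) : \bar R := ((fine Z)^-1%:E * \int[m]_(x in A) (w x)%:E)%E.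
have ew0 x : (0 <= (w x)%:E)%E by rewrite lee_fin.
have mew : measurable_fun setT (fun x => (w x)%:E) by exact/measurable_EFinP.
have nu0 : nu set0 = 0%E by rewrite /nu integral_set0 mule0.
have nu_ge0 A : (0 <= nu A)%E.
  by apply: mule_ge0; [rewrite lee_fin invr_ge0 ltW|apply: integral_ge0].
have nu_add : semi_sigma_additive nu.
{ move=> /= A mA tA mUA; rewrite /nu ge0_integral_bigcup//; last exact: measurable_funTS.
  rewrite -nneseriesZl//; last by move=> n _; apply: integral_ge0.
  apply: is_cvg_ereal_nneg_natsum_cond => n _ _; exact: nu_ge0. }
pose mix := isMeasure.Build _ _ _ nu nu0 nu_ge0 nu_add.
pose nuM : {measure set T -> \bar R} := HB.pack nu mix.
have nu1 : nuM setT = 1%E.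
  by rewrite /nuM /= /nu -/Z zE -EFinM mulVf// gt_eqF.
pose mix1 := Measure_isProbability.Build _ _ _ nuM nu1.
pose rho : probability T R := HB.pack nu mix mix1.
by exists rho.
Qed.

Lemma jensen_expR d (T : measurableType d) (R : realType) (m : probability T R) (X : T -> R) :
  bounded_mfun X -> expR (\int[m]_x X x) <= \int[m]_x expR (X x).
Proof.
move=> bX; set c := \int[m]_x X x.
have bE : bounded_mfun (fun x => expR (X x)).
{ case: bX => mX [M XM]; split; first exact: measurableT_comp.
  exists (expR M) => x; rewrite ger0_norm ?expR_ge0// ler_expR.
  by apply: le_trans (XM x); exact: ler_norm. }
have bL : bounded_mfun (fun x => expR c * (1 - c) + expR c * X x).
  by apply: bmfD (bmf_cst _ _) _; exact: bmfZ.
have -> : expR c = \int[m]_x (expR c * (1 - c) + expR c * X x).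
  rewrite RintD; [|exact: bmf_cst|exact: bmfZ].
  by rewrite Rint_cst RintZ// -/c; ring.
apply: Rint_le => // x.
have -> : X x = c + (X x - c) by rewrite addrC subrK.
rewrite expRD.
have -> : expR c * (1 - c) + expR c * (c + (X x - c)) = expR c * (1 + (X x - c)) by ring.
by rewrite ler_wpM2l ?expR_ge0// expR_ge1Dx.
Qed.

Section gibbs.
Context (R : realType) (alpha p gamma beta N L : R).
Variables (m : probability (borel (path_space R)) R).
Hypotheses (alpha0 : 0 < alpha) (p26 : 2 < p < 6) (beta0 : 0 <= beta) (N0 : 0 < N) (L0 : 0 < L).
Hypothesis ff : is_free_field alpha L m.
Notation w := (gibbs_weight p gamma beta N L).
Notation Z := (partition_function p gamma beta N L m).

Lemma gibbs_weightE phi :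
  w phi = expR (beta / (p * L `^ gamma) * potential p L phi) * ((mass L phi <= N * L)%R)%:R.
Proof.
rewrite /gibbs_weight indicE; congr (_ * (nat_of_bool _)%:R).
by apply/idP/idP => [/set_mem//|h]; exact/mem_set.
Qed.

Let th0 : 0 <= beta / (p * L `^ gamma).
Proof.
by case/andP: p26 => p2 _; rewrite divr_ge0// mulr_ge0 ?powR_ge0//; lra.
Qed.

Lemma gibbs_weight_ge0 phi : 0 <= w phi.
Proof. by rewrite gibbs_weightE mulr_ge0 ?expR_ge0. Qed.

Lemma measurable_gibbs_weight : measurable_fun setT (w : borel (path_space R) -> R).
Proof.
apply: measurable_funM.
  apply: measurableT_comp => //; apply: measurable_funM => //.
  apply: borel_continuous_measurable; exact: potential_continuous.
apply: measurable_indic.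
rewrite -[X in measurable X]setTI; apply: measurable_fun_le => //.
by apply: borel_continuous_measurable; exact: mass_continuous.
Qed.

Lemma partition_ge : (m [set phi | (mass L phi <= N * L)%R] <= Z)%E.
Proof.
have mA : measurable ([set phi | mass L phi <= N * L] : set (borel (path_space R))).
  rewrite -[X in measurable X]setTI; apply: measurable_fun_le => //.
  by apply: borel_continuous_measurable; exact: mass_continuous.
rewrite -[X in m X]setIT -integral_indic//; apply: ge0_le_integral => //.
- exact/measurable_EFinP/measurable_indic.
- by apply/measurable_EFinP; exact: measurable_gibbs_weight.
- move=> phi _; rewrite lee_fin /gibbs_weight ler_peMl ?indicE//.
  rewrite -expR0 ler_expR mulr_ge0//; exact: potential_ge0.
Qed.

Lemma partition_gt0 : (0 < Z)%E.
Proof.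
by apply: lt_le_trans partition_ge; apply: (small_mass_gt0 alpha0 L0 ff); rewrite mulr_gt0.
Qed.

Lemma partition_lty : (Z < +oo)%E.
Proof.
(* The moment bound concerns an open set of masses; {M < (N + 1) L} contains the closed cutoff {M <=
   N L}. *)
have m10 : 0 < (N + 1) * L by rewrite mulr_gt0// addr_gt0.
have [c hc] := gibbs_moment_finite alpha0 L0 p26 ff th0 m10.
apply: le_lt_trans (ltry c); apply: le_trans hc; apply: ge0_le_integral => //.
- by move=> phi _; rewrite lee_fin gibbs_weight_ge0.
- by apply/measurable_EFinP; exact: measurable_gibbs_weight.
- apply/measurable_EFinP; apply: measurable_funM.
    apply: measurableT_comp => //; apply: measurable_funM => //.
    apply: borel_continuous_measurable; exact: potential_continuous.
  by apply: measurable_indic; apply: sub_sigma_algebra; exact: open_mass_lt.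
- move=> phi _; rewrite lee_fin gibbs_weightE ler_wpM2l ?expR_ge0// indicE.
  have [h|_] := leP (mass L phi) (N * L); last by rewrite ler0n.
  by rewrite mem_set//=; apply: le_lt_trans h _; rewrite ltr_pM2r// ltrDl.
Qed.

Lemma gibbs_exists : exists rho : probability (borel (path_space R)) R,
  is_gibbs_measure p gamma beta N L m rho.
Proof.
have ZZ : (0 < Z < +oo)%E by rewrite partition_gt0 partition_lty.
have [rho rhoE] := density_probability measurable_gibbs_weight gibbs_weight_ge0 ZZ.
by exists rho.
Qed.

Variable rho : probability (borel (path_space R)) R.
Hypothesis rhoG : is_gibbs_measure p gamma beta N L m rho.
Let z := fine Z.

Lemma fine_partition_gt0 : 0 < z.
Proof. by rewrite fine_gt0// partition_gt0 partition_lty. Qed.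

Lemma gibbs_integral (h : borel (path_space R) -> R) : measurable_fun setT h -> (forall phi, 0 <= h phi) ->
  (\int[rho]_phi (h phi)%:E = z^-1%:E * \int[m]_phi (h phi * w phi)%:E)%E.
Proof.
move=> mh h0; have z0 := fine_partition_gt0; have [_ rE] := rhoG.
have mz : measurable_fun setT (fun phi : borel (path_space R) => z^-1 * w phi).
  by apply: measurable_funM => //; exact: measurable_gibbs_weight.
rewrite (@ge0_integral_density _ _ _ m rho (fun phi => z^-1 * w phi)) //.
- under eq_integral do rewrite mulrCA EFinM.
  rewrite ge0_integralZl// ?lee_fin ?invr_ge0 ?(ltW z0)//.
  + apply/measurable_EFinP; apply: measurable_funM => //; exact: measurable_gibbs_weight.
  + by move=> phi _; rewrite lee_fin mulr_ge0// gibbs_weight_ge0.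
- by move=> phi; rewrite mulr_ge0 ?invr_ge0 ?(ltW z0)// gibbs_weight_ge0.
- move=> A mA; apply: (etrans (rE A mA)); under [RHS]eq_integral do rewrite EFinM.
  rewrite ge0_integralZl// ?lee_fin ?invr_ge0 ?(ltW z0)//.
  + by apply: measurable_funTS; apply/measurable_EFinP; exact: measurable_gibbs_weight.
  + by move=> phi _; rewrite lee_fin gibbs_weight_ge0.
Qed.

Hypothesis L2 : 2 <= L.

Let weight_shift a phi : `|a| <= L -> periodic_paths L phi -> w (path_shift a phi) = w phi.
Proof.
move=> aL pphi; have p0 : 0 < p by case/andP: p26; lra.
have eM : mass L (path_shift a phi) = mass L phi.
  apply: (@energy_shift R (fun y => y ^+ 2)) => //; last exact: ltW.
  by move=> y; exact: exprn_continuous.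
have eV : potential p L (path_shift a phi) = potential p L phi.
  rewrite !potentialE_energy; apply: energy_shift => //; last exact: ltW.
  exact: continuous_norm_powR.
by rewrite !gibbs_weightE eM eV.
Qed.

Let gibbs_shift_ge0 a (h : borel (path_space R) -> R) : `|a| <= L -> measurable_fun setT h ->
  (forall phi, 0 <= h phi) ->
  (\int[rho]_phi (h (path_shift a phi))%:E = \int[rho]_phi (h phi)%:E)%E.
Proof.
move=> aL mh h0; have mw := measurable_gibbs_weight.
have mhs : measurable_fun setT (fun phi : borel (path_space R) => h (path_shift a phi)).
  exact: measurableT_comp mh (measurable_path_shift a).
have mws : measurable_fun setT (fun phi : borel (path_space R) => w (path_shift a phi)).
  exact: measurableT_comp mw (measurable_path_shift a).
rewrite !gibbs_integral//; congr (_ * _)%E.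
transitivity (\int[m]_phi (h (path_shift a phi) * w (path_shift a phi))%:E)%E.
{ apply: ae_eq_integral => //.
  - by apply/measurable_EFinP; exact: measurable_funM.
  - by apply/measurable_EFinP; exact: measurable_funM.
  - have [_ [_ [_ [_ [_ _ _ per]]]]] := free_field_rep alpha0 L0 ff.
    exists (~` periodic_paths L); split => //.
      by apply: measurableC; exact: measurable_periodic_paths.
    by move=> phi /= nE pphi; apply: nE => _; rewrite weight_shift. }
have := @free_field_shift R alpha alpha0 L m a (fun phi => (h phi * w phi)%:E) L2 ff.
apply; first by apply/measurable_EFinP; exact: measurable_funM.
by move=> phi; rewrite lee_fin mulr_ge0// gibbs_weight_ge0.
Qed.

(** The Gibbs weight is invariant under translations on periodic paths, which carry the whole mass
    of the free field, and the free field itself is translation invariant. Shifts by at most L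
    include all tile centres. *)
Lemma gibbs_shift a (F : borel (path_space R) -> R) : `|a| <= L -> bounded_mfun F ->
  \int[rho]_phi F (path_shift a phi) = \int[rho]_phi F phi.
Proof.
move=> aL [mF [M FM]].
have bF : bounded_mfun F by split => //; exists M.
have bFs : bounded_mfun (fun phi : borel (path_space R) => F (path_shift a phi)).
  by split; [exact: measurableT_comp mF (measurable_path_shift a)|exists M].
have bM : bounded_mfun (fun phi : borel (path_space R) => F phi + M) by exact: bmfD bF (bmf_cst _ _).
have bMs : bounded_mfun (fun phi : borel (path_space R) => F (path_shift a phi) + M) by exact: bmfD bFs (bmf_cst _ _).
have := @gibbs_shift_ge0 a (fun phi => F phi + M) aL (proj1 bM).
rewrite -(EFin_Rint rho bM) -(EFin_Rint rho bMs).
have M0 phi : 0 <= F phi + M by have := FM phi; rewrite ler_norml; lra.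
move=> H; have := H M0 => -[]; rewrite !RintD//; try exact: bmf_cst.
by move=> {}H; apply: (addIr (\int[rho]_phi M)).
Qed.

(* [2 x y <= x^2 + y^2] with [x] the Gibbs weight and [y = exp X]. *)
Lemma gibbs_exp_le (X : borel (path_space R) -> R) (Q a : R) : bounded_mfun X ->
  (\int[m]_phi (expR (2 * (beta / (p * L `^ gamma)) * potential p L phi) *
     \1_[set phi | (mass L phi < (N + 1) * L)%R] phi)%:E <= Q%:E)%E ->
  \int[m]_phi expR (2 * X phi) <= a ->
  expR (\int[rho]_phi X phi) <= (Q + a) / (2 * z).
Proof.
move=> bX hQ ha; have z0 := fine_partition_gt0; have mw := measurable_gibbs_weight.
have bexp c : bounded_mfun (fun phi : borel (path_space R) => expR (c * X phi)).
{ have [mX [M XM]] := bX; split; first by apply: measurableT_comp => //; exact: measurable_funM.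
  exists (expR (`|c| * M)) => phi; rewrite ger0_norm ?expR_ge0// ler_expR.
  by apply: le_trans (ler_norm _) _; rewrite normrM ler_wpM2l. }
have b1 : bounded_mfun (fun phi : borel (path_space R) => expR (X phi)).
  by have := bexp 1; under eq_fun do rewrite mul1r.
apply: (le_trans (jensen_expR rho bX)).
rewrite -lee_fin EFin_Rint// gibbs_integral//; last exact: (proj1 b1).
have -> : ((Q + a) / (2 * z))%:E = (z^-1%:E * ((2^-1 * (Q + a))%:E))%E.
  by rewrite -EFinM; congr EFin; field; rewrite gt_eqF.
apply: lee_wpmul2l; first by rewrite lee_fin invr_ge0 ltW.
set G := (fun phi : borel (path_space R) => expR (2 * (beta / (p * L `^ gamma)) * potential p L phi) *
     \1_[set phi | mass L phi < (N + 1) * L] phi) in hQ *.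
have mG : measurable_fun setT G.
{ apply: measurable_funM.
    apply: measurableT_comp => //; apply: measurable_funM => //.
    apply: borel_continuous_measurable; exact: potential_continuous.
  by apply: measurable_indic; apply: sub_sigma_algebra; exact: open_mass_lt. }
have G0 phi : 0 <= G phi by rewrite mulr_ge0 ?expR_ge0// indicE.
have mE2 : measurable_fun setT (fun phi : borel (path_space R) => expR (2 * X phi)) by exact: (proj1 (bexp 2)).
apply: (@le_trans _ _ (\int[m]_phi (2^-1%:E * ((G phi)%:E + (expR (2 * X phi))%:E)))%E).
{ apply: ge0_le_integral => //.
  - by move=> phi _; rewrite lee_fin mulr_ge0 ?expR_ge0// gibbs_weight_ge0.
  - by apply/measurable_EFinP; apply: measurable_funM => //; exact: (proj1 b1).
  - apply: emeasurable_funM => //; apply: emeasurable_funD; exact/measurable_EFinP.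
  - move=> phi _; suff h : expR (X phi) * w phi <= 2^-1 * (G phi + expR (2 * X phi)) by rewrite -lee_fin in h.
    have e2 y : expR (2 * y) = expR y ^+ 2 :> R by rewrite expr2 -expRD; congr expR; ring.
    rewrite gibbs_weightE /G indicE -[2 * _ * _]mulrA !e2.
    move: (expR_ge0 (X phi)); set x := expR (X phi); set y := expR (_ * potential p L phi); move=> x0.
    have [h|_] := leP (mass L phi) (N * L).
      rewrite mem_set/=; last by apply: le_lt_trans h _; rewrite ltr_pM2r// ltrDl.
      by have := sqr_ge0 (x - y); rewrite sqrrB !mulr1; lra.
    rewrite !mulr0 mulr_ge0// addr_ge0 ?sqr_ge0// mulr_ge0 ?sqr_ge0//. }
rewrite ge0_integralZl//; last 2 first.
- by apply: emeasurable_funD; exact/measurable_EFinP.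
- by move=> phi _; rewrite adde_ge0// lee_fin ?expR_ge0.
rewrite EFinM lee_wpmul2l// ge0_integralD//; last 3 first.
- by move=> phi _; rewrite lee_fin.
- exact/measurable_EFinP.
- exact/measurable_EFinP.
rewrite EFinD leeD//; rewrite -EFin_Rint ?lee_fin//; exact: bexp.
Qed.

End gibbs.

(** * Comparison of the Gibbs measure with the free field *)

Lemma lip_local_shift (R : realType) (A K M c : R) (F : (R -> Rcomplex R) -> R) : lip_local A K M F ->
  lip_local (A + `|c|) K M (fun f => F (fun x => f (x + c))).
Proof.
move=> [FM FK]; split => [f|f g d fg]; first exact: FM.
by apply: FK => x xA; apply: fg; rewrite (le_trans (ler_normD _ _))// lerD2r.
Qed.

Lemma lip_localW (R : realType) (A A' K M : R) (F : (R -> Rcomplex R) -> R) : A <= A' ->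
  lip_local A K M F -> lip_local A' K M F.
Proof.
by move=> AA [FM FK]; split => // f g d fg; apply: FK => x xA; apply: fg; exact: le_trans AA.
Qed.

Lemma lip_local_sum (R : realType) (A K M : R) (n : nat) (F : nat -> (R -> Rcomplex R) -> R) :
  (forall j, (j < n)%N -> lip_local A K M (F j)) ->
  lip_local A (n%:R * K) (n%:R * M) (fun f => \sum_(j < n) F j f).
Proof.
move=> FL; split => [f|f g d fg].
  apply: (le_trans (ler_norm_sum _ _ _)); rewrite mulr_natl -[X in _ *+ X](card_ord n) -sumr_const.
  by apply: ler_sum => j _; have [h _] := FL j (ltn_ord j).
rewrite -sumrB; apply: (le_trans (ler_norm_sum _ _ _)).
rewrite -mulrA mulr_natl -[X in _ *+ X](card_ord n) -sumr_const.
by apply: ler_sum => j _; have [_ h] := FL j (ltn_ord j); exact: h.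
Qed.

Section tiles.
Context (R : realType) (alpha L : R) (m : probability (borel (path_space R)) R).
Hypotheses (alpha0 : 0 < alpha) (L2 : 2 <= L) (ff : is_free_field alpha L m).
Variables (A K M : R) (F : (R -> Rcomplex R) -> R).
Hypotheses (K0 : 0 <= K) (FL : lip_local A K M F).
Variables (nt : nat) (s : R).
Hypotheses (s0 : 0 < s) (sL : s * nt%:R = L) (As : 2 * A <= s).

Let L0 : 0 < L. Proof. exact: lt_le_trans L2. Qed.

Definition tile_centre (j : nat) : R := - L / 2 + s * j%:R + s / 2.
Definition tile_sum (f : R -> Rcomplex R) : R := \sum_(j < nt) F (fun x => f (x + tile_centre j)).

Lemma tile_centre_le j : (j < nt)%N -> `|tile_centre j| <= L.
Proof.
move=> jn; rewrite /tile_centre.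
have h1 : 0 <= s * j%:R by rewrite mulr_ge0// ltW.
have h2 : s * j.+1%:R <= L by rewrite -sL ler_wpM2l ?(ltW s0)// ler_nat.
move: h2; rewrite -natr1 mulrDr mulr1 => h2; have l0 := ltW L0; have s0' := ltW s0.
by rewrite ler_norml; apply/andP; split; lra.
Qed.

Lemma tile_sum_lip : lip_local (A + L) (nt%:R * K) (nt%:R * M) tile_sum.
Proof.
apply: (@lip_local_sum _ _ _ _ _ (fun j f => F (fun x => f (x + tile_centre j)))) => j jn.
by apply: lip_localW (lip_local_shift (tile_centre j) FL); rewrite lerD2l tile_centre_le.
Qed.

Let nK0 : 0 <= nt%:R * K. Proof. exact: mulr_ge0. Qed.

Lemma bmf_tile_sum : bounded_mfun (fun phi : borel (path_space R) => tile_sum phi).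
Proof. exact: bmf_lip_local nK0 tile_sum_lip. Qed.

Let bF : bounded_mfun (fun phi : borel (path_space R) => F phi).
Proof. exact: bmf_lip_local K0 FL. Qed.

Let bFs c : bounded_mfun (fun phi : borel (path_space R) => F (path_shift c phi)).
Proof. exact: bmf_lip_local K0 (lip_local_shift c FL). Qed.

Lemma tile_sum_integral (P : probability (borel (path_space R)) R) :
  (forall c : R, `|c| <= L -> \int[P]_phi F (path_shift c phi) = \int[P]_phi F phi) ->
  \int[P]_phi tile_sum phi = nt%:R * \int[P]_phi F phi.
Proof.
move=> inv; rewrite /tile_sum.
rewrite (@Rint_sum _ _ _ P _ (index_enum 'I_nt) (fun j (phi : borel (path_space R)) => F (path_shift (tile_centre j) phi))); last first.
  by move=> j; exact: bFs.
rewrite mulr_natl -[X in _ *+ X](card_ord nt) -sumr_const; apply: eq_bigr => j _.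
by rewrite inv// tile_centre_le.
Qed.

Lemma free_field_shift_lip c : \int[m]_phi F (path_shift c phi) = \int[m]_phi F phi.
Proof.
have [cov [gf _ inc]] := free_field_gaussian alpha0 L2 ff.
apply/esym/(@Rint_law _ _ _ _ _ m m (path_shift c)) => //; first exact: measurable_path_shift.
exact: gaussian_field_shift gf inc c.
Qed.

Definition tile_const : R := (s^-1 + 1) / alpha + 1.

Lemma tile_const_gt0 : 0 < tile_const.
Proof. by rewrite ltr_wpDl// divr_ge0 ?(ltW alpha0)// addr_ge0// invr_ge0 ltW. Qed.

(** On each tile [F] changes by at most K sqrt (e_j), where e_j bounds the squared supremum there: 2
    A <= s keeps the window of [F] inside the tile. Young's inequality with weight [tile_const]
    makes the sum of the e_j cost at most D2 / 2. *)
Lemma tile_sum_diff (lam : R) n (a b : nat -> R) : 0 <= lam ->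
  2 * lam * (tile_sum (trig alpha L n a) - tile_sum (trig alpha L n b)) <=
  2 * nt%:R * lam ^+ 2 * K ^+ 2 * tile_const + (\sum_(i < n.*2.+1.*2) (a i - b i) ^+ 2) / 2.
Proof.
move=> l0; set D2 := \sum_(i < n.*2.+1.*2) _.
have [e [e0 eP eS]] := tile_bound alpha0 L0 n (fun i => a i - b i) s0 sL.
have C0 := tile_const_gt0.
rewrite /tile_sum -sumrB mulr_sumr.
have term (j : 'I_nt) : 2 * lam * (F (fun x => trig alpha L n a (x + tile_centre j)) - F (fun x => trig alpha L n b (x + tile_centre j))) <=
   2 * lam ^+ 2 * K ^+ 2 * tile_const + e j / (2 * tile_const).
{ have [_ FK] := FL.
  have h : F (fun x => trig alpha L n a (x + tile_centre j)) - F (fun x => trig alpha L n b (x + tile_centre j)) <= K * Num.sqrt (e j).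
  { apply: le_trans (ler_norm _) _; apply: FK => x xA; rewrite trigB.
    rewrite -[leLHS]ger0_norm// -sqrtr_sqr ler_wsqrtr//; apply: eP => //.
    have As2 : A <= s / 2 by rewrite ler_pdivlMr// mulrC.
    have xs := le_trans xA As2; rewrite /tile_centre -[j.+1%:R]natr1.
    by move: xs; rewrite ler_norml => /andP[x1 x2]; apply/andP; split; lra. }
  apply: (@le_trans _ _ (2 * lam * (K * Num.sqrt (e j)))); first by rewrite ler_wpM2l// mulr_ge0.
  have es : e j = Num.sqrt (e j) ^+ 2 by rewrite sqr_sqrtr.
  rewrite {2}es; move: (Num.sqrt (e j)) => y.
  have := sqr_ge0 (2 * lam * K * tile_const - y) => h2.
  rewrite -subr_ge0.
  have -> : 2 * lam ^+ 2 * K ^+ 2 * tile_const + y ^+ 2 / (2 * tile_const) - 2 * lam * (K * y) =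
     (2 * lam * K * tile_const - y) ^+ 2 / (2 * tile_const) by field; rewrite gt_eqF.
  by rewrite divr_ge0// mulr_ge0// ltW. }
apply: (@le_trans _ _ (\sum_(j < nt) (2 * lam ^+ 2 * K ^+ 2 * tile_const + e j / (2 * tile_const)))).
  by apply: ler_sum => j _; exact: term.
rewrite big_split/= sumr_const card_ord -mulr_suml; apply: lerD.
  by rewrite -mulr_natl le_eqVlt; apply/orP; left; apply/eqP; ring.
rewrite ler_pdivrMr ?mulr_gt0//; apply: (le_trans eS).
rewrite -/D2 -/tile_const; move: tile_const D2 => X Y.
have -> : Y / 2 * (2 * X) = X * Y by field.
exact: lexx.
Qed.

(** The means of exp(2 lam S) and exp(- 2 lam S - a) have product at most 1. Jensen's inequality
    bounds the second from below by the exponential of the mean, and translation invariance makes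
    the mean of S equal to n E F. *)
Lemma tile_concentration (lam : R) : 0 <= lam ->
  \int[m]_phi expR (2 * (lam * (tile_sum phi - nt%:R * \int[m]_psi F psi))) <=
  expR (2 * nt%:R * lam ^+ 2 * K ^+ 2 * tile_const).
Proof.
move=> l0; pose a := 2 * nt%:R * lam ^+ 2 * K ^+ 2 * tile_const; rewrite -/a; set E := \int[m]_psi F psi.
have a0 : 0 <= a by rewrite mulr_ge0 ?(ltW tile_const_gt0)// mulr_ge0 ?sqr_ge0// mulr_ge0 ?sqr_ge0// mulr_ge0.
have SL := tile_sum_lip; have [SM _] := SL.
have cS : continuous (fun phi : path_space R => tile_sum phi) by exact: lip_local_continuous nK0 SL.
pose u (phi : path_space R) := expR (2 * lam * tile_sum phi).
pose v (phi : path_space R) := expR (- (2 * lam) * tile_sum phi - a).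
have cu : continuous u.
{ move=> phi; apply: (@continuous_comp _ _ _ (fun phi : path_space R => tile_sum phi) (fun y => expR (2 * lam * y))); first exact: cS.
  apply: (@continuous_comp _ _ _ (fun y : R => 2 * lam * y) expR); last exact: continuous_expR.
  by apply: cvgM; [exact: cvg_cst|exact: cvg_id]. }
have cv : continuous v.
{ move=> phi; apply: (@continuous_comp _ _ _ (fun phi : path_space R => tile_sum phi) (fun y => expR (- (2 * lam) * y - a))); first exact: cS.
  apply: (@continuous_comp _ _ _ (fun y : R => - (2 * lam) * y - a) expR); last exact: continuous_expR.
  by apply: cvgB; [apply: cvgM; [exact: cvg_cst|exact: cvg_id]|exact: cvg_cst]. }
have l2 : 0 <= 2 * lam by rewrite mulr_ge0.
pose B := expR (2 * lam * (nt%:R * M)).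
have uB phi : 0 <= u phi <= B.
  rewrite expR_ge0 ler_expR ler_wpM2l//; apply: le_trans (SM phi); exact: ler_norm.
have vB phi : 0 <= v phi <= B.
  rewrite expR_ge0 ler_expR lerBlDr -[leLHS]addr0 lerD// mulNr -mulrN ler_wpM2l//.
  by apply: le_trans (SM phi); rewrite -normrN; exact: ler_norm.
have tau := @free_field_tau_lower_semi R alpha L m alpha0 L0 ff u v B
  (continuous_lower_semi cu) (continuous_lower_semi cv) uB vB.
have {}tau : (\int[m]_phi u phi) * (\int[m]_phi v phi) <= 1.
{ apply: tau => n x y; rewrite /u /v -expRD ler_expR.
  by have := tile_sum_diff n x y l0; rewrite -/a /=; lra. }
have bS := bmf_tile_sum.
have ES : \int[m]_phi tile_sum phi = nt%:R * E.
  by apply: tile_sum_integral => c _; exact: free_field_shift_lip.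
have jen : expR (- (2 * lam) * (nt%:R * E) - a) <= \int[m]_phi v phi.
{ rewrite -ES; apply: le_trans (jensen_expR m _); last first.
    by apply: bmfB; [exact: bmfZ|exact: bmf_cst].
  rewrite RintB; [|exact: bmfZ|exact: bmf_cst].
  by rewrite RintZ// Rint_cst. }
have u0 : 0 <= \int[m]_phi u phi by apply: Rintegral_ge0 => phi _; exact: expR_ge0.
have key : (\int[m]_phi u phi) * expR (- (2 * lam) * (nt%:R * E) - a) <= 1.
  by apply: le_trans tau; rewrite ler_wpM2l.
have bu : bounded_mfun (u : borel (path_space R) -> R).
  split; first exact: borel_continuous_measurable.
  by exists B => phi; have /andP[x y] := uB phi; rewrite ger0_norm.
have -> : \int[m]_phi expR (2 * (lam * (tile_sum phi - nt%:R * E))) =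
   expR (- (2 * lam) * (nt%:R * E)) * \int[m]_phi u phi.
  rewrite -RintZ//; apply: eq_Rintegral => phi _; rewrite /u -expRD; congr expR; ring.
by move: key; rewrite expRD expRN mulrA ler_pdivrMr ?expR_gt0// mul1r mulrC.
Qed.

End tiles.

Section comparison.
Context (R : realType) (alpha p gamma beta N L : R).
Variables (m rho : probability (borel (path_space R)) R).
Hypotheses (alpha0 : 0 < alpha) (p26 : 2 < p < 6) (beta0 : 0 <= beta) (N0 : 0 < N) (L2 : 2 <= L).
Hypothesis ff : is_free_field alpha L m.
Hypothesis rhoG : is_gibbs_measure p gamma beta N L m rho.
Hypothesis small : beta * L `^ (p / 2 - 1 - gamma) * drift_const alpha p N <= 2^-1.

Let L0 : 0 < L. Proof. exact: lt_le_trans L2. Qed.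

Definition entropy_bound : R := 256 * beta / p * K6 alpha * L `^ (1 - gamma) + mass_cut alpha N.

Lemma gibbs_free_field_diff (A K M s0 z0 lam : R) (F : (R -> Rcomplex R) -> R) :
  0 <= K -> lip_local A K M F -> 1 <= s0 -> 2 * A <= s0 -> s0 <= L -> 0 < z0 ->
  (z0%:E <= partition_function p gamma beta N L m)%E -> 0 < lam ->
  \int[rho]_phi F phi - \int[m]_phi F phi <=
  (`|ln (3 / (2 * z0))| + entropy_bound) * (2 * s0 / (lam * L)) + 2 * lam * K ^+ 2 * (2 / alpha + 1).
Proof.
move=> K0 FL s01 As sL z00 zZ l0.
have p0 : 0 < p by case/andP: p26; lra.
have s00 : 0 < s0 by apply: lt_le_trans s01.
(* The period is cut into whole tiles of length s = L / nt, slightly longer than s0. As s0 <= L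
   there is at least one, and nt >= L / (2 s0). *)
pose nt := Num.truncn (L / s0).
have /andP[n1 n2] : nt%:R <= L / s0 < nt.+1%:R by apply: truncn_itv; rewrite divr_ge0// ltW.
have nt1 : (1 <= nt)%N by rewrite truncn_gt0 ler_pdivlMr// mul1r.
have ntR : 1 <= nt%:R :> R by rewrite ler1n.
have nt0 : 0 < nt%:R :> R by apply: lt_le_trans ntR.
pose s := L / nt%:R.
have sE : s * nt%:R = L by rewrite /s divfK// gt_eqF.
have ss : s0 <= s by rewrite /s ler_pdivlMr// mulrC -ler_pdivlMr.
have sp : 0 < s by apply: lt_le_trans ss.
have s1 := le_trans s01 ss.
have As' := le_trans As ss.
set z := fine (partition_function p gamma beta N L m).
have z_gt : 0 < z by exact: (fine_partition_gt0 gamma alpha0 p26 beta0 N0 L0 ff).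
have zz : z0 <= z.
{ rewrite -lee_fin /z fineK// ge0_fin_numE; last by apply: ltW; exact: (partition_gt0 gamma alpha0 p26 beta0 N0 L0 ff).
  exact: (partition_lty gamma alpha0 p26 beta0 N0 L0 ff). }
have conc := tile_concentration alpha0 L2 ff K0 FL sp sE As' (ltW l0).
set E := \int[m]_phi F phi in conc *.
set a := 2 * nt%:R * lam ^+ 2 * K ^+ 2 * tile_const alpha s in conc.
have a0 : 0 <= a.
  have tc := tile_const_gt0 alpha0 sp.
  by rewrite /a mulr_ge0 ?(ltW tc)// mulr_ge0 ?sqr_ge0// mulr_ge0 ?sqr_ge0// mulr_ge0.
have k60 : 0 < K6 alpha by apply: lt_le_trans (K6_ge1 alpha0).
have mc0 : 0 < mass_cut alpha N by apply: addr_gt0; apply: mulr_gt0 => //; exact: addr_gt0.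
have c0 : 0 <= entropy_bound.
  apply: addr_ge0; last exact: ltW.
  apply: mulr_ge0; last exact: powR_ge0.
  apply: mulr_ge0; last exact: ltW.
  by apply: divr_ge0; [exact: mulr_ge0|exact: ltW].
have Q := gibbs_moment_large alpha0 p26 L2 ff N0 beta0 small.
have bS := bmf_tile_sum L2 K0 FL sp sE.
have bX : bounded_mfun (fun phi : borel (path_space R) => lam * (tile_sum L F nt s phi - nt%:R * E)).
  by apply: bmfZ; apply: bmfB => //; exact: bmf_cst.
have := gibbs_exp_le alpha0 p26 beta0 N0 L0 ff rhoG bX Q conc.
rewrite -/z -/entropy_bound => main.
have SE : \int[rho]_phi (lam * (tile_sum L F nt s phi - nt%:R * E)) =
    lam * (nt%:R * (\int[rho]_phi F phi - E)).
{ rewrite RintZ; last by apply: bmfB => //; exact: bmf_cst.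
  rewrite RintB//; last exact: bmf_cst.
  rewrite Rint_cst (tile_sum_integral L2 K0 FL sp sE)// ?mulrBr//.
  move=> c cL; apply: (gibbs_shift alpha0 p26 beta0 N0 L0 ff rhoG L2 cL (F := fun phi => F phi)).
  exact: bmf_lip_local K0 FL. }
rewrite SE in main.
move: entropy_bound c0 main => b c0 main.
set dl := \int[rho]_phi F phi - E in main *.
(* The 3 comes from 2 exp b + exp a <= 3 exp(a + b) for a, b >= 0. *)
have h1 : expR (lam * (nt%:R * dl)) <= expR (ln (3 / (2 * z0)) + b + a).
{ apply: (le_trans main); rewrite !expRD lnK ?posrE ?divr_gt0 ?mulr_gt0//.
  have e1 : 1 <= expR b by rewrite -expR0 ler_expR.
  have e2 : 1 <= expR a by rewrite -expR0 ler_expR.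
  rewrite ler_pdivrMr ?mulr_gt0//.
  apply: (@le_trans _ _ (3 * (expR b * expR a))).
    have f1 : expR b <= expR b * expR a by rewrite ler_peMr// expR_ge0.
    have f2 : expR a <= expR b * expR a by rewrite ler_peMl// expR_ge0.
    lra.
  have -> : 3 / (2 * z0) * expR b * expR a * (2 * z) = 3 * (expR b * expR a) * (z / z0).
    by field; rewrite gt_eqF.
  rewrite ler_peMr ?mulr_ge0 ?expR_ge0// ler_pdivlMr// mul1r//. }
rewrite ler_expR in h1.
have h2 : lam * (nt%:R * dl) <= (`|ln (3 / (2 * z0))| + b) + a.
  by apply: (le_trans h1); rewrite lerD2r lerD2r ler_norm.
have ln0 : 0 < lam * nt%:R by rewrite mulr_gt0.
have h3 : dl <= (`|ln (3 / (2 * z0))| + b) / (lam * nt%:R) + a / (lam * nt%:R).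
  by rewrite -mulrDl ler_pdivlMr// mulrC -mulrA.
apply: (le_trans h3); apply: lerD.
- rewrite ler_wpM2l ?addr_ge0//.
  have -> : 2 * s0 / (lam * L) = (lam * (L / (2 * s0)))^-1 by field; rewrite !gt_eqF.
  have c1 : 0 < L / (2 * s0) by apply: divr_gt0 => //; exact: mulr_gt0.
  have c2 : 0 < lam * (L / (2 * s0)) by exact: mulr_gt0.
  rewrite lef_pV2 ?posrE// ler_pM2l//.
  rewrite ler_pdivrMr ?mulr_gt0//; move: n2; rewrite ltr_pdivrMr// -natr1 => n2.
  apply: (le_trans (ltW n2)); rewrite mulrA ler_pM2r//; lra.
- have -> : a / (lam * nt%:R) = 2 * lam * K ^+ 2 * tile_const alpha s.
    by rewrite /a; field; rewrite !gt_eqF.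
  rewrite ler_wpM2l ?mulr_ge0 ?sqr_ge0 ?(ltW l0)// lerD2r ler_wpM2r ?invr_ge0 ?(ltW alpha0)//.
  have : s^-1 <= 1 by rewrite invf_le1.
  lra.
Qed.

End comparison.

(** * Convergence of the Gibbs measures *)

Lemma cvg_powR_y0 (R : realType) (r : R) : 0 < r -> x `^ (- r) @[x --> +oo] --> (0 : R).
Proof.
move=> r0; apply/cvgrPdist_le => e e0; near=> x.
have x0 : 0 < x by near: x; exact: nbhs_pinfty_gt.
have h : e `^ (- r^-1) <= x by near: x; exact: nbhs_pinfty_ge.
rewrite sub0r normrN ger0_norm ?powR_ge0//.
have -> : e = (e `^ (- r^-1)) `^ (- r).
  by rewrite -powRrM mulrNN mulVf ?gt_eqF// powRr1// ltW.
rewrite (powRN _ r) (powRN (_ `^ _) r) lef_pV2 ?posrE ?powR_gt0 ?powR_gt0//.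
by apply: ge0_ler_powR; rewrite ?nnegrE ?powR_ge0 ?(ltW r0) ?(ltW x0).
Unshelve. all: by end_near. Qed.

Section convergence.
Context (R : realType) (alpha p gamma beta N : R).
Hypotheses (alpha0 : 0 < alpha) (p26 : 2 < p < 6) (beta0 : 0 <= beta) (gamma0 : 0 < gamma)
  (NP : (2 * mass_par alpha)^-1 < N).
Notation prob := (probability (borel (path_space R)) R).

Let k0 : 0 < mass_par alpha. Proof. exact: mass_par_gt0. Qed.
Let N0 : 0 < N. Proof. by apply: lt_trans NP; rewrite invr_gt0 mulr_gt0. Qed.

Variables (L : nat -> R) (m rho : nat -> prob) (nu : prob).
Hypotheses (L2 : forall n, 2 <= L n) (Loo : L n @[n --> \oo] --> +oo)
  (ff : forall n, is_free_field alpha (L n) (m n)) (ou : is_ornstein_uhlenbeck alpha nu)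
  (rhoG : forall n, is_gibbs_measure p gamma beta N (L n) (m n) (rho n))
  (small : \forall n \near \oo, beta * L n `^ (p / 2 - 1 - gamma) * drift_const alpha p N <= 2^-1).

Let L0 n : 0 < L n. Proof. exact: lt_le_trans (L2 n). Qed.

Let cvg_invL : (L n)^-1 @[n --> \oo] --> (0 : R).
Proof.
have := cvg_comp _ _ Loo (cvg_powR_y0 (@ltr01 R)); apply: cvg_trans; apply: near_eq_cvg; apply: nearW => n.
by rewrite /= powR_inv1// ltW.
Qed.

(** Half of 1 - 1 / (2 sqrt alpha N), the limit of the lower bound that Markov's inequality gives
    for the probability of M <= N L. This is where N > 1 / (2 sqrt alpha) enters. *)
Let z0 : R := (1 - (2 * mass_par alpha)^-1 / N) / 2.

Let z00 : 0 < z0.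
Proof. by rewrite divr_gt0// subr_gt0 ltr_pdivrMr// mul1r. Qed.

Let partition_lower : \forall n \near \oo, (z0%:E <= partition_function p gamma beta N (L n) (m n))%E.
Proof.
have c : periodic_cov alpha (L n) 0 @[n --> \oo] --> line_cov alpha 0.
  exact: periodic_cov_cvg.
have lc : line_cov alpha 0 = (2 * mass_par alpha)^-1.
  by rewrite /line_cov normr0 mulr0 oppr0 expR0 mul1r.
have e0 : 0 < N * z0 by rewrite mulr_gt0.
move/cvgrPdist_le : c => /(_ _ e0); apply: filterS => n; rewrite lc => h.
apply: le_trans (partition_ge gamma N (m n) p26 beta0 (L0 n)).
pose B : set (borel (path_space R)) := [set phi | mass (L n) phi <= N * L n].
have mB : measurable B.
  rewrite -[X in measurable X]setTI; apply: measurable_fun_le => //.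
  by apply: borel_continuous_measurable; exact: mass_continuous.
have hC : (m n (~` B) <= (periodic_cov alpha (L n) 0 / N)%:E)%E.
  apply: le_trans (mass_tail alpha0 (L2 n) (ff n) N0); apply: le_measure; rewrite ?inE.
  - exact: measurableC.
  - rewrite -[X in measurable X]setTI; apply: measurable_fun_le => //.
    by apply: borel_continuous_measurable; exact: mass_continuous.
  - by move=> phi /= /negP; rewrite -ltNge => /ltW.
rewrite probability_setC// in hC.
have mE : m n B = (fine (m n B))%:E by rewrite fineK// fin_num_measure.
rewrite -/B mE lee_fin; rewrite mE -EFinB lee_fin in hC.
move: h; rewrite ler_norml => /andP[h _].
have h2 : periodic_cov alpha (L n) 0 / N <= (2 * mass_par alpha)^-1 / N + z0.
  by rewrite ler_pdivrMr// mulrDl divfK ?gt_eqF// [z0 * N]mulrC; lra.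
have : 2 * z0 = 1 - (2 * mass_par alpha)^-1 / N by rewrite /z0; field; rewrite !gt_eqF.
lra.
Qed.

Lemma gibbs_upper_limit (A K M e : R) (F : (R -> Rcomplex R) -> R) : 0 <= K -> lip_local A K M F -> 0 < e ->
  \forall n \near \oo, \int[rho n]_phi F phi - \int[m n]_phi F phi <= e.
Proof.
move=> K0 FL e0.
pose s0 : R := 2 * `|A| + 1.
have s01 : 1 <= s0 by rewrite lerDr mulr_ge0.
have As : 2 * A <= s0 by have := ler_norm A; rewrite /s0; lra.
have s00 : 0 < s0 by apply: lt_le_trans s01.
have ia : 0 < 2 / alpha + 1 by rewrite ltr_wpDl// divr_ge0// ltW.
(* With lam = e / w the term of [gibbs_free_field_diff] that is linear in lam is at most e / 2; the
   summand 1 keeps [w] positive when K = 0. *)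
pose w := 4 * (K ^+ 2 * (2 / alpha + 1)) + 1.
have w0 : 0 < w by rewrite ltr_wpDl// mulr_ge0// mulr_ge0 ?sqr_ge0// ltW.
pose lam := e / w; have l0 : 0 < lam by rewrite divr_gt0.
have le2 : 2 * lam * K ^+ 2 * (2 / alpha + 1) <= e / 2.
{ have -> : 2 * lam * K ^+ 2 * (2 / alpha + 1) = e / 2 * ((w - 1) / w).
    have -> : 2 * lam * K ^+ 2 * (2 / alpha + 1) = lam * ((w - 1) / 2).
      by rewrite /w; move: (2 / alpha + 1) => c; field.
    by rewrite /lam; move: (w) w0 => v v0; field; rewrite gt_eqF.
  by rewrite -[leRHS]mulr1 ler_wpM2l ?divr_ge0 ?(ltW e0)// ler_pdivrMr// mul1r gerBl. }
pose B := `|ln (3 / (2 * z0))| + mass_cut alpha N.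
have lim : (2 * s0 / lam) * (B * (L n)^-1 + 256 * beta / p * K6 alpha * L n `^ (- gamma)) @[n --> \oo] --> (0 : R).
{ rewrite -[X in _ --> X](mulr0 (2 * s0 / lam)); apply: cvgM; first exact: cvg_cst.
  rewrite -[X in _ --> X](addr0 0); apply: cvgD.
    by rewrite -[X in _ --> X](mulr0 B); apply: cvgM => //; exact: cvg_cst.
  rewrite -[X in _ --> X](mulr0 (256 * beta / p * K6 alpha)); apply: cvgM; first exact: cvg_cst.
  exact: (cvg_comp _ _ Loo (cvg_powR_y0 gamma0)). }
have e2 : 0 < e / 2 by rewrite divr_gt0.
move/cvgrPdist_le : lim => /(_ _ e2) lim.
have /cvgryPge/(_ s0) big := Loo.
near=> n.
have h := @gibbs_free_field_diff R alpha p gamma beta N (L n) (m n) (rho n) alpha0 p26 beta0 N0 (L2 n) (ff n) (rhoG n) _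
  A K M s0 z0 lam F K0 FL s01 As _ z00 _ l0.
have {}h := h (near small n _) (near big n _) (near partition_lower n _).
apply: (le_trans (h _ _ _)) => //.
rewrite [leRHS]splitr; apply: lerD => //.
have := near lim n _; rewrite sub0r normrN => /(_ _)/(le_trans (ler_norm _)) h2.
apply: le_trans (h2 _) => //.
rewrite le_eqVlt; apply/orP; left; apply/eqP.
rewrite /entropy_bound; have -> : L n `^ (1 - gamma) = L n * L n `^ (- gamma).
  by rewrite powRD ?powRr1 ?(ltW (L0 n))// (gt_eqF (L0 n)) implybT.
rewrite /B; have p0 : 0 < p by case/andP: p26; lra.
by have := L0 n => Ln0; field; rewrite !gt_eqF.
Unshelve. all: by end_near. Qed.

Lemma gibbs_cvg (F : path_space R -> R) M : continuous F -> (forall phi, `|F phi| <= M) ->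
  \int[rho n]_phi F phi @[n --> \oo] --> \int[nu]_phi F phi.
Proof.
apply: path_weak_cvg => {F M} A K M F K0 FL.
have cF := lip_local_continuous K0 FL; have [FM _] := FL.
have lim := free_field_cvg alpha0 L2 Loo ff ou cF (M := M) FM.
(* The upper estimate for - F is the lower estimate for F. *)
have NFL : lip_local A K M (fun f => - F f).
  split => [f|f g d fg]; first by rewrite normrN.
  by rewrite -opprD normrN; have [_ h] := FL; exact: h.
have bF (Q : prob) : \int[Q]_phi (- F phi) = - \int[Q]_phi F phi.
  under eq_Rintegral do rewrite -mulN1r.
  by rewrite RintZ ?mulN1r//; exact: bmf_lip_local K0 FL.
apply/cvgrPdist_le => e e0; have e2 : 0 < e / 2 by rewrite divr_gt0.
move/cvgrPdist_le : lim => /(_ _ e2) lim.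
have up := gibbs_upper_limit K0 FL e2; have dn := gibbs_upper_limit K0 NFL e2.
near=> n.
have h1 : `|\int[nu]_phi F phi - \int[m n]_phi F phi| <= e / 2 by near: n.
have h2 : \int[rho n]_phi F phi - \int[m n]_phi F phi <= e / 2 by near: n.
have h3 : \int[rho n]_phi (- F phi) - \int[m n]_phi (- F phi) <= e / 2 by near: n.
rewrite !bF in h3; move: h1; rewrite !ler_norml => /andP[h4 h5].
by apply/andP; split; lra.
Unshelve. all: by end_near. Qed.

End convergence.

Lemma gibbs_weak_cvg (R : realType) (alpha p gamma beta N : R) :
  0 < alpha -> 2 < p < 6 -> 0 <= beta -> 0 < gamma -> (2 * mass_par alpha)^-1 < N ->
  (\forall L \near +oo, beta * L `^ (p / 2 - 1 - gamma) * drift_const alpha p N <= 2^-1) ->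
  forall (mu : R -> probability (borel (path_space R)) R)
         (nu : probability (borel (path_space R)) R),
    (forall L, 0 < L -> is_free_field alpha L (mu L)) ->
    is_ornstein_uhlenbeck alpha nu ->
    exists rho : R -> probability (borel (path_space R)) R,
      (forall L, 0 < L ->
         is_gibbs_measure p gamma beta N L (mu L) (rho L)) /\
      converges_weakly rho nu.
Proof.
move=> alpha0 p26 beta0 gamma0 NP small mu nu ff ou.
have N0 : 0 < N by apply: lt_trans NP; rewrite invr_gt0 mulr_gt0// mass_par_gt0.
have ex (L : R) : exists r : probability (borel (path_space R)) R,
    0 < L -> is_gibbs_measure p gamma beta N L (mu L) r.
(* At L <= 0 the measure is a default value. *)
{ have [L0|L0] := ltP 0 L; last by exists (mu 1).
  by have [r rG] := gibbs_exists gamma alpha0 p26 beta0 N0 L0 (ff L L0); exists r. }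
have [rho rhoG] := choice ex.
exists rho; split => // F cF [M FM]; apply/cvg_pinftyP => u uoo.
(* The estimates are for L >= 2; since u tends to infinity, only finitely many terms are changed. *)
pose v n := Num.max (u n) 2.
have v2 n : 2 <= v n by rewrite /v le_max lexx orbT.
have v0 n : 0 < v n by apply: lt_le_trans (v2 n).
have uv : \forall n \near \oo, v n = u n.
  by have /cvgryPge/(_ 2) := uoo; apply: filterS => n h; apply/max_idPl.
have voo : v n @[n --> \oo] --> +oo.
  by apply: cvg_trans uoo; apply: near_eq_cvg; apply: filterS uv => n.
have vs : \forall n \near \oo, beta * v n `^ (p / 2 - 1 - gamma) * drift_const alpha p N <= 2^-1.
  exact: (voo _ small).
have := @gibbs_cvg R alpha p gamma beta N alpha0 p26 beta0 gamma0 NP v (fun n => mu (v n)) (fun n => rho (v n)) nu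
  v2 voo (fun n => ff _ (v0 n)) ou (fun n => rhoG _ (v0 n)) vs F M cF FM.
apply: cvg_trans; apply: near_eq_cvg; apply: filterS uv => n ->.
by [].
Qed.

Theorem theorem1p6 (R : realType) (p alpha N : R)
    (hp2 : 2 < p) (hp6 : p < 6) (halpha : 0 < alpha)
    (hN : 1 / (2 * Num.sqrt alpha) < N) :
  let convergence (gamma beta : R) :=
    forall (mu : R -> probability (borel (path_space R)) R)
           (nu : probability (borel (path_space R)) R),
      (forall L, 0 < L -> is_free_field alpha L (mu L)) ->
      is_ornstein_uhlenbeck alpha nu ->
      exists rho : R -> probability (borel (path_space R)) R,
        (forall L, 0 < L ->
           is_gibbs_measure p gamma beta N L (mu L) (rho L)) /\
        converges_weakly rho nu in
  (exists2 beta0 : R, 0 < beta0 &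
     forall beta, 0 <= beta < beta0 -> convergence (p / 2 - 1) beta) /\
  (forall gamma, p / 2 - 1 < gamma -> forall beta, 0 <= beta ->
     convergence gamma beta).
Proof.
move=> convergence.
have p26 : 2 < p < 6 by rewrite hp2.
have NP : (2 * mass_par alpha)^-1 < N by rewrite -[X in X < _]mul1r.
have N0 : 0 < N by apply: lt_trans NP; rewrite invr_gt0 mulr_gt0// mass_par_gt0.
have q0 : 0 < p / 2 - 1 by rewrite subr_gt0 ltr_pdivlMr// mul1r.
have d0 : 0 < drift_const alpha p N.
{ apply: mulr_gt0; first by apply: divr_gt0 => //; exact: lt_trans hp2.
  by apply: ltr_pwDl; [rewrite invr_gt0|apply: mulr_ge0 => //; exact: sqr_ge0]. }
(* At gamma = p / 2 - 1 the power of L in the smallness condition is L^0 = 1, so the condition reads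
   beta [drift_const] <= 1/2 and large L does not relax it. *)
split; [exists (2 * drift_const alpha p N)^-1|].
- by rewrite invr_gt0 mulr_gt0.
- move=> beta /andP[b0 bd]; apply: gibbs_weak_cvg => //; apply: nearW => L.
  rewrite subrr powRr0 mulr1; move: bd; rewrite invfM => /ltW.
  by rewrite ler_pdivlMr.
- move=> gamma hg beta b0; apply: gibbs_weak_cvg => //; first exact: lt_trans hg.
  set c := drift_const alpha p N in d0 *.
  (* For larger gamma the factor L^(- r) brings every beta below the threshold once L is large. *)
  pose r := gamma - (p / 2 - 1); have r0 : 0 < r by rewrite subr_gt0.
  suff h : beta * L `^ (- r) * c @[L --> +oo] --> (0 : R).
    have /cvgrPdist_le/(_ 2^-1) := h; rewrite invr_gt0 => /(_ (ltr0Sn _ _)); apply: filterS => L.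
    rewrite sub0r normrN => /(le_trans (ler_norm _)); by rewrite /r opprB.
  rewrite -[X in _ --> X](mul0r c); apply: cvgM; last exact: cvg_cst.
  rewrite -[X in _ --> X](mulr0 beta); apply: cvgM; first exact: cvg_cst.
  exact: cvg_powR_y0.
Qed.
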